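(* Let $\boldsymbol g\in\mathbb R^3$ be a constant unit vector or the zero vector and $T>0$. Let $(\boldsymbol x,\tau)$ be a solution to the transformed problem $$\begin{cases}\ddot{\boldsymbol x}-(\tau\boldsymbol x')'=\boldsymbol g & \text{in }(0,1)\times(0,T),\\ \boldsymbol x=\boldsymbol 0 &\text{on }\{s=1\}\times(0,T),\end{cases}\qquad \begin{cases}-\tau''+|\boldsymbol x''|^2\tau=|\dot{\boldsymbol x}'|^2&\text{in }(0,1)\times(0,T),\\ \tau=0&\text{on }\{s=0\}\times(0,T),\\ \tau'=-\boldsymbol g\cdot\boldsymbol x'&\text{on }\{s=1\}\times(0,T),\end{cases}$$ with initial condition $(\boldsymbol x,\dot{\boldsymbol x})|_{t=0}=(\boldsymbol x_0^{\rm in},\boldsymbol x_1^{\rm in})$ in $(0,1)$, in the class $\boldsymbol x'\in L^\infty(0,T;X^2)\cap W^{1,\infty}(0,T;X^1)$, satisfying the stability condition $\tau(s,t)/s\ge c_0>0$ for $(s,t)\in(0,1)\times(0,T)$ with some constant $c_0$. Suppose that the initial data satisfy $|\boldsymbol x_0^{{\rm in}\,\prime}(s)|\equiv1$ and $\boldsymbol x_0^{{\rm in}\,\prime}(s)\cdot\boldsymbol x_1^{{\rm in}\,\prime}(s)\equiv0$. Then $|\boldsymbol x'(s,t)|\equiv1$.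
   Context: Unknowns: $\boldsymbol x=\boldsymbol x(s,t)\in\mathbb R^3$ and $\tau=\tau(s,t)\in\mathbb R$, $(s,t)\in(0,1)\times(0,T)$. A dot denotes the $t$-derivative, a prime the $s$-derivative; in the second system $t$ is regarded as a parameter. $L^p$, $H^k$ are spaces on $(0,1)$. The norms are $\|u\|_{X^1}^2=\|u\|_{L^2}^2+\|s^{1/2}u'\|_{L^2}^2$ and $\|u\|_{X^2}^2=\|u\|_{H^1}^2+\|su''\|_{L^2}^2$, and $X^k$ is the set of $u\in L^2$ with $\|u\|_{X^k}<\infty$. The equations are understood to hold almost everywhere. For solutions in the class, $\boldsymbol x'\in W^{2,\infty}(0,T;L^2)$, so one may assume $\boldsymbol x,\boldsymbol x'\in C^0([0,T];X^1)\cap C^1([0,T];L^2)$ and the initial conditions are understood in the classical sense. *)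

(* Defs.v *)
From HB Require Import structures.
From mathcomp Require Import all_boot all_order all_algebra.
From mathcomp Require Import all_classical all_reals all_analysis.
Set Implicit Arguments.
Unset Strict Implicit.
Unset Printing Implicit Defensive.
Import Order.TTheory GRing.Theory Num.Theory.
Import numFieldNormedType.Exports.
Local Open Scope classical_set_scope.
Local Open Scope ring_scope.

(* The library norm `|u| on 'rV[R]_3 is the sup norm, hence the explicit
   Euclidean inner product and norm. *)
Definition dotp (R : realType) (u v : 'rV[R]_3) : R :=
  \sum_(i < 3) u 0 i * v 0 i.

Definition enorm (R : realType) (u : 'rV[R]_3) : R := Num.sqrt (dotp u u).

(* Test functions are C^1 with compact support in ]a, b[; for weak derivatives
   in one variable this is equivalent to using C^oo test functions. *)
Definition test_function (R : realType) (a b : R) (phi : R -> R) : Prop :=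
  [/\ forall y, derivable phi y 1,
      continuous (derive1 phi)
    & exists c d : R, [/\ a < c, d < b &
        forall y : R, y \notin `[c, d] -> phi y = 0]].

Definition weak_deriv (R : realType) (a b : R) (u v : R -> R) : Prop :=
  [/\ locally_integrable `]a, b[ u, locally_integrable `]a, b[ v &
      forall phi, test_function a b phi ->
        (\int[@lebesgue_measure R]_(y in `]a, b[) (u y * derive1 phi y) =
         - \int[@lebesgue_measure R]_(y in `]a, b[) (v y * phi y))%R].

Definition weak_derivV (R : realType) (a b : R) (u v : R -> 'rV[R]_3) : Prop :=
  forall i, weak_deriv a b (fun y => u y 0 i) (fun y => v y 0 i).

(* In the functions of (s, t) below, s in ]0, 1[ is the first argument and
   t in ]0, T[ the second. *)
Definition ae_Q (R : realType) (T : R) (P : R -> R -> Prop) : Prop :=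
  {ae (@lebesgue_measure R \x @lebesgue_measure R)%E,
    forall z, z.1 \in `]0, 1[ -> z.2 \in `]0, T[ -> P z.1 z.2}.

Definition ae_s (R : realType) (P : R -> Prop) : Prop :=
  {ae @lebesgue_measure R, forall s : R, s \in `]0, 1[ -> P s}.

Definition ae_t (R : realType) (T : R) (P : R -> Prop) : Prop :=
  {ae @lebesgue_measure R, forall t : R, t \in `]0, T[ -> P t}.

Definition jmeas (R : realType) (T : R) (u : R -> R -> R) : Prop :=
  measurable_fun ((`]0, 1[%classic : set (measurableTypeR R)) `*`
                  (`]0, T[%classic : set (measurableTypeR R)))
    (fun z : measurableTypeR R * measurableTypeR R => u z.1 z.2).

Definition jmeasV (R : realType) (T : R) (u : R -> R -> 'rV[R]_3) : Prop :=
  forall i, jmeas T (fun s t => u s t 0 i).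

Definition weak_ds (R : realType) (T : R) (u v : R -> R -> R) : Prop :=
  [/\ jmeas T u, jmeas T v & ae_t T (fun t => weak_deriv 0 1 (u^~ t) (v^~ t))].

Definition weak_dsV (R : realType) (T : R) (u v : R -> R -> 'rV[R]_3) : Prop :=
  forall i, weak_ds T (fun s t => u s t 0 i) (fun s t => v s t 0 i).

(* Weak t-derivative of u regarded as a function of t with values in functions
   of s: for each scalar test function of t, the integrals in t agree as
   functions of s, that is for almost every s. *)
Definition weak_dt (R : realType) (T : R) (u v : R -> R -> R) : Prop :=
  [/\ jmeas T u, jmeas T v,
      ae_s (fun s => locally_integrable `]0, T[ (u s) /\
                     locally_integrable `]0, T[ (v s)) &
      forall phi, test_function 0 T phi -> ae_s (fun s =>
        (\int[@lebesgue_measure R]_(t in `]0, T[) (u s t * derive1 phi t) =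
         - \int[@lebesgue_measure R]_(t in `]0, T[) (v s t * phi t))%R)].

Definition weak_dtV (R : realType) (T : R) (u v : R -> R -> 'rV[R]_3) : Prop :=
  forall i, weak_dt T (fun s t => u s t 0 i) (fun s t => v s t 0 i).

(* Squared norms on ]0, 1[. As arguments of X1sq and X2sq, u1 and u2 stand for
   the first and second weak derivatives of u. *)
Definition L2sq (R : realType) (u : R -> 'rV[R]_3) : \bar R :=
  (\int[@lebesgue_measure R]_(s in `]0%R, 1%R[) (enorm (u s) ^+ 2)%:E)%E.

Definition X1sq (R : realType) (u u1 : R -> 'rV[R]_3) : \bar R :=
  (L2sq u + L2sq (fun s => Num.sqrt s *: u1 s)%R)%E.

Definition X2sq (R : realType) (u u1 u2 : R -> 'rV[R]_3) : \bar R :=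
  (L2sq u + L2sq u1 + L2sq (fun s => s *: u2 s)%R)%E.

Definition in_L2 (R : realType) (u : R -> 'rV[R]_3) : Prop :=
  (forall i, measurable_fun (`]0, 1[ : set R) (fun s => u s 0 i)) /\
  (L2sq u < +oo)%E.

Definition in_X1 (R : realType) (u u1 : R -> 'rV[R]_3) : Prop :=
  weak_derivV 0 1 u u1 /\ (X1sq u u1 < +oo)%E.

(* L^oo(0,T;X^1), L^oo(0,T;X^2) and W^{1,oo}(0,T;X^1). *)
Definition Linf_X1 (R : realType) (T : R) (u : R -> R -> 'rV[R]_3) : Prop :=
  exists u1, weak_dsV T u u1 /\
    exists M : R, ae_t T (fun t => (X1sq (u^~ t) (u1^~ t) <= M%:E)%E).

Definition Linf_X2 (R : realType) (T : R) (u : R -> R -> 'rV[R]_3) : Prop :=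
  exists u1 u2, [/\ weak_dsV T u u1, weak_dsV T u1 u2 &
    exists M : R,
      ae_t T (fun t => (X2sq (u^~ t) (u1^~ t) (u2^~ t) <= M%:E)%E)].

Definition W1inf_X1 (R : realType) (T : R) (u : R -> R -> 'rV[R]_3) : Prop :=
  Linf_X1 T u /\ exists v, weak_dtV T u v /\ Linf_X1 T v.

(* C^0([0,T];L^2), C^0([0,T];X^1) and C^1([0,T];L^2), the latter with the
   t-derivative v. *)
Definition C0_L2 (R : realType) (T : R) (u : R -> R -> 'rV[R]_3) : Prop :=
  forall t : R, t \in `[0, T] -> in_L2 (u^~ t) /\
    L2sq (fun s => u s r - u s t) @[r --> within `[0, T] (nbhs t)] --> 0%E.

Definition C0_X1 (R : realType) (T : R) (u : R -> R -> 'rV[R]_3) : Prop :=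
  exists u1 : R -> R -> 'rV[R]_3, forall t : R, t \in `[0, T] ->
    in_X1 (u^~ t) (u1^~ t) /\
    X1sq (fun s => u s r - u s t) (fun s => u1 s r - u1 s t)
      @[r --> within `[0, T] (nbhs t)] --> 0%E.

Definition C1_L2 (R : realType) (T : R) (u v : R -> R -> 'rV[R]_3) : Prop :=
  [/\ C0_L2 T u, C0_L2 T v & forall t : R, t \in `[0, T] ->
    L2sq (fun s => (r - t)^-1 *: (u s r - u s t) - v s t)
      @[r --> within `[0, T] t^'] --> 0%E].

(* Here xs is the s-derivative and xt the t-derivative of x. Continuous
   representatives in s are chosen up to the boundary points at which values
   are prescribed. *)
Record in_class (R : realType) (T : R) (x xs xt : R -> R -> 'rV[R]_3) : Prop :=
  InClass {
    class_xs : forall t : R, t \in `[0, T] -> weak_derivV 0 1 (x^~ t) (xs^~ t);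
    class_Linf : Linf_X2 T xs;
    class_W1inf : W1inf_X1 T xs;
    class_x_C0 : C0_X1 T x;
    class_x_C1 : C1_L2 T x xt;
    class_xs_C0 : C0_X1 T xs;
    class_xs_C1 : exists xst, C1_L2 T xs xst;
    class_x_cont : forall t : R, t \in `[0, T] ->
      {within `]0, 1], continuous (x^~ t)};
    class_xs_cont : forall t : R, t \in `[0, T] ->
      {within `]0, 1], continuous (xs^~ t)} }.

Definition string_eq (R : realType) (g : 'rV[R]_3) (T : R)
    (x xs xt : R -> R -> 'rV[R]_3) (tau : R -> R -> R) : Prop :=
  (exists xtt flux : R -> R -> 'rV[R]_3,
    [/\ weak_dtV T xt xtt,
        weak_dsV T (fun s t => tau s t *: xs s t) flux &
        ae_Q T (fun s t => xtt s t - flux s t = g)]) /\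
  (forall t : R, t \in `]0, T[ -> x 1 t = 0).

Definition tension_eq (R : realType) (g : 'rV[R]_3) (T : R)
    (xs : R -> R -> 'rV[R]_3) (tau : R -> R -> R) : Prop :=
  exists (xss xst : R -> R -> 'rV[R]_3) (taus tauss : R -> R -> R),
    [/\ weak_dsV T xs xss,
        weak_dtV T xs xst,
        weak_ds T tau taus /\ weak_ds T taus tauss,
        ae_Q T (fun s t => - tauss s t + enorm (xss s t) ^+ 2 * tau s t =
                           enorm (xst s t) ^+ 2) &
        ae_t T (fun t =>
          [/\ {within `[0, 1[, continuous (tau^~ t)},
              {within `]0, 1], continuous (taus^~ t)},
              tau 0 t = 0 &
              taus 1 t = - dotp g (xs 1 t)])].

Definition initial_cond (R : realType) (x xt : R -> R -> 'rV[R]_3)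
    (x0 x1 : R -> 'rV[R]_3) : Prop :=
  ae_s (fun s => x s 0 = x0 s) /\ ae_s (fun s => xt s 0 = x1 s).

Record transformed_solution (R : realType) (g : 'rV[R]_3) (T : R)
    (x xs xt : R -> R -> 'rV[R]_3) (tau : R -> R -> R)
    (x0 x1 : R -> 'rV[R]_3) : Prop := TransformedSolution {
  sol_class : in_class T x xs xt;
  sol_string : string_eq g T x xs xt tau;
  sol_tension : tension_eq g T xs tau;
  sol_init : initial_cond x xt x0 x1 }.

Definition stability_cond (R : realType) (T : R) (tau : R -> R -> R) : Prop :=
  exists2 c0 : R, 0 < c0 &
    forall s t : R, s \in `]0, 1[ -> t \in `]0, T[ -> c0 <= tau s t / s.

(* Main.v *)
(* Put u = x', h = |u|^2 - 1 and let F = (tau u)' be the flux.  The function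
   N = 2 u.F - 2 tau' |u|^2 represents tau h', and differentiating it with the
   two equations shows that h solves a degenerate linear wave equation with no
   forcing.  Since tau = 0 at s = 0 and since F = -g, tau' = -g.u at s = 1, one
   has N = -2 tau'(1,t) h at s = 1; hence the boundary terms vanish when the
   equation is multiplied by s h_t after adding 2 tau'(1,t) s h to N.  The
   resulting identity controls the energy int_0^1 (s h_t^2 + s^2 h_s^2) ds, and
   as h and h_t vanish at t = 0, Gronwall's inequality gives h = 0.

   The term tau h_ts h_s has to be integrated by parts in t, but no
   t-derivative of tau is given.  It is enough that tau/s and tau'(1,.) are
   Lipschitz in t, which follows from an energy estimate for the difference of
   the tension equations at two times. *)
Require Import Defs.
From HB Require Import structures.
From mathcomp Require Import all_boot all_order all_algebra.
From mathcomp Require Import all_classical all_reals all_analysis.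
From mathcomp Require Import measurable_realfun ring lra.
Set Implicit Arguments.
Unset Strict Implicit.
Unset Printing Implicit Defensive.
Import Order.TTheory GRing.Theory Num.Theory.
Import numFieldNormedType.Exports.
Local Open Scope classical_set_scope.
Local Open Scope ring_scope.

(** * Integrals on intervals *)

Section OneDim.
Context {R : realType}.
Notation mu := (@lebesgue_measure R).
Implicit Types (a b c d : R) (f g : R -> R).

(** The tension vanishes like s at s = 0, and v = u_t is bounded only in X^1, so that |v|^2 may grow
    like log(1/s) there. This growth is still square integrable, which puts tau'' and u_tt = (tau
    u)'' in L^2 and makes tau - s tau' of order s^(3/2): exactly what the term (tau - s tau') h_t
    h_s needs against the weights s and s^2 of the energy. The relation F = -g at s = 1 is not among
    the hypotheses. It expresses that x_tt vanishes where x does, and is recovered by testing with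
    functions of s that do not vanish at s = 1. All equations hold only almost everywhere; they are
    therefore first turned into integral representations in s or in t, with countably many test
    functions so that one null set serves for all of them. The Lipschitz bounds in time are likewise
    known only on a set of times of full measure, and an extension to the line lets the functions
    concerned act as weights in an integration by parts. *)

#[global] Instance ae_mu_filter : Filter (nbhs (almost_everywhere mu)).
Proof. exact: (ae_filter_ringOfSetsType mu). Qed.

Definition intg a b f : Prop := mu.-integrable `]a, b[ (EFin \o f).
(** Not oriented: the value is 0 whenever [b <= a], so a primitive to the left of its base point is
    written with an explicit sign. *)
Definition II a b f : R := (\int[mu]_(x in `]a, b[) f x)%R.
Definition aeI a b (P : R -> Prop) : Prop :=
  {ae mu, forall x, x \in `]a, b[ -> P x}.
Definition mesI a b f : Prop := measurable_fun (`]a, b[ : set R) f.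

Lemma aeI_all a b (P : R -> Prop) :
  (forall x, x \in `]a, b[ -> P x) -> aeI a b P.
Proof. by move=> h; apply: aeW => x /=; exact: h. Qed.

Lemma aeI_imp a b (P Q : R -> Prop) :
  (forall x, x \in `]a, b[ -> P x -> Q x) -> aeI a b P -> aeI a b Q.
Proof. by move=> h; rewrite /aeI; apply: filterS => x + xab => /(_ xab); exact: h. Qed.

Lemma aeI_imp2 a b (P Q S : R -> Prop) :
  (forall x, x \in `]a, b[ -> P x -> Q x -> S x) ->
  aeI a b P -> aeI a b Q -> aeI a b S.
Proof. by move=> h; rewrite /aeI; apply: filterS2 => x + + xab => /(_ xab) + /(_ xab); exact: h. Qed.

Lemma aeI_imp3 a b (P Q S U : R -> Prop) :
  (forall x, x \in `]a, b[ -> P x -> Q x -> S x -> U x) ->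
  aeI a b P -> aeI a b Q -> aeI a b S -> aeI a b U.
Proof.
move=> h; rewrite /aeI; apply: filterS3 => x + + + xab.
by move=> /(_ xab) + /(_ xab) + /(_ xab); exact: h.
Qed.

Lemma aeI_and a b (P Q : R -> Prop) :
  aeI a b P -> aeI a b Q -> aeI a b (fun x => P x /\ Q x).
Proof. by apply: aeI_imp2. Qed.

Lemma aeI_sub a b c d (P : R -> Prop) : a <= c -> d <= b ->
  aeI a b P -> aeI c d P.
Proof.
move=> ac db; rewrite /aeI; apply: filterS => x + /[!in_itv]/= /andP[cx xd]; apply.
by rewrite in_itv/= (le_lt_trans ac cx) (lt_le_trans xd db).
Qed.

Lemma aeI_nat a b (P : nat -> R -> Prop) :
  (forall n, aeI a b (P n)) -> aeI a b (fun x => forall n, P n x).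
Proof.
move=> h; have : {ae mu, forall x, forall n, x \in `]a, b[ -> P n x}.
  by apply/ae_foralln => n; exact: h.
by rewrite /aeI; apply: filterS => x + xab n => /(_ n xab).
Qed.

Lemma aeI_count (I : countType) a b (P : I -> R -> Prop) :
  (forall n, aeI a b (P n)) -> aeI a b (fun x => forall n, P n x).
Proof.
move=> h.
have : aeI a b (fun x => forall n, (if unpickle n is Some i then P i x else True)).
  by apply: aeI_nat => n; case: unpickle => //; exact: aeI_all.
by apply: aeI_imp => x _ H i; have := H (pickle i); rewrite pickleK.
Qed.

Lemma mu_itv a b : a <= b -> mu `]a, b[ = (b - a)%:E.
Proof.
move=> ab; rewrite lebesgue_measure_itv/= lte_fin.
rewrite le_eqVlt in ab; case/orP: ab => [/eqP ->|->]; last by rewrite EFinN -EFinB.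
by rewrite ltxx subrr.
Qed.

Lemma aeI_ex a b (P : R -> Prop) : a < b -> aeI a b P ->
  exists2 x, x \in `]a, b[ & P x.
Proof.
move=> ab [N [mN N0 PN]]; apply: contrapT => nex.
have : (mu `]a, b[ <= mu N)%E.
  apply: le_measure; rewrite ?inE//.
  move=> x xab; apply: PN => /= h; apply: nex; exists x => //.
  exact: h.
by rewrite N0 (mu_itv (ltW ab)) lee_fin leNgt subr_gt0 ab.
Qed.

Lemma intg_mes a b f : intg a b f -> mesI a b f.
Proof. by move=> /integrableP[] /measurable_EFinP. Qed.

Lemma intgD a b f g : intg a b f -> intg a b g -> intg a b (fun x => f x + g x).
Proof. by move=> hf hg; apply: (integrableD _ hf hg). Qed.

Lemma intgZ a b f c : intg a b f -> intg a b (fun x => c * f x).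
Proof. by move=> hf; apply: (integrableZl _ c hf). Qed.

Lemma intgN a b f : intg a b f -> intg a b (fun x => - f x).
Proof. by move=> /(@intgZ _ _ _ (-1)); under eq_fun do rewrite mulN1r. Qed.

Lemma intgB a b f g : intg a b f -> intg a b g -> intg a b (fun x => f x - g x).
Proof. by move=> hf hg; apply: (intgD hf); exact: intgN. Qed.

Lemma intg_abs a b f : intg a b f -> intg a b (fun x => `|f x|).
Proof. by move=> hf; apply: integrable_norm. Qed.

Lemma intg_sub a b c d f : a <= c -> d <= b -> intg a b f -> intg c d f.
Proof.
move=> ac db; apply: integrableS => //.
by apply: subset_itv; rewrite bnd_simp.
Qed.

Lemma mesI_sub a b c d f : a <= c -> d <= b -> mesI a b f -> mesI c d f.
Proof.
move=> ac db; apply: measurable_funS => //.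
by apply: subset_itv; rewrite bnd_simp.
Qed.

Lemma mesI_cst a b c : mesI a b (fun=> c).
Proof. exact: measurable_cst. Qed.

Lemma mesI_id a b : mesI a b (fun x => x).
Proof. exact: measurable_id. Qed.

Lemma mesID a b f g : mesI a b f -> mesI a b g -> mesI a b (fun x => f x + g x).
Proof. by move=> hf hg; apply: measurable_funD. Qed.

Lemma mesIM a b f g : mesI a b f -> mesI a b g -> mesI a b (fun x => f x * g x).
Proof. by move=> hf hg; apply: measurable_funM. Qed.

Lemma mesIB a b f g : mesI a b f -> mesI a b g -> mesI a b (fun x => f x - g x).
Proof. by move=> hf hg; apply: measurable_funB. Qed.

Lemma mesIX a b f n : mesI a b f -> mesI a b (fun x => f x ^+ n).
Proof. by move=> hf; apply: measurable_funX. Qed.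

Lemma mesI_abs a b f : mesI a b f -> mesI a b (fun x => `|f x|).
Proof. by move=> hf; apply: measurableT_comp. Qed.

Lemma mesI_sum (I : finType) a b (f : I -> R -> R) :
  (forall i, mesI a b (f i)) -> mesI a b (fun x => \sum_i f i x).
Proof. by move=> hf; apply: measurable_sum. Qed.

Lemma intg_le a b f g : mesI a b f -> aeI a b (fun x => `|f x| <= g x) ->
  intg a b g -> intg a b f.
Proof.
move=> mf fg ig; apply/integrableP; split; first exact/measurable_EFinP.
have /integrableP[mg goo] := intg_abs ig.
apply: le_lt_trans goo; apply: ae_ge0_le_integral => //=.
- by do 2 apply: measurableT_comp => //.
- by do 3 apply: measurableT_comp => //; exact: intg_mes.
- move: fg; rewrite /aeI; apply: filterS => x + xab => /(_ xab) h.
  by rewrite lee_fin normr_id (le_trans h)// ler_norm.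
Qed.

Lemma mu_itv_fin a b : (mu `]a, b[ < +oo)%E.
Proof.
have [ab|ab] := leP a b; first by rewrite mu_itv// ltry.
by rewrite set_itv_ge ?measure0// bnd_simp -leNgt ltW.
Qed.

Lemma intg_cst a b c : intg a b (fun=> c).
Proof.
apply: measurable_bounded_integrable => //; first exact: mu_itv_fin.
by exists `|c|; split; [exact: num_real | move=> M /ltW cM x _ /=].
Qed.

Lemma intg_bnd a b f M : mesI a b f -> aeI a b (fun x => `|f x| <= M) ->
  intg a b f.
Proof. by move=> mf fM; apply: (intg_le mf fM); exact: intg_cst. Qed.

Lemma intg_ae a b f g : mesI a b f -> aeI a b (fun x => f x = g x) ->
  intg a b g -> intg a b f.
Proof.
move=> mf fg ig; apply: (intg_le mf _ (intg_abs ig)).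
by apply: aeI_imp fg => x _ ->.
Qed.

Lemma intg_sum (I : finType) a b (f : I -> R -> R) :
  (forall i, intg a b (f i)) -> intg a b (fun x => \sum_i f i x).
Proof.
move=> hf; rewrite /intg.
rewrite [X in _.-integrable _ X](_ : _ = (fun x => \sum_i (f i x)%:E)%E).
  exact: (integrable_sum _ _ (fun i _ => hf i)).
by apply/funext => x /=; rewrite sumEFin.
Qed.

Lemma intgM_bnd a b f g M : intg a b f -> mesI a b g ->
  aeI a b (fun x => `|g x| <= M) -> intg a b (fun x => g x * f x).
Proof.
move=> hf mg gM; have iM := intgZ M (intg_abs hf).
apply: (intg_le _ _ iM); first by apply: mesIM => //; exact: intg_mes.
by apply: aeI_imp gM => x _ h; rewrite normrM ler_wpM2r.
Qed.

Lemma intgM_L2 a b f g : mesI a b f -> mesI a b g ->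
  intg a b (fun x => f x ^+ 2) -> intg a b (fun x => g x ^+ 2) ->
  intg a b (fun x => f x * g x).
Proof.
move=> mf mg f2 g2; apply: (intg_le (mesIM mf mg) _ (intgD f2 g2)).
apply: aeI_all => x _; rewrite ler_norml; apply/andP; split; nra.
Qed.

Lemma intg_L2 a b f : mesI a b f -> intg a b (fun x => f x ^+ 2) -> intg a b f.
Proof.
move=> mf f2; apply: (intg_le mf _ (intgD (intg_cst a b 1) f2)).
by apply: aeI_all => x _; rewrite ler_norml; apply/andP; split; nra.
Qed.

Lemma IID a b f g : intg a b f -> intg a b g ->
  II a b (fun x => f x + g x) = II a b f + II a b g.
Proof. by move=> hf hg; rewrite /II RintegralD. Qed.

Lemma IIZ a b f c : intg a b f -> II a b (fun x => c * f x) = c * II a b f.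
Proof. by move=> hf; rewrite /II RintegralZl. Qed.

Lemma IIN a b f : intg a b f -> II a b (fun x => - f x) = - II a b f.
Proof.
move=> hf; rewrite -mulN1r -IIZ//; congr II.
by apply/funext => x; rewrite mulN1r.
Qed.

Lemma IIB a b f g : intg a b f -> intg a b g ->
  II a b (fun x => f x - g x) = II a b f - II a b g.
Proof. by move=> hf hg; rewrite IID ?IIN//; exact: intgN. Qed.

Lemma II_cst a b c : a <= b -> II a b (fun=> c) = c * (b - a).
Proof.
by move=> ab; rewrite /II Rintegral_cst//; congr (_ * _); rewrite -[RHS]/(fine (b - a)%:E) -(mu_itv ab).
Qed.

Lemma II_0 a b : II a b (fun=> 0) = 0.
Proof. by rewrite /II /Rintegral integral0. Qed.

Lemma II_ae a b f g : mesI a b f -> mesI a b g ->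
  aeI a b (fun x => f x = g x) -> II a b f = II a b g.
Proof.
move=> mf mg fg; rewrite /II /Rintegral; congr fine.
apply: ae_eq_integral => //; [exact/measurable_EFinP|exact/measurable_EFinP|].
by move: fg; rewrite /aeI; apply: filterS => x /= h xab; rewrite h.
Qed.

Lemma II_eq a b f g : (forall x, x \in `]a, b[ -> f x = g x) ->
  II a b f = II a b g.
Proof. by move=> fg; apply: eq_Rintegral => x /set_mem xab; apply: fg. Qed.

Lemma II_sum n a b (f : 'I_n -> R -> R) :
  (forall i, intg a b (f i)) ->
  II a b (fun x => \sum_i f i x) = \sum_i II a b (f i).
Proof.
elim: n f => [|n IH] f hf.
  by rewrite big_ord0 -[RHS](II_0 a b); apply: II_eq => x _; rewrite big_ord0.
rewrite big_ord_recl -IH// -IID//.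
  by apply: II_eq => x _; rewrite big_ord_recl.
exact: intg_sum.
Qed.

Lemma II_ge0 a b f : mesI a b f -> aeI a b (fun x => 0 <= f x) -> 0 <= II a b f.
Proof.
move=> mf f0; rewrite (II_ae mf (mesI_abs mf)); first exact: Rintegral_ge0.
by apply: aeI_imp f0 => x _ h; rewrite ger0_norm.
Qed.

Lemma II_le a b f g : intg a b f -> intg a b g ->
  aeI a b (fun x => f x <= g x) -> II a b f <= II a b g.
Proof.
move=> hf hg fg; rewrite -subr_ge0 -IIB//; apply: II_ge0.
  by apply: mesIB; exact: intg_mes.
by apply: aeI_imp fg => x _; rewrite subr_ge0.
Qed.

Lemma II_abs a b f : intg a b f -> `|II a b f| <= II a b (fun x => `|f x|).
Proof. by move=> hf; apply: le_normr_Rintegral. Qed.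

Lemma II_abs_le a b f g : mesI a b f -> intg a b g ->
  aeI a b (fun x => `|f x| <= g x) -> `|II a b f| <= II a b g.
Proof.
move=> mf hg fg; have hf := intg_le mf fg hg.
by apply: (le_trans (II_abs hf)); apply: II_le => //; exact: intg_abs.
Qed.

Lemma II_bnd a b f M : a <= b -> mesI a b f -> aeI a b (fun x => `|f x| <= M) ->
  `|II a b f| <= M * (b - a).
Proof.
move=> ab mf fM; rewrite -(II_cst M ab); apply: II_abs_le => //.
exact: intg_cst.
Qed.

Lemma II_nil a b f : b <= a -> II a b f = 0.
Proof.
by move=> ba; rewrite /II set_itv_ge ?Rintegral_set0// bnd_simp -leNgt.
Qed.

Lemma II_split a b c f : a <= c -> c <= b -> intg a b f ->
  II a b f = II a c f + II c b f.
Proof.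
move=> ac cb hf.
have hac : intg a c f by exact: intg_sub hf.
have hcb : intg c b f by exact: intg_sub hf.
have [->|ac'] := eqVneq a c; first by rewrite (@II_nil c c)// add0r.
have {}ac : a < c by rewrite lt_neqAle ac'.
have [->|cb'] := eqVneq c b; first by rewrite (@II_nil b b)// addr0.
have {}cb : c < b by rewrite lt_neqAle cb'.
have ac2 : (BRight a <= BRight c)%O by rewrite bnd_simp ltW.
have cb2 : (BRight c <= BLeft b)%O by rewrite bnd_simp.
(* The point [c] joins the left piece: []a, c]] and []c, b[] are disjoint and cover []a, b[]. *)
rewrite /II [in RHS]Rintegral_itv_bndo_bndc//.
rewrite [in LHS](@itv_bndbnd_setU _ _ (BRight a) (BRight c) (BLeft b))//.
rewrite Rintegral_setU//=.
- by rewrite -(@itv_bndbnd_setU _ _ (BRight a) (BRight c) (BLeft b))//.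
- apply/disj_setPRL => z /=; rewrite !in_itv/= => /andP[cz _].
  by rewrite leNgt cz andbF.
Qed.

Lemma II_mono a b c d f : a <= c -> c <= d -> d <= b -> intg a b f ->
  aeI a b (fun x => 0 <= f x) -> II c d f <= II a b f.
Proof.
move=> ac cd db hf f0; rewrite (II_split ac (le_trans cd db) hf).
rewrite (II_split cd db (intg_sub ac (lexx _) hf)).
have h e e' : a <= e -> e' <= b -> 0 <= II e e' f.
  move=> ae eb; apply: II_ge0; last exact: aeI_sub f0.
  by apply: mesI_sub (intg_mes hf).
by rewrite addrCA lerDl addr_ge0// h// ?(le_trans cd) ?(le_trans ac).
Qed.

Lemma intg_glue a b c f : a <= c -> c <= b -> intg a c f -> intg c b f ->
  intg a b f.
Proof.
move=> ac cb hac hcb.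
have [e|ac'] := eqVneq a c; first by rewrite e.
have {}ac : a < c by rewrite lt_neqAle ac'.
have [e|cb'] := eqVneq c b; first by rewrite -e.
have {}cb : c < b by rewrite lt_neqAle cb'.
have ac2 : (BRight a <= BRight c)%O by rewrite bnd_simp ltW.
have cb2 : (BRight c <= BLeft b)%O by rewrite bnd_simp.
rewrite /intg (@itv_bndbnd_setU _ _ (BRight a) (BRight c) (BLeft b))//.
have mf : measurable_fun (`]a, c] `|` `]c, b[ : set R) (EFin \o f).
  apply/measurable_funU => //; split; apply/measurable_EFinP.
    by apply/measurable_fun_itv_bndo_bndcP; exact: intg_mes.
  exact: intg_mes.
apply/integrableP; split => //.
have mabs D : measurable_fun D (EFin \o f) -> measurable_fun D (fun x => `|(f x)%:E|)%E.
  by move=> h; apply: measurableT_comp h.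
rewrite ge0_integral_setU//=.
- rewrite lte_add_pinfty//.
    have /integrableP[m] := hac.
    by rewrite integral_itv_bndo_bndc//; exact: mabs.
  by have /integrableP[m] := hcb.
- exact: mabs.
- apply/disj_setPRL => z /=; rewrite !in_itv/= => /andP[cz _].
  by rewrite leNgt cz andbF.
Qed.

End OneDim.

(** * Absolutely continuous functions *)

Section AC.
Context {R : realType}.
Notation mu := (@lebesgue_measure R).
Implicit Types (a b c d : R) (f g : R -> R).

Lemma intg_unif_cont a b f (e : R) : 0 < e -> intg a b f ->
  exists2 d : R, 0 < d & forall x y, a <= x -> x <= y -> y <= b -> y - x < d ->
    II x y (fun z => `|f z|) <= e.
Proof.
move=> e0 hf.
have hT : mu.-integrable setT (EFin \o (f \_ `]a, b[)).
  by rewrite -restrict_EFin; apply/(integrable_mkcond _ _).1.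
have [d [d0 h]] := integral_normr_continuous hT e0.
exists d => // x y ax xy yb yxd.
have mxy : (mu `]x, y[ < d%:E)%E by rewrite mu_itv// lte_fin.
have /ltW := h `]x, y[%classic (measurable_itv _) mxy; apply: le_trans.
rewrite le_eqVlt; apply/orP; left; apply/eqP; apply: II_eq => z.
rewrite in_itv/= => /andP[xz zy]; rewrite patchE ifT//.
by rewrite inE/= in_itv/= (le_lt_trans ax)// (lt_le_trans zy).
Qed.

(* Subdivide [a, b] finely and sum the local bound. *)
Lemma increment_le a b (L Th M : R -> R) : a <= b ->
  (forall e, 0 < e -> exists2 d : R, 0 < d & forall x y, a <= x -> x <= y ->
     y <= b -> y - x < d ->
     `|L y - L x| <= (Th y - Th x) + e * (M y - M x)) ->
  `|L b - L a| <= Th b - Th a.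
Proof.
move=> ab h; apply/ler_addgt0Pr => e e0.
(* The local error is taken with [e / m] in place of [e], so that its total over the interval stays
   below [e]. *)
pose m := `|M b - M a| + 1.
have m0 : 0 < m by rewrite ltr_pwDr.
have [d d0 {}h] := h (e / m) (divr_gt0 e0 m0).
have [n [nd n0]] : exists n : nat, (b - a) / n.+1%:R < d /\ 0 < n.+1%:R :> R.
  exists (Num.bound ((b - a) / d)); split => //.
  rewrite ltr_pdivrMr ?ltr0Sn// mulrC -ltr_pdivrMr//.
  apply: lt_trans (_ : (Num.bound ((b - a) / d))%:R < _); last by rewrite ltr_nat.
  by rewrite archi_boundP// divr_ge0 ?subr_ge0// ltW.
have [s [s0 sd]] : exists s : R, (0 <= s /\ s * n.+1%:R = b - a) /\ s < d.
  exists ((b - a) / n.+1%:R); split => //; split; first by rewrite divr_ge0 ?subr_ge0// ltW.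
  by rewrite divfK// gt_eqF.
have H : forall k, (k <= n.+1)%N -> `|L (a + k%:R * s) - L a| <=
   (Th (a + k%:R * s) - Th a) + e / m * (M (a + k%:R * s) - M a).
  elim=> [|k IH] kn; first by rewrite mul0r addr0 !subrr normr0 mulr0 addr0.
  have k1 : k.+1%:R * s = k%:R * s + s :> R by rewrite -natr1 mulrDl mul1r.
  have sb : a + k.+1%:R * s <= b.
    have : k.+1%:R * s <= n.+1%:R * s by rewrite ler_wpM2r ?ler_nat ?s0.1.
    by rewrite (mulrC n.+1%:R) s0.2; lra.
  have ks : 0 <= k%:R * s by rewrite mulr_ge0 ?s0.1.
  have := h (a + k%:R * s) (a + k.+1%:R * s).
  have {}s0 := s0.1.
  rewrite k1 => /(_ ltac:(lra) ltac:(lra) ltac:(rewrite -k1; exact: sb) ltac:(lra)).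
  have := IH (ltnW kn).
  move: (L _) (L (a + (_ + _))) (L a) => l1 l2 l3 H1 H2.
  have -> : l2 - l3 = (l1 - l3) + (l2 - l1) by ring.
  by apply: (le_trans (ler_normD _ _)); lra.
have := H n.+1 (leqnn _).
have -> : a + n.+1%:R * s = b by rewrite mulrC s0.2; ring.
move/le_trans; apply; rewrite lerD2l.
have : M b - M a <= m by rewrite /m; have := ler_norm (M b - M a); lra.
rewrite -(ler_pM2l (divr_gt0 e0 m0)) => /le_trans; apply.
by rewrite divfK// gt_eqF.
Qed.

(** Absolute continuity on the closed interval in integral form. The density is part of the data and
    matters only up to null sets, which is how weak derivatives enter. *)
Definition ac a b f f' : Prop :=
  intg a b f' /\ forall x, a <= x -> x <= b -> f x = f a + II a x f'.

Lemma ac_inc a b f f' x y : ac a b f f' -> a <= x -> x <= y -> y <= b ->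
  f y - f x = II x y f'.
Proof.
move=> [i h] ax xy yb; rewrite (h y)// ?(le_trans ax)// (h x)// ?(le_trans xy)//.
by rewrite (II_split ax xy); [ring|exact: intg_sub i].
Qed.

Lemma ac_sub a b c d f f' : a <= c -> d <= b -> ac a b f f' -> ac c d f f'.
Proof.
move=> ac_ db h; split; first exact: intg_sub h.1.
move=> x cx xd; rewrite -(ac_inc h ac_ cx) ?(le_trans xd)//; ring.
Qed.

Lemma acI a b f f' : intg a b f' ->
  (forall x y, a <= x -> x <= y -> y <= b -> f y - f x = II x y f') -> ac a b f f'.
Proof.
move=> i h; split=> // x ax xb; rewrite -(h a x)//; ring.
Qed.

Lemma ac_II a b f : intg a b f -> ac a b (fun x => II a x f) f.
Proof. by move=> i; split=> // x ax xb; rewrite (@II_nil _ a a)// add0r. Qed.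

Lemma ac_unif a b f f' (e : R) : 0 < e -> ac a b f f' ->
  exists2 d : R, 0 < d & forall x y, a <= x -> x <= y -> y <= b -> y - x < d ->
    `|f y - f x| <= e.
Proof.
move=> e0 h; have [d d0 H] := intg_unif_cont e0 h.1.
exists d => // x y ax xy yb yx; rewrite (ac_inc h ax xy yb).
apply: le_trans (H x y ax xy yb yx); apply: II_abs; exact: intg_sub h.1.
Qed.

Lemma ac_bnd a b f f' x : ac a b f f' -> a <= x -> x <= b ->
  `|f x| <= `|f a| + II a b (fun z => `|f' z|).
Proof.
move=> h ax xb; rewrite h.2//; apply: (le_trans (ler_normD _ _)); rewrite lerD2l.
have i : intg a x f' by exact: intg_sub h.1.
apply: (le_trans (II_abs i)); apply: II_mono => //; first exact: intg_abs h.1.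
by apply: aeI_all => z _.
Qed.

Lemma ac_cont a b f f' x : ac a b f f' -> a < x -> x < b -> {for x, continuous f}.
Proof.
move=> h ax xb; apply/cvgrPdist_le => e e0.
have [d d0 H] := ac_unif e0 h.
near=> y.
have ay : a <= y by apply: ltW; near: y; exact: lt_nbhsr.
have yb : y <= b by apply: ltW; near: y; exact: lt_nbhsl.
have yd : `|x - y| < d by near: y; by exists d.
have [xy|yx] := leP x y.
  rewrite distrC; apply: H => //; first exact: ltW.
  by move: yd; rewrite ltr_norml; lra.
apply: H => //; [exact: ltW|exact: ltW|].
by move: yd; rewrite ltr_norml; lra.
Unshelve. all: end_near. Qed.

Lemma ac_mes a b f f' : ac a b f f' -> mesI a b f.
Proof.
move=> h; apply: open_continuous_measurable_fun; first exact: itv_open.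
by move=> x; rewrite inE/= in_itv/= => /andP[ax xb]; exact: ac_cont h ax xb.
Qed.

Lemma ac_intg a b f f' : ac a b f f' -> intg a b f.
Proof.
move=> h; apply: (intg_bnd (ac_mes h)); apply: aeI_all => x.
by rewrite in_itv/= => /andP[ax xb]; apply: (ac_bnd h); exact: ltW.
Qed.

Lemma ac_cst a b k : ac a b (fun=> k) (fun=> 0).
Proof. by split; [exact: intg_cst|move=> x _ _; rewrite II_0 addr0]. Qed.

Lemma ac_id a b : ac a b (fun x => x) (fun=> 1).
Proof.
by split; [exact: intg_cst|move=> x ax _; rewrite II_cst//; ring].
Qed.

Lemma ac_add a b f f' g g' : ac a b f f' -> ac a b g g' ->
  ac a b (fun x => f x + g x) (fun x => f' x + g' x).
Proof.
move=> hf hg; split; first exact: intgD hf.1 hg.1.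
move=> x ax xb; rewrite IID; last 2 first.
- exact: intg_sub hf.1.
- exact: intg_sub hg.1.
by rewrite (hf.2 x)// (hg.2 x)//; ring.
Qed.

Lemma ac_scale a b f f' k : ac a b f f' ->
  ac a b (fun x => k * f x) (fun x => k * f' x).
Proof.
move=> hf; split; first exact: intgZ hf.1.
move=> x ax xb; rewrite IIZ ?(hf.2 x)//; first by ring.
exact: intg_sub hf.1.
Qed.

Lemma ac_sum n a b (f f' : 'I_n -> R -> R) : (forall i, ac a b (f i) (f' i)) ->
  ac a b (fun x => \sum_i f i x) (fun x => \sum_i f' i x).
Proof.
move=> h; split; first by apply: intg_sum => i; exact: (h i).1.
move=> x ax xb; rewrite II_sum; last by move=> i; exact: intg_sub (h i).1.
by rewrite -big_split/=; apply: eq_bigr => i _; exact: (h i).2.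
Qed.

Lemma ac_eq a b f f' g g' : ac a b f f' -> intg a b g' ->
  (forall x, a <= x -> x <= b -> f x = g x) ->
  aeI a b (fun x => f' x = g' x) -> ac a b g g'.
Proof.
move=> h i fg fg'; split=> // x ax xb.
rewrite -(fg x)// -(fg a)// ?(le_trans ax)// h.2//; congr (_ + _); apply: II_ae.
- by apply: mesI_sub (intg_mes h.1).
- by apply: mesI_sub (intg_mes i).
- exact: aeI_sub fg'.
Qed.

(** By [increment_le]: over a short interval the defect of the product rule is the integral of [f']
    and [g'] against oscillations of [g] and [f], hence at most [e] times the integral of |f'| +
    |g'|. *)
Lemma ac_mul a b f f' g g' : ac a b f f' -> ac a b g g' ->
  ac a b (fun x => f x * g x) (fun x => f' x * g x + f x * g' x).
Proof.
have [ba|ab] := ltP b a.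
  move=> _ _; split=> [|x ax xb]; last by have := le_trans ax xb; rewrite leNgt ba.
  by rewrite /intg set_itv_ge ?bnd_simp -?leNgt ?ltW//; exact: integrable_set0.
move=> hf hg.
have ifg : intg a b (fun x => f' x * g x + f x * g' x).
  apply: intgD; last first.
    apply: (intgM_bnd hg.1 (ac_mes hf)); apply: aeI_all => x.
    by rewrite in_itv/= => /andP[ax xb]; apply: (ac_bnd hf); exact: ltW.
  under eq_fun do rewrite mulrC.
  apply: (intgM_bnd hf.1 (ac_mes hg)); apply: aeI_all => x.
  by rewrite in_itv/= => /andP[ax xb]; apply: (ac_bnd hg); exact: ltW.
split=> // x ax xb.
have {ab xb b hf hg ifg} [hf hg ifg] : [/\ ac a x f f', ac a x g g' &
    intg a x (fun x => f' x * g x + f x * g' x)].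
  by split; [exact: ac_sub hf|exact: ac_sub hg|exact: intg_sub ifg].
pose L y := f y * g y - II a y (fun x => f' x * g x + f x * g' x).
pose m z := `|f' z| + `|g' z|.
have im : intg a x m by apply: intgD; apply: intg_abs; [exact: hf.1|exact: hg.1].
suff : `|L x - L a| <= 0 - 0.
  rewrite subrr normr_le0 subr_eq0 => /eqP; rewrite /L (@II_nil _ a a)//; lra.
apply: (@increment_le a x L (fun=> 0) (fun y => II a y m) ax) => e e0.
have [d1 d10 H1] := ac_unif e0 hf.
have [d2 d20 H2] := ac_unif e0 hg.
exists (Num.min d1 d2); first by rewrite lt_min d10.
move=> c d ac_ cd dx; rewrite lt_min => /andP[cd1 cd2].
have sub h : intg a x h -> intg c d h by move=> i; exact: intg_sub i.
rewrite (@II_split _ a d c m)//; last by exact: intg_sub im.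
have -> : II a c m + II c d m - II a c m = II c d m by ring.
rewrite subrr add0r -IIZ; last exact: sub.
have -> : L d - L c = II c d (fun z => f' z * (g d - g z) + g' z * (f c - f z)).
  rewrite /L (@II_split _ a d c)//; last by exact: intg_sub ifg.
  have -> : II c d (fun z => f' z * (g d - g z) + g' z * (f c - f z)) =
     II c d (fun z => (g d * f' z + f c * g' z) - (f' z * g z + f z * g' z)).
    by apply: II_eq => z _; ring.
  rewrite IIB; last 2 first.
  - by apply: intgD; apply: intgZ; apply: sub; [exact: hf.1|exact: hg.1].
  - exact: sub.
  rewrite [in RHS]IID; last 2 first.
  - by apply: intgZ; apply: sub; exact: hf.1.
  - by apply: intgZ; apply: sub; exact: hg.1.
  rewrite !IIZ; [|exact: sub hg.1|exact: sub hf.1].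
  by rewrite -(ac_inc hf ac_ cd dx) -(ac_inc hg ac_ cd dx); ring.
apply: II_abs_le.
- have mf := mesI_sub ac_ dx (ac_mes hf).
  have mg := mesI_sub ac_ dx (ac_mes hg).
  have mf' := intg_mes (sub _ hf.1); have mg' := intg_mes (sub _ hg.1).
  apply: mesID; apply: mesIM => //; apply: mesIB => //; exact: mesI_cst.
- by apply: intgZ; exact: sub.
- apply: aeI_all => z; rewrite in_itv/= => /andP[cz zd].
  apply: (le_trans (ler_normD _ _)); rewrite !normrM mulrDr.
  rewrite ![e * _]mulrC; apply: lerD; apply: ler_wpM2l => //.
    by apply: H2; lra.
  by rewrite distrC; apply: H1; lra.
Qed.

End AC.

(** * Lebesgue differentiation and test functions *)

Section Lebesgue.
Context {R : realType}.
Notation mu := (@lebesgue_measure R).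
Implicit Types (a b c d : R) (f g : R -> R).

Lemma near_itvoo a b x : x \in `]a, b[ -> \forall y \near x, y \in `]a, b[.
Proof. by move=> xab; apply: near_in_itvoo. Qed.

(** The differentiation theorem for primitives from -oo is applied to [f] cut off outside the
    interval; near each interior point the two primitives agree. *)
Lemma II_FTC a b f : intg a b f ->
  aeI a b (fun x => derivable (fun y => II a y f) x 1 /\
                    'D_1 (fun y => II a y f) x = f x).
Proof.
move=> hf; pose g := f \_ `]a, b[.
have ig : mu.-integrable setT (EFin \o g).
  by rewrite /g -restrict_EFin; apply/(integrable_mkcond _ _).1.
have lg : locally_integrable setT g by apply: open_integrable_locally ig; exact: openT.
have ig' y : mu.-integrable `]-oo, y] (EFin \o g) by apply: integrableS ig.
have := FTC1Ny ig' lg.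
rewrite /aeI; apply: filterS => x /= [dF F'] xab.
have fx : f x = g x by rewrite /g patchE ifT// inE.
have eqn : {near x, (fun y => (\int[mu]_(t in `]-oo, y]) g t)%R) =1
                    (fun y => II a y f)}.
  near=> y; rewrite /g -Rintegral_mkcondr /II.
  have : y \in `]a, b[ by near: y; exact: near_itvoo.
  rewrite in_itv/= => /andP[ay yb].
  rewrite [RHS]Rintegral_itv_bndo_bndc; last first.
    by apply: (@intg_sub _ a b) => //; exact: ltW.
  congr (Rintegral _ _ _); apply/seteqP; split=> z /=; rewrite !in_itv/=.
    by move=> [-> /andP[-> _]].
  by move=> /andP[-> zy]; rewrite zy (le_lt_trans zy yb).
split; first exact: near_eq_derivable eqn dF.
by rewrite -(near_eq_derive _ eqn) fx -F' derive1E.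
Unshelve. all: end_near. Qed.

Lemma ac_eq0 a b f f' : ac a b f f' -> f a = 0 ->
  (forall q : rat, a < ratr q -> ratr q < b -> f (ratr q) = 0) ->
  forall x, a <= x -> x < b -> f x = 0.
Proof.
move=> h fa H x ax xb; apply/eqP; rewrite -normr_le0.
apply/ler_addgt0Pr => e e0; rewrite add0r.
have [d d0 Hd] := ac_unif e0 h.
have [q] : exists q : rat, x < ratr q < Num.min b (x + d).
  by have [q] := @rat_in_itvoo R x (Num.min b (x + d)) ltac:(by rewrite lt_min xb ltrDl);
    rewrite in_itv/= => ?; exists q.
rewrite lt_min => /and3P[xq qb qd].
have := Hd x (ratr q) ax (ltW xq) (ltW qb).
rewrite (H q)// ?sub0r ?normrN; [|exact: le_lt_trans ax xq].
by apply; lra.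
Qed.

(** Rational end points suffice because the primitive is continuous. This is what later keeps the
    families of test functions countable. *)
Lemma II_zero a b f : intg a b f ->
  (forall q : rat, a < ratr q -> ratr q < b -> II a (ratr q) f = 0) ->
  aeI a b (fun x => f x = 0).
Proof.
move=> hf H; have z := @ac_eq0 a b (fun x => II a x f) f (ac_II hf) (II_nil _ (lexx _)) H.
apply: aeI_imp (II_FTC hf) => x xab [_ <-].
rewrite (@near_eq_derive _ _ _ _ (cst 0)) ?derive_cst//.
near=> y; have : y \in `]a, b[ by near: y; exact: near_itvoo.
by rewrite in_itv/= => /andP[ay yb]; rewrite z// ltW.
Unshelve. all: end_near. Qed.

Definition lintg a b f : Prop := forall c d, a < c -> d < b -> intg c d f.

Lemma lintgW a b f : intg a b f -> lintg a b f.
Proof. by move=> h c d ac_ db; apply: intg_sub h; exact: ltW. Qed.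

Lemma locally_lintg a b f : locally_integrable `]a, b[ f -> lintg a b f.
Proof.
move=> [mf _ h] c d ac_ db.
have sub : `[c, d] `<=` (`]a, b[ : set R).
  by move=> z; rewrite /= !in_itv/= => /andP[cz zd]; rewrite (lt_le_trans ac_)//= (le_lt_trans zd).
have hcd : mu.-integrable `[c, d] (EFin \o f).
  apply/integrableP; split; last by apply: h => //; exact: segment_compact.
  by apply/measurable_EFinP; apply: measurable_funS mf.
apply: integrableS hcd => //.
by apply: subset_itv; rewrite bnd_simp.
Qed.

Lemma aeI_rat a b (P : R -> Prop) :
  (forall q r : rat, a < ratr q -> ratr r < b -> ratr q < ratr r :> R ->
     aeI (ratr q) (ratr r) P) -> aeI a b P.
Proof.
move=> h.
have : aeI a b (fun x => forall qr : rat * rat, a < ratr qr.1 -> ratr qr.2 < b ->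
   x \in `](ratr qr.1 : R), ratr qr.2[ -> P x).
  apply: aeI_count => -[q r] /=.
  have [aq|aq] := ltP a (ratr q); last by apply: aeI_all.
  have [rb|rb] := ltP (ratr r) b; last by apply: aeI_all.
  have [qr|qr] := ltP (ratr q) (ratr r : R); last first.
    apply: aeI_all => x _ _ _; rewrite in_itv/= => /andP[/lt_trans/[apply]].
    by rewrite ltNge qr.
  have := h q r aq rb qr; rewrite /aeI; apply: filterS => x + _ _ _ xqr.
  exact.
apply: aeI_imp => x; rewrite in_itv/= => /andP[ax xb] H.
have [q] := @rat_in_itvoo R a x ax; rewrite in_itv/= => /andP[aq qx].
have [r] := @rat_in_itvoo R x b xb; rewrite in_itv/= => /andP[xr rb].
by apply: (H (q, r)) => //=; rewrite in_itv/= qx.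
Qed.

Lemma II_zero_loc a b f : lintg a b f ->
  (forall q r : rat, a < ratr q -> ratr q < ratr r :> R -> ratr r < b ->
     II (ratr q) (ratr r) f = 0) -> aeI a b (fun x => f x = 0).
Proof.
move=> hf H; apply: aeI_rat => q r aq rb qr; apply: II_zero; first exact: hf.
by move=> s qs sr; apply: H => //; exact: lt_trans rb.
Qed.

Lemma II_supp a b c d f : a <= c -> d <= b ->
  (forall x, x \notin `]c, d[ -> f x = 0) -> II a b f = II c d f.
Proof.
move=> ac_ db h; rewrite /II.
have -> : f = f \_ `]c, d[.
  apply/funext => x; rewrite patchE; case: ifPn => // /negP xcd.
  by apply: h; apply/negP => H; apply: xcd; rewrite inE.
rewrite -!Rintegral_mkcondr; congr (Rintegral _ _ _); rewrite setIid.
apply/seteqP; split=> [z []//|z /= zcd]; split=> //.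
by move: zcd; rewrite !in_itv/= => /andP[cz zd]; rewrite (le_lt_trans ac_)//= (lt_le_trans zd).
Qed.

(** A continuous trapezoid that rises with slope n + 1 at both ends of []c, d[] and tends to the
    indicator of this interval. *)
Definition trap c d (n : nat) (x : R) : R :=
  Num.max 0 (Num.min 1 (Num.min ((x - c) * n.+1%:R) ((d - x) * n.+1%:R))).

Lemma trap_cont c d n : continuous (trap c d n).
Proof.
move=> x.
have h1 : {for x, continuous (fun y : R => ((y - c) * n.+1%:R : R^o))}.
  by apply: cvgM; [apply: cvgB; [exact: cvg_id|exact: cvg_cst]|exact: cvg_cst].
have h2 : {for x, continuous (fun y : R => ((d - y) * n.+1%:R : R^o))}.
  by apply: cvgM; [apply: cvgB; [exact: cvg_cst|exact: cvg_id]|exact: cvg_cst].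
have hc k : {for x, continuous (fun _ : R => (k : R^o))} by exact: cvg_cst.
exact: (continuous_max (hc 0) (continuous_min (hc 1) (continuous_min h1 h2))).
Qed.

Lemma trap_ge0 c d n x : 0 <= trap c d n x.
Proof. by rewrite /trap le_max lexx. Qed.

Lemma trap_le1 c d n x : trap c d n x <= 1.
Proof. by rewrite /trap ge_max ler01 ge_min lexx. Qed.

Lemma trap_out c d n x : x \notin `]c, d[ -> trap c d n x = 0.
Proof.
rewrite in_itv/= negb_and -!leNgt => h; rewrite /trap; apply/max_idPl.
rewrite !ge_min; case/orP: h => h; apply/orP; right; apply/orP; [left|right];
  by rewrite mulr_le0_ge0// subr_le0.
Qed.

Lemma trap_lim c d x : x \in `]c, d[ -> \forall n \near \oo, trap c d n x = 1.
Proof.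
rewrite in_itv/= => /andP[cx xd].
pose m := Num.min (x - c) (d - x).
have m0 : 0 < m by rewrite lt_min !subr_gt0 cx.
near=> n.
have h : 1 <= m * n.+1%:R.
  rewrite mulrC -ler_pdivrMr// mul1r.
  apply: le_trans (_ : n%:R <= _); last by rewrite ler_nat.
  by apply: ltW; near: n; exact: nbhs_infty_gtr.
have h1 : 1 <= (x - c) * n.+1%:R.
  by apply: (le_trans h); rewrite ler_wpM2r// ge_min lexx.
have h2 : 1 <= (d - x) * n.+1%:R.
  by apply: (le_trans h); rewrite ler_wpM2r// ge_min lexx orbT.
rewrite /trap (min_idPl _); last by rewrite le_min h1.
by apply/max_idPr.
Unshelve. all: end_near. Qed.

Lemma cont_mesI a b p : continuous p -> mesI a b p.
Proof. by move=> cp; apply: measurable_funTS; exact: continuous_measurable_fun. Qed.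

Lemma trap_intg a b c d n : intg a b (trap c d n).
Proof.
apply: (@intg_bnd _ _ _ _ 1); first by apply: cont_mesI; exact: trap_cont.
by apply: aeI_all => x _; rewrite ger0_norm ?trap_ge0// trap_le1.
Qed.

(** If the integral vanished, so would the integral over every subinterval starting at [c], and
    [II_zero] would produce a zero of the trapezoid inside []c, d[]. *)
Lemma trap_pos c d n : c < d -> 0 < II c d (trap c d n).
Proof.
move=> cd; rewrite lt_neqAle; apply/andP; split; last first.
  apply: II_ge0; first exact: intg_mes (trap_intg _ _ _ _ _).
  by apply: aeI_all => x _; exact: trap_ge0.
apply/eqP => h0.
have Z x : c <= x -> x <= d -> II c x (trap c d n) = 0.
  move=> cx xd; apply/eqP; rewrite eq_le; apply/andP; split.
    rewrite [leRHS]h0; apply: II_mono => //; first exact: trap_intg.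
    by apply: aeI_all => z _; exact: trap_ge0.
  apply: II_ge0; first exact: intg_mes (trap_intg _ _ _ _ _).
  by apply: aeI_all => z _; exact: trap_ge0.
have := @II_zero c d (trap c d n) (trap_intg _ _ _ _ _).
have Z' (q : rat) : c < ratr q -> ratr q < d -> II c (ratr q) (trap c d n) = 0.
  by move=> cq qd; apply: Z; exact: ltW.
move=> /(_ Z')/(aeI_ex cd)[x xcd].
move: (xcd); rewrite in_itv/= => /andP[cx xd].
rewrite /trap => /max_idPl; rewrite !ge_min ler10/= => /orP[]; rewrite pmulr_lle0 ?ltr0Sn//; lra.
Qed.

(* The normalized trapezoid subtracted makes the mean vanish, so that the
   primitive has compact support. *)
Definition mbump c d c0 d0 n (x : R) : R :=
  trap c d n x - II c d (trap c d n) / II c0 d0 (trap c0 d0 0) * trap c0 d0 0 x.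

(** Integration starts at -oo so that the primitive is defined on the whole line, as test functions
    are. *)
Definition primit (p : R -> R) x : R := (\int[mu]_(t in `]-oo, x]) p t)%R.

Lemma mbump_cont c d c0 d0 n : continuous (mbump c d c0 d0 n).
Proof.
move=> x; apply: cvgB; first exact: trap_cont.
by apply: cvgM; [exact: cvg_cst|exact: trap_cont].
Qed.

Lemma mbump_out c d c0 d0 n lo hi x : lo <= c -> lo <= c0 -> d <= hi -> d0 <= hi ->
  x \notin `]lo, hi[ -> mbump c d c0 d0 n x = 0.
Proof.
move=> h1 h2 h3 h4 xo; rewrite /mbump !trap_out ?mulr0 ?subr0//.
  by apply: contra xo; rewrite !in_itv/= => /andP[? ?]; rewrite (le_lt_trans h2)//= (lt_le_trans _ h4).
by apply: contra xo; rewrite !in_itv/= => /andP[? ?]; rewrite (le_lt_trans h1)//= (lt_le_trans _ h3).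
Qed.

Lemma mbump_mean c d c0 d0 n lo hi : c0 < d0 ->
  lo <= c -> lo <= c0 -> d <= hi -> d0 <= hi -> II lo hi (mbump c d c0 d0 n) = 0.
Proof.
move=> cd0 h1 h2 h3 h4; rewrite IIB; [|exact: trap_intg|apply: intgZ; exact: trap_intg].
rewrite IIZ; last exact: trap_intg.
rewrite (@II_supp lo hi c d)//; last by move=> x; exact: trap_out.
rewrite (@II_supp lo hi c0 d0)//; last by move=> x; exact: trap_out.
by rewrite divfK ?subrr// gt_eqF// trap_pos.
Qed.

Section primitive.
Variables (p : R -> R) (lo hi : R).
Hypotheses (lohi : lo <= hi) (cp : continuous p)
  (pout : forall x, x \notin `]lo, hi[ -> p x = 0).

Lemma pout_intgT : intg lo hi p.
Proof.
have : {within `[lo, hi], continuous p} by apply: continuous_subspaceT.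
move=> /(continuous_compact_integrable (@segment_compact R lo hi)).
by apply: integrableS => //; apply: subset_itv; rewrite bnd_simp.
Qed.

Lemma pout_intg : mu.-integrable setT (EFin \o p).
Proof.
have -> : EFin \o p = EFin \o (p \_ `]lo, hi[).
  apply/funext => x /=; rewrite patchE; case: ifPn => // /negP xcd; congr EFin.
  by apply: pout; apply/negP => H; apply: xcd; rewrite inE.
by rewrite -restrict_EFin; apply/(integrable_mkcond _ _).1 => //; exact: pout_intgT.
Qed.

Lemma primit_inc x y : x <= y -> primit p y - primit p x = II x y p.
Proof.
move=> xy; rewrite /primit Rintegral_itvB ?bnd_simp//.
  rewrite /II -Rintegral_itv_bndo_bndc//.
  by apply: integrableS pout_intg.
by apply: integrableS pout_intg.
Qed.

Lemma primit_lo x : x <= lo -> primit p x = 0.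
Proof.
move=> xlo; rewrite /primit -(@Rintegral_set0 _ _ _ mu p) [LHS]Rintegral_mkcond [RHS]Rintegral_mkcond.
congr (Rintegral _ _ _); apply/funext => z; rewrite !patchE in_set0.
case: ifPn => //; rewrite inE/= in_itv/= => zx; apply: pout.
by rewrite in_itv/= negb_and -leNgt (le_trans zx xlo).
Qed.

Lemma primit_hi x : II lo hi p = 0 -> hi <= x -> primit p x = 0.
Proof.
move=> p0 hx; have := primit_inc (le_trans lohi hx).
rewrite (primit_lo (lexx lo)) subr0 => ->; rewrite -[RHS]p0.
exact: II_supp.
Qed.

Lemma primit_ac a b : ac a b (primit p) p.
Proof.
apply: acI => [|x y _ xy _]; last exact: primit_inc.
by apply: integrableS pout_intg.
Qed.

Lemma primit_derivable x : derivable (primit p) x 1 /\ derive1 (primit p) x = p x.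
Proof.
apply: (@continuous_FTC1 _ p -oo%O x (x + 1)) => //; first by rewrite ltrDl.
- by apply: integrableS pout_intg.
- exact: ltNyr.
- exact: cp.
Qed.

Lemma primit_test a b : a < lo -> hi < b -> II lo hi p = 0 ->
  test_function a b (primit p).
Proof.
move=> alo hib p0; split.
- by move=> y; exact: (primit_derivable y).1.
- have -> : derive1 (primit p) = p by apply/funext => y; exact: (primit_derivable y).2.
  exact: cp.
- exists lo, hi; split=> // y; rewrite in_itv/= negb_and -!ltNge => /orP[h|h].
    by apply: primit_lo; exact: ltW.
  by apply: primit_hi => //; exact: ltW.
Qed.

End primitive.

End Lebesgue.

(** * Weak derivatives and absolutely continuous representatives *)

Section WeakAC.
Context {R : realType}.
Notation mu := (@lebesgue_measure R).
Implicit Types (a b c d : R) (f g u v : R -> R).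

(** Dominated convergence: the trapezoids are at most 1 and tend to 1 on []c, d[]. *)
Lemma trap_limit c d f : intg c d f ->
  (forall n, II c d (fun x => f x * trap c d n x) = 0) -> II c d f = 0.
Proof.
move=> hf h.
have mft n : mesI c d (fun x => f x * trap c d n x).
  by apply: mesIM; [exact: intg_mes|apply: cont_mesI; exact: trap_cont].
have ift n : intg c d (fun x => f x * trap c d n x).
  apply: (intg_le (mft n) _ (intg_abs hf)); apply: aeI_all => x _.
  by rewrite normrM ler_piMr// ger0_norm ?trap_ge0 ?trap_le1.
have [] := @dominated_convergence _ _ R mu `]c, d[ (measurable_itv _)
  (fun n => EFin \o (fun x => f x * trap c d n x)) (EFin \o f) (fun x => `|f x|%:E)%E.
- by move=> n; apply/measurable_EFinP; exact: mft.
- by apply/measurable_EFinP; exact: intg_mes.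
- apply: aeW => x xcd; apply/cvg_EFin; first by near=> n.
  apply: cvg_near_cst; near=> n => /=.
  have -> : trap c d n x = 1 by near: n; exact: trap_lim.
  by rewrite mulr1.
- exact: intg_abs.
- apply: aeW => x n xcd; rewrite lee_fin normrM ler_piMr// ger0_norm ?trap_ge0 ?trap_le1//.
move=> _ _ /cvg_lim lim0.
rewrite /II /Rintegral -lim0//.
rewrite (_ : (fun n => _) = cst 0%E) ?lim_cst//.
apply/funext => n /=; have := h n; rewrite /II /Rintegral => h'.
rewrite -[LHS]fineK ?h'//.
by apply: integrable_fin_num => //; exact: ift.
Unshelve. all: end_near. Qed.

(** The integration by parts that defines a weak derivative, for the single test function [primit p]
    whose derivative is [p]. *)
Definition weak_id a b u v (p : R -> R) : Prop :=
  II a b (fun x => u x * p x) = - II a b (fun x => v x * primit p x).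

(** A du Bois-Reymond argument. Integrating V by parts, u - V is orthogonal to every mean-zero bump;
    after subtraction of its average against one fixed bump it is orthogonal to every rational
    trapezoid, hence zero. The fixed bump has rational end points too, so only countably many
    identities are assumed. *)
Lemma weak_ac a b u v V (q0 r0 : rat) :
  lintg a b u -> lintg a b v ->
  (forall x y, a < x -> x <= y -> y < b -> V y - V x = II x y v) ->
  a < ratr q0 -> ratr q0 < ratr r0 :> R -> ratr r0 < b ->
  (forall (q r : rat) n, a < ratr q -> ratr q < ratr r :> R -> ratr r < b ->
     weak_id a b u v (mbump (ratr q) (ratr r) (ratr q0) (ratr r0) n)) ->
  exists k, aeI a b (fun x => u x = k + V x).
Proof.
move=> lu lv hV aq0 qr0 r0b H.
set c0 := ratr q0 : R; set d0 := ratr r0 : R; rewrite -/c0 -/d0 in H aq0 qr0 r0b.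
have acV lo hi : a < lo -> hi < b -> ac lo hi V v.
  move=> alo hib; apply: acI => [|x y lx xy yh]; first exact: lv.
  by apply: hV => //; [exact: lt_le_trans lx|exact: le_lt_trans hib].
have lw : lintg a b (fun x => u x - V x).
  by move=> lo hi alo hib; apply: intgB; [exact: lu|exact: ac_intg (acV _ _ alo hib)].
pose rho := trap c0 d0 0.
have rp : 0 < II c0 d0 rho by exact: trap_pos.
pose w x := u x - V x.
(* The average of u - V against the fixed bump, the only value the constant can have. *)
pose k := II c0 d0 (fun x => w x * rho x) / II c0 d0 rho.
have iM lo hi f n c d : intg lo hi f -> intg lo hi (fun x => f x * trap c d n x).
  move=> hf; under eq_fun do rewrite mulrC.
  apply: (@intgM_bnd _ _ _ _ _ 1 hf); first by apply: cont_mesI; exact: trap_cont.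
  by apply: aeI_all => x _; rewrite ger0_norm ?trap_ge0 ?trap_le1.
exists k.
suff : aeI a b (fun x => w x - k = 0).
  by apply: aeI_imp => x _; rewrite /w => h; lra.
apply: II_zero_loc => [lo hi alo hib|q r aq qr rb].
  by apply: intgB; [exact: lw|exact: intg_cst].
set c := ratr q : R; set d := ratr r : R; rewrite -/c -/d in aq qr rb.
have iw : intg c d w by exact: lw.
apply: trap_limit => [|n]; first by apply: intgB => //; exact: intg_cst.
have eqp : II c d (fun x => (w x - k) * trap c d n x) =
   II c d (fun x => w x * trap c d n x) - k * II c d (trap c d n).
  rewrite -IIZ; last exact: trap_intg.
  rewrite -IIB; [|exact: iM|apply: intgZ; exact: trap_intg].
  by apply: II_eq => x _; ring.
rewrite eqp; apply/eqP; rewrite subr_eq0; apply/eqP.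
(* An interval that contains the supports of both trapezoids and stays compactly inside []a, b[];
   all integrals are reduced to it. *)
pose lo := Num.min c c0; pose hi := Num.max d d0.
have [lc lc0] : lo <= c /\ lo <= c0 by rewrite /lo !ge_min !lexx orbT.
have [dh d0h] : d <= hi /\ d0 <= hi by rewrite /hi !le_max !lexx orbT.
have alo : a < lo by rewrite lt_min aq.
have hib : hi < b by rewrite gt_max rb.
have lohi : lo <= hi by apply: (le_trans lc); apply: le_trans dh; exact: ltW.
pose p := mbump c d c0 d0 n.
have cp : continuous p by exact: mbump_cont.
have pout x : x \notin `]lo, hi[ -> p x = 0 by exact: mbump_out.
have pm : II lo hi p = 0 by exact: mbump_mean.
have ilo : primit p lo = 0 by exact: (primit_lo pout).
have ihi : primit p hi = 0 by exact: (primit_hi lohi cp pout).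
have pho x : x \notin `]lo, hi[ -> primit p x = 0.
  rewrite in_itv/= negb_and -!leNgt => /orP[|] h.
    exact: (primit_lo pout).
  exact: (primit_hi lohi cp pout).
have pac := primit_ac cp pout lo hi.
have := H q r n aq qr rb; rewrite /weak_id -/c -/d -/p.
rewrite (@II_supp _ a b lo hi (fun x => u x * p x)) ?(ltW alo) ?(ltW hib)//; last first.
  by move=> x /pout ->; rewrite mulr0.
rewrite (@II_supp _ a b lo hi (fun x => v x * primit p x)) ?(ltW alo) ?(ltW hib)//; last first.
  by move=> x /pho ->; rewrite mulr0.
have mVp := ac_mul (acV _ _ alo hib) pac.
have iup : intg lo hi (fun x => u x * p x).
  under eq_fun do rewrite mulrC.
  apply: (@intgM_bnd _ _ _ _ _ (1 + `|II c d (trap c d n) / II c0 d0 rho|) (lu _ _ alo hib)).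
    exact: cont_mesI.
  apply: aeI_all => x _; rewrite /p /mbump; apply: (le_trans (ler_normB _ _)).
  apply: lerD; first by rewrite ger0_norm ?trap_ge0 ?trap_le1.
  by rewrite normrM ler_piMr// ger0_norm ?trap_ge0 ?trap_le1.
have ivp : intg lo hi (fun x => v x * primit p x).
  under eq_fun do rewrite mulrC.
  apply: (intgM_bnd (lv _ _ alo hib) (ac_mes pac)).
  apply: aeI_all => x; rewrite in_itv/= => /andP[lx xh].
  by apply: (ac_bnd pac); exact: ltW.
have iVp : intg lo hi (fun x => V x * p x).
  have := intgB mVp.1 ivp; congr intg; apply/funext => x; ring.
have e1 : II lo hi (fun x => v x * primit p x) = - II lo hi (fun x => V x * p x).
  have := ac_inc mVp (lexx _) lohi (lexx _).
  by rewrite ilo ihi !mulr0 subrr IID// => h; lra.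
rewrite e1 opprK => e2.
have e3 : II lo hi (fun x => w x * p x) = 0.
  rewrite -[RHS](subrr (II lo hi (fun x => V x * p x))) -{1}e2 -IIB//.
  by apply: II_eq => x _; rewrite /w; ring.
have ilw : intg lo hi w by exact: lw.
have e4 : II lo hi (fun x => w x * p x) = II lo hi (fun x => w x * trap c d n x) -
   II c d (trap c d n) / II c0 d0 rho * II lo hi (fun x => w x * rho x).
  rewrite -IIZ; last exact: iM.
  rewrite -IIB; [|exact: iM|apply: intgZ; exact: iM].
  by apply: II_eq => x _; rewrite /p /mbump -/rho; ring.
have e5 : II lo hi (fun x => w x * trap c d n x) = II c d (fun x => w x * trap c d n x).
  by apply: II_supp => // x xo; rewrite trap_out ?mulr0.
have e6 : II lo hi (fun x => w x * rho x) = II c0 d0 (fun x => w x * rho x).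
  by apply: II_supp => // x xo; rewrite /rho trap_out ?mulr0.
move: e4; rewrite e3 e5 e6 => e4; rewrite /k.
apply/eqP; rewrite -subr_eq0; apply/eqP; rewrite [in RHS]e4; ring.
Qed.

Lemma rat_in2 a b : a < b -> exists q r : rat,
  [/\ a < ratr q, ratr q < ratr r :> R & ratr r < b].
Proof.
move=> ab; have [q] := @rat_in_itvoo R a b ab; rewrite in_itv/= => /andP[aq qb].
have [r] := @rat_in_itvoo R (ratr q) b qb; rewrite in_itv/= => /andP[qr rb].
by exists q, r.
Qed.

Lemma mbump_test a b c d c0 d0 n : a < c -> c < d -> d < b ->
  a < c0 -> c0 < d0 -> d0 < b ->
  test_function a b (primit (mbump c d c0 d0 n)) /\
  derive1 (primit (mbump c d c0 d0 n)) = mbump c d c0 d0 n.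
Proof.
move=> ac_ cd db ac0 cd0 db0.
pose lo := Num.min c c0; pose hi := Num.max d d0.
have [lc lc0] : lo <= c /\ lo <= c0 by rewrite /lo !ge_min !lexx orbT.
have [dh d0h] : d <= hi /\ d0 <= hi by rewrite /hi !le_max !lexx orbT.
have alo : a < lo by rewrite lt_min ac_.
have hib : hi < b by rewrite gt_max db.
have lohi : lo <= hi by apply: (le_trans lc); apply: le_trans dh; exact: ltW.
have cp := @mbump_cont R c d c0 d0 n.
have pout x : x \notin `]lo, hi[ -> mbump c d c0 d0 n x = 0 by exact: mbump_out.
split; first by apply: (@primit_test _ _ lo hi) => //; exact: mbump_mean.
by apply/funext => x; exact: (primit_derivable cp pout x).2.
Qed.

Lemma weak_deriv_id a b u v (q r q0 r0 : rat) n : weak_deriv a b u v ->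
  a < ratr q -> ratr q < ratr r :> R -> ratr r < b ->
  a < ratr q0 -> ratr q0 < ratr r0 :> R -> ratr r0 < b ->
  weak_id a b u v (mbump (ratr q) (ratr r) (ratr q0) (ratr r0) n).
Proof.
move=> [_ _ h] h1 h2 h3 h4 h5 h6.
have [t de] := mbump_test n h1 h2 h3 h4 h5 h6.
by have := h _ t; rewrite de.
Qed.

Lemma weak_deriv_ac a b u v V : a < b -> weak_deriv a b u v ->
  (forall x y, a < x -> x <= y -> y < b -> V y - V x = II x y v) ->
  exists k, aeI a b (fun x => u x = k + V x).
Proof.
move=> ab h hV; have [q0 [r0 [h1 h2 h3]]] := rat_in2 ab.
have [lu lv _] := h.
apply: (weak_ac (locally_lintg lu) (locally_lintg lv) hV h1 h2 h3).
by move=> q r n *; exact: weak_deriv_id.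
Qed.

(* A null test integral means that v is a weak derivative of 0. *)
Lemma weak_zero a b v (q0 r0 : rat) :
  lintg a b v -> a < ratr q0 -> ratr q0 < ratr r0 :> R -> ratr r0 < b ->
  (forall (q r : rat) n, a < ratr q -> ratr q < ratr r :> R -> ratr r < b ->
   II a b (fun x => v x * primit (mbump (ratr q) (ratr r) (ratr q0) (ratr r0) n) x) = 0) ->
  aeI a b (fun x => v x = 0).
Proof.
move=> lv h1 h2 h3 H.
set m := ratr q0 : R.
(* The oriented primitive from [m]; the case distinction supplies the sign, since [II] is not
   oriented. *)
pose V x := if m <= x then II m x v else - II x m v.
have hV x y : a < x -> x <= y -> y < b -> V y - V x = II x y v.
  move=> ax xy yb; rewrite /V.
  have mb : m < b by apply: lt_trans h3.
  have [mx|xm] := leP m x.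
    rewrite (le_trans mx xy) (@II_split _ m y x)//; last exact: lv.
    by ring.
  have [my|ym] := leP m y.
    rewrite (@II_split _ x y m) ?(ltW xm)//; last exact: lv.
    by ring.
  rewrite (@II_split _ x m y) ?(ltW ym)//; last exact: lv.
  by ring.
have l0 : lintg a b (fun=> 0) by move=> *; exact: intg_cst.
have [|k hk] := weak_ac l0 lv hV h1 h2 h3.
  move=> q r n ? ? ?; rewrite /weak_id H// oppr0 -[RHS](@II_0 R a b).
  by apply: II_eq => x _; rewrite mul0r.
(* [weak_ac] with u = 0 gives V = -k almost everywhere, and continuity of V extends it to every
   point. *)
have kV x : a < x -> x < b -> V x = - k.
  move=> ax xb; apply/eqP; rewrite -subr_eq0 -normr_le0; apply/ler_addgt0Pr => e e0.
  rewrite add0r.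
  have [d0 [xd0 d0b]] : exists d0, x < d0 /\ d0 < b by exists ((x + b) / 2); split; lra.
  have acV : ac x d0 V v.
    by apply: acI => [|z y xz zy yd]; [exact: lv|apply: hV; lra].
  have [dl dl0 Hd] := ac_unif e0 acV.
  have mn : x < Num.min d0 (x + dl) by rewrite lt_min; lra.
  have : aeI x (Num.min d0 (x + dl)) (fun x => 0 = k + V x).
    by apply: aeI_sub hk; [exact: ltW|rewrite ge_min; lra].
  move=> /(aeI_ex mn)[z]; rewrite in_itv/= lt_min => /and3P[xz zd zl] hz.
  have := Hd x z (lexx _) (ltW xz) (ltW zd).
  have -> : V z - V x = - (V x - - k) by lra.
  by rewrite normrN; apply; lra.
apply: II_zero_loc => // q r aq qr rb.
rewrite -hV//; [|exact: ltW].
by rewrite (kV _ aq (lt_trans qr rb)) (kV _ (lt_trans aq qr) rb) subrr.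
Qed.

End WeakAC.

(** * Inequalities, boundary terms at 0 and Lipschitz weights *)

Section Tools.
Context {R : realType}.
Notation mu := (@lebesgue_measure R).
Implicit Types (a b c d : R) (f g u v : R -> R).

Lemma II_CS a b f g : mesI a b f -> mesI a b g ->
  intg a b (fun x => f x ^+ 2) -> intg a b (fun x => g x ^+ 2) ->
  II a b (fun x => f x * g x) ^+ 2 <=
  II a b (fun x => f x ^+ 2) * II a b (fun x => g x ^+ 2).
Proof.
move=> mf mg f2 g2; have fg := intgM_L2 mf mg f2 g2.
set A := II a b (fun x => f x ^+ 2); set B := II a b (fun x => g x ^+ 2).
set C := II a b (fun x => f x * g x).
have A0 : 0 <= A.
  by apply: II_ge0; [exact: intg_mes|apply: aeI_all => x _; exact: sqr_ge0].
have B0 : 0 <= B.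
  by apply: II_ge0; [exact: intg_mes|apply: aeI_all => x _; exact: sqr_ge0].
have H l m : 0 <= l ^+ 2 * A + m ^+ 2 * B - 2 * (l * m) * C.
  rewrite /A /B /C -!IIZ// -IID; [|exact: intgZ|exact: intgZ].
  rewrite -IIB; [|by apply: intgD; exact: intgZ|exact: intgZ].
  apply: II_ge0; first by apply: intg_mes; apply: intgB; [apply: intgD; exact: intgZ|exact: intgZ].
  apply: aeI_all => x _; have := sqr_ge0 (l * f x - m * g x); nra.
have [B1|B1] := eqVneq B 0.
  have [->|C0] := eqVneq C 0; first by rewrite expr0n mulr_ge0.
  (* When B = 0 and C is not, this multiplier makes the quadratic form equal to -A - 2, which is
     negative. *)
  have := H 1 ((A + 1) / C); rewrite B1 mulr0 addr0 mul1r expr1n mul1r -mulrA divfK//.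
  lra.
have B2 : 0 < B by rewrite lt_neqAle eq_sym B1.
have := H B C => h.
have : 0 <= B * (A * B - C ^+ 2) by move: h; congr (_ <= _); ring.
by rewrite pmulr_rge0// subr_ge0.
Qed.

(** Monotone convergence along intervals []x_ n, b[] that increase to []a, b[], for integrands
    singular at the left end point. *)
Lemma intg_mono_lim a b f M : a < b -> (forall x, x \in `]a, b[ -> 0 <= f x) ->
  (forall x, a < x -> x < b -> intg x b f /\ II x b f <= M) ->
  intg a b f /\ II a b f <= M.
Proof.
move=> ab f0 H.
pose x_ (n : nat) : R := a + (b - a) / n.+2%:R.
have xa n : a < x_ n by rewrite /x_ ltrDl divr_gt0// subr_gt0.
have xb n : x_ n < b.
  rewrite /x_ -ltrBrDl ltr_pdivrMr// ltr_pMr ?subr_gt0//.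
  by rewrite ltr1n.
pose F n : set R := `]x_ n, b[%classic.
have UF : \bigcup_n F n = `]a, b[%classic.
  apply/seteqP; split=> [z [n _]|z]; rewrite /F /= !in_itv/=.
    by move=> /andP[h ->]; rewrite (lt_trans (xa n) h).
  move=> /andP[az zb].
  have za : 0 < z - a by rewrite subr_gt0.
  exists (Num.bound ((b - a) / (z - a))) => //=; rewrite in_itv/= zb andbT.
  rewrite /x_ -ltrBrDl ltr_pdivrMr// mulrC -ltr_pdivrMr//.
  apply: (@lt_trans _ _ (Num.bound ((b - a) / (z - a)))%:R); last by rewrite ltr_nat.
  by rewrite archi_boundP// divr_ge0// subr_ge0 ltW.
have mF n : measurable_fun (F n) (EFin \o f).
  by apply/measurable_EFinP; exact: intg_mes (H _ (xa n) (xb n)).1.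
have mab : measurable_fun (`]a, b[ : set R) (EFin \o f).
  by rewrite -UF; apply/measurable_fun_bigcup => // n; exact: measurable_itv.
have f0' n x : F n x -> (0 <= (EFin \o f) x)%E.
  move=> h; rewrite /= lee_fin; apply: f0; have : `]a, b[%classic x by rewrite -UF; exists n.
  by [].
have nd : nondecreasing_seq F.
  move=> n m nm; apply/subsetPset => z; rewrite /F /= !in_itv/= => /andP[h ->].
  have hnm : m.+2%:R^-1 <= n.+2%:R^-1 :> R by rewrite lef_pV2 ?posrE// ler_nat !ltnS.
  rewrite andbT; apply: le_lt_trans h; rewrite /x_ lerD2l; apply: ler_wpM2l => //.
  by rewrite subr_ge0 ltW.
have cv : (\int[mu]_(x in F i) (EFin \o f) x)%E @[i --> \oo] -->
          (\int[mu]_(x in \bigcup_i F i) (EFin \o f) x)%E.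
  by apply: ge0_nondecreasing_set_cvg_integral => // n; exact: measurable_itv.
rewrite UF in cv.
have le_ : (\int[mu]_(x in `]a, b[) (EFin \o f) x <= M%:E)%E.
  rewrite -(cvg_lim _ cv)//; apply: lime_le; first by apply/cvg_ex; eexists; exact: cv.
  apply: nearW => n.
  have [h1 h2] := H _ (xa n) (xb n).
  rewrite -lee_fin in h2; apply: le_trans h2; rewrite /II /Rintegral fineK//.
  exact: integrable_fin_num.
have ii : intg a b f.
  apply/integrableP; split => //; apply: le_lt_trans (ltry M).
  apply: le_trans le_; rewrite le_eqVlt; apply/orP; left; apply/eqP.
  apply: eq_integral => x /set_mem xab /=; rewrite ger0_norm//; exact: f0.
split => //; rewrite -lee_fin /II /Rintegral fineK//.
exact: integrable_fin_num.
Qed.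

(** Absolute continuity on every [[x, 1]] with x > 0: up to the right end point, while the
    derivative may fail to be integrable at 0, where the weights of X^1 and X^2 degenerate. *)
Definition acr f f' : Prop := forall x : R, 0 < x -> x <= 1 -> ac x 1 f f'.

(* The boundary term at 0 disappears in the limit. *)
Lemma acr_end f f' C : acr f f' -> intg 0 1 f' ->
  (forall x, 0 < x -> x <= 1 -> f x ^+ 2 <= C * x) -> II 0 1 f' = f 1.
Proof.
move=> h i Hs; apply/eqP; rewrite -subr_eq0 -normr_le0; apply/ler_addgt0Pr => e e0.
rewrite add0r.
have e2 : 0 < e / 2 by rewrite divr_gt0.
have [d d0 Hd] := intg_unif_cont e2 i.
have C1 : 0 < `|C| + 1 by rewrite ltr_pwDr.
(* So small that the integral over []0, x[] and the value of [f] at [x] are each at most e/2. *)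
pose x := Num.min (Num.min (d / 2) 1) ((e / 2) ^+ 2 / (`|C| + 1)).
have x0 : 0 < x by rewrite !lt_min ltr01 !divr_gt0// mulr_gt0.
have x1 : x <= 1 by rewrite /x !ge_min lexx orbT.
have xd : x < d.
  apply: (@le_lt_trans _ _ (d / 2)); first by rewrite /x !ge_min lexx.
  lra.
have xC : `|f x| <= e / 2.
  rewrite -(ler_pXn2r (_ : 0 < 2)%N) ?nnegrE ?(ltW e2)//.
  rewrite real_normK ?num_real//; apply: (le_trans (Hs x x0 x1)).
  have : x <= (e / 2) ^+ 2 / (`|C| + 1) by rewrite /x ge_min lexx orbT.
  rewrite ler_pdivlMr// => h1; apply: le_trans h1; rewrite mulrC ler_wpM2l ?(ltW x0)//.
  by have := ler_norm C; lra.
have h1 := (h x x0 x1).2 1 x1 (lexx _).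
rewrite (II_split (ltW x0) x1 i).
have -> : II 0 x f' + II x 1 f' - f 1 = II 0 x f' - f x by rewrite h1; ring.
apply: (le_trans (ler_normB _ _)).
have : `|II 0 x f'| <= e / 2.
  have ix : intg 0 x f' by exact: intg_sub i.
  by apply: (le_trans (II_abs ix)); apply: Hd; rewrite ?subr0// ltW.
lra.
Qed.

Lemma II_abs2 a b c f : a <= c -> c <= b -> intg a b f ->
  `|II c b f| <= II a b (fun x => `|f x|).
Proof.
move=> ac_ cb i; have ic : intg c b f by exact: intg_sub i.
apply: (le_trans (II_abs ic)); apply: II_mono => //; first exact: intg_abs.
by apply: aeI_all.
Qed.

(** For every x, f(s)^2 is at most 2 f(x)^2 plus twice the square of the integral of |f'|; this is
    averaged over x in []c, b[], so that [f] is only needed away from [a]. *)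
Lemma ac_sup a b f f' s : a < b -> ac a b f f' -> a <= s -> s <= b ->
  intg a b (fun x => f x ^+ 2) ->
  forall c, a <= c -> c < b ->
  (b - c) * f s ^+ 2 <= 2 * II c b (fun x => f x ^+ 2) +
    2 * (b - c) * II a b (fun x => `|f' x|) ^+ 2.
Proof.
move=> ab h as_ sb f2 c ac_ cb.
set D := II a b (fun x => `|f' x|).
have i2 : intg c b (fun x => f x ^+ 2) by exact: intg_sub f2.
have : II c b (fun=> f s ^+ 2) <= II c b (fun x => 2 * f x ^+ 2 + 2 * D ^+ 2).
  apply: II_le.
  - exact: intg_cst.
  - by apply: intgD; [exact: intgZ|exact: intg_cst].
  - apply: aeI_all => x; rewrite in_itv/= => /andP[cx xb].
    have ax : a <= x by apply: (le_trans ac_); exact: ltW.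
    have : `|f s - f x| <= D.
      have [sx|xs] := leP s x.
        rewrite distrC (ac_inc h as_ sx (ltW xb)).
        have ix : intg s x f' by apply: intg_sub h.1 => //; exact: ltW.
        apply: (le_trans (II_abs ix)); apply: II_mono => //; first exact: ltW.
          exact: intg_abs h.1.
        by apply: aeI_all.
      rewrite (ac_inc h ax (ltW xs) sb).
      have ix : intg x s f' by apply: intg_sub h.1.
      apply: (le_trans (II_abs ix)); apply: II_mono => //; first exact: ltW.
        exact: intg_abs h.1.
      by apply: aeI_all.
    rewrite ler_norml => /andP[h1 h2].
    have : (f s - f x) ^+ 2 <= D ^+ 2 by nra.
    have := sqr_ge0 (f s - 2 * f x); nra.
rewrite II_cst ?(ltW cb)// IID; [|exact: intgZ|exact: intg_cst].
by rewrite IIZ// II_cst ?(ltW cb)//; lra.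
Qed.

Lemma ac_C1 a b f f' : a <= b ->
  (forall x, a <= x -> x <= b -> is_derive x (1 : R) f (f' x)) ->
  (forall x, a <= x -> x <= b -> {for x, continuous f'}) -> ac a b f f'.
Proof.
move=> ab df cf.
have cw x y : a <= x -> y <= b -> {within `[x, y], continuous f'}.
  move=> ax yb; apply: continuous_in_subspaceT => z; rewrite inE/= in_itv/= => /andP[xz zy].
  by apply: cf; [exact: le_trans xz|exact: le_trans zy yb].
have i x y : a <= x -> y <= b -> intg x y f'.
  move=> ax yb; have := continuous_compact_integrable (@segment_compact R x y) (cw x y ax yb).
  by apply: integrableS => //; apply: subset_itv; rewrite bnd_simp.
apply: acI => [|x y ax xy yb]; first exact: i.
have [->|xy'] := eqVneq x y; first by rewrite subrr II_nil.
have {}xy : x < y by rewrite lt_neqAle xy'.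
have fc z : x <= z -> z <= y -> {for z, continuous f}.
  move=> xz zy; apply: differentiable_continuous; apply/derivable1_diffP.
  by have [] := df z (le_trans ax xz) (le_trans zy yb).
have := @continuous_FTC2 R f' f x y xy (cw x y ax yb).
move=> /(_ _ _)/(congr1 fine) /= <-.
- have icc := continuous_compact_integrable (@segment_compact R x y) (cw x y ax yb).
  rewrite -/(Rintegral mu `[x, y] f') /II Rintegral_itv_bndo_bndc; last exact: i.
  rewrite Rintegral_itv_obnd_cbnd//.
  by apply: integrableS icc => //; apply: subset_itv; rewrite bnd_simp.
- split.
  + move=> z; rewrite in_itv/= => /andP[xz zy].
    by have [] := df z (le_trans ax (ltW xz)) (le_trans (ltW zy) yb).
  + by apply: cvg_at_right_filter; apply: fc; rewrite ?lexx ?ltW.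
  + by apply: cvg_at_left_filter; apply: fc; rewrite ?lexx ?ltW.
- move=> z; rewrite in_itv/= => /andP[xz zy].
  have [_ <-] := df z (le_trans ax (ltW xz)) (le_trans (ltW zy) yb).
  by rewrite derive1E.
Qed.

(** On []0, 1]] this is 1 + |ln s|: it dominates the integral of 1/z over []s, 1[], and hence the
    squared growth at 0 of functions in X^1, and it is square integrable. *)
Definition logw (s : R) : R := 1 - ln s.

Lemma logw_ac x : 0 < x -> x <= 1 -> ac x 1 logw (fun s => - s^-1).
Proof.
move=> x0 x1; apply: ac_C1 => // z xz z1.
  have z0 : 0 < z by exact: lt_le_trans xz.
  have h := is_derive1_ln z0.
  rewrite -[- z^-1]add0r; apply: is_deriveB.
have z0 : 0 < z by exact: lt_le_trans xz.
by apply: continuousN; apply: continuousV; [rewrite gt_eqF|exact: cvg_id].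
Qed.

Lemma logw_ge1 s : 0 < s -> s <= 1 -> 1 <= logw s.
Proof. by move=> s0 s1; rewrite /logw; have := ln_le0 s1; lra. Qed.

Lemma logw1 : logw 1 = 1.
Proof. by rewrite /logw ln1 subr0. Qed.

Lemma sinv_logw s : 0 < s -> s <= 1 -> II s 1 (fun z => z^-1) <= logw s.
Proof.
move=> s0 s1; have h := logw_ac s0 s1.
have := ac_inc h (lexx _) s1 (lexx _); rewrite logw1.
have -> : II s 1 (fun z => z^-1) = - II s 1 (fun z => - z^-1).
  by rewrite -IIN; [apply: II_eq => z _; rewrite opprK|exact: h.1].
lra.
Qed.

Lemma smul_logw s : 0 < s -> s <= 1 -> s * logw s <= 2.
Proof.
move=> s0 s1; have : ln (s^-1) < s^-1 by apply: ln_sublinear; rewrite invr_gt0.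
rewrite lnV ?posrE// -(ltr_pM2l s0) mulfV ?gt_eqF// /logw mulrBr mulr1 mulrN; lra.
Qed.

Lemma logw_intg x : 0 < x -> x <= 1 -> intg x 1 logw /\ II x 1 logw <= 2.
Proof.
move=> x0 x1; have h := logw_ac x0 x1.
have i := ac_intg h; split => //.
have hs := ac_mul (ac_id x 1) h.
have := ac_inc hs (lexx _) x1 (lexx _).
have -> : II x 1 (fun z => 1 * logw z + z * - z^-1) = II x 1 (fun z => logw z - 1).
  apply: II_eq => z; rewrite in_itv/= => /andP[xz _].
  by rewrite mul1r mulrN mulfV// gt_eqF// (lt_trans x0).
rewrite IIB//; last exact: intg_cst.
rewrite II_cst// logw1.
have : 0 <= x * logw x by rewrite mulr_ge0 ?(ltW x0)// (le_trans ler01)// logw_ge1.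
lra.
Qed.

(** Integrating by parts against s, the integral of the square over []x, 1[] is at most 1 plus twice
    the integral of [logw], which is at most 2; hence 5. *)
Lemma logw2_intg : intg 0 1 (fun s => logw s ^+ 2) /\ II 0 1 (fun s => logw s ^+ 2) <= 5.
Proof.
apply: intg_mono_lim => // [x _|x x0 x1]; first exact: sqr_ge0.
have h := logw_ac x0 (ltW x1).
have [i1 i2] := logw_intg x0 (ltW x1).
have hs := ac_mul (ac_id x 1) (ac_mul h h).
have i : intg x 1 (fun s => logw s ^+ 2) by exact: ac_intg (ac_mul h h).
split => //.
have := ac_inc hs (lexx _) (ltW x1) (lexx _).
have -> : II x 1 (fun z => 1 * (logw z * logw z) + z * (- z^-1 * logw z + logw z * - z^-1)) =
     II x 1 (fun z => logw z ^+ 2 - 2 * logw z).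
  apply: II_eq => z; rewrite in_itv/= => /andP[xz _].
  have z0 : z != 0 by rewrite gt_eqF// (lt_trans x0).
  by field.
rewrite IIB//; last exact: intgZ.
rewrite IIZ// logw1.
have : 0 <= x * (logw x * logw x) by rewrite mulr_ge0 ?(ltW x0)// -expr2 sqr_ge0.
lra.
Qed.

Lemma sinv2 (s : R) : 0 < s -> s <= 1 ->
  intg s 1 (fun z => z^-1 ^+ 2) /\ II s 1 (fun z => z^-1 ^+ 2) <= s^-1.
Proof.
move=> s0 s1.
have h : ac s 1 (fun z => z^-1) (fun z => - z^-1 ^+ 2).
  apply: ac_C1 => // z xz z1; have z0 : 0 < z by exact: lt_le_trans xz.
    have zn : z != 0 by rewrite gt_eqF.
    have := is_deriveV (f := (fun y : R => y)) zn (is_derive_id z 1).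
    by move=> H; apply: is_derive_eq; rewrite /= exprVn scaleNr [_ *: _]mulr1.
  apply: continuousN; apply: (@continuous_comp _ _ _ (fun y : R => y^-1) (fun y : R => y ^+ 2)).
    by apply: continuousV; [rewrite gt_eqF|exact: cvg_id].
  exact: exprn_continuous.
split.
  by have := intgN h.1; congr intg; apply/funext => z; rewrite opprK.
have := ac_inc h (lexx _) s1 (lexx _); rewrite invr1.
have -> : II s 1 (fun z => z^-1 ^+ 2) = - II s 1 (fun z => - z^-1 ^+ 2).
  by rewrite -IIN; [apply: II_eq => z _; rewrite opprK|exact: h.1].
lra.
Qed.

Lemma lip_cont (W : R -> R) K x : (forall x y, `|W y - W x| <= K * `|y - x|) ->
  {for x, continuous W}.
Proof.
move=> H; apply/cvgrPdist_le => e e0; near=> y.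
rewrite distrC; apply: (le_trans (H x y)).
have K1 : 0 < `|K| + 1 by rewrite ltr_pwDr.
have : `|x - y| <= e / (`|K| + 1).
  by near: y; apply: (@cvgr_dist_le _ _ _ _ _ id); [exact: cvg_id|exact: divr_gt0].
rewrite distrC ler_pdivlMr// => h; apply: le_trans h; rewrite mulrC ler_wpM2l//.
by have := ler_norm K; lra.
Unshelve. all: end_near. Qed.

(** McShane's extension, the infimum over r in G of w(r) + K|t - r|. It makes a Lipschitz bound on a
    set of full measure into one on the line, so that the function is continuous and can be a weight
    in an integral. *)
Lemma mcshane (G : set R) (w : R -> R) K : 0 <= K ->
  (forall x y, G x -> G y -> `|w y - w x| <= K * `|y - x|) -> G !=set0 ->
  exists W : R -> R, (forall x y, `|W y - W x| <= K * `|y - x|) /\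
    forall x, G x -> W x = w x.
Proof.
move=> K0 H [r0 Gr0].
pose S t := [set w r + K * `|t - r| | r in G].
have lbS t r1 : G r1 -> lbound (S t) (w r1 - K * `|t - r1|).
  move=> G1 _ [r Gr <-]; have := H r r1 Gr G1; rewrite ler_norml => /andP[_].
  have : `|r1 - r| <= `|t - r| + `|t - r1|.
    by have := ler_distD t r1 r; rewrite [`|r1 - t|]distrC; lra.
  move=> /(ler_wpM2l K0); rewrite mulrDr; lra.
have infS t : has_inf (S t).
  by split; [exists (w r0 + K * `|t - r0|); exists r0|exists (w r0 - K * `|t - r0|); exact: lbS].
exists (fun t => inf (S t)); split; last first.
  move=> x Gx; apply/eqP; rewrite eq_le; apply/andP; split.
    by apply: (inf_lbound (infS x).2); exists x => //; rewrite subrr normr0 mulr0 addr0.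
  apply: lb_le_inf; first exact: (infS x).1.
  by move=> z hz; have := lbS x x Gx z hz; rewrite subrr normr0 mulr0 subr0.
suff h x y : inf (S y) - inf (S x) <= K * `|y - x|.
  by move=> x y; rewrite ler_norml h andbT lerNl opprB distrC h.
rewrite lerBlDr -lerBlDl; apply: lb_le_inf; first exact: (infS x).1.
move=> _ [r Gr <-]; rewrite lerBlDl.
have h1 : inf (S y) <= w r + K * `|y - r| by apply: (inf_lbound (infS y).2); exists r.
apply: (le_trans h1).
have : `|y - r| <= `|y - x| + `|x - r| by exact: (ler_distD x y r).
move=> /(ler_wpM2l K0); rewrite mulrDr; lra.
Qed.

(** Integration by parts of W f' as if |W'| were at most K, without differentiating W. By
    [increment_le], over a short interval W is frozen at the right end point, and the error is small
    relative to the integral of |f'|. *)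
Lemma lip_weight t0 (W f f' : R -> R) K : 0 <= t0 -> 0 <= K ->
  (forall x y, `|W y - W x| <= K * `|y - x|) -> ac 0 t0 f f' -> f 0 = 0 ->
  `|II 0 t0 (fun t => W t * f' t) - W t0 * f t0| <= K * II 0 t0 (fun t => `|f t|).
Proof.
move=> t00 K0 HW hf f0.
have mW a b : mesI a b W.
  by apply: cont_mesI => x; apply: lip_cont; exact: HW.
have iWf a b : 0 <= a -> b <= t0 -> intg a b (fun t => W t * f' t).
  move=> a0 bt; have h : intg 0 t0 (fun t => W t * f' t).
    apply: (@intgM_bnd _ _ _ _ _ (`|W 0| + K * t0) hf.1 (mW _ _)).
    apply: aeI_all => t; rewrite in_itv/= => /andP[t1 t2].
    have := HW 0 t; rewrite subr0 (ger0_norm (ltW t1)) => h.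
    have -> : W t = W 0 + (W t - W 0) by ring.
    apply: (le_trans (ler_normD _ _)); rewrite lerD2l; apply: (le_trans h).
    by rewrite ler_wpM2l// ltW.
  exact: intg_sub h.
have iaf : intg 0 t0 (fun t => `|f t|) by apply: intg_abs; exact: ac_intg hf.
have iaf' : intg 0 t0 (fun t => `|f' t|) by apply: intg_abs; exact: hf.1.
pose L t := II 0 t (fun t => W t * f' t) - W t * f t.
pose Th t := K * II 0 t (fun t => `|f t|).
pose M t := II 0 t (fun t => `|f' t|).
suff : `|L t0 - L 0| <= Th t0 - Th 0.
  by rewrite /L /Th f0 mulr0 !(@II_nil _ 0 0)// mulr0 !subr0.
apply: (@increment_le _ 0 t0 L Th M t00) => e e0.
(* Freezing W and replacing f(x) by the average of f over the interval each cost K(y - x) times the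
   integral of |f'|, whence 2K; the 1 keeps the divisor positive. *)
exists (e / (2 * K + 1)); first by rewrite divr_gt0//; lra.
move=> x y x0 xy yt yx.
have y0 : 0 <= y by exact: le_trans xy.
have xt : x <= t0 by exact: le_trans yt.
rewrite /L /Th /M (@II_split _ 0 y x)//; last exact: iWf.
rewrite (@II_split _ 0 y x (fun t => `|f t|))//; last by exact: intg_sub iaf.
rewrite (@II_split _ 0 y x (fun t => `|f' t|))//; last by exact: intg_sub iaf'.
set A := II x y (fun t => `|f' t|).
set B := II x y (fun t => `|f t|).
have ifxy : intg x y f' by exact: intg_sub hf.1.
have A0 : 0 <= A by apply: II_ge0; [exact: intg_mes (intg_abs ifxy)|exact: aeI_all].
have e1 : II x y (fun t => W t * f' t) =
   II x y (fun t => (W t - W y) * f' t) + W y * (f y - f x).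
  rewrite (ac_inc hf x0 xy yt) -IIZ// -IID.
  - by apply: II_eq => z _; ring.
  - have -> : (fun t => (W t - W y) * f' t) = (fun t => W t * f' t - W y * f' t).
      by apply/funext => z; ring.
    by apply: intgB; [exact: iWf|exact: intgZ].
  - exact: intgZ.
have h1 : `|II x y (fun t => (W t - W y) * f' t)| <= K * (y - x) * A.
  rewrite -IIZ; last exact: intg_abs.
  apply: II_abs_le.
  - apply: mesIM; last exact: intg_mes.
    by apply: mesIB; [exact: mW|exact: mesI_cst].
  - by apply: intgZ; exact: intg_abs.
  - apply: aeI_all => z; rewrite in_itv/= => /andP[xz zy].
    rewrite normrM ler_wpM2r//; apply: (le_trans (HW y z)).
    rewrite ler_wpM2l// ler_norml; apply/andP; split; lra.
have h2 : (y - x) * `|f x| <= B + (y - x) * A.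
  have : II x y (fun=> `|f x|) <= II x y (fun t => `|f t| + A).
    apply: II_le.
    - exact: intg_cst.
    - by apply: intgD; [exact: intg_sub iaf|exact: intg_cst].
    - apply: aeI_all => z; rewrite in_itv/= => /andP[xz zy].
      have : `|f z - f x| <= A.
        rewrite (ac_inc hf x0 (ltW xz)) ?(le_trans (ltW zy))//.
        have iz : intg x z f' by apply: intg_sub ifxy => //; exact: ltW.
        apply: (le_trans (II_abs iz)); apply: II_mono => //; try exact: ltW.
          exact: intg_abs.
        by apply: aeI_all.
      by rewrite distrC => h; have := ler_normD (f z) (f x - f z); rewrite addrC subrK; lra.
  rewrite II_cst// IID; [|exact: intg_sub iaf|exact: intg_cst].
  by rewrite II_cst// -/B; lra.
have h3 : `|(W y - W x) * f x| <= K * (y - x) * `|f x|.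
  rewrite normrM ler_wpM2r//; apply: (le_trans (HW x y)).
  by rewrite ger0_norm// subr_ge0.
have -> : II 0 x (fun t => W t * f' t) + II x y (fun t => W t * f' t) - W y * f y -
   (II 0 x (fun t => W t * f' t) - W x * f x) =
   II x y (fun t => (W t - W y) * f' t) - (W y - W x) * f x by rewrite e1; ring.
apply: (le_trans (ler_normB _ _)).
have h4 : (2 * K + 1) * (y - x) <= e.
  by rewrite mulrC -ler_pdivlMr; [exact: ltW|lra].
have h5 : (2 * K + 1) * (y - x) * A <= e * A by rewrite ler_wpM2r.
have h6 : 0 <= (y - x) * A by rewrite mulr_ge0// subr_ge0.
have h7 := ler_wpM2l K0 h2.
nra.
Qed.

Lemma lip_ae (T t0 : R) (G : set R) (w f f' : R -> R) K : 0 < t0 -> t0 < T -> 0 <= K ->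
  aeI 0 T G -> G t0 ->
  (forall x y, G x -> G y -> `|w y - w x| <= K * `|y - x|) ->
  mesI 0 T w -> ac 0 t0 f f' -> f 0 = 0 ->
  `|II 0 t0 (fun t => w t * f' t) - w t0 * f t0| <= K * II 0 t0 (fun t => `|f t|).
Proof.
move=> t00 t0T K0 aG Gt0 H mw hf f0.
have [W [HW eW]] := mcshane K0 H (ex_intro _ t0 Gt0).
rewrite -(eW t0 Gt0).
suff -> : II 0 t0 (fun t => w t * f' t) = II 0 t0 (fun t => W t * f' t).
  by apply: lip_weight => //; exact: ltW.
apply: II_ae.
- apply: mesIM; last by exact: intg_mes hf.1.
  by apply: mesI_sub mw => //; exact: ltW.
- apply: mesIM; last by exact: intg_mes hf.1.
  by apply: cont_mesI => x; apply: lip_cont; exact: HW.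
- have : aeI 0 t0 G by apply: aeI_sub aG => //; exact: ltW.
  by apply: aeI_imp => x _ Gx; rewrite eW.
Qed.

Lemma II_eq0_ae a b f : intg a b f -> aeI a b (fun x => 0 <= f x) ->
  II a b f <= 0 -> aeI a b (fun x => f x = 0).
Proof.
move=> hf f0 h; apply: II_zero => // q aq qb.
apply/eqP; rewrite eq_le; apply/andP; split.
  by apply: le_trans h; apply: II_mono => //; exact: ltW.
apply: II_ge0; first by apply: mesI_sub (intg_mes hf) => //; exact: ltW.
by apply: aeI_sub f0 => //; exact: ltW.
Qed.

(** The inequality holds only almost everywhere, so it is iterated over steps of length l with 2Cl
    <= 1: if the integral of E up to t vanishes, its integral over the next step is at most half of
    itself. *)
Lemma gronwall (T : R) E C : 0 < T -> 0 <= C -> intg 0 T E ->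
  aeI 0 T (fun t => 0 <= E t) -> aeI 0 T (fun t => E t <= C * II 0 t E) ->
  aeI 0 T (fun t => E t = 0).
Proof.
move=> T0 C0 iE E0 EC.
pose n := (Num.bound (2 * C * T)).+1.
have n0 : 0 < n%:R :> R by rewrite ltr0n.
pose l := T / n%:R.
have l0 : 0 < l by rewrite divr_gt0.
have Cl : 2 * C * l <= 1.
  rewrite /l mulrA ler_pdivrMr// mul1r.
  apply: (@le_trans _ _ (Num.bound (2 * C * T))%:R); last by rewrite ler_nat.
  by apply: ltW; rewrite archi_boundP// !mulr_ge0// ltW.
have ln_ : n%:R * l = T by rewrite /l mulrC divfK// gt_eqF.
have step t : 0 <= t -> t + l <= T -> II 0 t E <= 0 -> II 0 (t + l) E <= 0.
  move=> t0 tT h.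
  have it : intg 0 (t + l) E by exact: intg_sub iE.
  have tl : t <= t + l by rewrite lerDl ltW.
  have : II t (t + l) E <= II t (t + l) (fun=> C * II 0 (t + l) E).
    apply: II_le.
    - exact: intg_sub it.
    - exact: intg_cst.
    - have := aeI_and (aeI_sub t0 tT EC) (aeI_sub t0 tT E0).
      apply: aeI_imp => z; rewrite in_itv/= => /andP[tz zt] [h1 _].
      apply: (le_trans h1); rewrite ler_wpM2l//.
      apply: II_mono => //; [exact: le_trans (ltW tz)|exact: ltW|].
      exact: aeI_sub E0.
  rewrite II_cst// (II_split t0 tl it).
  have : 0 <= II t (t + l) E.
    apply: II_ge0; first by apply: mesI_sub (intg_mes it).
    exact: aeI_sub E0.
  have : 0 <= II 0 t E.
    apply: II_ge0; first by apply: mesI_sub (intg_mes it).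
    by apply: aeI_sub E0 => //; exact: le_trans tT.
  have -> : t + l - t = l by ring.
  move: (II 0 t E) (II t _ E) h => X Y; nra.
have H k : (k <= n)%N -> II 0 (k%:R * l) E <= 0.
  elim: k => [|k IH] kn; first by rewrite mul0r II_nil.
  rewrite -natr1 mulrDl mul1r; apply: step.
  - by rewrite mulr_ge0// ltW.
  - have : k.+1%:R * l <= n%:R * l by rewrite ler_wpM2r ?ler_nat// ltW.
    by rewrite ln_ -natr1 mulrDl mul1r.
  - by apply: IH; exact: ltnW.
apply: II_eq0_ae => //; rewrite -ln_; exact: H.
Qed.

Lemma ac_inv (a : R) : 0 < a -> a <= 1 -> ac a 1 (fun z : R => z^-1) (fun z => - z^-1 ^+ 2).
Proof.
move=> a0 a1; apply: ac_C1 => // z xz z1; have z0 : 0 < z by exact: lt_le_trans xz.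
  have zn : z != 0 by rewrite gt_eqF.
  have := is_deriveV (f := (fun y : R => y)) zn (is_derive_id z 1).
  by move=> H; apply: is_derive_eq; rewrite /= exprVn scaleNr [_ *: _]mulr1.
apply: continuousN; apply: (@continuous_comp _ _ _ (fun y : R => y^-1) (fun y : R => y ^+ 2)).
  by apply: continuousV; [rewrite gt_eqF|exact: cvg_id].
exact: exprn_continuous.
Qed.

End Tools.

(** * Integration over rectangles *)

Section TwoDim.
Context {R : realType}.
Notation mu := (@lebesgue_measure R).
Notation RR := (measurableTypeR R).
Variables (a b c d : R).
Implicit Types (f g u v : R -> R -> R).

Definition box : set (RR * RR) :=
  (`]a, b[%classic : set RR) `*` (`]c, d[%classic : set RR).

Definition mes2 u : Prop := measurable_fun box (fun z : RR * RR => u z.1 z.2).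

Lemma measurable_box : measurable box.
Proof. by apply: measurableX; exact: measurable_itv. Qed.

Lemma boxP s t : s \in `]a, b[ -> t \in `]c, d[ -> box (s, t).
Proof. by move=> hs ht; split. Qed.

Lemma mes2D u v : mes2 u -> mes2 v -> mes2 (fun s t => u s t + v s t).
Proof. by move=> hu hv; apply: measurable_funD. Qed.

Lemma mes2B u v : mes2 u -> mes2 v -> mes2 (fun s t => u s t - v s t).
Proof. by move=> hu hv; apply: measurable_funB. Qed.

Lemma mes2M u v : mes2 u -> mes2 v -> mes2 (fun s t => u s t * v s t).
Proof. by move=> hu hv; apply: measurable_funM. Qed.

Lemma mes2N u : mes2 u -> mes2 (fun s t => - u s t).
Proof. by move=> hu; apply: measurableT_comp. Qed.

Lemma mes2X u n : mes2 u -> mes2 (fun s t => u s t ^+ n).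
Proof. by move=> hu; apply: measurable_funX. Qed.

Lemma mes2_abs u : mes2 u -> mes2 (fun s t => `|u s t|).
Proof. by move=> hu; apply: measurableT_comp. Qed.

Lemma mes2_cst k : mes2 (fun _ _ => k).
Proof. exact: measurable_cst. Qed.

Lemma mes2_sum (I : finType) (u : I -> R -> R -> R) : (forall i, mes2 (u i)) ->
  mes2 (fun s t => \sum_i u i s t).
Proof. by move=> h; apply: measurable_sum. Qed.

Lemma mes2_s (f : R -> R) : mesI a b f -> mes2 (fun s _ => f s).
Proof.
move=> mf; apply: (@measurable_comp _ _ _ _ _ _ (`]a, b[%classic : set RR) f _ fst) => //.
  by move=> _ [z [h _] <-].
exact: measurable_funTS.
Qed.

Lemma mes2_t (f : R -> R) : mesI c d f -> mes2 (fun _ t => f t).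
Proof.
move=> mf; apply: (@measurable_comp _ _ _ _ _ _ (`]c, d[%classic : set RR) f _ snd) => //.
  by move=> _ [z [_ h] <-].
exact: measurable_funTS.
Qed.

Lemma mes2_sect_t u t : mes2 u -> t \in `]c, d[ -> mesI a b (u^~ t).
Proof.
move=> mu_ ht; apply: (@measurable_comp _ _ _ _ _ _ box (fun z : RR * RR => u z.1 z.2) _ (fun s => (s, t))) => //.
- exact: measurable_box.
- by move=> _ [s hs <-]; exact: boxP.
- by apply: measurable_funTS; exact: measurable_pair2.
Qed.

Lemma mes2_sect_s u s : mes2 u -> s \in `]a, b[ -> mesI c d (u s).
Proof.
move=> mu_ hs; apply: (@measurable_comp _ _ _ _ _ _ box (fun z : RR * RR => u z.1 z.2) _ (fun t => (s, t))) => //.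
- exact: measurable_box.
- by move=> _ [t ht <-]; exact: boxP.
- by apply: measurable_funTS; exact: measurable_pair1.
Qed.

(** Extension by zero to the plane, where the theorems of Fubini and Tonelli are applied. *)
Definition pat u : RR * RR -> R := (fun z : RR * RR => u z.1 z.2) \_ box.

Lemma pat_mes u : mes2 u -> measurable_fun setT (pat u).
Proof. by move=> h; apply/(measurable_restrictT _ _).1 => //; exact: measurable_box. Qed.

Lemma patE u s t : s \in `]a, b[ -> pat u (s, t) = (u s \_ `]c, d[%classic) t.
Proof.
move=> hs; rewrite /pat !patchE; case: (boolP (t \in `]c, d[%classic)) => ht.
  by rewrite ifT// inE; split => //=; move: ht; rewrite inE.
rewrite ifF//; apply/negP; rewrite inE => -[_ /= h].
by move/negP: ht; apply; rewrite inE.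
Qed.

Lemma patE' u s t : t \in `]c, d[ -> pat u (s, t) = ((u^~ t) \_ `]a, b[%classic) s.
Proof.
move=> ht; rewrite /pat !patchE; case: (boolP (s \in `]a, b[%classic)) => hs.
  by rewrite ifT// inE; split => //=; move: hs; rewrite inE.
rewrite ifF//; apply/negP; rewrite inE => -[/= h _].
by move/negP: hs; apply; rewrite inE.
Qed.

Lemma pat0 u s t : s \notin `]a, b[ -> pat u (s, t) = 0.
Proof.
move=> hs; rewrite /pat patchE ifF//; apply/negP; rewrite inE => -[/= h _].
by rewrite h in hs.
Qed.

Lemma pat0' u s t : t \notin `]c, d[ -> pat u (s, t) = 0.
Proof.
move=> hs; rewrite /pat patchE ifF//; apply/negP; rewrite inE => -[_ /= h].
by rewrite h in hs.
Qed.

Lemma int_pat_s u s : s \in `]a, b[ ->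
  (\int[mu]_t (pat u (s, t))%:E = \int[mu]_(t in `]c, d[) (u s t)%:E)%E.
Proof.
move=> hs; rewrite [RHS]integral_mkcond; apply: eq_integral => t _.
by rewrite restrict_EFin patE.
Qed.

Lemma int_pat_t u t : t \in `]c, d[ ->
  (\int[mu]_s (pat u (s, t))%:E = \int[mu]_(s in `]a, b[) (u s t)%:E)%E.
Proof.
move=> ht; rewrite [RHS]integral_mkcond; apply: eq_integral => s _.
by rewrite restrict_EFin patE'.
Qed.

Lemma pat_intg u : mes2 u -> aeI c d (fun t => intg a b (u^~ t)) ->
  forall M, aeI c d (fun t => II a b (fun s => `|u s t|) <= M) ->
  (mu \x mu)%E.-integrable setT (EFin \o pat u).
Proof.
move=> hu iu M hM.
have mp : measurable_fun setT (EFin \o pat u) by apply/measurable_EFinP; exact: pat_mes.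
apply/(integrable21ltyP _ _ mp).
apply: (@le_lt_trans _ _ (\int[mu]_(t in `]c, d[) (`|M|)%:E)%E); last first.
  have /integrableP[_] := intg_cst c d M; apply: le_lt_trans.
  by rewrite le_eqVlt; apply/orP; left; apply/eqP; apply: eq_integral.
rewrite [leRHS]integral_mkcond; apply: ae_ge0_le_integral => //.
- by move=> t _; exact: integral_ge0.
- apply: (@measurable_fun_fubini_tonelli_G _ _ _ _ R mu (abse \o (EFin \o pat u))) => //.
  exact: measurableT_comp.
- by move=> z; exact: abse_ge0.
- by move=> t _; rewrite patchE; case: ifP.
- by apply/(measurable_restrictT _ _).1 => //; exact: measurable_cst.
move: iu hM; rewrite /aeI; apply: filterS2 => t h1 h2 _.
rewrite patchE; case: (boolP (t \in `]c, d[%classic)) => ht; last first.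
  rewrite (_ : (fun s => _) = cst 0%E) ?integral0//; apply/funext => s.
  rewrite /= pat0' ?normr0//; apply/negP => h; move/negP: ht; apply.
  by rewrite inE.
have {}ht : t \in `]c, d[ by move: ht; rewrite inE.
have {}h1 := h1 ht; have {}h2 := h2 ht.
have -> : (\int[mu]_x `|(EFin \o pat u) (x, t)| = \int[mu]_(s in `]a, b[) (`|u s t|)%:E)%E.
  rewrite [RHS]integral_mkcond; apply: eq_integral => s _ /=.
  by rewrite restrict_EFin patE'// restrict_normr.
have i := intg_abs h1.
have /fineK <- : (\int[mu]_(s in `]a, b[) (`|u s t|)%:E)%E \is a fin_num.
  by apply: integrable_fin_num => //.
by rewrite lee_fin; apply: le_trans (ler_norm M); exact: h2.
Qed.

(** L^oo in t with values in L^1 in s. The box being bounded, this is enough for Fubini, and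
    products of the quantities below stay in it. *)
Definition linf1 u : Prop := mes2 u /\ exists M, aeI c d (fun t =>
  intg a b (u^~ t) /\ II a b (fun s => `|u s t|) <= M).

Lemma linf1_pat u : linf1 u -> (mu \x mu)%E.-integrable setT (EFin \o pat u).
Proof.
move=> [m [M h]]; apply: (pat_intg m _ (M := M)).
  by apply: aeI_imp h => t _ [].
by apply: aeI_imp h => t _ [].
Qed.

Lemma fubini u : linf1 u ->
  [/\ aeI a b (fun s => intg c d (u s)), intg a b (fun s => II c d (u s)),
      intg c d (fun t => II a b (u^~ t)) &
      II a b (fun s => II c d (u s)) = II c d (fun t => II a b (u^~ t))].
Proof.
move=> h; have ip := linf1_pat h.
have h1 : aeI a b (fun s => intg c d (u s)).
  have := ae_integrable1 ip; rewrite /aeI; apply: filterS => s + hs => is_.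
  rewrite /intg; apply/(integrable_mkcond _ _).2 => //.
  by move: is_; congr (_.-integrable _ _); apply/funext => t; rewrite /= patE// restrict_EFin.
have h2 : aeI c d (fun t => intg a b (u^~ t)).
  by have [_ [M]] := h; apply: aeI_imp => t _ [].
have F0 s : s \notin `]a, b[ -> (\int[mu]_t (pat u (s, t))%:E = 0)%E.
  move=> hs; rewrite (_ : (fun t => _) = cst 0%E) ?integral0//.
  by apply/funext => t; rewrite pat0.
have G0 t : t \notin `]c, d[ -> (\int[mu]_s (pat u (s, t))%:E = 0)%E.
  move=> hs; rewrite (_ : (fun t => _) = cst 0%E) ?integral0//.
  by apply/funext => s; rewrite pat0'.
have mF : mesI a b (fun s => II c d (u s)).
  have m : measurable_fun setT (fun s => fine (\int[mu]_t (pat u (s, t))%:E)%E).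
    apply: measurableT_comp; first exact: fine_measurable.
    exact: (measurable_fubini_F ip).
  apply: (@eq_measurable_fun _ _ _ _ _ (fun s => fine (\int[mu]_t (pat u (s, t))%:E)%E)).
    by move=> s; rewrite inE/= => hs; rewrite int_pat_s.
  exact: measurable_funTS.
have mG : mesI c d (fun t => II a b (u^~ t)).
  have m : measurable_fun setT (fun t => fine (\int[mu]_s (pat u (s, t))%:E)%E).
    apply: measurableT_comp; first exact: fine_measurable.
    exact: (measurable_fubini_G ip).
  apply: (@eq_measurable_fun _ _ _ _ _ (fun t => fine (\int[mu]_s (pat u (s, t))%:E)%E)).
    by move=> s; rewrite inE/= => hs; rewrite int_pat_t.
  exact: measurable_funTS.
have iG : intg c d (fun t => II a b (u^~ t)).
  have [_ [M hM]] := h; apply: (intg_bnd (M := M) mG).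
  by apply: aeI_imp hM => t _ [i hm]; apply: le_trans hm; exact: II_abs.
have eF : (\int[mu]_s \int[mu]_t (pat u (s, t))%:E = \int[mu]_(s in `]a, b[) (II c d (u s))%:E)%E.
  rewrite [RHS]integral_mkcond; apply: ae_eq_integral => //.
  - exact: (measurable_fubini_F ip).
  - by apply/(measurable_restrictT _ _).1 => //; apply/measurable_EFinP.
  move: h1; rewrite /aeI; apply: filterS => s hs _; rewrite patchE.
  case: (boolP (s \in `]a, b[%classic)) => h3; last first.
    by apply: F0; apply/negP => h4; move/negP: h3; apply; rewrite inE.
  have {}h3 : s \in `]a, b[ by move: h3; rewrite inE.
  rewrite int_pat_s// /II /Rintegral fineK//.
  by apply: integrable_fin_num => //; exact: hs.
have eG : (\int[mu]_t \int[mu]_s (pat u (s, t))%:E = \int[mu]_(t in `]c, d[) (II a b (u^~ t))%:E)%E.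
  rewrite [RHS]integral_mkcond; apply: ae_eq_integral => //.
  - exact: (measurable_fubini_G ip).
  - by apply/(measurable_restrictT _ _).1 => //; apply/measurable_EFinP.
  move: h2; rewrite /aeI; apply: filterS => t ht _; rewrite patchE.
  case: (boolP (t \in `]c, d[%classic)) => h3; last first.
    by apply: G0; apply/negP => h4; move/negP: h3; apply; rewrite inE.
  have {}h3 : t \in `]c, d[ by move: h3; rewrite inE.
  rewrite int_pat_t// /II /Rintegral fineK//.
  by apply: integrable_fin_num => //; exact: ht.
split; [exact: h1| |exact: iG|]; last first.
  transitivity (fine (\int[mu]_s \int[mu]_t (pat u (s, t))%:E)%E); first by rewrite eF.
  by rewrite (Fubini ip) eG.
have := integrable_fubini_F ip => /integrableP[_ hF].
apply/integrableP; split; first exact/measurable_EFinP.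
apply: le_lt_trans hF; rewrite integral_mkcond le_eqVlt; apply/orP; left; apply/eqP.
apply: ae_eq_integral => //.
- apply/(measurable_restrictT _ _).1 => //; apply: measurableT_comp => //.
  exact/measurable_EFinP.
- by apply: measurableT_comp => //; exact: (measurable_fubini_F ip).
move: h1; rewrite /aeI; apply: filterS => s hs _; rewrite patchE.
case: (boolP (s \in `]a, b[%classic)) => h3; last first.
  by rewrite /fubini_F F0 ?abse0//; apply/negP => h4; move/negP: h3; apply; rewrite inE.
have {}h3 : s \in `]a, b[ by move: h3; rewrite inE.
have -> // : fubini_F mu (EFin \o pat u) s = (II c d (u s))%:E.
rewrite /fubini_F int_pat_s//= /II /Rintegral fineK//.
by apply: integrable_fin_num => //; exact: hs.
Qed.

(** By Tonelli, the double integral of |f - g| vanishes in one order if and only if it does in the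
    other; joint measurability is what permits the exchange of null sets. *)
Lemma swap_st f g : mes2 f -> mes2 g ->
  aeI a b (fun s => aeI c d (fun t => f s t = g s t)) ->
  aeI c d (fun t => aeI a b (fun s => f s t = g s t)).
Proof.
move=> mf mg h.
pose w s t := `|f s t - g s t|.
have mw : mes2 w by apply: mes2_abs; exact: mes2B.
have mp : measurable_fun setT (EFin \o pat w) by apply/measurable_EFinP; exact: pat_mes.
have p0 z : (0 <= (EFin \o pat w) z)%E.
  by rewrite /= lee_fin /pat patchE; case: ifP => // _; exact: normr_ge0.
have F0 : (\int[mu]_s \int[mu]_t (EFin \o pat w) (s, t) = 0)%E.
  rewrite -[RHS](@integral0 _ _ _ mu setT); apply: ae_eq_integral => //.
    exact: measurable_fun_fubini_tonelli_F.
  move: h; rewrite /aeI; apply: filterS => s h _.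
  case: (boolP (s \in `]a, b[)) => hs; last first.
    by rewrite (_ : (fun t => _) = cst 0%E) ?integral0//; apply/funext => t /=; rewrite pat0.
  rewrite int_pat_s// -[RHS](@integral0 _ _ _ mu `]c, d[%classic); apply: ae_eq_integral => //.
    by apply/measurable_EFinP; exact: mes2_sect_s.
  have := h hs; rewrite /aeI; apply: filterS => t e ht.
  by rewrite /w e// subrr normr0.
have G0 : (\int[mu]_t \int[mu]_s (EFin \o pat w) (s, t) = 0)%E.
  by rewrite -F0 -fubini_tonelli.
have mG := measurable_fun_fubini_tonelli_G (m1 := mu) _ mp p0.
have GA : (\int[mu]_t `| \int[mu]_s (EFin \o pat w) (s, t) | = 0)%E.
  rewrite -[RHS]G0; apply: eq_integral => t _; rewrite gee0_abs//.
  by apply: integral_ge0 => s _; exact: p0.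
have [+ _] := ae_eq_integral_abs mu measurableT mG.
move=> /(_ GA); rewrite /aeI; apply: filterS => t /(_ I) + ht.
rewrite /fubini_G /= int_pat_t// => h0.
have mwt : mesI a b (fun s => w s t) by exact: (mes2_sect_t mw ht).
have e0 : (\int[mu]_(s in `]a, b[) `|(w s t)%:E| = 0)%E.
  rewrite -[RHS]h0; apply: eq_integral => s _.
  by rewrite gee0_abs// lee_fin /w.
have mE : measurable_fun (`]a, b[%classic : set R) (fun s => (w s t)%:E).
  exact/measurable_EFinP.
have [+ _] := ae_eq_integral_abs mu (measurable_itv `]a, b[) mE.
move=> /(_ e0); rewrite /aeI; apply: filterS => s hs sab.
have [] := hs sab => /eqP; rewrite /w normr_eq0 subr_eq0 => /eqP //.
Qed.

Lemma swap_ts f g : mes2 f -> mes2 g ->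
  aeI c d (fun t => aeI a b (fun s => f s t = g s t)) ->
  aeI a b (fun s => aeI c d (fun t => f s t = g s t)).
Proof.
move=> mf mg h.
pose w s t := `|f s t - g s t|.
have mw : mes2 w by apply: mes2_abs; exact: mes2B.
have mp : measurable_fun setT (EFin \o pat w) by apply/measurable_EFinP; exact: pat_mes.
have p0 z : (0 <= (EFin \o pat w) z)%E.
  by rewrite /= lee_fin /pat patchE; case: ifP => // _; exact: normr_ge0.
have F0 : (\int[mu]_t \int[mu]_s (EFin \o pat w) (s, t) = 0)%E.
  rewrite -[RHS](@integral0 _ _ _ mu setT); apply: ae_eq_integral => //.
    exact: measurable_fun_fubini_tonelli_G.
  move: h; rewrite /aeI; apply: filterS => t h _.
  case: (boolP (t \in `]c, d[)) => ht; last first.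
    by rewrite (_ : (fun s => _) = cst 0%E) ?integral0//; apply/funext => s /=; rewrite pat0'.
  rewrite int_pat_t// -[RHS](@integral0 _ _ _ mu `]a, b[%classic); apply: ae_eq_integral => //.
    by apply/measurable_EFinP; exact: (mes2_sect_t mw).
  have := h ht; rewrite /aeI; apply: filterS => s e hs.
  by rewrite /w e// subrr normr0.
have G0 : (\int[mu]_s \int[mu]_t (EFin \o pat w) (s, t) = 0)%E.
  by rewrite -F0 fubini_tonelli.
have mG := measurable_fun_fubini_tonelli_F (m2 := mu) _ mp p0.
have GA : (\int[mu]_s `| \int[mu]_t (EFin \o pat w) (s, t) | = 0)%E.
  rewrite -[RHS]G0; apply: eq_integral => s _; rewrite gee0_abs//.
  by apply: integral_ge0 => t _; exact: p0.
have [+ _] := ae_eq_integral_abs mu measurableT mG.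
move=> /(_ GA); rewrite /aeI; apply: filterS => s /(_ I) + hs.
rewrite /fubini_F /= int_pat_s// => h0.
have mwt : mesI c d (w s) by exact: (mes2_sect_s mw hs).
have e0 : (\int[mu]_(t in `]c, d[) `|(w s t)%:E| = 0)%E.
  rewrite -[RHS]h0; apply: eq_integral => t _.
  by rewrite gee0_abs// lee_fin /w.
have mE : measurable_fun (`]c, d[%classic : set R) (fun t => (w s t)%:E).
  exact/measurable_EFinP.
have [+ _] := ae_eq_integral_abs mu (measurable_itv `]c, d[) mE.
move=> /(_ e0); rewrite /aeI; apply: filterS => t ht tcd.
have [] := ht tcd => /eqP; rewrite /w normr_eq0 subr_eq0 => /eqP //.
Qed.

(** Tonelli for the indicator of a measurable null set that contains the exceptional points. *)
Lemma ae_prod (P : RR * RR -> Prop) : {ae (mu \x mu)%E, forall z, P z} ->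
  {ae mu, forall t, {ae mu, forall s, P (s, t)}}.
Proof.
move=> [N [mN N0 PN]].
have m1 : measurable_fun setT (\1_N : RR * RR -> R) by exact: measurable_indic.
have G0 : (\int[mu]_t fubini_G mu (EFin \o (\1_N : RR * RR -> R)) t = 0)%E.
  rewrite -fubini_tonelli2//; last 2 first.
  - by apply/measurable_EFinP.
  - by move=> z; rewrite lee_fin.
  by rewrite (integral_indic _ measurableT mN) setIT; exact: N0.
have g0 t : (0 <= fubini_G mu (EFin \o (\1_N : RR * RR -> R)) t)%E.
  by apply: integral_ge0 => s _; rewrite lee_fin.
have mG : measurable_fun setT (fubini_G mu (EFin \o (\1_N : RR * RR -> R))).
  apply: measurable_fun_fubini_tonelli_G; first exact/measurable_EFinP.
  by move=> z; rewrite lee_fin.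
have GA : (\int[mu]_t `|fubini_G mu (EFin \o (\1_N : RR * RR -> R)) t| = 0)%E.
  by rewrite -[RHS]G0; apply: eq_integral => t _; rewrite gee0_abs.
have [+ _] := ae_eq_integral_abs mu measurableT mG.
move=> /(_ GA); apply: filterS => t /(_ I) ht.
have mS : measurable_fun setT (fun s : RR => (\1_N (s, t) : R)%:E).
  apply/measurable_EFinP; apply: (@measurableT_comp _ _ _ _ _ _ (\1_N : RR * RR -> R)) => //.
have SA : (\int[mu]_s `|(\1_N (s, t) : R)%:E| = 0)%E.
  rewrite -[RHS]ht; apply: eq_integral => s _ /=.
  by rewrite ger0_norm.
have [+ _] := ae_eq_integral_abs mu measurableT mS.
move=> /(_ SA); apply: filterS => s /(_ I) /= hs.
apply: contrapT => nP; have : N (s, t) by apply: PN.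
move: hs; rewrite indicE; case: (boolP ((s, t) \in N)) => [_ [] /eqP|]; first by rewrite oner_eq0.
by move=> /negP h _ /mem_set.
Qed.

(** The variable upper limit becomes a factor r < t in a function of the three variables (s, t, r).
    Partial integrals of its positive and negative parts are measurable by Tonelli. *)
Lemma mes2_primt u : mes2 u -> mes2 (fun s t => II c t (u s)).
Proof.
move=> hu.
pose H (z : (RR * RR) * RR) : \bar R :=
  (if z.2 < z.1.2 then pat u (z.1.1, z.2) else 0)%:E.
have mH : measurable_fun setT H.
  apply/measurable_EFinP; apply: measurable_fun_ifT => //.
    apply: measurable_fun_ltr; first exact: measurable_snd.
    exact: measurableT_comp.
  apply: (@measurableT_comp _ _ _ _ _ _ (pat u)); first exact: pat_mes.
  apply: measurable_fun_pair; last exact: measurable_snd.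
  exact: (measurableT_comp (f := fst) measurable_fst measurable_fst).
have m : measurable_fun setT (fun z : RR * RR => fine (\int[mu]_r H (z, r))%E).
  apply: measurableT_comp; first exact: fine_measurable.
  rewrite (_ : (fun z => _) = (fun z => \int[mu]_r H^\+ (z, r) - \int[mu]_r H^\- (z, r))%E); last first.
    apply/funext => z; rewrite integralE; congr (_ - _)%E; apply: eq_integral => r _.
      by rewrite -[in LHS]/((H \o pair z)^\+ r)%E funepos_comp.
    by rewrite -[in LHS]/((H \o pair z)^\- r)%E funeneg_comp.
  apply: emeasurable_funB.
    apply: (measurable_fun_fubini_tonelli_F (m2 := mu) (H^\+)%E); first exact: measurable_funepos.
    by move=> z; exact: funepos_ge0.
  apply: (measurable_fun_fubini_tonelli_F (m2 := mu) (H^\-)%E); first exact: measurable_funeneg.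
  by move=> z; exact: funeneg_ge0.
apply: (@eq_measurable_fun _ _ _ _ _ (fun z : RR * RR => fine (\int[mu]_r H (z, r))%E)); last exact: measurable_funTS.
move=> [s t]; rewrite inE/= => -[/= hs ht]; rewrite /II /Rintegral; congr fine.
rewrite [RHS]integral_mkcond; apply: eq_integral => r _; rewrite restrict_EFin /H /= patE//.
congr EFin; rewrite !patchE; case: ifPn => rt.
  congr (if _ then _ else _); apply/idP/idP; rewrite !inE/= !in_itv/=.
    by move=> /andP[->].
  by move=> /andP[-> _] /=; move: ht; rewrite /= in_itv/= => /andP[_]; exact: lt_trans.
rewrite ifF//; apply/negP; rewrite inE/= in_itv/= => /andP[_ h].
by rewrite h in rt.
Qed.

End TwoDim.

(** * Classes of functions bounded in time *)

Section Families.
Context {R : realType}.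
Variable T : R.
Implicit Types (f g u v : R -> R -> R).

Local Notation mes := (mes2 0 1 0 T).
Local Notation lf1 := (linf1 0 1 0 T).

Definition linf2 f : Prop := mes f /\ exists M, aeI 0 T (fun t =>
  intg 0 1 (fun s => f s t ^+ 2) /\ II 0 1 (fun s => f s t ^+ 2) <= M).

Definition bndt f : Prop := mes f /\ exists M, aeI 0 T (fun t =>
  aeI 0 1 (fun s => `|f s t| <= M)).

Lemma bndt_pos f : bndt f -> exists2 M, 0 <= M & aeI 0 T (fun t =>
  aeI 0 1 (fun s => `|f s t| <= M)).
Proof.
move=> [_ [M h]]; exists `|M| => //; apply: aeI_imp h => t _; apply: aeI_imp => s _ h.
exact: le_trans h (ler_norm _).
Qed.

Lemma linf1D f g : lf1 f -> lf1 g -> lf1 (fun s t => f s t + g s t).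
Proof.
move=> [mf [M hf]] [mg [N hg]]; split; first exact: mes2D.
exists (M + N); apply: aeI_imp2 hf hg => t ht [i1 l1] [i2 l2]; split; first exact: intgD.
apply: (@le_trans _ _ (II 0 1 (fun s => `|f s t| + `|g s t|))).
  apply: II_le; [by apply: intg_abs; exact: intgD|by apply: intgD; exact: intg_abs|].
  by apply: aeI_all => s _; exact: ler_normD.
by rewrite IID ?lerD//; exact: intg_abs.
Qed.

Lemma linf1N f : lf1 f -> lf1 (fun s t => - f s t).
Proof.
move=> [mf [M hf]]; split; first exact: mes2N.
exists M; apply: aeI_imp hf => t ht [i1 l1]; split; first exact: intgN.
by under eq_fun do rewrite normrN.
Qed.

Lemma linf1B f g : lf1 f -> lf1 g -> lf1 (fun s t => f s t - g s t).
Proof. by move=> hf hg; apply: linf1D => //; exact: linf1N. Qed.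

Lemma linf1_bnd f g : bndt g -> lf1 f -> lf1 (fun s t => g s t * f s t).
Proof.
move=> hg [mf [M hf]]; have mg := hg.1; have [N N0 {}hg] := bndt_pos hg.
split; first exact: mes2M.
exists (N * M); apply: aeI_imp2 hf hg => t ht [i1 l1] h.
have ig : intg 0 1 (fun s => g s t * f s t) by apply: (intgM_bnd i1 (mes2_sect_t mg ht) h).
split => //; apply: (@le_trans _ _ (II 0 1 (fun s => N * `|f s t|))).
  apply: II_le; [exact: intg_abs|by apply: intgZ; exact: intg_abs|].
  by apply: aeI_imp h => s _ h; rewrite normrM ler_wpM2r.
by rewrite IIZ ?ler_wpM2l//; exact: intg_abs.
Qed.

Lemma linf2M f g : linf2 f -> linf2 g -> lf1 (fun s t => f s t * g s t).
Proof.
move=> [mf [M hf]] [mg [N hg]]; split; first exact: mes2M.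
exists (M + N); apply: aeI_imp2 hf hg => t ht [i1 l1] [i2 l2].
have i := intgM_L2 (mes2_sect_t mf ht) (mes2_sect_t mg ht) i1 i2; split => //.
apply: (@le_trans _ _ (II 0 1 (fun s => f s t ^+ 2 + g s t ^+ 2))); last first.
  by rewrite IID// lerD.
apply: II_le; [exact: intg_abs|exact: intgD|].
by apply: aeI_all => s _; rewrite ler_norml; apply/andP; split; nra.
Qed.

Lemma linf2D f g : linf2 f -> linf2 g -> linf2 (fun s t => f s t + g s t).
Proof.
move=> [mf [M hf]] [mg [N hg]]; split; first exact: mes2D.
exists (2 * M + 2 * N); apply: aeI_imp2 hf hg => t ht [i1 l1] [i2 l2].
have i3 : intg 0 1 (fun s => 2 * f s t ^+ 2 + 2 * g s t ^+ 2).
  by apply: intgD; exact: intgZ.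
have h s : (f s t + g s t) ^+ 2 <= 2 * f s t ^+ 2 + 2 * g s t ^+ 2.
  by have := sqr_ge0 (f s t - g s t); nra.
have i : intg 0 1 (fun s => (f s t + g s t) ^+ 2).
  apply: (intg_le _ _ i3).
    by apply: mesIX; apply: mesID; [exact: (mes2_sect_t mf)|exact: (mes2_sect_t mg)].
  by apply: aeI_all => s _; rewrite ger0_norm ?sqr_ge0.
split => //; apply: (@le_trans _ _ (II 0 1 (fun s => 2 * f s t ^+ 2 + 2 * g s t ^+ 2))).
  by apply: II_le => //; exact: aeI_all.
by rewrite IID; [rewrite !IIZ// lerD// ler_wpM2l|exact: intgZ|exact: intgZ].
Qed.

Lemma linf2_bnd f g : bndt g -> linf2 f -> linf2 (fun s t => g s t * f s t).
Proof.
move=> hg [mf [M hf]]; have mg := hg.1; have [N N0 {}hg] := bndt_pos hg.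
split; first exact: mes2M.
exists (N ^+ 2 * M); apply: aeI_imp2 hf hg => t ht [i1 l1] h.
have h2 : aeI 0 1 (fun s => `|(g s t * f s t) ^+ 2| <= N ^+ 2 * f s t ^+ 2).
  apply: aeI_imp h => s _; rewrite ler_norml => /andP[h3 h4].
  by rewrite ger0_norm ?sqr_ge0// exprMn ler_wpM2r ?sqr_ge0//; nra.
have i : intg 0 1 (fun s => (g s t * f s t) ^+ 2).
  apply: (intg_le _ h2); last exact: intgZ.
  by apply: mesIX; apply: mesIM; [exact: (mes2_sect_t mg)|exact: (mes2_sect_t mf)].
split => //; apply: (@le_trans _ _ (II 0 1 (fun s => N ^+ 2 * f s t ^+ 2))).
  apply: II_le => //; first exact: intgZ.
  by apply: aeI_imp h2 => s _; apply: le_trans; exact: ler_norm.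
by rewrite IIZ// ler_wpM2l ?sqr_ge0.
Qed.

Lemma bndt_cst k : bndt (fun _ _ => k).
Proof. by split; [exact: mes2_cst|exists `|k|; apply: aeI_all => t _; exact: aeI_all]. Qed.

Lemma bndtD f g : bndt f -> bndt g -> bndt (fun s t => f s t + g s t).
Proof.
move=> [mf [M hf]] [mg [N hg]]; split; first exact: mes2D.
exists (M + N); apply: aeI_imp2 hf hg => t ht; apply: aeI_imp2 => s _ h1 h2.
by apply: (le_trans (ler_normD _ _)); exact: lerD.
Qed.

Lemma bndtM f g : bndt f -> bndt g -> bndt (fun s t => f s t * g s t).
Proof.
move=> hf hg; have mf := hf.1; have mg := hg.1.
have [M M0 {}hf] := bndt_pos hf; have [N N0 {}hg] := bndt_pos hg.
split; first exact: mes2M.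
exists (M * N); apply: aeI_imp2 hf hg => t ht; apply: aeI_imp2 => s _ h1 h2.
by rewrite normrM ler_pM.
Qed.

Lemma bndtN f : bndt f -> bndt (fun s t => - f s t).
Proof.
move=> [mf [M hf]]; split; first exact: mes2N.
by exists M; apply: aeI_imp hf => t ht; apply: aeI_imp => s _ h1; rewrite normrN.
Qed.

Lemma bndtB f g : bndt f -> bndt g -> bndt (fun s t => f s t - g s t).
Proof. by move=> hf hg; apply: bndtD => //; exact: bndtN. Qed.

Lemma bndt_id : bndt (fun s _ => s).
Proof.
split; first by apply: mes2_s; exact: mesI_id.
exists 1; apply: aeI_all => t _; apply: aeI_all => s; rewrite in_itv/= => /andP[s0 s1].
by rewrite ger0_norm ltW.
Qed.

Lemma bndt_sum n (f : 'I_n -> R -> R -> R) : (forall i, bndt (f i)) ->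
  bndt (fun s t => \sum_i f i s t).
Proof.
elim: n f => [|n IH] f hf.
  by rewrite (_ : (fun s t => _) = (fun _ _ => 0));
    [exact: bndt_cst|apply/funext => s; apply/funext => t; rewrite big_ord0].
rewrite (_ : (fun s t => _) =
   (fun s t => f ord0 s t + \sum_(i < n) f (lift ord0 i) s t)); last first.
  by apply/funext => s; apply/funext => t; rewrite big_ord_recl.
by apply: bndtD => //; exact: IH.
Qed.

Lemma linf2_0 : linf2 (fun _ _ => 0).
Proof.
split; first exact: mes2_cst.
exists 0; apply: aeI_all => t _; under eq_fun do rewrite expr0n/=.
by split; [exact: intg_cst|rewrite II_0].
Qed.

Lemma linf2_sum n (f : 'I_n -> R -> R -> R) : (forall i, linf2 (f i)) ->
  linf2 (fun s t => \sum_i f i s t).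
Proof.
elim: n f => [|n IH] f hf.
  by rewrite (_ : (fun s t => _) = (fun _ _ => 0));
    [exact: linf2_0|apply/funext => s; apply/funext => t; rewrite big_ord0].
rewrite (_ : (fun s t => _) =
   (fun s t => f ord0 s t + \sum_(i < n) f (lift ord0 i) s t)); last first.
  by apply/funext => s; apply/funext => t; rewrite big_ord_recl.
by apply: linf2D => //; exact: IH.
Qed.

Lemma bndt_linf2 f : bndt f -> linf2 f.
Proof.
move=> hf; have mf := hf.1; have [M M0 {}hf] := bndt_pos hf; split => //.
exists (M ^+ 2); apply: aeI_imp hf => t ht h.
have h2 : aeI 0 1 (fun s => `|f s t ^+ 2| <= M ^+ 2).
  apply: aeI_imp h => s _; rewrite ler_norml => /andP[h3 h4].
  by rewrite ger0_norm ?sqr_ge0//; nra.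
have mf2 : mesI 0 1 (fun s => f s t ^+ 2) by apply: mesIX; exact: (mes2_sect_t mf).
split; first exact: intg_bnd h2.
have := II_bnd ler01 mf2 h2; rewrite subr0 mulr1; apply: le_trans; exact: ler_norm.
Qed.

Lemma linf2_linf1 f : linf2 f -> lf1 f.
Proof.
move=> hf; have := linf2M hf (bndt_linf2 (bndt_cst 1)).
by congr linf1; apply/funext => s; apply/funext => t; rewrite mulr1.
Qed.

End Families.

Lemma linf1_restr (R : realType) (T t1 t2 : R) f : 0 <= t1 -> t2 <= T ->
  linf1 0 1 0 T f -> linf1 0 1 t1 t2 f.
Proof.
move=> h1 h2 [mf [M h]]; split.
  apply: measurable_funS mf; first exact: measurable_box.
  move=> [s t] [/= hs ht]; split => //=; move: ht; rewrite /= !in_itv/= => /andP[h3 h4].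
  by rewrite (le_lt_trans h1 h3) (lt_le_trans h4 h2).
by exists M; apply: aeI_sub h.
Qed.

(** The arithmetic that closes the energy inequality: X is absorbed by T^2 Y, and division by the
    coefficients 1/2 and c0/4 on the left produces 2 + 4/c0. *)
Lemma energy_closure (R : realFieldType) (T c0 A D a b X Y Z : R) : 0 < c0 -> 0 <= A -> 0 <= D ->
  X <= T ^+ 2 * Y -> 0 <= Z -> 0 <= a -> 0 <= b ->
  a / 2 + c0 / 4 * b <= (A + D) * (X + Y + Z) ->
  a + b <= (2 + 4 / c0) * ((A + D) * (T ^+ 2 + 1)) * (Y + Z).
Proof.
move=> c00 A0 AA0 hE0 hE2 p1 p2 main.
have n2 : (A + D) * (X + Y + Z) <= (A + D) * (T ^+ 2 + 1) * (Y + Z).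
  rewrite -mulrA ler_wpM2l ?addr_ge0//.
  have : 0 <= T ^+ 2 * Z by rewrite mulr_ge0 ?sqr_ge0.
  lra.
rewrite -mulrA; set W := (A + D) * (T ^+ 2 + 1) * (Y + Z) in n2 *.
have p3 : 0 <= c0 / 4 * b by rewrite mulr_ge0// divr_ge0// ltW.
have h1 : a <= 2 * W by lra.
have h2 : b <= 4 / c0 * W.
  have : b * c0 <= 4 * W by lra.
  by rewrite -ler_pdivlMr//; lra.
by rewrite mulrDl lerD.
Qed.

(** * Energy estimate for h *)

Section Facts.
Context {R : realType}.
Variables (T c0 C : R) (g : 'I_3 -> R) (u v p q k : 'I_3 -> R -> R -> R).
Variables (ta ta1 ta2 : R -> R -> R) (x0 x1 p0 : 'I_3 -> R -> R) (G : set R).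

Local Notation mes := (mes2 0 1 0 T).
Local Notation lf1 := (linf1 0 1 0 T).

(* Encoding: u = x', v = u_t, p = u_s, q = v_s, k = v_t = (tau u)_ss, and
   ta, ta1, ta2 = tau, tau', tau''; x0, x1, p0 are the values of u, v, p at
   t = 0.  G is a set of full measure of times at which the equations hold
   in s, and u, ta, ta1 are taken absolutely continuous there. *)
Record facts : Prop := Facts {
  f_T : 0 < T; f_c0 : 0 < c0; f_C : 0 <= C;
  f_mu : forall i, mes (u i); f_mv : forall i, mes (v i);
  f_mta : mes ta; f_mta1 : mes ta1;
  f_G : aeI 0 T G; f_GT : forall t, G t -> 0 < t /\ t < T;
  f_u : forall t, G t -> forall i, acr (fun s => u i s t) (fun s => p i s t);
  f_ub : forall t, G t -> forall i s, 0 < s -> s <= 1 -> `|u i s t| <= C;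
  f_v : forall t, G t -> forall i, exists w,
    [/\ acr w (fun s => q i s t), aeI 0 1 (fun s => v i s t = w s) &
        forall s, 0 < s -> s <= 1 -> s * w s ^+ 2 <= C];
  f_pb : forall t, G t -> forall i, aeI 0 1 (fun s => s * p i s t ^+ 2 <= C);
  f_ta : forall t, G t -> ac 0 1 (fun s => ta s t) (fun s => ta1 s t);
  f_ta1 : forall t, G t -> ac 0 1 (fun s => ta1 s t) (fun s => ta2 s t);
  f_ta0 : forall t, G t -> ta 0 t = 0;
  f_ta11 : forall t, G t -> ta1 1 t = - \sum_i g i * u i 1 t;
  f_low : forall t, G t -> forall s, 0 < s -> s <= 1 -> c0 * s <= ta s t;
  f_up : forall t, G t -> forall s, 0 <= s -> s <= 1 -> ta s t <= C * s;
  f_ta1b : forall t, G t -> forall s, 0 <= s -> s <= 1 -> `|ta1 s t| <= C;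
  f_flux : forall t, G t -> forall i, aeI 0 1 (fun s =>
    ta1 s t * u i s t + ta s t * p i s t = - g i - II s 1 (fun z => k i z t));
  f_ta2 : forall t, G t -> aeI 0 1 (fun s =>
    ta2 s t = ta s t * (\sum_i p i s t ^+ 2) - \sum_i v i s t ^+ 2);
  f_ik : forall t, G t -> forall i, intg 0 1 (fun s => k i s t);
  f_p2 : forall i, linf2 T (p i);
  f_q2 : forall i, linf2 T (fun s t => s * q i s t);
  f_k2 : forall i, linf2 T (k i);
  f_v2 : forall i, linf2 T (fun s t => v i s t ^+ 2);
  f_ta22 : linf2 T ta2;
  f_mx0 : forall i, mesI 0 1 (x0 i); f_mx1 : forall i, mesI 0 1 (x1 i);
  f_mp0 : forall i, mesI 0 1 (p0 i);
  f_ut : forall i, aeI 0 T (fun t => aeI 0 1 (fun s =>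
    u i s t = x0 i s + II 0 t (v i s)));
  f_vt : forall i, aeI 0 T (fun t => aeI 0 1 (fun s =>
    v i s t = x1 i s + II 0 t (k i s)));
  f_pt : forall i, aeI 0 T (fun t => aeI 0 1 (fun s =>
    p i s t = p0 i s + II 0 t (q i s)));
  f_x00 : aeI 0 1 (fun s => \sum_i x0 i s ^+ 2 = 1);
  f_x01 : aeI 0 1 (fun s => \sum_i x0 i s * x1 i s = 0);
  f_x0p : aeI 0 1 (fun s => \sum_i x0 i s * p0 i s = 0) }.

Definition dot (a b : 'I_3 -> R -> R -> R) s t : R := \sum_i a i s t * b i s t.
(** |u|^2 - 1, followed by its derivatives h_s, h_t, h_st and h_tt expanded by the product rule. *)
Definition hh s t : R := dot u u s t - 1.
Definition hs s t : R := 2 * dot u p s t.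
Definition ht s t : R := 2 * dot u v s t.
Definition hst s t : R := 2 * (dot p v s t + dot u q s t).
Definition htt s t : R := 2 * (dot v v s t + dot u k s t).

(* [be] stands for tau'(1,.); it is kept separate so that it can be replaced by
   an extension that is Lipschitz on the whole line. *)
Variable be : R -> R.
(** [DD] is the s-derivative of s h_t (N + 2 be s h). The terms [Z1], [Z2], [Z3] contain a second
    derivative of h and are integrated by parts in t; [rem] contains none and is estimated
    directly. *)
Definition Z1 s t : R := s * (ht s t * htt s t).
Definition Z2 s t : R := s * (ta s t * (hst s t * hs s t)).
Definition Z3 s t : R := be t * (s ^+ 2 * (hst s t * hh s t)).
Definition rem s t : R := (ta s t - s * ta1 s t) * (ht s t * hs s t)
  + 4 * (be t * (s * (ht s t * hh s t))) - 2 * (s * (ta2 s t * (ht s t * hh s t)))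
  + 2 * (be t * (s ^+ 2 * (ht s t * hs s t))).
Definition DD s t : R := Z1 s t + Z2 s t + 2 * Z3 s t + rem s t.

Hypothesis F : facts.

Lemma dot_sq (a b : 'I_3 -> R) : (\sum_i a i * b i) ^+ 2 <=
  (\sum_i a i ^+ 2) * (\sum_i b i ^+ 2).
Proof.
rewrite !big_ord_recl !big_ord0 !addr0 /=.
set i0 := ord0; set i1 := lift _ _; set i2 := lift _ _.
have h1 := sqr_ge0 (a i0 * b i1 - a i1 * b i0).
have h2 := sqr_ge0 (a i0 * b i2 - a i2 * b i0).
have h3 := sqr_ge0 (a i1 * b i2 - a i2 * b i1).
rewrite -subr_ge0; apply: le_trans (addr_ge0 (addr_ge0 h1 h2) h3) _.
by rewrite le_eqVlt; apply/orP; left; apply/eqP; ring.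
Qed.

(* With [N = 2 u.flux - 2 ta' |u|^2], which represents [ta h'], the product
   [s h_t (N + 2 be s h)] vanishes at both end points. *)
Lemma spatial t : G t -> be t = ta1 1 t -> intg 0 1 (fun s => DD s t) ->
  II 0 1 (fun s => DD s t) = 0.
Proof.
move=> Gt bt iD.
have [w hw] := choice (f_v F Gt).
have C0 := f_C F.
(* The absolutely continuous representative of the flux (tau u)', with value -g at s = 1. *)
pose Phi i s := - g i - II s 1 (fun z => k i z t).
have ik i := f_ik F Gt i.
have acPhi i : acr (Phi i) (fun s => k i s t).
  move=> x x0_ x1_; apply: acI; first exact: intg_sub (ltW x0_) (lexx _) (ik i).
  move=> y z xy yz z1; rewrite /Phi (II_split yz z1); first ring.
  by apply: intg_sub (ik i) => //; apply: le_trans xy; exact: ltW.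
pose su s := \sum_i u i s t * w i s.
(* [A] represents s h_t, with [w] in place of [v], and [B] below represents N + 2 be s h; both are
   absolutely continuous away from 0. *)
pose A s := s * (2 * su s).
pose A' s := 1 * (2 * su s) + s * (2 * \sum_i (p i s t * w i s + u i s t * q i s t)).
have acA : acr A A'.
  move=> x x0_ x1_; apply: ac_mul; first exact: ac_id.
  apply: ac_scale; apply: ac_sum => i; apply: ac_mul; first exact: (f_u F Gt).
  by have [h _ _] := hw i; exact: h.
pose uu s := \sum_i u i s t * u i s t.
pose B s := 2 * (\sum_i u i s t * Phi i s) + (- 2) * (ta1 s t * uu s) +
   (2 * be t) * (s * (uu s + - 1)).
pose uu' s := \sum_i (p i s t * u i s t + u i s t * p i s t).
pose B' s := 2 * (\sum_i (p i s t * Phi i s + u i s t * k i s t)) +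
   (- 2) * (ta2 s t * uu s + ta1 s t * uu' s) +
   (2 * be t) * (1 * (uu s + - 1) + s * (uu' s + 0)).
have acuu : acr uu uu'.
  move=> x x0_ x1_; apply: ac_sum => i; apply: ac_mul; exact: (f_u F Gt).
have acB : acr B B'.
  move=> x x0_ x1_; apply: ac_add; first apply: ac_add.
  - apply: ac_scale; apply: ac_sum => i; apply: ac_mul; first exact: (f_u F Gt).
    exact: acPhi.
  - apply: ac_scale; apply: ac_mul; last exact: acuu.
    exact: ac_sub (ltW x0_) (lexx _) (f_ta1 F Gt).
  - apply: ac_scale; apply: ac_mul; first exact: ac_id.
    by apply: ac_add; [exact: acuu|exact: ac_cst].
have eD : aeI 0 1 (fun s => A' s * B s + A s * B' s = DD s t).
  have hwv : aeI 0 1 (fun s => forall i, v i s t = w i s).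
    by apply: aeI_count => i; have [_ h _] := hw i.
  have hfl : aeI 0 1 (fun s => forall i, ta1 s t * u i s t + ta s t * p i s t = Phi i s).
    by apply: aeI_count => i; exact: (f_flux F Gt i).
  apply: aeI_imp3 hwv hfl (f_ta2 F Gt) => s _ e1 e2 e3.
  rewrite /A' /A /B /B' /su /uu /uu' /DD /rem /Z1 /Z2 /Z3 /ht /hs /hst /htt /hh /dot e3.
  under eq_bigr do rewrite -e1.
  under [X in 2 * X + - 2 * _]eq_bigr do rewrite -e2.
  under [X in _ + s * (2 * X)]eq_bigr do rewrite -e1.
  under [\sum_i (p i s t * Phi i s + _)]eq_bigr do rewrite -e2.
  rewrite !big_ord_recl !big_ord0 /=; ring.
have acF : acr (fun s => A s * B s) (fun s => DD s t).
  move=> x x0_ x1_; apply: (ac_eq (ac_mul (acA x x0_ x1_) (acB x x0_ x1_))) => //.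
    exact: intg_sub (ltW x0_) (lexx _) iD.
  exact: aeI_sub (ltW x0_) (lexx _) eD.
(* At s = 1 one has u.Phi = -g.u = tau' = be, so B = 2 tau' - 2 tau' |u|^2 + 2 tau' (|u|^2 - 1). *)
have B1 : B 1 = 0.
  rewrite /B mul1r bt (f_ta11 F Gt).
  have -> : \sum_i u i 1 t * Phi i 1 = - \sum_i g i * u i 1 t.
    by rewrite -sumrN; apply: eq_bigr => i _; rewrite /Phi II_nil//; ring.
  ring.
pose K i := `|g i| + II 0 1 (fun z => `|k i z t|).
have hPhi i s : 0 < s -> s <= 1 -> `|Phi i s| <= K i.
  move=> s0 s1; rewrite /Phi; apply: (le_trans (ler_normB _ _)).
  by rewrite normrN lerD2l; apply: II_abs2 => //; exact: ltW.
have huu s : 0 < s -> s <= 1 -> 0 <= uu s <= 3 * C ^+ 2.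
  move=> s0 s1; apply/andP; split; first by apply: sumr_ge0 => i _; rewrite -expr2 sqr_ge0.
  rewrite (_ : 3 * _ = \sum_(i < 3) C ^+ 2); last by rewrite sumr_const card_ord; ring.
  apply: ler_sum => i _; have := f_ub F Gt i s0 s1; rewrite ler_norml => /andP[h1 h2].
  by rewrite -expr2; nra.
pose KB := 2 * (\sum_i C * K i) + 2 * (C * (3 * C ^+ 2)) + 2 * `|be t| * (3 * C ^+ 2 + 1).
have hB s : 0 < s -> s <= 1 -> `|B s| <= KB.
  move=> s0 s1; have /andP[u0 u3] := huu s s0 s1.
  rewrite /B /KB; apply: (le_trans (ler_normD _ _)); apply: lerD.
    apply: (le_trans (ler_normD _ _)); apply: lerD.
      rewrite normrM ger0_norm// ler_wpM2l//; apply: (le_trans (ler_norm_sum _ _ _)).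
      by apply: ler_sum => i _; rewrite normrM ler_pM//; [exact: (f_ub F Gt)|exact: hPhi].
    rewrite mulNr normrN normrM (ger0_norm (_ : 0 <= 2 :> R))// ler_wpM2l// normrM ler_pM//.
      by apply: (f_ta1b F Gt) => //; exact: ltW.
    by rewrite ger0_norm.
  rewrite !normrM (ger0_norm (_ : 0 <= 2 :> R))// ler_wpM2l ?mulr_ge0//.
  apply: (@le_trans _ _ (1 * (3 * C ^+ 2 + 1))); last by rewrite mul1r.
  apply: ler_pM => //; first by rewrite ger0_norm// ltW.
  by rewrite ler_norml; apply/andP; split; nra.
(* A^2 = 4 s^2 (u.w)^2 is of order s because s |w|^2 and u are bounded. With B bounded, this is the
   decay at 0 that [acr_end] requires. *)
have hA s : 0 < s -> s <= 1 -> A s ^+ 2 <= (4 * (3 * C ^+ 2) * (3 * C)) * s.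
  move=> s0 s1; have /andP[u0 u3] := huu s s0 s1.
  have hw2 : s * \sum_i w i s ^+ 2 <= 3 * C.
    rewrite mulr_sumr (_ : 3 * _ = \sum_(i < 3) C); last by rewrite sumr_const card_ord; ring.
    by apply: ler_sum => i _; have [_ _ h] := hw i; exact: h.
  have w0 : 0 <= \sum_i w i s ^+ 2 by apply: sumr_ge0 => i _; exact: sqr_ge0.
  have := dot_sq (fun i => u i s t) (fun i => w i s); rewrite -/(su s).
  rewrite (_ : \sum_i u i s t ^+ 2 = uu s); last by apply: eq_bigr => i _; rewrite expr2.
  move: (\sum_i w i s ^+ 2) hw2 w0 => W hw2 w0 h3.
  have h4 : s * su s ^+ 2 <= 3 * C ^+ 2 * (3 * C).
    apply: (@le_trans _ _ (uu s * (s * W))); first by rewrite [leRHS]mulrCA; apply: ler_wpM2l => //; exact: ltW.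
    by apply: ler_pM => //; rewrite mulr_ge0// ltW.
  have -> : A s ^+ 2 = 4 * (s * su s ^+ 2) * s by rewrite /A; ring.
  by rewrite ler_wpM2r ?(ltW s0)// -mulrA ler_wpM2l.
rewrite (acr_end acF iD (C := (4 * (3 * C ^+ 2) * (3 * C)) * KB ^+ 2)); first by rewrite B1 mulr0.
move=> s s0 s1; rewrite exprMn [leRHS]mulrAC; apply: ler_pM; rewrite ?sqr_ge0//; first exact: hA.
by have := hB s s0 s1; rewrite ler_norml => /andP[h1 h2]; nra.
Qed.

Lemma G_ae (P : R -> Prop) : (forall t, G t -> P t) -> aeI 0 T P.
Proof. by move=> h; apply: aeI_imp (f_G F) => t _; exact: h. Qed.

Lemma u_bndt i : bndt T (u i).
Proof.
split; first exact: f_mu F i.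
exists C; apply: G_ae => t Gt; apply: aeI_all => s; rewrite in_itv/= => /andP[s0 s1].
by apply: (f_ub F Gt) => //; exact: ltW.
Qed.

Lemma ta_bndt : bndt T ta.
Proof.
split; first exact: f_mta F.
exists C; apply: G_ae => t Gt; apply: aeI_all => s; rewrite in_itv/= => /andP[s0 s1].
have h1 := f_low F Gt s0 (ltW s1); have h2 := f_up F Gt (ltW s0) (ltW s1).
have h3 : C * s <= C by rewrite ler_piMr ?(f_C F)// ltW.
rewrite ger0_norm ?(le_trans h2)//; apply: le_trans h1.
by rewrite mulr_ge0// ltW// (f_c0 F).
Qed.

Lemma ta1_bndt : bndt T ta1.
Proof.
split; first exact: f_mta1 F.
exists C; apply: G_ae => t Gt; apply: aeI_all => s; rewrite in_itv/= => /andP[s0 s1].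
by apply: (f_ta1b F Gt); exact: ltW.
Qed.

Lemma v_linf2 i : linf2 T (v i).
Proof.
split; first exact: f_mv F i.
have [_ [M h]] := linf2_linf1 (f_v2 F i); exists M; apply: aeI_imp h => t _ [i1].
by split => //; move: b; under eq_fun do rewrite ger0_norm ?sqr_ge0//.
Qed.

(** Both s p^2 and s v^2 are bounded, so each factor may absorb one square root of s. *)
Lemma spv_bndt i : bndt T (fun s t => s * (p i s t * v i s t)).
Proof.
split.
  apply: mes2M; first by apply: mes2_s; exact: mesI_id.
  by apply: mes2M; [have [] := f_p2 F i|exact: f_mv F i].
exists C; apply: G_ae => t Gt; have [w [_ h1 h2]] := f_v F Gt i.
apply: aeI_imp2 h1 (f_pb F Gt i) => s; rewrite in_itv/= => /andP[s0 s1] -> h3.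
have h4 := h2 s s0 (ltW s1).
have h5 : 0 <= s * (p i s t - w s) ^+ 2 by rewrite mulr_ge0 ?sqr_ge0// ltW.
have h6 : 0 <= s * (p i s t + w s) ^+ 2 by rewrite mulr_ge0 ?sqr_ge0// ltW.
by rewrite ler_norml; apply/andP; split; nra.
Qed.

Lemma dot_linf2 (a b : 'I_3 -> R -> R -> R) : (forall i, bndt T (a i)) ->
  (forall i, linf2 T (b i)) -> linf2 T (dot a b).
Proof. by move=> ha hb; apply: linf2_sum => i; exact: linf2_bnd. Qed.

Lemma ht_linf2 : linf2 T ht.
Proof.
by apply: linf2_bnd; [exact: bndt_cst|apply: dot_linf2; [exact: u_bndt|exact: v_linf2]].
Qed.

Lemma hs_linf2 : linf2 T hs.
Proof.
by apply: linf2_bnd; [exact: bndt_cst|apply: dot_linf2; [exact: u_bndt|exact: (f_p2 F)]].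
Qed.

Lemma htt_linf2 : linf2 T htt.
Proof.
apply: linf2_bnd; [exact: bndt_cst|apply: linf2D].
  by apply: linf2_sum => i; have := f_v2 F i.
by apply: dot_linf2; [exact: u_bndt|exact: (f_k2 F)].
Qed.

Lemma shst_linf2 : linf2 T (fun s t => s * hst s t).
Proof.
rewrite (_ : (fun s t => _) = (fun s t => 2 * (\sum_i s * (p i s t * v i s t) +
   \sum_i u i s t * (s * q i s t)))).
  apply: linf2_bnd; [exact: bndt_cst|apply: linf2D].
    by apply: bndt_linf2; apply: bndt_sum => i; exact: spv_bndt.
  by apply: linf2_sum => i; apply: linf2_bnd; [exact: u_bndt|exact: f_q2].
apply/funext => s; apply/funext => t; rewrite /hst /dot !big_ord_recl !big_ord0; ring.
Qed.

Lemma hh_bndt : bndt T hh.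
Proof.
apply: bndtB; last exact: bndt_cst.
by apply: bndt_sum => i; apply: bndtM; exact: u_bndt.
Qed.

Hypothesis mbe : mesI 0 T be.
Hypothesis be_ta1 : forall t, G t -> be t = ta1 1 t.

Lemma be_bndt : bndt T (fun _ t => be t).
Proof.
split; first exact: mes2_t.
exists C; apply: G_ae => t Gt; apply: aeI_all => s _.
by rewrite be_ta1//; exact: (f_ta1b F Gt).
Qed.

Lemma Z1_linf1 : lf1 Z1.
Proof. by apply: linf1_bnd; [exact: bndt_id|apply: linf2M; [exact: ht_linf2|exact: htt_linf2]]. Qed.

Lemma Z2_linf1 : lf1 Z2.
Proof.
rewrite (_ : Z2 = (fun s t => (s * hst s t) * (ta s t * hs s t))).
  apply: linf2M; first exact: shst_linf2.
  by apply: linf2_bnd; [exact: ta_bndt|exact: hs_linf2].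
by apply/funext => s; apply/funext => t; rewrite /Z2; ring.
Qed.

Lemma Z3_linf1 : lf1 Z3.
Proof.
rewrite (_ : Z3 = (fun s t => (be t * (s * hh s t)) * (s * hst s t))).
  apply: linf1_bnd; last exact: linf2_linf1 shst_linf2.
  by apply: bndtM; [exact: be_bndt|apply: bndtM; [exact: bndt_id|exact: hh_bndt]].
by apply/funext => s; apply/funext => t; rewrite /Z3; ring.
Qed.

Lemma hths_linf1 : lf1 (fun s t => ht s t * hs s t).
Proof. by apply: linf2M; [exact: ht_linf2|exact: hs_linf2]. Qed.

Lemma hthh_linf1 : lf1 (fun s t => ht s t * hh s t).
Proof. by apply: linf2M; [exact: ht_linf2|apply: bndt_linf2; exact: hh_bndt]. Qed.

Lemma rem_linf1 : lf1 rem.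
Proof.
have b2 : bndt T (fun s _ => s ^+ 2).
  rewrite (_ : (fun s _ => _) = (fun s _ => s * s)); first by apply: bndtM; exact: bndt_id.
  by apply/funext => s; apply/funext => t; rewrite expr2.
apply: linf1D; first apply: linf1B; first apply: linf1D.
- apply: linf1_bnd hths_linf1; apply: bndtB; first exact: ta_bndt.
  by apply: bndtM; [exact: bndt_id|exact: ta1_bndt].
- do 2 (apply: linf1_bnd; first (exact: bndt_cst || exact: be_bndt)).
  by apply: linf1_bnd; [exact: bndt_id|exact: hthh_linf1].
- apply: linf1_bnd; first exact: bndt_cst.
  apply: linf1_bnd; first exact: bndt_id.
  apply: linf2M; first exact: (f_ta22 F).
  rewrite (_ : (fun s t => _) = (fun s t => hh s t * ht s t)).
    by apply: linf2_bnd; [exact: hh_bndt|exact: ht_linf2].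
  by apply/funext => s; apply/funext => t; rewrite mulrC.
- do 2 (apply: linf1_bnd; first (exact: bndt_cst || exact: be_bndt)).
  by apply: linf1_bnd; [exact: b2|exact: hths_linf1].
Qed.

Lemma linf1_intg f : lf1 f -> aeI 0 T (fun t => intg 0 1 (fun s => f s t)).
Proof. by move=> [_ [M]]; apply: aeI_imp => t _ []. Qed.

Lemma energy_space : aeI 0 T (fun t =>
  II 0 1 (fun s => Z1 s t) = - II 0 1 (fun s => Z2 s t) -
    2 * II 0 1 (fun s => Z3 s t) - II 0 1 (fun s => rem s t)).
Proof.
have h1 := aeI_and (linf1_intg Z1_linf1) (linf1_intg Z2_linf1).
have h2 := aeI_and (linf1_intg Z3_linf1) (linf1_intg rem_linf1).
apply: aeI_imp3 h1 h2 (f_G F) => t _ [i1 i2] [i3 i4] Gt.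
have i5 : intg 0 1 (fun s => 2 * Z3 s t) by exact: intgZ.
have i6 := intgD i1 i2; have i7 := intgD i6 i5.
have := spatial Gt (be_ta1 Gt) (intgD i7 i4).
by rewrite /DD IID// IID// IID// IIZ//; lra.
Qed.

Variable K : R.
Hypothesis K0 : 0 <= K.
Hypothesis lip_ta : forall t1 t2, G t1 -> G t2 -> forall s, 0 < s -> s <= 1 ->
  `|ta s t2 - ta s t1| <= K * s * `|t2 - t1|.
Hypothesis lip_be : forall t1 t2, G t1 -> G t2 -> `|be t2 - be t1| <= K * `|t2 - t1|.

Definition reps s t0 : Prop := forall i,
  [/\ u i s t0 = x0 i s + II 0 t0 (v i s), v i s t0 = x1 i s + II 0 t0 (k i s) &
      p i s t0 = p0 i s + II 0 t0 (q i s)].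

(** At fixed s the functions h, h_s and h_t are absolutely continuous in t and vanish at t = 0, so
    the products with a second derivative integrate to boundary terms at t0. The weights [ta] and
    [be] are only Lipschitz in t on G, which is the case treated by [lip_ae]. *)
Lemma energy_time s t0 : 0 < s -> s <= 1 -> G t0 ->
  (forall i, [/\ intg 0 T (v i s), intg 0 T (k i s) & intg 0 T (q i s)]) ->
  (forall i, [/\ mesI 0 T (u i s) & mesI 0 T (p i s)]) -> mesI 0 T (ta s) ->
  aeI 0 T (reps s) -> reps s t0 ->
  \sum_i x0 i s ^+ 2 = 1 -> \sum_i x0 i s * x1 i s = 0 -> \sum_i x0 i s * p0 i s = 0 ->
  [/\ II 0 t0 (fun t => ht s t * htt s t) = ht s t0 ^+ 2 / 2,
     `|II 0 t0 (fun t => ta s t * (hst s t * hs s t)) - ta s t0 * (hs s t0 ^+ 2 / 2)| <=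
       K * s * II 0 t0 (fun t => hs s t ^+ 2 / 2),
     `|II 0 t0 (fun t => be t * (hst s t * hh s t + hs s t * ht s t)) -
        be t0 * (hs s t0 * hh s t0)| <= K * II 0 t0 (fun t => `|hs s t * hh s t|) &
     hh s t0 ^+ 2 <= t0 * II 0 t0 (fun t => ht s t ^+ 2)] /\
  [/\ intg 0 t0 (fun t => hs s t ^+ 2), intg 0 t0 (fun t => hs s t * hh s t),
      intg 0 t0 (fun t => hs s t * ht s t) & intg 0 t0 (fun t => hst s t * hh s t)] /\
  [/\ intg 0 t0 (fun t => ht s t ^+ 2) & intg 0 t0 (fun t => hh s t ^+ 2)].
Proof.
move=> s0 s1 Gt0 iv mu_ mta rp rp0 e00 e01 e0p.
have [t00 t0T] := f_GT F Gt0.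
have tT : t0 <= T by exact: ltW.
(* Representatives in t of u, v and p; [HT], [HS] and [HH] are the corresponding representatives of
   h_t, h_s and h. *)
pose U i t := x0 i s + II 0 t (v i s).
pose V i t := x1 i s + II 0 t (k i s).
pose P i t := p0 i s + II 0 t (q i s).
have acc (c : R) f : intg 0 T f -> ac 0 t0 (fun t => c + II 0 t f) f.
  move=> i; have := ac_add (ac_cst 0 t0 c) (ac_II (intg_sub (lexx 0) tT i)).
  by move=> h; apply: (ac_eq h) => //; [exact: intg_sub (lexx 0) tT i|apply: aeI_all => x _; rewrite add0r].
have aU i : ac 0 t0 (U i) (v i s) by apply: acc; have [] := iv i.
have aV i : ac 0 t0 (V i) (k i s) by apply: acc; have [] := iv i.
have aP i : ac 0 t0 (P i) (q i s) by apply: acc; have [] := iv i.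
pose HT t := 2 * \sum_i U i t * V i t.
pose HT' t := 2 * \sum_i (v i s t * V i t + U i t * k i s t).
have aHT : ac 0 t0 HT HT' by apply: ac_scale; apply: ac_sum => i; exact: ac_mul.
pose HS t := 2 * \sum_i U i t * P i t.
pose HS' t := 2 * \sum_i (v i s t * P i t + U i t * q i s t).
have aHS : ac 0 t0 HS HS' by apply: ac_scale; apply: ac_sum => i; exact: ac_mul.
pose HH t := \sum_i U i t * U i t + - 1.
pose HH' t := \sum_i (v i s t * U i t + U i t * v i s t) + 0.
have aHH : ac 0 t0 HH HH'.
  by apply: ac_add; [apply: ac_sum => i; exact: ac_mul|exact: ac_cst].
have z i f : U i 0 = x0 i s /\ V i 0 = x1 i s /\ P i 0 = p0 i s /\ f = f :> R.
  by rewrite /U /V /P !II_nil// !addr0.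
have HT0 : HT 0 = 0.
  rewrite /HT (eq_bigr (fun i => x0 i s * x1 i s)) ?e01 ?mulr0// => i _.
  by have [-> [-> _]] := z i 0.
have HS0 : HS 0 = 0.
  rewrite /HS (eq_bigr (fun i => x0 i s * p0 i s)) ?e0p ?mulr0// => i _.
  by have [-> [_ [-> _]]] := z i 0.
have HH0 : HH 0 = 0.
  rewrite /HH (eq_bigr (fun i => x0 i s ^+ 2)) ?e00 ?subrr// => i _.
  by have [-> _] := z i 0; rewrite expr2.
have eqs t : reps s t -> [/\ ht s t = HT t, hs s t = HS t, hh s t = HH t,
    htt s t = HT' t & hst s t = HS' t /\ ht s t = HH' t].
  move=> r; rewrite /ht /hs /hh /htt /hst /dot /HT /HS /HH /HT' /HS' /HH'.
  have eu i : u i s t = U i t by have [] := r i.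
  have ev i : v i s t = V i t by have [] := r i.
  have ep i : p i s t = P i t by have [] := r i.
  split; last split.
  - by congr (2 * _); apply: eq_bigr => i _; rewrite eu ev.
  - by congr (2 * _); apply: eq_bigr => i _; rewrite eu ep.
  - by congr (_ - 1); apply: eq_bigr => i _; rewrite eu.
  - by rewrite -big_split/=; congr (2 * _); apply: eq_bigr => i _; rewrite eu ev.
  - by rewrite -big_split/=; congr (2 * _); apply: eq_bigr => i _; rewrite eu ep mulrC.
  - by rewrite addr0 mulr_sumr; apply: eq_bigr => i _; rewrite eu; ring.
have ae_ : aeI 0 t0 (fun t => [/\ ht s t = HT t, hs s t = HS t, hh s t = HH t,
    htt s t = HT' t & hst s t = HS' t /\ ht s t = HH' t]).
  by apply: aeI_sub (lexx 0) tT _; apply: aeI_imp rp => t _; exact: eqs.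
have [E1 E2 E3 _ _] := eqs t0 rp0.
have sub f : mesI 0 T f -> mesI 0 t0 f by move=> h; apply: mesI_sub h.
have mu' i : mesI 0 t0 (u i s) by apply: sub; have [] := mu_ i.
have mp' i : mesI 0 t0 (p i s) by apply: sub; have [] := mu_ i.
have mv' i : mesI 0 t0 (v i s) by apply: sub; have [/intg_mes] := iv i.
have mk' i : mesI 0 t0 (k i s) by apply: sub; have [_ /intg_mes] := iv i.
have mq' i : mesI 0 t0 (q i s) by apply: sub; have [_ _ /intg_mes] := iv i.
have md (a b : 'I_3 -> R -> R -> R) : (forall i, mesI 0 t0 (a i s)) ->
   (forall i, mesI 0 t0 (b i s)) -> mesI 0 t0 (fun t => dot a b s t).
  by move=> ha hb; apply: mesI_sum => i; apply: mesIM.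
have mht : mesI 0 t0 (ht s) by apply: mesIM; [exact: mesI_cst|exact: md].
have mhs : mesI 0 t0 (hs s) by apply: mesIM; [exact: mesI_cst|exact: md].
have mhh : mesI 0 t0 (hh s) by apply: mesIB; [exact: md|exact: mesI_cst].
have mhtt : mesI 0 t0 (htt s).
  by apply: mesIM; [exact: mesI_cst|apply: mesID; exact: md].
have mhst : mesI 0 t0 (hst s).
  by apply: mesIM; [exact: mesI_cst|apply: mesID; exact: md].
have aHT2 := ac_mul aHT aHT.
have aHS2 := ac_scale (1 / 2) (ac_mul aHS aHS).
have aSH := ac_mul aHS aHH.
have mta' := sub _ mta; have mbe' := sub _ mbe.
split; last first.
  split; last first.
    split.
      apply: (intg_ae (mesIX 2 mht) _ (ac_intg (ac_mul aHT aHT))).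
      by apply: aeI_imp ae_ => t _ [-> _ _ _ _]; rewrite expr2.
    apply: (intg_ae (mesIX 2 mhh) _ (ac_intg (ac_mul aHH aHH))).
    by apply: aeI_imp ae_ => t _ [_ _ -> _ _]; rewrite expr2.
  split.
  - apply: (intg_ae (mesIX 2 mhs) _ (ac_intg (ac_mul aHS aHS))).
    by apply: aeI_imp ae_ => t _ [_ -> _ _ _]; rewrite expr2.
  - apply: (intg_ae (mesIM mhs mhh) _ (ac_intg aSH)).
    by apply: aeI_imp ae_ => t _ [_ -> -> _ _].
  - apply: (intg_ae (mesIM mhs mht) _ (ac_intg (ac_mul aHS aHT))).
    by apply: aeI_imp ae_ => t _ [-> -> _ _ _].
  - have i : intg 0 t0 (fun t => HH t * HS' t).
      apply: (intgM_bnd aHS.1 (ac_mes aHH)); apply: aeI_all => t.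
      by rewrite in_itv/= => /andP[x y]; apply: (ac_bnd aHH); exact: ltW.
    apply: (intg_ae (mesIM mhst mhh) _ i).
    by apply: aeI_imp ae_ => t _ [_ _ -> _ [-> _]]; rewrite mulrC.
split.
- have -> : II 0 t0 (fun t => ht s t * htt s t) =
      II 0 t0 (fun t => 1 / 2 * (HT' t * HT t + HT t * HT' t)).
    apply: II_ae; first exact: mesIM.
      by apply: intg_mes; apply: intgZ; exact: aHT2.1.
    by apply: aeI_imp ae_ => t _ [-> _ _ -> _]; field.
  rewrite IIZ; last exact: aHT2.1.
  by rewrite -(ac_inc aHT2 (lexx 0) (ltW t00) (lexx _)) HT0 E1; field.
- have -> : II 0 t0 (fun t => ta s t * (hst s t * hs s t)) =
      II 0 t0 (fun t => ta s t * (1 / 2 * (HS' t * HS t + HS t * HS' t))).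
    apply: II_ae; first by apply: mesIM => //; exact: mesIM.
      by apply: mesIM => //; apply: intg_mes; exact: aHS2.1.
    by apply: aeI_imp ae_ => t _ [_ -> _ _ [-> _]]; field.
  have -> : II 0 t0 (fun t => hs s t ^+ 2 / 2) = II 0 t0 (fun t => `|1 / 2 * (HS t * HS t)|).
    apply: II_ae.
    - by apply: mesIM; [exact: mesIX|exact: mesI_cst].
    - by apply: mesI_abs; exact: ac_mes aHS2.
    - apply: aeI_imp ae_ => t _ [_ -> _ _ _]; rewrite ger0_norm; first by field.
      by rewrite mulr_ge0// -expr2 sqr_ge0.
  have -> : ta s t0 * (hs s t0 ^+ 2 / 2) = ta s t0 * (1 / 2 * (HS t0 * HS t0)).
    by rewrite E2; field.
  apply: (@lip_ae _ T t0 G) => //.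
  - by rewrite mulr_ge0// ltW.
  - exact: f_G F.
  - by move=> x y Gx Gy; exact: lip_ta.
  - by rewrite HS0 !mulr0.
- have -> : II 0 t0 (fun t => be t * (hst s t * hh s t + hs s t * ht s t)) =
      II 0 t0 (fun t => be t * (HS' t * HH t + HS t * HH' t)).
    apply: II_ae; first by apply: mesIM => //; apply: mesID; exact: mesIM.
      by apply: mesIM => //; apply: intg_mes; exact: aSH.1.
    by apply: aeI_imp ae_ => t _ [_ -> -> _ [-> ->]].
  have -> : II 0 t0 (fun t => `|hs s t * hh s t|) = II 0 t0 (fun t => `|HS t * HH t|).
    apply: II_ae; first by apply: mesI_abs; exact: mesIM.
      by apply: mesI_abs; exact: ac_mes aSH.
    by apply: aeI_imp ae_ => t _ [_ -> -> _ _].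
  rewrite E2 E3.
  apply: (@lip_ae _ T t0 G) => //.
  - exact: f_G F.
  - by rewrite HS0 mul0r.
- have h : HH t0 = II 0 t0 (fun t => 1 * ht s t).
    rewrite (aHH.2 t0 (ltW t00) (lexx _)) HH0 add0r; apply: II_ae; first exact: intg_mes aHH.1.
      by apply: mesIM => //; exact: mesI_cst.
    by apply: aeI_imp ae_ => t _ [_ _ _ _ [_ ->]]; rewrite mul1r.
  have i2 : intg 0 t0 (fun t => ht s t ^+ 2).
    apply: (intg_ae (mesIX 2 mht) _ (ac_intg (ac_mul aHT aHT))).
    by apply: aeI_imp ae_ => t _ [-> _ _ _ _]; rewrite expr2.
  rewrite E3 h; have := @II_CS _ 0 t0 (fun=> 1) (ht s) _ mht _ i2.
  move=> /(_ (@mesI_cst _ _ _ _) (intg_cst _ _ _)) /le_trans; apply.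
  by rewrite (II_cst _ (ltW t00)) expr1n mul1r subr0.
Qed.

(** The multiplier s gives the weight s of h_t^2, and the factor tau, comparable to s, gives s^2 for
    h_s^2. The term [e0] is recovered from [e1] by integration in time. *)
Definition e0 t := II 0 1 (fun s => s * hh s t ^+ 2).
Definition e1 t := II 0 1 (fun s => s * ht s t ^+ 2).
Definition e2 t := II 0 1 (fun s => s ^+ 2 * hs s t ^+ 2).

Lemma e0_linf1 : lf1 (fun s t => s * hh s t ^+ 2).
Proof.
apply: linf1_bnd; first exact: bndt_id.
by rewrite (_ : (fun s t => _) = (fun s t => hh s t * hh s t));
  [apply: linf2M; apply: bndt_linf2; exact: hh_bndt|apply/funext => s; apply/funext => t; rewrite expr2].
Qed.

Lemma e1_linf1 : lf1 (fun s t => s * ht s t ^+ 2).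
Proof.
apply: linf1_bnd; first exact: bndt_id.
by rewrite (_ : (fun s t => _) = (fun s t => ht s t * ht s t));
  [apply: linf2M; exact: ht_linf2|apply/funext => s; apply/funext => t; rewrite expr2].
Qed.

Lemma e2_linf1 : lf1 (fun s t => s ^+ 2 * hs s t ^+ 2).
Proof.
rewrite (_ : (fun s t => _) = (fun s t => (s * hs s t) * (s * hs s t))).
  by apply: linf2M; apply: linf2_bnd; [exact: bndt_id|exact: hs_linf2|exact: bndt_id|exact: hs_linf2].
by apply/funext => s; apply/funext => t; ring.
Qed.

Lemma ge0_e (f : R -> R) : intg 0 1 f ->
  (forall s, 0 < s -> 0 <= f s) -> 0 <= II 0 1 f.
Proof.
move=> i h; apply: II_ge0; first exact: intg_mes i.
by apply: aeI_all => s; rewrite in_itv/= => /andP[s0 _]; exact: h.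
Qed.

(** [ac_sup] on [a, 1] with a = min(s, 1/2). By Cauchy-Schwarz against 1/z the squared integral of
    |h_s| is at most [e2] divided by a, and the factor s pays for it since s/a <= 2. *)
Lemma hh_sup t : G t -> intg 0 1 (fun s => s * hh s t ^+ 2) ->
  intg 0 1 (fun s => s ^+ 2 * hs s t ^+ 2) ->
  forall s, 0 < s -> s <= 1 -> s * hh s t ^+ 2 <= 8 * e0 t + 4 * e2 t.
Proof.
move=> Gt i0 i2 s s0 s1.
pose hs' s := \sum_i (p i s t * u i s t + u i s t * p i s t) + 0.
have ach : acr (fun s => hh s t) hs'.
  move=> x x0_ x1_; apply: ac_add; last exact: ac_cst.
  by apply: ac_sum => i; apply: ac_mul; exact: (f_u F Gt).
have hse z : hs' z = hs z t.
  by rewrite /hs' /hs /dot !big_ord_recl !big_ord0; ring.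
have e00 : 0 <= e0 t by apply: (ge0_e i0) => // z z0; rewrite mulr_ge0 ?sqr_ge0// ltW.
have e20 : 0 <= e2 t by apply: (ge0_e i2) => // z z0; rewrite mulr_ge0 ?sqr_ge0.
pose a := Num.min s (1 / 2).
have a0 : 0 < a by rewrite lt_min s0/=; lra.
have as_ : a <= s by rewrite /a ge_min lexx.
have a2 : a <= 1 / 2 by rewrite /a ge_min lexx orbT.
have a1 : a < 1 by lra.
have sa : s * a^-1 <= 2.
  rewrite ler_pdivrMr// /a; case: (leP s (1 / 2)) => h; lra.
have acha := ach a a0 (ltW a1).
have ih2 : intg a 1 (fun s => hh s t ^+ 2).
  by have := ac_intg (ac_mul acha acha); congr intg; apply/funext => z; rewrite expr2.
have := ac_sup a1 acha as_ s1 ih2 (c := 1 / 2) a2 _.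
have -> : (1 - 1 / 2 : R) = 1 / 2 by field.
move=> /(_ ltac:(lra)) H.
have mhs : mesI a 1 (fun z => hs z t).
  have := intg_mes acha.1; congr mesI; apply/funext => z; exact: hse.
have i2a : intg a 1 (fun s => (s * hs s t) ^+ 2).
  by have := intg_sub (ltW a0) (lexx _) i2; congr intg; apply/funext => z; move: (hs z t) => y; rewrite exprMn.
have D : II a 1 (fun z => `|hs' z|) ^+ 2 <= a^-1 * e2 t.
  have -> : II a 1 (fun z => `|hs' z|) = II a 1 (fun z => z^-1 * `|z * hs z t|).
    apply: II_eq => z; rewrite in_itv/= => /andP[az z1].
    have z0 : 0 < z by exact: lt_trans az.
    by rewrite hse; move: (hs z t) => y; rewrite normrM (gtr0_norm z0) mulKf// gt_eqF.
  have [iv iv2] := sinv2 a0 (ltW a1).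
  have minv : mesI a 1 (fun z : R => z^-1).
    exact: ac_mes (ac_inv a0 (ltW a1)).
  have mzh : mesI a 1 (fun z => z * hs z t) by apply: mesIM => //; exact: mesI_id.
  have i2b : intg a 1 (fun z => `|z * hs z t| ^+ 2).
    by move: i2a; congr intg; apply/funext => z; rewrite real_normK ?num_real.
  apply: (le_trans (II_CS minv (mesI_abs mzh) iv i2b)).
  apply: ler_pM => //.
  - by apply: II_ge0; [exact: intg_mes iv|apply: aeI_all => z _; exact: sqr_ge0].
  - by apply: II_ge0; [exact: intg_mes i2b|apply: aeI_all => z _; exact: sqr_ge0].
  - have -> : II a 1 (fun z => `|z * hs z t| ^+ 2) = II a 1 (fun z => z ^+ 2 * hs z t ^+ 2).
      by apply: II_eq => z _; rewrite real_normK ?num_real//; move: (hs z t) => y; rewrite exprMn.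
    by apply: II_mono => //; [exact: ltW|exact: ltW|apply: aeI_all => z _; rewrite mulr_ge0 ?sqr_ge0].
have D2 : II (1 / 2) 1 (fun z => hh z t ^+ 2) <= 2 * e0 t.
  rewrite /e0 -IIZ//; apply: (@le_trans _ _ (II (1 / 2) 1 (fun z => 2 * (z * hh z t ^+ 2)))).
    apply: II_le.
    - by apply: intg_sub ih2.
    - by apply: intgZ; apply: intg_sub i0 => //; lra.
    - apply: aeI_all => z; rewrite in_itv/= => /andP[z2 z1].
      have := sqr_ge0 (hh z t); nra.
  have h0 : (0 : R) <= 1 / 2 by lra.
  have h1 : (1 / 2 : R) <= 1 by lra.
  apply: (II_mono h0 h1 (lexx _)); [exact: intgZ|].
  apply: aeI_all => z; rewrite in_itv/= => /andP[z0 z1].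
  by rewrite mulr_ge0// mulr_ge0 ?sqr_ge0// ltW.
have H2 : hh s t ^+ 2 <= 8 * e0 t + 2 * (a^-1 * e2 t) by lra.
have H3 : s * hh s t ^+ 2 <= s * (8 * e0 t + 2 * (a^-1 * e2 t)).
  by rewrite ler_wpM2l// ltW.
have H4 : s * (8 * e0 t) <= 8 * e0 t by rewrite ler_piMl// mulr_ge0.
have H5 : s * a^-1 * (2 * e2 t) <= 2 * (2 * e2 t) by rewrite ler_wpM2r// mulr_ge0.
apply: (le_trans H3); rewrite mulrDr.
have -> : s * (2 * (a^-1 * e2 t)) = s * a^-1 * (2 * e2 t) by ring.
lra.
Qed.

(** Since tau(0) = 0, the difference tau - s tau' is minus the integral of z tau'' over []0, s[].
    Cauchy-Schwarz then gives the power 3, because z^2 integrates to at most s^3. *)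
Lemma ta_defect t M : G t -> intg 0 1 (fun s => ta2 s t ^+ 2) ->
  II 0 1 (fun s => ta2 s t ^+ 2) <= M -> forall s, 0 < s -> s <= 1 ->
  (ta s t - s * ta1 s t) ^+ 2 <= M * s ^+ 3.
Proof.
move=> Gt i2 hM s s0 s1.
have hc := ac_mul (ac_id 0 1) (f_ta1 F Gt).
have it2 : intg 0 1 (fun s => ta2 s t) := (f_ta1 F Gt).1.
have e1' := ac_inc hc (lexx 0) (ltW s0) s1.
have e2' := ac_inc (f_ta F Gt) (lexx 0) (ltW s0) s1.
rewrite mul0r subr0 in e1'; rewrite (f_ta0 F Gt) subr0 in e2'.
have isub f : intg 0 1 f -> intg 0 s f by move=> h; apply: intg_sub h.
have it1 : intg 0 s (fun s => ta1 s t) := isub _ (f_ta F Gt).1.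
have mt2 := intg_mes (isub _ it2).
have idt : intg 0 s (fun z => z * ta2 z t).
  apply: (@intgM_bnd _ _ _ _ _ 1 (isub _ it2)); first exact: mesI_id.
  apply: aeI_all => z; rewrite in_itv/= => /andP[z0 zs].
  by rewrite ger0_norm ltW// (lt_le_trans zs).
have -> : ta s t - s * ta1 s t = - II 0 s (fun z => z * ta2 z t).
  rewrite e1' e2'.
  have -> : II 0 s (fun x => 1 * ta1 x t + x * ta2 x t) =
     II 0 s (fun x => ta1 x t + x * ta2 x t) by apply: II_eq => z _; rewrite mul1r.
  rewrite IID//; ring.
rewrite sqrrN.
have iz2 : intg 0 s (fun z => z ^+ 2).
  by have := ac_intg (ac_mul (ac_id 0 s) (ac_id 0 s)); congr intg; apply/funext => z; rewrite expr2.
have CS := II_CS (@mesI_id _ 0 s) mt2 iz2 (isub _ i2).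
apply: (le_trans CS).
have b1 : II 0 s (fun z => z ^+ 2) <= s ^+ 3.
  have := II_le iz2 (intg_cst 0 s (s ^+ 2)); rewrite (II_cst _ (ltW s0)) subr0 -exprSr; apply.
  apply: aeI_all => z; rewrite in_itv/= => /andP[z0 zs].
  by have := ltW zs; nra.
have b2 : II 0 s (fun z => ta2 z t ^+ 2) <= M.
  apply: le_trans hM; apply: II_mono => //; first exact: ltW.
  by apply: aeI_all => z _; exact: sqr_ge0.
rewrite mulrC; apply: ler_pM => //.
  by apply: II_ge0; [exact: intg_mes (isub _ i2)|apply: aeI_all => z _; exact: sqr_ge0].
by apply: II_ge0; [exact: intg_mes iz2|apply: aeI_all => z _; exact: sqr_ge0].
Qed.

(** The defect of order s^(3/2) splits as s^(1/2) h_t times s h_s. In the term with tau'', which is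
    only in L^2, the supremum bound of [hh_sup] puts tau''^2 under the integral. The two terms with
    [be] are plain products. *)
Lemma rem_bound : exists2 A, 0 <= A & aeI 0 T (fun t =>
  `|II 0 1 (fun s => rem s t)| <= A * (e0 t + e1 t + e2 t)).
Proof.
have [mt2 [M hM]] := f_ta22 F.
have C0 := f_C F.
pose A := 10 * (1 + C + `|M|).
have A0 : 0 <= A by rewrite mulr_ge0// addr_ge0// addr_ge0.
exists A => //.
have h1 := aeI_and (linf1_intg e0_linf1) (aeI_and (linf1_intg e1_linf1) (linf1_intg e2_linf1)).
have h2 := aeI_and (linf1_intg rem_linf1) hM.
apply: aeI_imp3 h1 h2 (f_G F) => t _ [i0 [i1 i2]] [ir [it2 lM]] Gt.
pose Q := 8 * e0 t + 4 * e2 t.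
have hQ := hh_sup Gt i0 i2.
have hd := ta_defect Gt it2 lM.
(* A common majorant for the estimates [r1] to [r4] below; [Q] bounds s h^2 uniformly in s and is a
   constant here. *)
pose W s := 5 * (1 + C) * (s * ht s t ^+ 2) + (`|M| + C) * (s ^+ 2 * hs s t ^+ 2) +
   2 * C * (s * hh s t ^+ 2) + Q * ta2 s t ^+ 2.
have iW : intg 0 1 W.
  by apply: intgD; [apply: intgD; [apply: intgD|]|]; exact: intgZ.
have e00 : 0 <= e0 t by apply: (ge0_e i0) => // z z0; rewrite mulr_ge0 ?sqr_ge0// ltW.
have e10 : 0 <= e1 t by apply: (ge0_e i1) => // z z0; rewrite mulr_ge0 ?sqr_ge0// ltW.
have e20 : 0 <= e2 t by apply: (ge0_e i2) => // z z0; rewrite mulr_ge0 ?sqr_ge0.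
apply: (@le_trans _ _ (II 0 1 W)); last first.
  have j1 : intg 0 1 (fun s => 5 * (1 + C) * (s * ht s t ^+ 2)) by exact: intgZ.
  have j2 : intg 0 1 (fun s => (`|M| + C) * (s ^+ 2 * hs s t ^+ 2)) by exact: intgZ.
  have j3 : intg 0 1 (fun s => 2 * C * (s * hh s t ^+ 2)) by exact: intgZ.
  have j4 : intg 0 1 (fun s => Q * ta2 s t ^+ 2) by exact: intgZ.
  have j5 := intgD j1 j2; have j6 := intgD j5 j3.
  rewrite /W IID// IID// IID// !IIZ// -/(e0 t) -/(e1 t) -/(e2 t).
  have lM' : II 0 1 (fun x => ta2 x t ^+ 2) <= `|M| by apply: le_trans lM _; exact: ler_norm.
  have Q0 : 0 <= Q by rewrite /Q; lra.
  have : Q * II 0 1 (fun x => ta2 x t ^+ 2) <= Q * `|M| by rewrite ler_wpM2l.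
  have := normr_ge0 M; rewrite /A /Q => M0.
  have p1 := mulr_ge0 C0 e00; have p2 := mulr_ge0 C0 e10; have p3 := mulr_ge0 C0 e20.
  have p4 := mulr_ge0 M0 e00; have p5 := mulr_ge0 M0 e10; have p6 := mulr_ge0 M0 e20.
  lra.
apply: II_abs_le => //; first exact: intg_mes ir.
apply: aeI_all => s; rewrite in_itv/= => /andP[s0 s1].
have {}hQ := hQ s s0 (ltW s1); rewrite -/Q in hQ.
have {}hd := hd s s0 (ltW s1).
have bC : `|be t| <= C by rewrite be_ta1//; apply: (f_ta1b F Gt).
have M1 : M <= `|M| := ler_norm M.
rewrite /rem /W.
move: (ht s t) (hs s t) (hh s t) (ta s t - s * ta1 s t) (ta2 s t) (be t) hd hQ bC => X Y Z a b c hd hQ bC.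
have r1 : `|a * (X * Y)| <= s * X ^+ 2 + `|M| * (s ^+ 2 * Y ^+ 2).
  have ha : (a * Y) ^+ 2 <= s * (`|M| * (s ^+ 2 * Y ^+ 2)).
    rewrite exprMn; apply: (@le_trans _ _ (M * s ^+ 3 * Y ^+ 2)).
      by rewrite ler_wpM2r ?sqr_ge0.
    have -> : s * (`|M| * (s ^+ 2 * Y ^+ 2)) = `|M| * s ^+ 3 * Y ^+ 2 by ring.
    by rewrite ler_wpM2r ?sqr_ge0// ler_wpM2r// exprn_ge0// ltW.
  have sv : 0 < s^-1 by rewrite invr_gt0.
  have k1 : 0 <= s^-1 * (a * Y + s * X) ^+ 2 by rewrite mulr_ge0 ?sqr_ge0// ltW.
  have k2 : 0 <= s^-1 * (a * Y - s * X) ^+ 2 by rewrite mulr_ge0 ?sqr_ge0// ltW.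
  have k3 : s^-1 * (a * Y) ^+ 2 <= `|M| * (s ^+ 2 * Y ^+ 2).
    by rewrite mulrC ler_pdivrMr// [leRHS]mulrC.
  have q1 : s^-1 * (a * Y + s * X) ^+ 2 = s^-1 * (a * Y) ^+ 2 + 2 * (a * (X * Y)) + s * X ^+ 2.
    by field; rewrite gt_eqF.
  have q2 : s^-1 * (a * Y - s * X) ^+ 2 = s^-1 * (a * Y) ^+ 2 - 2 * (a * (X * Y)) + s * X ^+ 2.
    by field; rewrite gt_eqF.
  have := sqr_ge0 X => X2; have : 0 <= s * X ^+ 2 by rewrite mulr_ge0// ltW.
  have := mulr_ge0 (normr_ge0 M) (mulr_ge0 (sqr_ge0 s) (sqr_ge0 Y)).
  by rewrite ler_norml; lra.
have sXZ : `|s * (X * Z)| <= (s * X ^+ 2 + s * Z ^+ 2) / 2.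
  have k1 : 0 <= s * (X + Z) ^+ 2 by rewrite mulr_ge0 ?sqr_ge0// ltW.
  have k2 : 0 <= s * (X - Z) ^+ 2 by rewrite mulr_ge0 ?sqr_ge0// ltW.
  by rewrite ler_norml; apply/andP; split; nra.
have r2 : `|4 * (c * (s * (X * Z)))| <= 2 * C * (s * X ^+ 2 + s * Z ^+ 2).
  rewrite normrM ger0_norm// normrM.
  have := ler_pM (normr_ge0 c) (normr_ge0 (s * (X * Z))) bC sXZ; lra.
have r3 : `|2 * (s * (b * (X * Z)))| <= s * X ^+ 2 + Q * b ^+ 2.
  have k1 : 0 <= s * (X + b * Z) ^+ 2 by rewrite mulr_ge0 ?sqr_ge0// ltW.
  have k2 : 0 <= s * (X - b * Z) ^+ 2 by rewrite mulr_ge0 ?sqr_ge0// ltW.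
  have k3 : (s * Z ^+ 2) * b ^+ 2 <= Q * b ^+ 2 by rewrite ler_wpM2r ?sqr_ge0.
  by rewrite ler_norml; apply/andP; split; nra.
have sXY : `|s ^+ 2 * (X * Y)| <= (s * X ^+ 2 + s ^+ 2 * Y ^+ 2) / 2.
  have k1 : 0 <= s ^+ 2 * (X + Y) ^+ 2 by rewrite mulr_ge0 ?sqr_ge0.
  have k2 : 0 <= s ^+ 2 * (X - Y) ^+ 2 by rewrite mulr_ge0 ?sqr_ge0.
  have k3 : s ^+ 2 * X ^+ 2 <= s * X ^+ 2.
    by rewrite ler_wpM2r ?sqr_ge0// expr2 ler_piMl// ltW.
  by rewrite ler_norml; apply/andP; split; nra.
have r4 : `|2 * (c * (s ^+ 2 * (X * Y)))| <= C * (s * X ^+ 2 + s ^+ 2 * Y ^+ 2).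
  rewrite normrM ger0_norm// normrM.
  have := ler_pM (normr_ge0 c) (normr_ge0 (s ^+ 2 * (X * Y))) bC sXY; lra.
apply: (le_trans (ler_normD _ _)); apply: (@le_trans _ _ (`|a * (X * Y)| +
  `|4 * (c * (s * (X * Z)))| + `|2 * (s * (b * (X * Z)))| + `|2 * (c * (s ^+ 2 * (X * Y)))|)).
  rewrite lerD2r; apply: (le_trans (ler_normB _ _)); rewrite lerD2r.
  exact: ler_normD.
have : 0 <= s * X ^+ 2 by rewrite mulr_ge0 ?sqr_ge0// ltW.
have : 0 <= C * (s * X ^+ 2) := mulr_ge0 C0 (mulr_ge0 (ltW s0) (sqr_ge0 X)).
lra.
Qed.

Lemma ae_reps_st : aeI 0 T (fun t => aeI 0 1 (fun s => reps s t)).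
Proof.
have h1 : aeI 0 T (fun t => forall i, aeI 0 1 (fun s => u i s t = x0 i s + II 0 t (v i s))).
  by apply: aeI_count => i; exact: (f_ut F i).
have h2 : aeI 0 T (fun t => forall i, aeI 0 1 (fun s => v i s t = x1 i s + II 0 t (k i s))).
  by apply: aeI_count => i; exact: (f_vt F i).
have h3 : aeI 0 T (fun t => forall i, aeI 0 1 (fun s => p i s t = p0 i s + II 0 t (q i s))).
  by apply: aeI_count => i; exact: (f_pt F i).
apply: aeI_imp3 h1 h2 h3 => t _ h1 h2 h3; apply: aeI_count => i.
by apply: aeI_imp3 (h1 i) (h2 i) (h3 i) => s _.
Qed.

Lemma mq i : mes (q i).
Proof.
have [m _] := f_q2 F i.
have mi : mes (fun s _ => s^-1).
  apply: mes2_s; apply: open_continuous_measurable_fun; first exact: itv_open.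
  move=> x; rewrite inE/= in_itv/= => /andP[x00 _]; apply: continuousV; last exact: cvg_id.
  by rewrite gt_eqF.
have := mes2M mi m; apply: eq_measurable_fun => -[s t] /=.
rewrite inE => -[/= + _]; rewrite in_itv/= => /andP[s0 _].
by rewrite mulKf// gt_eqF.
Qed.

(** The integrations in time take place at fixed s, so the null sets of the representations have to
    be exchanged. *)
Lemma ae_reps_ts : aeI 0 1 (fun s => aeI 0 T (reps s)).
Proof.
have h (a b : R -> R -> R) c : mes a -> mes b -> mesI 0 1 c ->
    aeI 0 T (fun t => aeI 0 1 (fun s => a s t = c s + II 0 t (b s))) ->
    aeI 0 1 (fun s => aeI 0 T (fun t => a s t = c s + II 0 t (b s))).
  move=> ma mb mc; apply: (@swap_ts R 0 1 0 T a (fun s t => c s + II 0 t (b s))) => //.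
  by apply: mes2D; [exact: mes2_s|exact: mes2_primt].
have h1 : aeI 0 1 (fun s => forall i, aeI 0 T (fun t => u i s t = x0 i s + II 0 t (v i s))).
  apply: aeI_count => i; apply: h (f_ut F i); [exact: (f_mu F)|exact: (f_mv F)|exact: (f_mx0 F)].
have h2 : aeI 0 1 (fun s => forall i, aeI 0 T (fun t => v i s t = x1 i s + II 0 t (k i s))).
  by apply: aeI_count => i; apply: h (f_vt F i);
    [exact: (f_mv F)|have [] := f_k2 F i|exact: (f_mx1 F)].
have h3 : aeI 0 1 (fun s => forall i, aeI 0 T (fun t => p i s t = p0 i s + II 0 t (q i s))).
  by apply: aeI_count => i; apply: h (f_pt F i);
    [have [] := f_p2 F i|exact: mq|exact: (f_mp0 F)].
apply: aeI_imp3 h1 h2 h3 => s _ h1 h2 h3; apply: aeI_count => i.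
by apply: aeI_imp3 (h1 i) (h2 i) (h3 i) => t _.
Qed.

Lemma intg_div a b (c : R) f : c != 0 -> intg a b (fun x => c * f x) -> intg a b f.
Proof. by move=> c_0 /(intgZ c^-1); congr intg; apply/funext => x; rewrite mulKf. Qed.

Lemma IIZ' a b (c : R) f : c != 0 -> intg a b (fun x => c * f x) ->
  II a b (fun x => c * f x) = c * II a b f.
Proof. by move=> c_0 /(intg_div c_0); exact: IIZ. Qed.

Lemma ae_intg_t : aeI 0 1 (fun s => forall i,
  [/\ intg 0 T (v i s), intg 0 T (k i s) & intg 0 T (q i s)]).
Proof.
apply: aeI_count => i.
have [h1 _ _ _] := fubini (linf2_linf1 (v_linf2 i)).
have [h2 _ _ _] := fubini (linf2_linf1 (f_k2 F i)).
have [h3 _ _ _] := fubini (linf2_linf1 (f_q2 F i)).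
apply: aeI_imp3 h1 h2 h3 => s; rewrite in_itv/= => /andP[s0 _] i1 i2 i3; split => //.
by apply: intg_div i3; rewrite gt_eqF.
Qed.

Lemma fub t0 f : 0 < t0 -> t0 < T -> lf1 f ->
  [/\ aeI 0 1 (fun s => intg 0 t0 (f s)), intg 0 1 (fun s => II 0 t0 (f s)),
      intg 0 t0 (fun t => II 0 1 (fun s => f s t)) &
      II 0 1 (fun s => II 0 t0 (f s)) = II 0 t0 (fun t => II 0 1 (fun s => f s t))].
Proof. by move=> t00 t0T h; apply: fubini; apply: linf1_restr h => //; exact: ltW. Qed.

(** 2K dominates the errors from the Lipschitz weights, C bounds the term be s^2 h_s h_t, and the
    last summand comes from Young's inequality for the boundary term be s^2 h_s h at time t0. *)
Definition AA : R := 2 * K + C + 4 * C ^+ 2 * T / c0.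

Lemma AA_ge0 : 0 <= AA.
Proof.
have C0 := f_C F; have T0 := ltW (f_T F); have c00 := ltW (f_c0 F).
by rewrite /AA addr_ge0// ?addr_ge0// ?mulr_ge0// ?invr_ge0// exprn_ge0.
Qed.

(** By tau >= c0 s the boundary term of [Z2] is at least c0/2 times s^2 h_s^2. Half of this absorbs
    the h_s part of the boundary term of [Z3], which leaves c0/4; the h part is an integral of
    h_t^2, as h vanishes at t = 0. *)
Lemma energy_pointwise t0 : G t0 -> aeI 0 1 (fun s => reps s t0) ->
  aeI 0 1 (fun s =>
    s * ht s t0 ^+ 2 / 2 + c0 / 4 * (s ^+ 2 * hs s t0 ^+ 2) <=
    II 0 t0 (Z1 s) + II 0 t0 (Z2 s) + 2 * II 0 t0 (Z3 s) +
    AA * (II 0 t0 (fun t => s * hh s t ^+ 2) + II 0 t0 (fun t => s * ht s t ^+ 2) +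
         II 0 t0 (fun t => s ^+ 2 * hs s t ^+ 2)) /\
    s * hh s t0 ^+ 2 <= T * II 0 t0 (fun t => s * ht s t ^+ 2)).
Proof.
move=> Gt0 r0.
have [t00 t0T] := f_GT F Gt0.
have C0 := f_C F; have c00 := f_c0 F; have T0 := f_T F.
have [jZ1 _ _ _] := fub t00 t0T Z1_linf1.
have [jZ2 _ _ _] := fub t00 t0T Z2_linf1.
have h0 := aeI_and jZ1 jZ2.
have hx : aeI 0 1 (fun s => [/\ \sum_i x0 i s ^+ 2 = 1, \sum_i x0 i s * x1 i s = 0 &
    \sum_i x0 i s * p0 i s = 0]).
  by apply: aeI_imp3 (f_x00 F) (f_x01 F) (f_x0p F) => s _.
have hr : aeI 0 1 (fun s => [/\ aeI 0 T (reps s), reps s t0 & forall i,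
    [/\ intg 0 T (v i s), intg 0 T (k i s) & intg 0 T (q i s)]]).
  by apply: aeI_imp3 ae_reps_ts r0 ae_intg_t => s _.
apply: aeI_imp3 h0 hx hr => s ss [iZ1 iZ2] [y1 y2 y3] [z1 z2 z3].
have mup i : [/\ mesI 0 T (u i s) & mesI 0 T (p i s)].
  by split; [exact: mes2_sect_s (f_mu F i) ss|have [m _] := f_p2 F i; exact: mes2_sect_s m ss].
have mta := mes2_sect_s (f_mta F) ss.
move: (ss); rewrite in_itv/= => /andP[s0 s1].
have [[T1 T2 T3 T4] [[i1 i2 i3 i4] [i5 i6]]] :=
  energy_time s0 (ltW s1) Gt0 z3 mup mta z1 z2 y1 y2 y3.
have sn : s != 0 by rewrite gt_eqF.
have bC : aeI 0 t0 (fun t => `|be t| <= C).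
  apply: aeI_sub (lexx 0) (ltW t0T) _; apply: G_ae => t Gt.
  by rewrite be_ta1//; exact: (f_ta1b F Gt).
have mbe' : mesI 0 t0 be by apply: mesI_sub mbe => //; exact: ltW.
have iw f : intg 0 t0 f -> intg 0 t0 (fun t => be t * f t).
  by move=> h; exact: (intgM_bnd h mbe' bC).
have e1' : II 0 t0 (Z1 s) = s * (ht s t0 ^+ 2 / 2) by rewrite -T1 -IIZ'.
have e2' : II 0 t0 (Z2 s) = s * II 0 t0 (fun t => ta s t * (hst s t * hs s t)).
  by rewrite -IIZ'.
have e3' : II 0 t0 (Z3 s) = s ^+ 2 * (II 0 t0 (fun t => be t * (hst s t * hh s t + hs s t * ht s t)) -
    II 0 t0 (fun t => be t * (hs s t * ht s t))).
  rewrite -IIB; [|by apply: iw; exact: intgD|exact: iw].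
  have -> : II 0 t0 (Z3 s) = II 0 t0 (fun t => s ^+ 2 * (be t * (hst s t * hh s t))).
    by apply: II_eq => t _; rewrite /Z3; ring.
  rewrite IIZ; last exact: iw.
  by congr (_ * _); apply: II_eq => t _; ring.
rewrite e1' e2' e3' !IIZ//.
have n1 : II 0 t0 (fun t => hs s t ^+ 2 / 2) = II 0 t0 (fun t => hs s t ^+ 2) / 2.
  by rewrite mulrC -IIZ//; apply: II_eq => t _; rewrite mulrC.
rewrite n1 in T2.
set I0 := II 0 t0 (fun t => hh s t ^+ 2); set I1 := II 0 t0 (fun t => ht s t ^+ 2).
set I2 := II 0 t0 (fun t => hs s t ^+ 2).
rewrite -/I1 in T4; rewrite -/I2 in T2.
have I00 : 0 <= I0 by apply: II_ge0; [exact: intg_mes|apply: aeI_all => t _; exact: sqr_ge0].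
have I10 : 0 <= I1 by apply: II_ge0; [exact: intg_mes|apply: aeI_all => t _; exact: sqr_ge0].
have I20 : 0 <= I2 by apply: II_ge0; [exact: intg_mes|apply: aeI_all => t _; exact: sqr_ge0].
have J : II 0 t0 (fun t => `|hs s t * hh s t|) <= (I2 + I0) / 2.
  rewrite /I2 /I0 -IID// mulrC -IIZ; last exact: intgD.
  apply: II_le; [exact: intg_abs|by apply: intgZ; exact: intgD|].
  apply: aeI_all => t _; move: (hs s t) (hh s t) => a b.
  have := sqr_ge0 (a - b); have := sqr_ge0 (a + b).
  by rewrite ler_norml; move=> ? ?; apply/andP; split; nra.
have L : `|II 0 t0 (fun t => be t * (hs s t * ht s t))| <= C * ((I2 + I1) / 2).
  have -> : C * ((I2 + I1) / 2) = II 0 t0 (fun t => C / 2 * (hs s t ^+ 2 + ht s t ^+ 2)).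
    by rewrite IIZ; [rewrite IID// -/I1 -/I2; ring|exact: intgD].
  apply: II_abs_le; first by apply: mesIM => //; exact: intg_mes.
    by apply: intgZ; exact: intgD.
  apply: aeI_imp bC => t _ h; rewrite normrM.
  have : `|hs s t * ht s t| <= (hs s t ^+ 2 + ht s t ^+ 2) / 2.
    move: (hs s t) (ht s t) => a b; have := sqr_ge0 (a - b); have := sqr_ge0 (a + b).
    by rewrite ler_norml; move=> ? ?; apply/andP; split; nra.
  move=> h2; apply: (le_trans (ler_pM (normr_ge0 _) (normr_ge0 _) h h2)); lra.
have low := f_low F Gt0 s0 (ltW s1).
have bC0 : `|be t0| <= C by rewrite be_ta1//; exact: (f_ta1b F Gt0).
have s2 : s ^+ 2 <= s by rewrite expr2 ler_piMl// ltW.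
have s20 : 0 < s ^+ 2 by rewrite exprn_gt0.
have tI : t0 * I1 <= T * I1 by rewrite ler_wpM2r// ltW.
move: (ht s t0) (hs s t0) (hh s t0) (ta s t0) (be t0)
  (II 0 t0 (fun t => ta s t * (hst s t * hs s t)))
  (II 0 t0 (fun t => be t * (hst s t * hh s t + hs s t * ht s t)))
  (II 0 t0 (fun t => be t * (hs s t * ht s t)))
  (II 0 t0 (fun t => `|hs s t * hh s t|)) T1 T2 T3 T4 J L low bC0 {n1 e1' e2' e3'} =>
  a b c ta0 be0 z2' w1 w2 j _ T2 T3 T4 J L low bC0.
have sc : s * c ^+ 2 <= T * (s * I1).
  have : s * c ^+ 2 <= s * (T * I1) by rewrite ler_wpM2l ?(ltW s0)//; lra.
  by rewrite [s * (T * _)]mulrCA.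
split=> //.
have k2 : s * z2' >= c0 * (s ^+ 2 * b ^+ 2) / 2 - K / 2 * (s ^+ 2 * I2).
  have : ta0 * (b ^+ 2 / 2) - K * s * (I2 / 2) <= z2'.
    by move: T2; rewrite ler_norml => /andP[+ _]; lra.
  move=> /(ler_wpM2l (ltW s0)); apply: le_trans.
  have : s * (c0 * s * (b ^+ 2 / 2)) <= s * (ta0 * (b ^+ 2 / 2)).
    by rewrite ler_wpM2l ?(ltW s0)// ler_wpM2r// divr_ge0 ?sqr_ge0.
  rewrite mulrBr.
  have -> : s * (K * s * (I2 / 2)) = K / 2 * (s ^+ 2 * I2) by ring.
  have -> : s * (c0 * s * (b ^+ 2 / 2)) = c0 * (s ^+ 2 * b ^+ 2) / 2 by ring.
  lra.
have k3 : s ^+ 2 * `|w1 - w2| <= s ^+ 2 * (C * `|b * c| + K * ((I2 + I0) / 2) + C * ((I2 + I1) / 2)).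
  rewrite ler_wpM2l ?(ltW s20)//; apply: (le_trans (ler_normB _ _)); rewrite lerD//.
  have -> : w1 = (w1 - be0 * (b * c)) + be0 * (b * c) by ring.
  apply: (le_trans (ler_normD _ _)); rewrite addrC lerD//.
    by rewrite normrM ler_wpM2r.
  by apply: (le_trans T3); rewrite ler_wpM2l.
(* Young's inequality, with weights chosen so that the h_s part costs exactly c0/4. *)
have k4 : 2 * (s ^+ 2 * (C * `|b * c|)) <= c0 / 4 * (s ^+ 2 * b ^+ 2) + 4 * C ^+ 2 / c0 * (s ^+ 2 * c ^+ 2).
  have : 2 * (C * `|b * c|) <= c0 / 4 * b ^+ 2 + 4 * C ^+ 2 / c0 * c ^+ 2.
    rewrite normrM -(real_normK (num_real b)) -(real_normK (num_real c)).
    move: (`|b|) (`|c|) => B D; rewrite -subr_ge0.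
    have -> : c0 / 4 * B ^+ 2 + 4 * C ^+ 2 / c0 * D ^+ 2 - 2 * (C * (B * D)) =
        c0 * (B / 2 - 2 * C / c0 * D) ^+ 2 by field; rewrite gt_eqF.
    by rewrite mulr_ge0 ?sqr_ge0// ltW.
  move=> /(ler_wpM2l (ltW s20)); lra.
have k5 : 4 * C ^+ 2 / c0 * (s ^+ 2 * c ^+ 2) <= 4 * C ^+ 2 * T / c0 * (s * I1).
  have h1 : s ^+ 2 * c ^+ 2 <= T * (s * I1).
    by apply: le_trans sc; rewrite ler_wpM2r ?sqr_ge0.
  have h2 : 0 <= 4 * C ^+ 2 / c0 by rewrite divr_ge0 ?mulr_ge0 ?sqr_ge0// ltW.
  by have := ler_wpM2l h2 h1; lra.
have k6 : - (s ^+ 2 * `|w1 - w2|) <= s ^+ 2 * (w1 - w2).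
  by rewrite -mulrN ler_wpM2l ?(ltW s20)// lerNl -normrN ler_norm.
have p1 : 0 <= s * I0 by rewrite mulr_ge0// ltW.
have p2 : 0 <= s * I1 by rewrite mulr_ge0// ltW.
have p3 : 0 <= s ^+ 2 * I2 by rewrite mulr_ge0// ltW.
have q1 : s ^+ 2 * I0 <= s * I0 by rewrite ler_wpM2r.
have q2 : s ^+ 2 * I1 <= s * I1 by rewrite ler_wpM2r.
have r1 := ler_wpM2l K0 q1; have r2 := ler_wpM2l C0 q2.
have u1 := mulr_ge0 K0 p1; have u2 := mulr_ge0 K0 p2; have u3 := mulr_ge0 K0 p3.
have v1 := mulr_ge0 C0 p1; have v2 := mulr_ge0 C0 p2; have v3 := mulr_ge0 C0 p3.
have D0 : 0 <= 4 * C ^+ 2 * T / c0.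
  by rewrite divr_ge0 ?mulr_ge0 ?sqr_ge0// ltW.
have w1' := mulr_ge0 D0 p1; have w3' := mulr_ge0 D0 p3.
rewrite /AA; move: (4 * C ^+ 2 * T / c0) D0 w1' w3' k5 => D _ w1' w3' k5.
lra.
Qed.

Lemma intg_II f : lf1 f -> intg 0 T (fun t => II 0 1 (fun s => f s t)).
Proof. by move=> h; have [_ _ ? _] := fubini h. Qed.

Lemma e0_le : aeI 0 T (fun t0 => e0 t0 <= T * II 0 t0 e1).
Proof.
apply: aeI_imp3 (linf1_intg e0_linf1) ae_reps_st (f_G F) => t0 _ i0 r0 Gt0.
have [t00 t0T] := f_GT F Gt0.
have [_ j1 _ j2] := fub t00 t0T e1_linf1.
have h := II_le i0 (intgZ T j1) (aeI_imp (fun s _ (H : _ /\ _) => proj2 H) (energy_pointwise Gt0 r0)).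
apply: (le_trans h); rewrite (IIZ T j1); apply: ler_wpM2l; first exact: ltW (f_T F).
by rewrite j2 lexx.
Qed.

Definition EE t := e1 t + e2 t.

Lemma e_ge0 : aeI 0 T (fun t => [/\ 0 <= e0 t, 0 <= e1 t & 0 <= e2 t]).
Proof.
apply: aeI_imp3 (linf1_intg e0_linf1) (linf1_intg e1_linf1) (linf1_intg e2_linf1).
move=> t _ i0 i1 i2; split.
- by apply: (ge0_e i0) => s s0; rewrite mulr_ge0 ?sqr_ge0// ltW.
- by apply: (ge0_e i1) => s s0; rewrite mulr_ge0 ?sqr_ge0// ltW.
- by apply: (ge0_e i2) => s s0; rewrite mulr_ge0 ?sqr_ge0.
Qed.

(** [energy_pointwise] integrated in s bounds the energy at t0 by the double integral of Z1 + Z2 + 2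
    Z3 and lower-order terms. By [energy_space] that double integral is minus the one of [rem],
    which [rem_bound] controls. *)
Lemma EE_le : exists2 B, 0 <= B & aeI 0 T (fun t => EE t <= B * II 0 t EE).
Proof.
have [A A0 hA] := rem_bound.
have T0 := ltW (f_T F); have c00 := f_c0 F; have AA0 := AA_ge0.
have alg (X a b r y z : R) : - (A * X) <= r ->
    1 / 2 * a + c0 / 4 * b <= - z - 2 * y - r + z + 2 * y + AA * X ->
    a / 2 + c0 / 4 * b <= (A + AA) * X by lra.
exists ((2 + 4 / c0) * ((A + AA) * (T ^+ 2 + 1))).
  have c40 : 0 <= 4 / c0 by rewrite divr_ge0// ltW.
  exact: mulr_ge0 (addr_ge0 (ler0n _ 2) c40) (mulr_ge0 (addr_ge0 A0 AA0) (addr_ge0 (exprn_ge0 2 T0) ler01)).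
have I0 := intg_II e0_linf1; have I1 := intg_II e1_linf1; have I2 := intg_II e2_linf1.
rewrite -/e0 -/e1 -/e2 in I0 I1 I2.
apply: aeI_imp3 (aeI_and (linf1_intg e1_linf1) (linf1_intg e2_linf1)) ae_reps_st (f_G F).
move=> t0 _ [i1 i2] r0 Gt0; have [t00 t0T] := f_GT F Gt0.
have sub P : aeI 0 T P -> aeI 0 t0 P by exact: aeI_sub (lexx 0) (ltW t0T).
have isub f : intg 0 T f -> intg 0 t0 f by exact: intg_sub (lexx 0) (ltW t0T).
have p1 : 0 <= e1 t0 := ge0_e i1 (fun s s0 => mulr_ge0 (ltW s0) (sqr_ge0 (ht s t0))).
have p2 : 0 <= e2 t0 := ge0_e i2 (fun s s0 => mulr_ge0 (sqr_ge0 s) (sqr_ge0 (hs s t0))).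
have [_ y0 _ x0'] := fub t00 t0T e0_linf1.
have [_ y1 _ x1'] := fub t00 t0T e1_linf1.
have [_ y2 _ x2'] := fub t00 t0T e2_linf1.
have [_ a1 b1 d1] := fub t00 t0T Z1_linf1.
have [_ a2 b2 d2] := fub t00 t0T Z2_linf1.
have [_ a3 b3 d3] := fub t00 t0T Z3_linf1.
have [_ _ br _] := fub t00 t0T rem_linf1.
set E0 := II 0 t0 e0; set E1 := II 0 t0 e1; set E2 := II 0 t0 e2.
have j0 := isub _ I0; have j1 := isub _ I1; have j2 := isub _ I2.
have hE1 : 0 <= E1.
  by apply: II_ge0; [exact: intg_mes|apply: sub; apply: aeI_imp e_ge0 => t _ []].
have hE2 : 0 <= E2.
  by apply: II_ge0; [exact: intg_mes|apply: sub; apply: aeI_imp e_ge0 => t _ []].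
have hE0 : E0 <= T ^+ 2 * E1.
  have h : aeI 0 t0 (fun t => e0 t <= T * E1).
    apply: aeI_imp (sub _ e0_le) => t; rewrite in_itv/= => /andP[tp tt0] h.
    apply: (le_trans h); apply: (ler_wpM2l T0); apply: (II_mono (lexx 0) (ltW tp) (ltW tt0) j1).
    by apply: sub; apply: aeI_imp e_ge0 => z _ [].
  apply: (le_trans (II_le j0 (intg_cst 0 t0 (T * E1)) h)).
  rewrite (II_cst _ (ltW t00)) subr0 expr2 mulrAC.
  by apply: (ler_wpM2r hE1); apply: (ler_wpM2l T0); exact: ltW.
have main : e1 t0 / 2 + c0 / 4 * e2 t0 <= (A + AA) * (E0 + E1 + E2).
  have w1 := intgD a1 a2; have w2 : intg 0 1 (fun s => 2 * II 0 t0 (Z3 s)) by exact: intgZ.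
  have w3 := intgD w1 w2; have w4 := intgD y0 y1; have w5 := intgD w4 y2.
  have w6 := intgZ AA w5; have w7 := intgD w3 w6.
  have k1 : intg 0 1 (fun s => 1 / 2 * (s * ht s t0 ^+ 2)) by exact: intgZ.
  have k2 : intg 0 1 (fun s => c0 / 4 * (s ^+ 2 * hs s t0 ^+ 2)) by exact: intgZ.
  have k3 := intgD k1 k2.
  have hle : aeI 0 1 (fun s => 1 / 2 * (s * ht s t0 ^+ 2) + c0 / 4 * (s ^+ 2 * hs s t0 ^+ 2) <=
     II 0 t0 (Z1 s) + II 0 t0 (Z2 s) + 2 * II 0 t0 (Z3 s) +
     AA * (II 0 t0 (fun t => s * hh s t ^+ 2) + II 0 t0 (fun t => s * ht s t ^+ 2) +
         II 0 t0 (fun t => s ^+ 2 * hs s t ^+ 2))).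
    have half (y : R) : 1 / 2 * y = y / 2 by field.
    by apply: aeI_imp (energy_pointwise Gt0 r0) => s _ [h _]; rewrite half; exact: h.
  have H := II_le k3 w7 hle.
  rewrite (IID k1 k2) (IIZ _ i1) (IIZ _ i2) (IID w3 w6) (IID w1 w2) (IID a1 a2) (IIZ _ a3) in H.
  rewrite (IIZ _ w5) (IID w4 y2) (IID y0 y1) x0' x1' x2' d1 d2 d3 in H.
  (* The spatial identity, integrated over []0, t0[], removes all second derivatives at once. *)
  have hZ : II 0 t0 (fun t => II 0 1 (fun s => Z1 s t)) =
      - II 0 t0 (fun t => II 0 1 (fun s => Z2 s t)) - 2 * II 0 t0 (fun t => II 0 1 (fun s => Z3 s t))
      - II 0 t0 (fun t => II 0 1 (fun s => rem s t)).
    have g1 := intgN b2; have g2 := intgZ 2 b3; have g3 := intgB g1 g2.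
    rewrite -(IIN b2) -(IIZ _ b3) -(IIB g1 g2) -(IIB g3 br).
    exact: II_ae (intg_mes b1) (intg_mes (intgB g3 br)) (sub _ energy_space).
  have rb : `|II 0 t0 (fun t => II 0 1 (fun s => rem s t))| <= A * (E0 + E1 + E2).
    have m1 := intgD j0 j1; have m2 := intgD m1 j2.
    rewrite /E0 /E1 /E2 -(IID j0 j1) -(IID m1 j2) -(IIZ _ m2).
    exact: II_abs_le (intg_mes br) (intgZ A m2) (sub _ hA).
  rewrite hZ -/(e1 t0) -/(e2 t0) -/e0 -/e1 -/e2 -/E0 -/E1 -/E2 in H.
  move: rb H; rewrite ler_norml => /andP[+ _].
  exact: alg.
have -> : II 0 t0 EE = E1 + E2 by exact: IID j1 j2.
rewrite /EE; exact: energy_closure c00 A0 AA0 hE0 hE2 p1 p2 main.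
Qed.

(** Gronwall applies to e1 + e2; then [e0] vanishes because it is bounded by the time integral of
    [e1]. *)
Lemma hh_eq0 : aeI 0 T (fun t => aeI 0 1 (fun s => hh s t = 0)).
Proof.
have [B B0 hB] := EE_le.
have iE : intg 0 T EE by apply: intgD; [exact: intg_II e1_linf1|exact: intg_II e2_linf1].
have E0 : aeI 0 T (fun t => 0 <= EE t).
  by apply: aeI_imp e_ge0 => t _ [_ h1 h2]; rewrite addr_ge0.
have EZ := gronwall (f_T F) B0 iE E0 hB.
have e1Z : aeI 0 T (fun t => e1 t = 0).
  apply: aeI_imp2 e_ge0 EZ => t _ [_ h1 h2]; rewrite /EE => h.
  by apply/eqP; rewrite eq_le h1 andbT -h lerDl.
apply: aeI_imp3 (linf1_intg e0_linf1) e0_le e_ge0 => t; rewrite in_itv/= => /andP[t0 tT] i0 h [e00 _ _].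
have e1Z' : II 0 t e1 = 0.
  rewrite -[RHS](II_0 0 t); apply: II_ae.
  - by apply: mesI_sub (intg_mes (intg_II e1_linf1)) => //; exact: ltW.
  - exact: mesI_cst.
  - by apply: aeI_sub e1Z => //; exact: ltW.
rewrite e1Z' mulr0 in h.
have h0 : aeI 0 1 (fun s => 0 <= s * hh s t ^+ 2).
  apply: aeI_all => s; rewrite in_itv/= => /andP[s0 _]; exact: mulr_ge0 (ltW s0) (sqr_ge0 _).
apply: aeI_imp (II_eq0_ae i0 h0 h) => s; rewrite in_itv/= => /andP[s0 _] /eqP.
by rewrite mulf_eq0 gt_eqF//= sqrf_eq0 => /eqP.
Qed.

End Facts.

(** Cauchy-Schwarz in t and then Fubini: a primitive in time of a function in L^oo(L^2) is Lipschitz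
    in time with values in L^2. *)
Lemma incr_L2 (R : realType) (T : R) (b : R -> R -> R) : linf2 T b ->
  exists2 M, 0 <= M & forall t1 t2, 0 <= t1 -> t1 <= t2 -> t2 <= T ->
    [/\ intg 0 1 (fun s => II t1 t2 (b s)), intg 0 1 (fun s => II t1 t2 (b s) ^+ 2) &
    II 0 1 (fun s => II t1 t2 (b s) ^+ 2) <= M * (t2 - t1) ^+ 2].
Proof.
move=> hb; have mb := hb.1; have [_ [M hM]] := hb.
exists `|M| => // t1 t2 t10 t12 t2T.
have lb := linf1_restr t10 t2T (linf2_linf1 hb).
have lb2 := linf1_restr t10 t2T (linf2M hb hb).
have [_ i1 _ _] := fubini lb; have [i2 i3 i4 e] := fubini lb2.
have h : aeI 0 1 (fun s => II t1 t2 (b s) ^+ 2 <= (t2 - t1) * II t1 t2 (fun t => b s t * b s t)).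
  apply: aeI_imp i2 => s ss i.
  have mbs : mesI t1 t2 (b s).
    exact: mesI_sub (mes2_sect_s mb ss).
  have := @II_CS _ t1 t2 (fun=> 1) (b s) (@mesI_cst _ _ _ _) mbs.
  have -> : II t1 t2 (fun x => 1 * b s x) = II t1 t2 (b s) by apply: II_eq => x _; rewrite mul1r.
  have -> : II t1 t2 (fun=> 1 ^+ 2) = t2 - t1 by rewrite (II_cst _ t12) expr1n mul1r.
  have -> : (fun x => b s x ^+ 2) = (fun x => b s x * b s x) by apply/funext => x; rewrite expr2.
  by move/(_ _ i); apply; exact: intg_cst.
have i5 : intg 0 1 (fun s => II t1 t2 (b s) ^+ 2).
  apply: (intg_le _ _ (intgZ (t2 - t1) i3)); first exact: (mesIX 2 (intg_mes i1)).
  by apply: aeI_imp h => s _ h; rewrite ger0_norm ?sqr_ge0.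
split => //; apply: (le_trans (II_le i5 (intgZ (t2 - t1) i3) h)).
rewrite (IIZ _ i3) e expr2 mulrCA; apply: ler_wpM2l; first by rewrite subr_ge0.
rewrite -(II_cst _ t12); apply: (II_le i4 (intg_cst _ _ _)).
have : aeI t1 t2 (fun t => II 0 1 (fun s => b s t ^+ 2) <= M).
  by apply: aeI_sub t10 t2T _; apply: aeI_imp hM => t _ [].
apply: aeI_imp => t _ hh; apply: le_trans (le_trans hh (ler_norm _)).
by rewrite le_eqVlt; apply/orP; left; apply/eqP/II_eq => s _; rewrite expr2.
Qed.

(** * Lipschitz dependence of the tension on time *)

Section Tension.
Context {R : realType}.

(** Multiplying by d and integrating gives D + int P d^2 = d(1) d1(1) - int d Fo, where D is the
    integral of d1^2. As P >= 0 and |d| is at most the square root of D, that root is at most [B].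
    The equation then bounds d2 in L^1, hence d1, hence d/s. *)
Lemma tension_energy (d d1 d2 P Fo : R -> R) : ac 0 1 d d1 -> ac 0 1 d1 d2 -> d 0 = 0 ->
  intg 0 1 P -> intg 0 1 Fo -> (forall s, 0 <= P s) ->
  aeI 0 1 (fun s => d2 s = P s * d s + Fo s) ->
  let B := `|d1 1| + II 0 1 (fun s => `|Fo s|) in
  let K := B * (1 + II 0 1 P) in
  (forall s, 0 <= s -> s <= 1 -> `|d1 s| <= K) /\
  (forall s, 0 <= s -> s <= 1 -> `|d s| <= K * s).
Proof.
move=> hd hd1 d0 iP iF P0 e B K.
have i01 : (0 : R) <= 1 := ler01.
have iaF := intg_abs iF.
have F0 : 0 <= II 0 1 (fun s => `|Fo s|) by apply: II_ge0; [exact: intg_mes|exact: aeI_all].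
have B0 : 0 <= B by rewrite addr_ge0.
have md := ac_mes hd; have md1 := ac_mes hd1.
have i11 : intg 0 1 (fun s => d1 s ^+ 2).
  by have := ac_intg (ac_mul hd1 hd1); congr intg; apply/funext => s; rewrite expr2.
set D := II 0 1 (fun s => d1 s ^+ 2).
have D0 : 0 <= D by apply: II_ge0; [exact: intg_mes i11|apply: aeI_all => s _; exact: sqr_ge0].
have sup s : 0 <= s -> s <= 1 -> d s ^+ 2 <= D.
  move=> s0 s1; have := hd.2 s s0 s1; rewrite d0 add0r => ->.
  have is1 : intg 0 s (fun x => d1 x ^+ 2) by apply: intg_sub i11.
  have ms1 : mesI 0 s d1 by apply: mesI_sub md1.
  have CS := II_CS (@mesI_cst _ 0 s 1) ms1 (intg_cst _ _ _) is1.
  have e1 : II 0 s (fun x => 1 * d1 x) = II 0 s d1 by apply: II_eq => x _; rewrite mul1r.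
  rewrite e1 (II_cst _ s0) subr0 expr1n mul1r in CS.
  apply: (le_trans CS); have h : II 0 s (fun x => d1 x ^+ 2) <= D.
    by apply: II_mono => //; apply: aeI_all => x _; exact: sqr_ge0.
  have h0 : 0 <= II 0 s (fun x => d1 x ^+ 2).
    by apply: II_ge0; [exact: intg_mes is1|apply: aeI_all => x _; exact: sqr_ge0].
  by apply: le_trans h; rewrite ler_piMl.
pose S := Num.sqrt D.
have S0 : 0 <= S := sqrtr_ge0 D.
have SD : S ^+ 2 = D by rewrite sqr_sqrtr.
have supS s : 0 <= s -> s <= 1 -> `|d s| <= S.
  by move=> s0 s1; rewrite -sqrtr_sqr ler_wsqrtr// sup.
have bd : aeI 0 1 (fun s => `|d s| <= S).
  by apply: aeI_all => s; rewrite in_itv/= => /andP[s0 s1]; apply: supS; exact: ltW.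
have iFd : intg 0 1 (fun s => d s * Fo s) := intgM_bnd iF md bd.
have iPd : intg 0 1 (fun s => d s * P s) := intgM_bnd iP md bd.
have iPdd : intg 0 1 (fun s => d s * (d s * P s)) := intgM_bnd iPd md bd.
have SB : D <= S * B.
  have E := ac_inc (ac_mul hd hd1) (lexx 0) i01 (lexx 1).
  have e2 : II 0 1 (fun x => d1 x * d1 x + d x * d2 x) =
      D + (II 0 1 (fun x => d x * (d x * P x)) + II 0 1 (fun x => d x * Fo x)).
    rewrite /D -(IID iPdd iFd) -IID//; last exact: intgD.
    apply: II_ae; first exact: intg_mes (ac_mul hd hd1).1.
      by apply: intg_mes; apply: intgD => //; exact: intgD.
    by apply: aeI_imp e => s _ ->; ring.
  rewrite d0 mul0r subr0 e2 in E.
  have h1 : 0 <= II 0 1 (fun x => d x * (d x * P x)).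
    apply: II_ge0; [exact: intg_mes iPdd|apply: aeI_all => x _].
    by rewrite mulrA -expr2 mulr_ge0 ?sqr_ge0.
  have h2 : `|II 0 1 (fun x => d x * Fo x)| <= S * II 0 1 (fun s => `|Fo s|).
    rewrite -IIZ//; apply: II_abs_le; [exact: intg_mes iFd|exact: intgZ|].
    by apply: aeI_imp bd => s _ h; rewrite normrM ler_wpM2r.
  have h3 : d 1 * d1 1 <= S * `|d1 1|.
    by apply: (le_trans (ler_norm _)); rewrite normrM ler_wpM2r// supS.
  by move: h2; rewrite ler_norml => /andP[h2 _]; rewrite /B; lra.
have SleB : S <= B.
  have [S00|Sn] := eqVneq S 0; first by rewrite S00.
  have Sp : 0 < S by rewrite lt_neqAle eq_sym Sn S0.
  by move: SB; rewrite -SD expr2 ler_pM2l.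
have P1 : 0 <= II 0 1 P by apply: II_ge0; [exact: intg_mes|exact: aeI_all].
have id2 : II 0 1 (fun x => `|d2 x|) <= S * II 0 1 P + II 0 1 (fun s => `|Fo s|).
  have i2 : intg 0 1 (fun x => S * P x + `|Fo x|) by apply: intgD => //; exact: intgZ.
  apply: (@le_trans _ _ (II 0 1 (fun x => S * P x + `|Fo x|))); last first.
    by rewrite IID// ?IIZ//; exact: intgZ.
  apply: II_le => //; first exact: intg_abs hd1.1.
  apply: aeI_imp2 e bd => s _ -> h; apply: (le_trans (ler_normD _ _)).
  by rewrite lerD2r normrM mulrC (ger0_norm (P0 s)) ler_wpM2r.
have hd1K s : 0 <= s -> s <= 1 -> `|d1 s| <= K.
  move=> s0 s1.
  have E := ac_inc hd1 s0 s1 (lexx 1).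
  have -> : d1 s = d1 1 - II s 1 d2 by rewrite -E; ring.
  apply: (le_trans (ler_normB _ _)).
  have h1 : `|II s 1 d2| <= II 0 1 (fun x => `|d2 x|) by apply: II_abs2 => //; exact: hd1.1.
  have h2 : S * II 0 1 P <= B * II 0 1 P by rewrite ler_wpM2r.
  have -> : K = B + B * II 0 1 P by rewrite /K mulrDr mulr1.
  by rewrite {1}/B; lra.
split => // s s0 s1.
have E := hd.2 s s0 s1; rewrite d0 add0r in E; rewrite E.
have := @II_bnd _ 0 s d1 K s0 _ _; rewrite subr0; apply; first by apply: mesI_sub md1.
apply: aeI_all => x; rewrite in_itv/= => /andP[x0 xs].
by apply: hd1K; [exact: ltW|exact: le_trans (ltW xs) s1].
Qed.

End Tension.

Section Lipschitz.
Context {R : realType}.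
Variables (T c0 C : R) (g : 'I_3 -> R) (u v p q k : 'I_3 -> R -> R -> R).
Variables (ta ta1 ta2 : R -> R -> R) (x0 x1 p0 : 'I_3 -> R -> R) (G : set R).

Local Notation fcts := (facts T c0 C g u v p q k ta ta1 ta2 x0 x1 p0).

Lemma facts_sub (G' : set R) : (forall t, G' t -> G t) -> aeI 0 T G' ->
  fcts G -> fcts G'.
Proof. by move=> sub aG [*]; constructor => // t /sub; auto. Qed.

Hypothesis F : fcts G.

(** Times of G at which the time representations and the L^2 bounds also hold with one constant, so
    that any two of them can be compared. *)
Definition good (N t : R) : Prop := [/\ G t,
  aeI 0 1 (fun s => reps u v p q k x0 x1 p0 s t) &
  forall i, [/\ intg 0 1 (fun s => p i s t ^+ 2), II 0 1 (fun s => p i s t ^+ 2) <= N,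
    intg 0 1 (fun s => v i s t ^+ 2) & II 0 1 (fun s => v i s t ^+ 2) <= N]].

Lemma good_ae : exists2 N, 0 <= N & aeI 0 T (good N).
Proof.
have hp i : exists M, aeI 0 T (fun t =>
    intg 0 1 (fun s => p i s t ^+ 2) /\ II 0 1 (fun s => p i s t ^+ 2) <= M).
  by have [_] := f_p2 F i.
have hv i : exists M, aeI 0 T (fun t =>
    intg 0 1 (fun s => v i s t ^+ 2) /\ II 0 1 (fun s => v i s t ^+ 2) <= M).
  by have [_] := v_linf2 F i.
have [M hM] := choice hp; have [M' hM'] := choice hv.
pose N := \sum_i (`|M i| + `|M' i|).
have le_ i : `|M i| + `|M' i| <= N.
  by rewrite /N (bigD1 i)//= lerDl; apply: sumr_ge0 => j _; exact: addr_ge0.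
exists N; first by apply: sumr_ge0 => j _; exact: addr_ge0.
have h : aeI 0 T (fun t => forall i, [/\ intg 0 1 (fun s => p i s t ^+ 2), II 0 1 (fun s => p i s t ^+ 2) <= N,
    intg 0 1 (fun s => v i s t ^+ 2) & II 0 1 (fun s => v i s t ^+ 2) <= N]).
  apply: aeI_count => i; apply: aeI_imp2 (hM i) (hM' i) => t _ [i1 l1] [i2 l2]; split => //.
    apply: (le_trans l1); apply: le_trans (le_ i); apply: (le_trans (ler_norm _)).
    by rewrite lerDl.
  apply: (le_trans l2); apply: le_trans (le_ i); apply: (le_trans (ler_norm _)).
  by rewrite lerDr.
by apply: aeI_imp3 (f_G F) (ae_reps_st F) h => t _.
Qed.

(** The increment of p carries the weight s because its t-derivative q is controlled in L^2 only
    after multiplication by s. *)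
Lemma incr_bound : exists2 M, 0 <= M & forall N t1 t2, good N t1 -> good N t2 -> t1 <= t2 -> forall i,
  [/\ intg 0 1 (fun s => (s * (p i s t2 - p i s t1)) ^+ 2) /\
       II 0 1 (fun s => (s * (p i s t2 - p i s t1)) ^+ 2) <= M * (t2 - t1) ^+ 2,
     intg 0 1 (fun s => (v i s t2 - v i s t1) ^+ 2) /\
       II 0 1 (fun s => (v i s t2 - v i s t1) ^+ 2) <= M * (t2 - t1) ^+ 2 &
     intg 0 1 (fun s => (u i s t2 - u i s t1) ^+ 2) /\
       II 0 1 (fun s => (u i s t2 - u i s t1) ^+ 2) <= M * (t2 - t1) ^+ 2].
Proof.
pose X (b : R -> R -> R) M := 0 <= M /\ forall t1 t2, 0 <= t1 -> t1 <= t2 -> t2 <= T ->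
    [/\ intg 0 1 (fun s => II t1 t2 (b s)), intg 0 1 (fun s => II t1 t2 (b s) ^+ 2) &
    II 0 1 (fun s => II t1 t2 (b s) ^+ 2) <= M * (t2 - t1) ^+ 2].
have XM b M M' : X b M -> M <= M' -> X b M'.
  move=> [M0 h] MM; split; first exact: le_trans MM.
  move=> t1 t2 h1 h2 h3; have [j i l] := h t1 t2 h1 h2 h3; split => //.
  by apply: (le_trans l); rewrite ler_wpM2r ?sqr_ge0.
have X1 b : linf2 T b -> exists M, X b M by move=> /incr_L2[M M0 h]; exists M.
have [Mq hq] := choice (fun i => X1 _ (f_q2 F i)).
have [Mk hk] := choice (fun i => X1 _ (f_k2 F i)).
have [Mv hv] := choice (fun i => X1 _ (v_linf2 F i)).
pose M := \sum_i (Mq i + Mk i + Mv i).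
have pos i : 0 <= Mq i + Mk i + Mv i.
  by rewrite addr_ge0 ?(hv i).1// addr_ge0 ?(hq i).1 ?(hk i).1.
have le_ i : Mq i + Mk i + Mv i <= M.
  by rewrite /M (bigD1 i)//= lerDl; apply: sumr_ge0 => j _.
exists M; first exact: sumr_ge0.
move=> N t1 t2 [G1 r1 _] [G2 r2 _] t12 i.
have [t10 _] := f_GT F G1; have [t20 t2T] := f_GT F G2.
have q0 := (hq i).1; have k0 := (hk i).1; have v0 := (hv i).1; have le_i := le_ i.
have hq' : X (fun s t => s * q i s t) M by apply: XM (hq i) _; lra.
have hk' : X (k i) M by apply: XM (hk i) _; lra.
have hv' : X (v i) M by apply: XM (hv i) _; lra.
have dII f : intg 0 T f -> II 0 t2 f - II 0 t1 f = II t1 t2 f.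
  move=> h; rewrite (II_split (ltW t10) t12); first ring.
  by apply: intg_sub h => //; exact: ltW.
have tr (a : R -> R) b : mesI 0 1 a -> X b M -> aeI 0 1 (fun s => a s = II t1 t2 (b s)) ->
    intg 0 1 (fun s => a s ^+ 2) /\ II 0 1 (fun s => a s ^+ 2) <= M * (t2 - t1) ^+ 2.
  move=> ma [_ /(_ t1 t2 (ltW t10) t12 (ltW t2T))[_ ib lb]] e.
  have e2 : aeI 0 1 (fun s => a s ^+ 2 = II t1 t2 (b s) ^+ 2) by apply: aeI_imp e => s _ ->.
  have ma2 := mesIX 2 ma; split; first exact: intg_ae e2 ib.
  by rewrite (II_ae ma2 (intg_mes ib) e2).
have mB (f : R -> R -> R) : mes2 0 1 0 T f -> mesI 0 1 (fun s => f s t2 - f s t1).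
  move=> mf; apply: mesIB; apply: (mes2_sect_t mf); rewrite in_itv/=.
    by rewrite t20.
  by rewrite t10 (le_lt_trans t12).
have mp : mes2 0 1 0 T (p i) by have [] := f_p2 F i.
split.
- apply: (tr _ _ _ hq'); first by apply: mesIM; [exact: mesI_id|exact: mB].
  apply: aeI_imp3 r1 r2 (ae_intg_t F) => s _ /(_ i)[_ _ ->] /(_ i)[_ _ ->] /(_ i)[_ _ iq].
  rewrite -(dII _ (intgZ s iq)) !IIZ; [ring| |].
    by apply: intg_sub iq => //; apply: ltW; exact: le_lt_trans t12 t2T.
  by apply: intg_sub iq => //; exact: ltW.
- apply: (tr _ _ _ hk'); first exact: mB (f_mv F i).
  apply: aeI_imp3 r1 r2 (ae_intg_t F) => s _ /(_ i)[_ -> _] /(_ i)[_ -> _] /(_ i)[_ ik _].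
  by rewrite -(dII _ ik); ring.
- apply: (tr _ _ _ hv'); first exact: mB (f_mu F i).
  apply: aeI_imp3 r1 r2 (ae_intg_t F) => s _ /(_ i)[-> _ _] /(_ i)[-> _ _] /(_ i)[iv _ _].
  by rewrite -(dII _ iv); ring.
Qed.

(** Young's inequality. With l = t2 - t1, [a] an increment of order l in L^2 and [b] a bounded sum,
    both summands integrate to order l. *)
Lemma weighted_diff (a b l : R) : 0 < l ->
  `|a * b| <= 1 / 2 * (l^-1 * a ^+ 2 + l * b ^+ 2).
Proof.
move=> l0; have li : 0 < l^-1 by rewrite invr_gt0.
have h1 : 0 <= l^-1 * (a - l * b) ^+ 2 by rewrite mulr_ge0 ?sqr_ge0// ltW.
have h2 : 0 <= l^-1 * (a + l * b) ^+ 2 by rewrite mulr_ge0 ?sqr_ge0// ltW.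
have e1 : l^-1 * (a - l * b) ^+ 2 = l^-1 * a ^+ 2 - 2 * (a * b) + l * b ^+ 2.
  by field; rewrite gt_eqF.
have e2 : l^-1 * (a + l * b) ^+ 2 = l^-1 * a ^+ 2 + 2 * (a * b) + l * b ^+ 2.
  by field; rewrite gt_eqF.
by rewrite ler_norml; lra.
Qed.

(** Only [[1/2, 1]] is used, where the weight s is harmless: there [ac_sup] gives d(1)^2 <= 12 M
    l^2, and 12 M is at most (12 M + 1)^2. *)
Lemma bdry_incr M l (d d' : R -> R) : 0 <= M -> 0 < l -> acr d d' ->
  intg 0 1 (fun s => (s * d' s) ^+ 2) -> II 0 1 (fun s => (s * d' s) ^+ 2) <= M * l ^+ 2 ->
  intg 0 1 (fun s => d s ^+ 2) -> II 0 1 (fun s => d s ^+ 2) <= M * l ^+ 2 ->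
  `|d 1| <= (12 * M + 1) * l.
Proof.
move=> M0 l0 hd i1 l1 i2 l2.
have h0 : (0 : R) < 1 / 2 by lra.
have h1 : (1 / 2 : R) < 1 by lra.
have hh := hd _ h0 (ltW h1).
have i2' : intg (1 / 2) 1 (fun s => d s ^+ 2) by apply: intg_sub i2 => //; exact: ltW.
have i1' : intg (1 / 2) 1 (fun s => (s * d' s) ^+ 2) by apply: intg_sub i1 => //; exact: ltW.
have := ac_sup h1 hh (ltW h1) (lexx 1) i2' (lexx _) h1.
have b2 : II (1 / 2) 1 (fun s => d s ^+ 2) <= M * l ^+ 2.
  apply: le_trans l2; apply: (II_mono (ltW h0) (ltW h1) (lexx _) i2).
  by apply: aeI_all => s _; exact: sqr_ge0.
have b1 : II (1 / 2) 1 (fun s => `|d' s|) ^+ 2 <= 4 * (M * l ^+ 2).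
  have md := mesI_abs (intg_mes hh.1).
  have le4 : aeI (1 / 2) 1 (fun s => `| `|d' s| ^+ 2| <= 4 * (s * d' s) ^+ 2).
    apply: aeI_all => s; rewrite in_itv/= => /andP[s0 s1].
    rewrite real_normK ?num_real// ger0_norm ?sqr_ge0// exprMn mulrA.
    by rewrite ler_peMl ?sqr_ge0//; nra.
  have id : intg (1 / 2) 1 (fun s => `|d' s| ^+ 2) := intg_le (mesIX 2 md) le4 (intgZ 4 i1').
  have CS := II_CS (@mesI_cst _ (1 / 2) 1 1) md (intg_cst _ _ _) id.
  have e1 : II (1 / 2) 1 (fun x => 1 * `|d' x|) = II (1 / 2) 1 (fun x => `|d' x|).
    by apply: II_eq => x _; rewrite mul1r.
  rewrite e1 (II_cst _ (ltW h1)) expr1n [1 * (1 - _)]mul1r in CS; apply: (le_trans CS).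
  have p1 : 0 <= II (1 / 2) 1 (fun x => `|d' x| ^+ 2).
    by apply: II_ge0; [exact: intg_mes id|apply: aeI_all => s _; exact: sqr_ge0].
  apply: (@le_trans _ _ (II (1 / 2) 1 (fun x => `|d' x| ^+ 2))); first by rewrite ler_piMl//; lra.
  apply: (@le_trans _ _ (II (1 / 2) 1 (fun s => 4 * (s * d' s) ^+ 2))).
    apply: (II_le id (intgZ 4 i1')); apply: aeI_imp le4 => s _; apply: le_trans; exact: ler_norm.
  rewrite (IIZ _ i1') ler_wpM2l//; apply: le_trans l1.
  apply: (II_mono (ltW h0) (ltW h1) (lexx _) i1).
  by apply: aeI_all => s _; exact: sqr_ge0.
move=> H.
have {}H : d 1 ^+ 2 <= 12 * M * l ^+ 2 by lra.
rewrite -(@ler_pXn2r _ 2) ?nnegrE//; last by rewrite mulr_ge0 ?(ltW l0)// addr_ge0// mulr_ge0.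
rewrite real_normK ?num_real// exprMn; apply: (le_trans H); rewrite ler_wpM2r ?sqr_ge0//.
by nra.
Qed.

(** The difference of the tension equations at t1 and t2 has the form required by [tension_energy],
    with P = |p|^2 at t1. In the forcing the factor tau <= C s supplies the weight that the
    increment of p needs, so it is of order t2 - t1 in L^1; the boundary datum is handled by
    [bdry_incr]. *)
Lemma lip_tension N : 0 <= N -> exists2 K, 0 <= K & forall t1 t2, good N t1 -> good N t2 -> t1 < t2 ->
  (forall s, 0 <= s -> s <= 1 -> `|ta1 s t2 - ta1 s t1| <= K * (t2 - t1)) /\
  (forall s, 0 <= s -> s <= 1 -> `|ta s t2 - ta s t1| <= K * (t2 - t1) * s).
Proof.
move=> N0; have [M M0 hM] := incr_bound; have C0 := f_C F.
(* The first summand bounds the increment of tau' at s = 1, the second the L^1 norm of the forcing,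
   both divided by t2 - t1. *)
pose K1 := (\sum_i `|g i|) * (12 * M + 1) + 3 * ((C + 1) / 2 * (M + 4 * N)).
have g0 : 0 <= \sum_i `|g i| by apply: sumr_ge0.
have K10 : 0 <= K1.
  by rewrite addr_ge0 ?mulr_ge0 ?addr_ge0 ?mulr_ge0 ?divr_ge0 ?addr_ge0.
exists (K1 * (1 + 3 * N)); first by rewrite mulr_ge0// addr_ge0// mulr_ge0.
move=> t1 t2 g1 g2 t12; have hi := hM N t1 t2 g1 g2 (ltW t12).
have [G1 r1 h1] := g1; have [G2 r2 h2] := g2.
have [t10 t1T] := f_GT F G1; have [t20 t2T] := f_GT F G2.
set l := t2 - t1 in hi *; have l0 : 0 < l by rewrite subr_gt0.
have ti : t1 \in `]0, T[ by rewrite in_itv/= t10 t1T.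
have tj : t2 \in `]0, T[ by rewrite in_itv/= t20 t2T.
have mp i t : t \in `]0, T[ -> mesI 0 1 (fun s => p i s t).
  by move=> tt; have [m _] := f_p2 F i; exact: (mes2_sect_t m tt).
have mv i t : t \in `]0, T[ -> mesI 0 1 (fun s => v i s t).
  by move=> tt; exact: (mes2_sect_t (f_mv F i) tt).
pose P s := \sum_i p i s t1 ^+ 2.
have iP : intg 0 1 P by apply: intg_sum => i; have [] := h1 i.
have P0 s : 0 <= P s by apply: sumr_ge0 => i _; exact: sqr_ge0.
have P3 : II 0 1 P <= 3 * N.
  rewrite II_sum; last by move=> i; have [] := h1 i.
  rewrite (_ : 3 * N = \sum_(i < 3) N); last by rewrite sumr_const card_ord; ring.
  by apply: ler_sum => i _; have [] := h1 i.
(* The remainder once P times the difference of the tensions is split off: increments of |p|^2,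
   weighted by tau at t2, and of |v|^2. *)
pose Fo s := ta s t2 * (\sum_i (p i s t2 ^+ 2 - p i s t1 ^+ 2)) -
  \sum_i (v i s t2 ^+ 2 - v i s t1 ^+ 2).
pose Wi i s := C / 2 * (l^-1 * (s * (p i s t2 - p i s t1)) ^+ 2 + l * (2 * (p i s t2 ^+ 2 + p i s t1 ^+ 2)))
  + 1 / 2 * (l^-1 * (v i s t2 - v i s t1) ^+ 2 + l * (2 * (v i s t2 ^+ 2 + v i s t1 ^+ 2))).
have Wi_ i : intg 0 1 (Wi i) /\ II 0 1 (Wi i) <= (C + 1) / 2 * (M + 4 * N) * l.
  have [[a1 b1] [a2 b2] _] := hi i.
  have [c1 d1 c2 d2] := h1 i; have [c3 d3 c4 d4] := h2 i.
  have A1 := intgZ l^-1 a1; have A2 := intgD c3 c1; have A3 := intgZ 2 A2; have A4 := intgZ l A3.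
  have A5 := intgD A1 A4; have A6 := intgZ (C / 2) A5.
  have B1 := intgZ l^-1 a2; have B2 := intgD c4 c2; have B3 := intgZ 2 B2; have B4 := intgZ l B3.
  have B5 := intgD B1 B4; have B6 := intgZ (1 / 2) B5.
  split; first exact: intgD A6 B6.
  rewrite /Wi (IID A6 B6) (IIZ _ A5) (IIZ _ B5) (IID A1 A4) (IID B1 B4) (IIZ _ A3) (IIZ _ B3).
  rewrite (IIZ _ A2) (IIZ _ B2) (IID c3 c1) (IID c4 c2) (IIZ _ a1) (IIZ _ a2).
  have li : 0 <= l^-1 by rewrite invr_ge0 ltW.
  have e : l^-1 * (M * l ^+ 2) = M * l by field; rewrite gt_eqF.
  have y1 := ler_wpM2l li b1; have y2 := ler_wpM2l li b2; rewrite e in y1 y2.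
  have z1 := ler_wpM2l (ltW l0) (lerD d3 d1); have z2 := ler_wpM2l (ltW l0) (lerD d4 d2).
  move: y1 y2 z1 z2; move: (l^-1 * _) (l^-1 * _) => Y1 Y2.
  set Z1 := II 0 1 _ + _; set Z2 := II 0 1 _ + _.
  rewrite [l * (2 * Z1)]mulrCA [l * (2 * Z2)]mulrCA; move: (l * Z1) (l * Z2) => W1 W2.
  move=> y1 y2 z1 z2.
  have C2 : 0 <= C / 2 by rewrite divr_ge0.
  have := ler_wpM2l C2 (lerD y1 (ler_wpM2l (ler0n _ 2) z1)).
  lra.
pose W s := \sum_i Wi i s.
have iW : intg 0 1 W by apply: intg_sum => i; have [] := Wi_ i.
have WK : II 0 1 W <= 3 * ((C + 1) / 2 * (M + 4 * N)) * l.
  rewrite II_sum; last by move=> i; have [] := Wi_ i.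
  rewrite (_ : 3 * _ * l = \sum_(i < 3) ((C + 1) / 2 * (M + 4 * N) * l)); last first.
    by rewrite sumr_const card_ord; ring.
  by apply: ler_sum => i _; have [] := Wi_ i.
have hd0 := f_ta F G1; have hd0' := f_ta F G2.
have hd1 := f_ta1 F G1; have hd1' := f_ta1 F G2.
have mFo : mesI 0 1 Fo.
  apply: mesIB; last by apply: mesI_sum => i; apply: mesIB; apply: (mesIX 2); exact: mv.
  apply: mesIM; first exact: ac_mes hd0'.
  by apply: mesI_sum => i; apply: mesIB; apply: (mesIX 2); exact: mp.
have FW : aeI 0 1 (fun s => `|Fo s| <= W s).
  apply: aeI_all => s; rewrite in_itv/= => /andP[s0 s1].
  have tl := f_low F G2 s0 (ltW s1); have tu := f_up F G2 (ltW s0) (ltW s1).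
  have tp : 0 <= ta s t2 by apply: le_trans tl; rewrite mulr_ge0// ltW// (f_c0 F).
  rewrite /Fo /W; apply: (le_trans (ler_normB _ _)); rewrite mulr_sumr.
  apply: (@le_trans _ _ (\sum_i `|ta s t2 * (p i s t2 ^+ 2 - p i s t1 ^+ 2)| +
    \sum_i `|v i s t2 ^+ 2 - v i s t1 ^+ 2|)); first by apply: lerD; exact: ler_norm_sum.
  rewrite -big_split/=; apply: ler_sum => i _.
  have sqD (x y : R) : (x + y) ^+ 2 <= 2 * (x ^+ 2 + y ^+ 2) by have := sqr_ge0 (x - y); nra.
  rewrite /Wi; apply: lerD.
    have -> : ta s t2 * (p i s t2 ^+ 2 - p i s t1 ^+ 2) =
      (ta s t2 * (p i s t2 - p i s t1)) * (p i s t2 + p i s t1) by ring.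
    apply: (@le_trans _ _ (C * `|(s * (p i s t2 - p i s t1)) * (p i s t2 + p i s t1)|)).
      rewrite !normrM (ger0_norm tp) (ger0_norm (ltW s0)) !mulrA ler_wpM2r// ler_wpM2r//.
    have := weighted_diff (s * (p i s t2 - p i s t1)) (p i s t2 + p i s t1) l0.
    move=> /(ler_wpM2l C0) h; apply: (le_trans h).
    have cc (X : R) : C * (1 / 2 * X) = C / 2 * X by field.
    rewrite cc.
    rewrite ler_wpM2l ?divr_ge0// lerD2l ler_wpM2l// ltW//.
  have -> : v i s t2 ^+ 2 - v i s t1 ^+ 2 = (v i s t2 - v i s t1) * (v i s t2 + v i s t1) by ring.
  apply: (le_trans (weighted_diff _ _ l0)); rewrite ler_wpM2l//.
  by rewrite lerD2l ler_wpM2l// ltW.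
have iFo := intg_le mFo FW iW.
have hd : ac 0 1 (fun s => ta s t2 - ta s t1) (fun s => ta1 s t2 - ta1 s t1).
  have := ac_add hd0' (ac_scale (-1) hd0); congr ac; apply/funext => s; ring.
have hd' : ac 0 1 (fun s => ta1 s t2 - ta1 s t1) (fun s => ta2 s t2 - ta2 s t1).
  have := ac_add hd1' (ac_scale (-1) hd1); congr ac; apply/funext => s; ring.
have d00 : (fun s => ta s t2 - ta s t1) 0 = 0 by rewrite /= (f_ta0 F G1) (f_ta0 F G2) subrr.
have de : aeI 0 1 (fun s => ta2 s t2 - ta2 s t1 = P s * (ta s t2 - ta s t1) + Fo s).
  apply: aeI_imp2 (f_ta2 F G1) (f_ta2 F G2) => s _ -> ->.
  by rewrite /P /Fo !big_ord_recl !big_ord0; ring.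
have [c1 c2] := tension_energy hd hd' d00 iP iFo P0 de.
have B1 : `|ta1 1 t2 - ta1 1 t1| + II 0 1 (fun s => `|Fo s|) <= K1 * l.
  rewrite /K1 mulrDl; apply: lerD; last first.
    by apply: le_trans WK; apply: II_le => //; exact: intg_abs.
  rewrite (f_ta11 F G1) (f_ta11 F G2) opprK addrC -sumrB -mulrA mulr_suml.
  apply: (le_trans (ler_norm_sum _ _ _)); apply: ler_sum => i _.
  rewrite -mulrBr normrM ler_wpM2l// distrC.
  have [[a1 b1] _ [a3 b3]] := hi i.
  apply: (@bdry_incr _ _ (fun s => u i s t2 - u i s t1) (fun s => p i s t2 - p i s t1)) => // x x0_ x1_.
  have := ac_add (f_u F G2 i x0_ x1_) (ac_scale (-1) (f_u F G1 i x0_ x1_)).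
  by congr ac; apply/funext => s; ring.
have KK : (`|ta1 1 t2 - ta1 1 t1| + II 0 1 (fun s => `|Fo s|)) * (1 + II 0 1 P) <= K1 * (1 + 3 * N) * l.
  rewrite mulrAC; apply: ler_pM => //; last by rewrite lerD2l.
    by rewrite addr_ge0//; apply: II_ge0; [apply: mesI_abs|exact: aeI_all].
  by rewrite addr_ge0//; apply: II_ge0; [exact: intg_mes|exact: aeI_all].
split => s s0 s1; first exact: le_trans (c1 s s0 s1) KK.
by apply: (le_trans (c2 s s0 s1)); rewrite ler_wpM2r.
Qed.

End Lipschitz.

(** G is shrunk to the good times, where [lip_tension] holds for all pairs, and [be] is taken as
    McShane's extension of tau'(1,.), which is measurable because it is continuous. *)
Theorem facts_unit (R : realType) (T c0 C : R) g u v p q k ta ta1 ta2 x0 x1 p0 G :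
  facts T c0 C g u v p q k ta ta1 ta2 x0 x1 p0 G ->
  aeI 0 T (fun t => aeI 0 1 (fun s => \sum_(i < 3) u i s t ^+ 2 = 1)).
Proof.
move=> F; have [N N0 aG] := good_ae F.
have F' := facts_sub (fun t (h : good u v p q k x0 x1 p0 G N t) => let: And3 x _ _ := h in x) aG F.
have [K K0 hK] := lip_tension F N0.
have lip1 t1 t2 : good u v p q k x0 x1 p0 G N t1 -> good u v p q k x0 x1 p0 G N t2 ->
  (forall s, 0 <= s -> s <= 1 -> `|ta1 s t2 - ta1 s t1| <= K * `|t2 - t1|) /\
  (forall s, 0 <= s -> s <= 1 -> `|ta s t2 - ta s t1| <= K * s * `|t2 - t1|).
  move=> g1 g2; case: (ltgtP t1 t2) => t12.
  - have [h1 h2] := hK _ _ g1 g2 t12; rewrite gtr0_norm ?subr_gt0//; split => // s s0 s1.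
    by rewrite mulrAC; exact: h2.
  - have [h1 h2] := hK _ _ g2 g1 t12; rewrite [`|t2 - t1|]distrC gtr0_norm ?subr_gt0//.
    by split=> s s0 s1; rewrite distrC; [exact: h1|rewrite mulrAC; exact: h2].
  - by rewrite t12; split => s s0 s1; rewrite !subrr normr0 ?mulr0.
have [r _ gr] := aeI_ex (f_T F) aG.
have L1 x y : good u v p q k x0 x1 p0 G N x -> good u v p q k x0 x1 p0 G N y ->
    `|ta1 1 y - ta1 1 x| <= K * `|y - x|.
  by move=> gx gy; have [h _] := lip1 _ _ gx gy; exact: h.
have [be [be_lip be_eq]] := mcshane K0 L1 (ex_intro _ r gr).
have mbe : mesI 0 T be by apply: cont_mesI => x; exact: lip_cont (be_lip).
have := hh_eq0 F' mbe be_eq K0 _ (fun t1 t2 _ _ => be_lip t1 t2).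
have lt s t1 t2 : good u v p q k x0 x1 p0 G N t1 -> good u v p q k x0 x1 p0 G N t2 ->
   0 < s -> s <= 1 -> `|ta s t2 - ta s t1| <= K * s * `|t2 - t1|.
  by move=> g1 g2 s0; have [_ h] := lip1 _ _ g1 g2; apply: h; exact: ltW.
move=> /(_ (fun t1 t2 g1 g2 s => @lt s t1 t2 g1 g2)).
apply: aeI_imp => t _; apply: aeI_imp => s _; rewrite /hh /dot => /eqP.
by rewrite subr_eq0 => /eqP <-; apply: eq_bigr => i _; rewrite expr2.
Qed.

(** * Testing in s *)

Section Cutoffs.
Context {R : realType}.
Implicit Types (P Q f u v w : R -> R).

(* The primitive of a cutoff is a test function of s that need not vanish
   at s = 1. *)
Record cutoff (P : R -> R) (B lo : R) : Prop := Cutoff {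
  cut_lo0 : 0 < lo; cut_lo1 : lo <= 1; cut_B : 0 <= B;
  cut_mes : mesI 0 1 P;
  cut_out : forall s, s <= lo -> P s = 0;
  cut_bnd : forall s, `|P s| <= B }.

Definition prim P s : R := II 0 s P.

Lemma cut_intg P B lo : cutoff P B lo -> intg 0 1 P.
Proof. by move=> c; apply: (intg_bnd (cut_mes c)); apply: aeI_all => s _; exact: cut_bnd c s. Qed.

Lemma prim_ac P B lo : cutoff P B lo -> ac 0 1 (prim P) P.
Proof. by move=> c; apply: ac_II; exact: cut_intg c. Qed.

Lemma prim_lo P B lo s : cutoff P B lo -> s <= lo -> prim P s = 0.
Proof.
move=> c sl; rewrite /prim -[RHS](@II_0 R 0 s); apply: II_eq => z; rewrite in_itv/= => /andP[_ zs].
by apply: (cut_out c); exact: le_trans (ltW zs) sl.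
Qed.

Lemma prim_bnd P B lo s : cutoff P B lo -> 0 <= s -> s <= 1 -> `|prim P s| <= B * s.
Proof.
move=> c s0 s1; have := @II_bnd _ 0 s P B s0 _ _; rewrite subr0; apply.
  by apply: mesI_sub (cut_mes c).
by apply: aeI_all => z _; exact: cut_bnd c z.
Qed.

Lemma prim_bnd1 P B lo s : cutoff P B lo -> 0 <= s -> s <= 1 -> `|prim P s| <= B.
Proof.
move=> c s0 s1; apply: (le_trans (prim_bnd c s0 s1)).
by rewrite ler_piMr// (cut_B c).
Qed.

Lemma prim_div P B lo s : cutoff P B lo -> 0 < s -> s <= 1 -> `|prim P s / s| <= B.
Proof.
move=> c s0 s1; rewrite normrM normfV (gtr0_norm s0) ler_pdivrMr//.
exact: prim_bnd c (ltW s0) s1.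
Qed.

(** [P] and [prim P] vanish up to [lo] > 0, so there is no contribution from s = 0, while the
    boundary term at s = 1 is kept. *)
Lemma cut_ibp P B lo f f' : cutoff P B lo -> acr f f' ->
  [/\ intg 0 1 (fun s => f s * P s), intg 0 1 (fun s => f' s * prim P s) &
      II 0 1 (fun s => f s * P s) = f 1 * prim P 1 - II 0 1 (fun s => f' s * prim P s)].
Proof.
move=> c h; have l0 := cut_lo0 c; have l1 := cut_lo1 c.
have hl := h lo l0 l1; have hQ := ac_sub (ltW l0) (lexx _) (prim_ac c).
have hm := ac_mul hl hQ.
have i1 : intg lo 1 (fun s => f s * P s).
  apply: (intgM_bnd hQ.1 (ac_mes hl) (M := `|f lo| + II lo 1 (fun z => `|f' z|))).
  by apply: aeI_all => s; rewrite in_itv/= => /andP[s0 s1]; apply: (ac_bnd hl); exact: ltW.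
have i2 : intg lo 1 (fun s => f' s * prim P s).
  have : intg lo 1 (fun s => prim P s * f' s).
    apply: (intgM_bnd hl.1 (ac_mes hQ) (M := B)); apply: aeI_all => s; rewrite in_itv/= => /andP[s0 s1].
    by apply: prim_bnd1 c _ (ltW s1); rewrite ltW// (lt_trans l0).
  by congr intg; apply/funext => s; rewrite mulrC.
have z1 s : s \in `]0, lo[ -> f s * P s = 0.
  by rewrite in_itv/= => /andP[s0 sl]; rewrite (cut_out c) ?mulr0// ltW.
have z2 s : s \in `]0, lo[ -> f' s * prim P s = 0.
  by rewrite in_itv/= => /andP[s0 sl]; rewrite (prim_lo c) ?mulr0// ltW.
have glue F : (forall s, s \in `]0, lo[ -> F s = 0) -> intg lo 1 F ->
    intg 0 1 F /\ II 0 1 F = II lo 1 F.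
  move=> z i; have i0 : intg 0 lo F.
    apply: (eq_integrable _ (EFin \o (fun=> 0))) (intg_cst 0 lo 0) => //.
    by move=> s; rewrite inE => /= hs; rewrite z.
  have i01 := intg_glue (ltW l0) l1 i0 i; split => //.
  rewrite (II_split (ltW l0) l1 i01) (_ : II 0 lo F = 0) ?add0r//.
  by rewrite -[RHS](@II_0 R 0 lo); exact: II_eq.
have [j1 e1] := glue _ z1 i1; have [j2 e2] := glue _ z2 i2; split => //.
have := ac_inc hm (lexx _) l1 (lexx _); rewrite (prim_lo c (lexx _)) mulr0 subr0 => ->.
by rewrite e1 e2 IID//; ring.
Qed.

(** Normalised so that its primitive equals 1 at s = 1: testing with it extracts a boundary value
    there. *)
Definition step (s : R) : R := if s <= 1 / 2 then 0 else 2.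

Lemma step_cutoff : cutoff step 2 (1 / 2).
Proof.
split => //; try lra.
- rewrite /mesI; apply: measurable_funTS; apply: measurable_fun_ifT => //; exact: measurable_fun_ler.
- by move=> s h; rewrite /step h.
- by move=> s; rewrite /step; case: ifP => _; rewrite ?normr0// ger0_norm.
Qed.

Lemma prim_step : prim step 1 = 1.
Proof.
have h0 : (0 : R) <= 1 / 2 by lra.
have h1 : (1 / 2 : R) <= 1 by lra.
rewrite /prim (II_split h0 h1 (cut_intg step_cutoff)).
rewrite (_ : II 0 (1 / 2) step = 0); last first.
  by rewrite -[RHS](@II_0 R 0 (1 / 2)); apply: II_eq => s; rewrite in_itv/= => /andP[_ h]; rewrite /step ltW.
rewrite (_ : II (1 / 2) 1 step = II (1 / 2) 1 (fun=> 2)); last first.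
  by apply: II_eq => s; rewrite in_itv/= => /andP[h _]; rewrite /step leNgt h.
by rewrite (II_cst _ h1); field.
Qed.

Let qr : {qr : rat * rat | [/\ (0 : R) < ratr qr.1, (ratr qr.1 : R) < ratr qr.2 & (ratr qr.2 : R) < 1]}.
Proof. by apply: cid; have [q [r h]] := @rat_in2 R 0 1 ltr01; exists (q, r). Qed.

Let q0 := (sval qr).1.
Let r0 := (sval qr).2.

Lemma q0r0 : [/\ (0 : R) < ratr q0, (ratr q0 : R) < ratr r0 & (ratr r0 : R) < 1].
Proof. exact: (svalP qr). Qed.

(* Countably many test functions suffice to detect a weak derivative, so the
   exceptional null set of times can be taken independent of the test
   function. *)
Definition famok (j : rat * rat * nat) : bool :=
  [&& (0 : R) < ratr j.1.1, (ratr j.1.1 : R) < ratr j.1.2 & (ratr j.1.2 : R) < 1].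

Definition fam (j : rat * rat * nat) : R -> R :=
  if famok j then mbump (ratr j.1.1) (ratr j.1.2) (ratr q0) (ratr r0) j.2 else fun=> 0.

Lemma mbump_bnd (c d c0 d0 : R) n : exists2 B, 0 <= B & forall s, `|mbump c d c0 d0 n s| <= B.
Proof.
exists (1 + `|II c d (trap c d n) / II c0 d0 (trap c0 d0 0)|); first by rewrite addr_ge0.
move=> s; rewrite /mbump; apply: (le_trans (ler_normB _ _)); apply: lerD.
  by rewrite ger0_norm ?trap_ge0// trap_le1.
rewrite normrM ler_piMr//.
by rewrite ger0_norm ?trap_ge0// trap_le1.
Qed.

Lemma fam_mbump q r n : (0 : R) < ratr q -> (ratr q : R) < ratr r -> (ratr r : R) < 1 ->
  fam (q, r, n) = mbump (ratr q) (ratr r) (ratr q0) (ratr r0) n /\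
  forall s, 0 <= s -> primit (fam (q, r, n)) s = prim (fam (q, r, n)) s.
Proof.
move=> h1 h2 h3; have [k1 k2 k3] := q0r0.
have E : fam (q, r, n) = mbump (ratr q) (ratr r) (ratr q0) (ratr r0) n.
  by rewrite /fam /famok /= h1 h2 h3.
split => // s s0; rewrite E.
pose lo := Num.min (ratr q : R) (ratr q0); pose hi := Num.max (ratr r : R) (ratr r0).
have [lc lc0] : lo <= ratr q /\ lo <= ratr q0 by rewrite /lo !ge_min !lexx orbT.
have [dh d0h] : ratr r <= hi /\ ratr r0 <= hi by rewrite /hi !le_max !lexx orbT.
have alo : 0 < lo by rewrite lt_min h1.
have lohi : lo <= hi by apply: (le_trans lc); apply: le_trans dh; exact: ltW.
have cp := @mbump_cont R (ratr q) (ratr r) (ratr q0) (ratr r0) n.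
have pout x : x \notin `]lo, hi[ -> mbump (ratr q) (ratr r) (ratr q0) (ratr r0) n x = 0 by exact: mbump_out.
have := primit_inc cp pout s0.
by rewrite (primit_lo pout (ltW alo)) subr0.
Qed.

Lemma fam_cut j : (exists B lo, cutoff (fam j) B lo) /\ prim (fam j) 1 = 0.
Proof.
case: (boolP (famok j)) => [|jn]; last first.
  have E : fam j = fun=> 0 by rewrite /fam (negbTE jn).
  rewrite E; split; last by rewrite /prim II_0.
  exists 0, 1; split => //; [exact: mesI_cst|by move=> s; rewrite normr0].
case: j => [[q r] n] /and3P[/= h1 h2 h3]; have [k1 k2 k3] := q0r0.
have [E e] := fam_mbump n h1 h2 h3.
pose lo := Num.min (ratr q : R) (ratr q0); pose hi := Num.max (ratr r : R) (ratr r0).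
have [lc lc0] : lo <= ratr q /\ lo <= ratr q0 by rewrite /lo !ge_min !lexx orbT.
have [dh d0h] : ratr r <= hi /\ ratr r0 <= hi by rewrite /hi !le_max !lexx orbT.
have alo : 0 < lo by rewrite lt_min h1.
have hib : hi < 1 by rewrite gt_max h3.
have lohi : lo <= hi by apply: (le_trans lc); apply: le_trans dh; exact: ltW.
have pout x : x \notin `]lo, hi[ -> mbump (ratr q) (ratr r) (ratr q0) (ratr r0) n x = 0 by exact: mbump_out.
have [B B0 hB] := mbump_bnd (ratr q) (ratr r) (ratr q0) (ratr r0) n.
split.
  exists B, lo; rewrite E; split => //.
  - by apply: ltW; exact: le_lt_trans lohi hib.
  - by apply: cont_mesI; exact: mbump_cont.
  - by move=> s h; apply: pout; rewrite in_itv/= negb_and -leNgt h.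
rewrite -e// E; apply: (primit_hi lohi (@mbump_cont R _ _ _ _ n) pout) => //; last exact: ltW.
exact: mbump_mean.
Qed.

Lemma fam_supp j : exists2 hi, hi < 1 & forall s, hi <= s -> s <= 1 -> prim (fam j) s = 0.
Proof.
case: (boolP (famok j)) => [|jn]; last first.
  have E : fam j = fun=> 0 by rewrite /fam (negbTE jn).
  by exists 0 => // s _ _; rewrite E /prim II_0.
case: j => [[q r] n] /and3P[/= h1 h2 h3]; have [k1 k2 k3] := q0r0.
have [E e] := fam_mbump n h1 h2 h3.
pose lo := Num.min (ratr q : R) (ratr q0); pose hi := Num.max (ratr r : R) (ratr r0).
have [lc lc0] : lo <= ratr q /\ lo <= ratr q0 by rewrite /lo !ge_min !lexx orbT.
have [dh d0h] : ratr r <= hi /\ ratr r0 <= hi by rewrite /hi !le_max !lexx orbT.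
have alo : 0 < lo by rewrite lt_min h1.
have hib : hi < 1 by rewrite gt_max h3.
have lohi : lo <= hi by apply: (le_trans lc); apply: le_trans dh; exact: ltW.
have pout x : x \notin `]lo, hi[ -> mbump (ratr q) (ratr r) (ratr q0) (ratr r0) n x = 0 by exact: mbump_out.
exists hi => // s his s1.
have s0 : 0 <= s by apply: le_trans his; apply: le_trans lohi; exact: ltW.
rewrite -e// E; apply: (primit_hi lohi (@mbump_cont R _ _ _ _ n) pout) => //.
exact: mbump_mean.
Qed.

(** The primitives of the family vanish near both end points, so local integrability is enough. This
    is all that is known at first about the derivative of the initial velocity. *)
Lemma fam_prim_intg j f : lintg 0 1 f -> intg 0 1 (fun s => f s * prim (fam j) s).
Proof.
move=> lf; have [[B [lo c]] _] := fam_cut j; have [hi hi1 hz] := fam_supp j.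
pose d := Num.max (1 / 2) hi; pose a := Num.min (1 / 2) lo.
have a0 : 0 < a by rewrite lt_min (cut_lo0 c) andbT; lra.
have d1 : d < 1 by rewrite gt_max hi1 andbT; lra.
have a2 : a <= 1 / 2 by rewrite ge_min lexx.
have d2 : 1 / 2 <= d by rewrite le_max lexx.
have z F x y : (forall s, s \in `]x, y[ -> F s = 0) -> intg x y F.
  move=> h; apply: (eq_integrable _ (EFin \o (fun=> 0))) (intg_cst x y 0) => //.
  by move=> s; rewrite inE => /= hs; rewrite h.
have ad : a <= d := le_trans a2 d2.
have i1 : intg 0 a (fun s => f s * prim (fam j) s).
  apply: z => s; rewrite in_itv/= => /andP[_ sa]; rewrite (prim_lo c) ?mulr0//.
  by apply: le_trans (ltW sa) _; rewrite ge_min lexx orbT.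
have i3 : intg d 1 (fun s => f s * prim (fam j) s).
  apply: z => s; rewrite in_itv/= => /andP[ds s1]; rewrite hz ?mulr0//; last exact: ltW.
  by apply: le_trans (ltW ds); rewrite le_max lexx orbT.
have i2 : intg a d (fun s => f s * prim (fam j) s).
  have b : aeI a d (fun s => `|prim (fam j) s| <= B).
    apply: aeI_all => s; rewrite in_itv/= => /andP[as_ sd]; apply: (prim_bnd1 c).
      by apply: ltW; exact: lt_trans as_.
    by apply: ltW; exact: lt_trans d1.
  have mQ : mesI a d (prim (fam j)) by apply: mesI_sub (ac_mes (prim_ac c)); exact: ltW.
  by have := intgM_bnd (lf a d a0 d1) mQ b; congr intg; apply/funext => s; rewrite mulrC.
exact: intg_glue (ltW a0) (le_trans ad (ltW d1)) i1 (intg_glue ad (ltW d1) i2 i3).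
Qed.

Lemma fam_weak u v j : weak_deriv 0 1 u v ->
  II 0 1 (fun s => u s * fam j s) = - II 0 1 (fun s => v s * prim (fam j) s).
Proof.
move=> h; case: (boolP (famok j)) => [|jn]; last first.
  have E : fam j = fun=> 0 by rewrite /fam (negbTE jn).
  have -> : II 0 1 (fun s => u s * fam j s) = 0.
    by rewrite -[RHS](@II_0 R 0 1); apply: II_eq => s _; rewrite E mulr0.
  have -> : II 0 1 (fun s => v s * prim (fam j) s) = 0.
    by rewrite -[RHS](@II_0 R 0 1); apply: II_eq => s _; rewrite E /prim II_0 mulr0.
  by rewrite oppr0.
case: j => [[q r] n] /and3P[/= h1 h2 h3]; have [k1 k2 k3] := q0r0.
have [E e] := fam_mbump n h1 h2 h3.
have w : weak_id 0 1 u v (fam (q, r, n)) by rewrite E; exact: weak_deriv_id.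
have e2 : II 0 1 (fun s => v s * primit (fam (q, r, n)) s) = II 0 1 (fun s => v s * prim (fam (q, r, n)) s).
  by apply: II_eq => s; rewrite in_itv/= => /andP[s0 _]; rewrite e// ltW.
by rewrite -e2; exact: w.
Qed.

Lemma fam_zero v : lintg 0 1 v -> (forall j, II 0 1 (fun s => v s * prim (fam j) s) = 0) ->
  aeI 0 1 (fun s => v s = 0).
Proof.
move=> lv H; have [k1 k2 k3] := q0r0.
apply: (weak_zero lv k1 k2 k3) => q r n h1 h2 h3.
have [E e] := fam_mbump n h1 h2 h3; rewrite -[RHS](H (q, r, n)) -E.
by apply: II_eq => s; rewrite in_itv/= => /andP[s0 _]; rewrite e// ltW.
Qed.

End Cutoffs.

(** * Continuous representatives, one-sided limits and pointwise bounds *)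

Section LocalAC.
Context {R : realType}.
Implicit Types (f g u v w : R -> R).

Lemma weak_acr u v : weak_deriv 0 1 u v -> (forall x, 0 < x -> x <= 1 -> intg x 1 v) ->
  exists w, acr w v /\ aeI 0 1 (fun s => u s = w s).
Proof.
move=> h iv.
have [|k hk] := @weak_deriv_ac _ 0 1 u v (fun s => - II s 1 v) ltr01 h.
  by move=> x y x0 xy y1; rewrite (II_split xy (ltW y1)); [ring|apply: iv => //; apply: ltW; exact: le_lt_trans y1].
exists (fun s => k + - II s 1 v); split => // x x0 x1.
apply: acI; first exact: iv.
move=> y z xy yz z1; have y0 := lt_le_trans x0 xy.
rewrite (II_split yz z1); first ring.
exact: iv y0 (le_trans yz z1).
Qed.

Lemma cont_ae_eq (a b : R) f g : (forall x, a < x -> x < b -> {for x, continuous f}) ->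
  (forall x, a < x -> x < b -> {for x, continuous g}) -> aeI a b (fun x => f x = g x) ->
  forall x, a < x -> x < b -> f x = g x.
Proof.
move=> cf cg e x ax xb; apply/eqP; rewrite -subr_eq0 -normr_le0; apply/ler_addgt0Pr => d d0.
rewrite add0r; have d2 : 0 < d / 2 by rewrite divr_gt0.
have /cvgrPdist_le/(_ _ d2) h1 := cf x ax xb.
have /cvgrPdist_le/(_ _ d2) h2 := cg x ax xb.
have [r /= r0 hr] : nbhs x [set y | `|f x - f y| <= d / 2 /\ `|g x - g y| <= d / 2].
  by near=> y; split; near: y.
have xr : x < Num.min b (x + r) by rewrite lt_min xb ltrDl.
have e' : aeI x (Num.min b (x + r)) (fun x => f x = g x).
  by apply: aeI_sub e; [exact: ltW|rewrite ge_min lexx].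
have [y + fg] := aeI_ex xr e'.
rewrite in_itv/= lt_min => /and3P[xy yb yr].
have [|k1 k2] := hr y; first by rewrite /= distrC gtr0_norm ?subr_gt0// ltrBlDl.
have -> : f x - g x = (f x - f y) - (g x - g y) by rewrite fg; ring.
apply: (le_trans (ler_normB _ _)); lra.
Unshelve. all: end_near. Qed.

(** Absolute continuity on compact subintervals of the open interval: what a weak derivative gives
    with no information at either end point. *)
Definition lac (a b : R) f f' : Prop := lintg a b f' /\
  forall x y, a < x -> x <= y -> y < b -> f y - f x = II x y f'.

Lemma lac_ac a b f f' c d : lac a b f f' -> a < c -> d < b -> ac c d f f'.
Proof.
move=> [l h] ac_ db; apply: acI; first exact: l.
by move=> x y cx xy yd; apply: h => //; [exact: lt_le_trans cx|exact: le_lt_trans yd db].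
Qed.

Lemma lac_cont a b f f' x : lac a b f f' -> a < x -> x < b -> {for x, continuous f}.
Proof.
move=> h ax xb; pose c := (a + x) / 2; pose d := (x + b) / 2.
have h1 : a < c by rewrite /c; lra.
have h2 : d < b by rewrite /d; lra.
apply: (ac_cont (lac_ac h h1 h2)); rewrite /c /d; lra.
Qed.

Lemma lintg_prim a b v : a < b -> lintg a b v -> exists V, lac a b V v.
Proof.
move=> ab lv; pose m := (a + b) / 2.
have am : a < m by rewrite /m; lra.
have mb : m < b by rewrite /m; lra.
exists (fun x => if m <= x then II m x v else - II x m v); split => // x y ax xy yb.
have [mx|xm] := leP m x.
  by rewrite (le_trans mx xy) (II_split mx xy (lv _ _ am yb)); ring.
have [my|ym] := leP m y.
  by rewrite (II_split (ltW xm) my (lv _ _ ax yb)); ring.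
by rewrite (II_split xy (ltW ym) (lv _ _ ax mb)); ring.
Qed.

Lemma lac_uniq a b f g f' g' : lac a b f f' -> lac a b g g' -> aeI a b (fun x => f x = g x) ->
  (forall x, a < x -> x < b -> f x = g x) /\ aeI a b (fun x => f' x = g' x).
Proof.
move=> hf hg e.
have E := cont_ae_eq (fun x ax xb => lac_cont hf ax xb) (fun x ax xb => lac_cont hg ax xb) e.
split => //.
have l : lintg a b (fun x => f' x - g' x).
  by move=> c d ac_ db; apply: intgB; [exact: hf.1|exact: hg.1].
have Z : aeI a b (fun x => f' x - g' x = 0).
  apply: II_zero_loc => // q r aq qr rb.
  rewrite IIB; [|exact: hf.1|exact: hg.1].
  rewrite -(hf.2 _ _ aq (ltW qr) rb) -(hg.2 _ _ aq (ltW qr) rb).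
  by rewrite !E ?subrr//; [exact: lt_trans rb|exact: lt_trans aq qr].
by apply: aeI_imp Z => x _ /eqP; rewrite subr_eq0 => /eqP.
Qed.

Lemma weak_lac a b u v : a < b -> weak_deriv a b u v ->
  exists w, lac a b w v /\ aeI a b (fun x => u x = w x).
Proof.
move=> ab h; have [_ /locally_lintg lv _] := h.
have [V [_ hV]] := lintg_prim ab lv.
have [k hk] := weak_deriv_ac ab h hV.
exists (fun x => k + V x); split => //; split => // x y ax xy yb.
by rewrite -(hV x y)//; ring.
Qed.

Lemma weak_uniq a b u v w w' : a < b -> weak_deriv a b u v -> lac a b w w' ->
  aeI a b (fun x => u x = w x) -> aeI a b (fun x => v x = w' x).
Proof.
move=> ab h hw e; have [w2 [h2 e2]] := weak_lac ab h.
have e3 : aeI a b (fun x => w2 x = w x) by apply: aeI_imp2 e e2 => x _ -> ->.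
by have [] := lac_uniq h2 hw e3.
Qed.

Lemma acr_lac w w' : acr w w' -> lac 0 1 w w'.
Proof.
move=> h; split.
  move=> c d c0 d1; have [c1|c1] := leP c 1.
    exact: intg_sub (lexx c) (ltW d1) (h c c0 c1).1.
  rewrite /intg set_itv_ge; first exact: integrable_set0.
  by rewrite bnd_simp -leNgt ltW// (lt_trans d1).
move=> x y x0 xy y1; have x1 := le_trans xy (ltW y1).
by apply: (ac_inc (h x x0 x1)) => //; exact: ltW.
Qed.

Lemma within_oc (a b : R) f : a < b -> {within `]a, b], continuous f} ->
  (forall x, a < x -> x < b -> {for x, continuous f}) /\ f x @[x --> b^'-] --> f b.
Proof.
move=> ab cf.
have h c : a < c -> c < b -> {in `]c, b[, continuous f} /\ f x @[x --> b^'-] --> f b.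
  move=> ac_ cb; have : {within `[c, b], continuous f}.
    by apply: continuous_subspaceW cf => x; rewrite /= !in_itv/= => /andP[cx ->]; rewrite (lt_le_trans ac_).
  by move=> /(continuous_within_itvP _ cb)[].
split=> [x ax xb|].
  have [||k _] := h ((a + x) / 2); [lra|lra|].
  by apply: k; rewrite in_itv/= xb andbT; lra.
by have [||_ k] := h ((a + b) / 2); [lra|lra|].
Qed.

Lemma within_co (a b : R) f : a < b -> {within `[a, b[, continuous f} ->
  (forall x, a < x -> x < b -> {for x, continuous f}) /\ f x @[x --> a^'+] --> f a.
Proof.
move=> ab cf.
have h c : a < c -> c < b -> {in `]a, c[, continuous f} /\ f x @[x --> a^'+] --> f a.
  move=> ac_ cb; have : {within `[a, c], continuous f}.
    by apply: continuous_subspaceW cf => x; rewrite /= !in_itv/= => /andP[-> cx]; rewrite (le_lt_trans cx).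
  by move=> /(continuous_within_itvP _ ac_)[].
split=> [x ax xb|].
  have [||k _] := h ((x + b) / 2); [lra|lra|].
  by apply: k; rewrite in_itv/= ax/=; lra.
by have [||_ k] := h ((a + b) / 2); [lra|lra|].
Qed.

Lemma ac_lim_right a b f f' : a < b -> ac a b f f' -> f x @[x --> b^'-] --> f b.
Proof.
move=> ab h; apply/cvgrPdist_le => e e0; have [d d0 H] := ac_unif e0 h.
near=> x.
have xb : x < b by [].
have ax : a <= x by apply: ltW; near: x; exact: nbhs_left_gt.
apply: (H _ _ ax (ltW xb) (lexx _)).
by rewrite ltrBlDr -ltrBlDl; near: x; apply: nbhs_left_gt; rewrite ltrBlDr ltrDl.
Unshelve. all: end_near. Qed.

Lemma ac_lim_left a b f f' : a < b -> ac a b f f' -> f x @[x --> a^'+] --> f a.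
Proof.
move=> ab h; apply/cvgrPdist_le => e e0; have [d d0 H] := ac_unif e0 h.
near=> x; rewrite distrC.
have xa : a < x by [].
have bx : x <= b by apply: ltW; near: x; exact: nbhs_right_lt.
apply: (H _ _ (lexx _) (ltW xa) bx).
by rewrite ltrBlDl; near: x; apply: nbhs_right_lt; rewrite ltrDl.
Unshelve. all: end_near. Qed.

Lemma lim_right_eq (a b : R) f g (l m : R) : a < b -> (forall x, a < x -> x < b -> f x = g x) ->
  f x @[x --> b^'-] --> l -> g x @[x --> b^'-] --> m -> l = m.
Proof.
move=> ab e hf hg; have : g x @[x --> b^'-] --> l.
  apply: cvg_trans hf; apply: near_eq_cvg; near=> x; rewrite e//.
by move=> hg'; exact: cvg_unique hg' hg.
Unshelve. all: end_near. Qed.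

Lemma lim_left_eq (a b : R) f g (l m : R) : a < b -> (forall x, a < x -> x < b -> f x = g x) ->
  f x @[x --> a^'+] --> l -> g x @[x --> a^'+] --> m -> l = m.
Proof.
move=> ab e hf hg; have : g x @[x --> a^'+] --> l.
  apply: cvg_trans hf; apply: near_eq_cvg; near=> x; rewrite e//.
by move=> hg'; exact: cvg_unique hg' hg.
Unshelve. all: end_near. Qed.

Lemma acr_cont_eq u w w' : {within `]0, 1], continuous u} -> acr w w' ->
  aeI 0 1 (fun x => u x = w x) -> forall x, 0 < x -> x <= 1 -> u x = w x.
Proof.
move=> cu hw e; have [c1 c2] := within_oc ltr01 cu; have lw := acr_lac hw.
have E := cont_ae_eq c1 (fun x ax xb => lac_cont lw ax xb) e.
move=> x x0; rewrite le_eqVlt => /orP[/eqP->|]; last exact: E.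
have h0 : (0 : R) < 1 / 2 by lra.
have h1 : (1 / 2 : R) < 1 by lra.
apply: (lim_right_eq h1 _ c2 (ac_lim_right h1 (hw _ h0 (ltW h1)))).
by move=> z z0 z1; apply: E => //; exact: lt_trans z0.
Qed.

Lemma acr_ext u w w' : (forall x, 0 < x -> x <= 1 -> u x = w x) -> acr w w' -> acr u w'.
Proof.
move=> e h x x0 x1; apply: (ac_eq (h x x0 x1) (h x x0 x1).1); last by apply: aeI_all.
by move=> z xz z1; rewrite e// (lt_le_trans x0).
Qed.

Lemma acr_ae w w' v : acr w w' -> (forall x, 0 < x -> x <= 1 -> intg x 1 v) ->
  aeI 0 1 (fun s => w' s = v s) -> acr w v.
Proof.
move=> h i e x x0 x1; apply: (ac_eq (h x x0 x1) (i x x0 x1)) => //.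
exact: aeI_sub (ltW x0) (lexx _) e.
Qed.

(** [ac_sup] averaged over []1/2, 1[]. The integral of |w'| starts at a = min(s, 1/2) and is left
    for the next lemmas to estimate with their own weights. *)
Lemma acr_pos_bound w w' s a : acr w w' -> 0 < s -> s <= 1 -> a = Num.min s (1 / 2) ->
  intg 0 1 (fun x => w x ^+ 2) ->
  w s ^+ 2 <= 4 * II 0 1 (fun x => w x ^+ 2) + 2 * II a 1 (fun x => `|w' x|) ^+ 2.
Proof.
move=> h s0 s1 ea i.
have a0 : 0 < a by rewrite ea lt_min s0/=; lra.
have as_ : a <= s by rewrite ea ge_min lexx.
have a2 : a <= 1 / 2 by rewrite ea ge_min lexx orbT.
have a1 : a < 1 by lra.
have ia : intg a 1 (fun x => w x ^+ 2) := intg_sub (ltW a0) (lexx _) i.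
have h2 : (1 / 2 : R) < 1 by lra.
have h0 : (0 : R) <= 1 / 2 by lra.
have := ac_sup a1 (h a a0 (ltW a1)) as_ s1 ia a2 h2.
have m : II (1 / 2) 1 (fun x => w x ^+ 2) <= II 0 1 (fun x => w x ^+ 2).
  by apply: (II_mono h0 (ltW h2) (lexx _) i); apply: aeI_all => x _; exact: sqr_ge0.
have -> : (1 - 1 / 2 : R) = 1 / 2 by field.
lra.
Qed.

(** This and the next two lemmas bound the integral of |w'| by Cauchy-Schwarz against 1, 1/x and the
    square root of 1/x, according to the weight 1, s or sqrt(s) with which w' lies in L^2; the
    results are a bound on w^2, on s w^2, and logarithmic growth of w^2. *)
Lemma acr_bound w w' M s : acr w w' -> mesI 0 1 w' ->
  intg 0 1 (fun x => w x ^+ 2) -> II 0 1 (fun x => w x ^+ 2) <= M ->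
  intg 0 1 (fun x => w' x ^+ 2) -> II 0 1 (fun x => w' x ^+ 2) <= M ->
  0 < s -> s <= 1 -> w s ^+ 2 <= 6 * M.
Proof.
move=> h mw i1 l1 i2 l2 s0 s1; pose a := Num.min s (1 / 2).
have a0 : 0 < a by rewrite lt_min s0/=; lra.
have a1 : a < 1 by have : a <= 1 / 2 by [rewrite ge_min lexx orbT]; lra.
have B := acr_pos_bound h s0 s1 (erefl a) i1.
have sa f : intg 0 1 f -> intg a 1 f by move=> k; apply: intg_sub k => //; exact: ltW.
have mw' : mesI a 1 (fun x => `|w' x|) by apply: mesI_abs; apply: mesI_sub mw => //; exact: ltW.
have e x : `|w' x| ^+ 2 = w' x ^+ 2 by rewrite real_normK ?num_real.
have i2' : intg a 1 (fun x => `|w' x| ^+ 2) by under eq_fun do rewrite e; exact: sa.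
have CS := II_CS (@mesI_cst _ a 1 1) mw' (intg_cst _ _ _) i2'.
rewrite (II_cst _ (ltW a1)) expr1n in CS.
have e1 : II a 1 (fun x => 1 * `|w' x|) = II a 1 (fun x => `|w' x|) by apply: II_eq => x _; rewrite mul1r.
have e2 : II a 1 (fun x => `|w' x| ^+ 2) = II a 1 (fun x => w' x ^+ 2) by apply: II_eq => x _; rewrite e.
have m : II a 1 (fun x => w' x ^+ 2) <= M.
  apply: le_trans l2; apply: (II_mono (ltW a0) (ltW a1) (lexx _) i2).
  by apply: aeI_all => x _; exact: sqr_ge0.
have m0 : 0 <= II a 1 (fun x => w' x ^+ 2).
  by apply: II_ge0; [exact: intg_mes (sa _ i2)|apply: aeI_all => x _; exact: sqr_ge0].
rewrite e1 e2 in CS.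
move: CS; rewrite [1 * (1 - a)]mul1r => CS.
have : (1 - a) * II a 1 (fun x => w' x ^+ 2) <= II a 1 (fun x => w' x ^+ 2).
  by rewrite ler_piMl//; lra.
lra.
Qed.

Lemma acr_bound_s w w' M s : acr w w' -> mesI 0 1 w' ->
  intg 0 1 (fun x => w x ^+ 2) -> II 0 1 (fun x => w x ^+ 2) <= M ->
  intg 0 1 (fun x => (x * w' x) ^+ 2) -> II 0 1 (fun x => (x * w' x) ^+ 2) <= M ->
  0 < s -> s <= 1 -> s * w s ^+ 2 <= 8 * M.
Proof.
move=> h mw i1 l1 i2 l2 s0 s1; pose a := Num.min s (1 / 2).
have a0 : 0 < a by rewrite lt_min s0/=; lra.
have a1 : a < 1 by have : a <= 1 / 2 by [rewrite ge_min lexx orbT]; lra.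
have sa2 : s * a^-1 <= 2 by rewrite ler_pdivrMr// /a; case: (leP s (1 / 2)) => ?; lra.
have B := acr_pos_bound h s0 s1 (erefl a) i1.
have sa f : intg 0 1 f -> intg a 1 f by move=> k; apply: intg_sub k => //; exact: ltW.
have mw' : mesI a 1 (fun x => `|x * w' x|).
  by apply: mesI_abs; apply: mesIM; [exact: mesI_id|apply: mesI_sub mw => //; exact: ltW].
have e x : `|x * w' x| ^+ 2 = (x * w' x) ^+ 2 by rewrite real_normK ?num_real.
have i2' : intg a 1 (fun x => `|x * w' x| ^+ 2) by under eq_fun do rewrite e; exact: sa.
have [iv lv] := sinv2 a0 (ltW a1).
have CS := II_CS (ac_mes (ac_inv a0 (ltW a1))) mw' iv i2'.
have e1 : II a 1 (fun x => x^-1 * `|x * w' x|) = II a 1 (fun x => `|w' x|).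
  apply: II_eq => x; rewrite in_itv/= => /andP[ax _].
  have x0 : 0 < x := lt_trans a0 ax.
  by rewrite normrM (gtr0_norm x0) mulKf// gt_eqF.
have e2 : II a 1 (fun x => `|x * w' x| ^+ 2) = II a 1 (fun x => (x * w' x) ^+ 2) by apply: II_eq => x _; rewrite e.
have m : II a 1 (fun x => (x * w' x) ^+ 2) <= M.
  apply: le_trans l2; apply: (II_mono (ltW a0) (ltW a1) (lexx _) i2).
  by apply: aeI_all => x _; exact: sqr_ge0.
have m0 : 0 <= II a 1 (fun x => (x * w' x) ^+ 2).
  by apply: II_ge0; [exact: intg_mes (sa _ i2)|apply: aeI_all => x _; exact: sqr_ge0].
have v0 : 0 <= II a 1 (fun x => x^-1 ^+ 2).
  by apply: II_ge0; [exact: intg_mes iv|apply: aeI_all => x _; exact: sqr_ge0].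
rewrite e1 e2 in CS.
have {}CS : II a 1 (fun x => `|w' x|) ^+ 2 <= a^-1 * M by apply: (le_trans CS); apply: ler_pM.
have M0 : 0 <= M by exact: le_trans m0 m.
have h1 : s * w s ^+ 2 <= s * (4 * M + 2 * (a^-1 * M)).
  by apply: (ler_wpM2l (ltW s0)); lra.
have h2 : s * M <= M by rewrite ler_piMl.
have h3 : s * a^-1 * M <= 2 * M by rewrite ler_wpM2r.
by apply: (le_trans h1); rewrite mulrDr; nra.
Qed.

Lemma acr_bound_log w w' M s : acr w w' -> mesI 0 1 w' ->
  intg 0 1 (fun x => w x ^+ 2) -> II 0 1 (fun x => w x ^+ 2) <= M ->
  intg 0 1 (fun x => (Num.sqrt x * w' x) ^+ 2) -> II 0 1 (fun x => (Num.sqrt x * w' x) ^+ 2) <= M ->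
  0 < s -> s <= 1 -> w s ^+ 2 <= 14 * M * logw s.
Proof.
move=> h mw i1 l1 i2 l2 s0 s1; pose a := Num.min s (1 / 2).
have a0 : 0 < a by rewrite lt_min s0/=; lra.
have a1 : a < 1 by have : a <= 1 / 2 by [rewrite ge_min lexx orbT]; lra.
have B := acr_pos_bound h s0 s1 (erefl a) i1.
have sa f : intg 0 1 f -> intg a 1 f by move=> k; apply: intg_sub k => //; exact: ltW.
have mw' : mesI a 1 w' by apply: mesI_sub mw => //; exact: ltW.
have e x : 0 < x -> (Num.sqrt x * w' x) ^+ 2 = x * w' x ^+ 2.
  by move=> x0; rewrite exprMn sqr_sqrtr// ltW.
have inv := ac_inv a0 (ltW a1).
have minv := ac_mes inv.
have msq : measurable_fun setT (Num.sqrt : R -> R).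
  by apply: continuous_measurable_fun; exact: sqrt_continuous.
have msi : mesI a 1 (fun x => Num.sqrt (x^-1)) := measurableT_comp msq minv.
have mz : mesI a 1 (fun x => Num.sqrt x * `|w' x|).
  by apply: mesIM; [exact: measurable_funTS|exact: mesI_abs].
have iv : intg a 1 (fun x => Num.sqrt (x^-1) ^+ 2).
  have := ac_intg inv; apply: eq_integrable => //.
  move=> x; rewrite inE /= in_itv/= => /andP[ax _].
  by rewrite sqr_sqrtr// invr_ge0 ltW// (lt_trans a0).
have ez x : (Num.sqrt x * `|w' x|) ^+ 2 = (Num.sqrt x * w' x) ^+ 2.
  by rewrite !exprMn real_normK ?num_real.
have iz : intg a 1 (fun x => (Num.sqrt x * `|w' x|) ^+ 2).
  by under eq_fun do rewrite ez; exact: sa.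
have CS := II_CS msi mz iv iz.
have e1 : II a 1 (fun x => Num.sqrt (x^-1) * (Num.sqrt x * `|w' x|)) = II a 1 (fun x => `|w' x|).
  apply: II_eq => x; rewrite in_itv/= => /andP[ax _].
  have x0 : 0 < x := lt_trans a0 ax.
  by rewrite mulrA -sqrtrM ?invr_ge0 ?(ltW x0)// mulVf ?gt_eqF// sqrtr1 mul1r.
have e2 : II a 1 (fun x => (Num.sqrt x * `|w' x|) ^+ 2) = II a 1 (fun x => (Num.sqrt x * w' x) ^+ 2).
  by apply: II_eq => x _; rewrite ez.
have e3 : II a 1 (fun x => Num.sqrt (x^-1) ^+ 2) = II a 1 (fun x => x^-1).
  apply: II_eq => x; rewrite in_itv/= => /andP[ax _].
  by rewrite sqr_sqrtr// invr_ge0 ltW// (lt_trans a0).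
have m : II a 1 (fun x => (Num.sqrt x * w' x) ^+ 2) <= M.
  apply: le_trans l2; apply: (II_mono (ltW a0) (ltW a1) (lexx _) i2).
  by apply: aeI_all => x _; exact: sqr_ge0.
have m0 : 0 <= II a 1 (fun x => (Num.sqrt x * w' x) ^+ 2).
  by apply: II_ge0; [exact: intg_mes (sa _ i2)|apply: aeI_all => x _; exact: sqr_ge0].
have v0 : 0 <= II a 1 (fun x => Num.sqrt (x^-1) ^+ 2).
  by apply: II_ge0; [exact: intg_mes iv|apply: aeI_all => x _; exact: sqr_ge0].
have M0 : 0 <= M by exact: le_trans m0 m.
have lw := sinv_logw a0 (ltW a1).
rewrite e1 e2 in CS.
have {}CS : II a 1 (fun x => `|w' x|) ^+ 2 <= logw a * M.
  by apply: (le_trans CS); apply: ler_pM => //; rewrite e3.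
have L1 := logw_ge1 s0 s1.
(* If a = 1/2, [smul_logw] gives the value at most 4, and [logw s] is at least 1. *)
have La : logw a <= 5 * logw s.
  have h2 : (0 : R) < 1 / 2 by lra.
  have h3 : (1 / 2 : R) <= 1 by lra.
  have L2 := smul_logw h2 h3; have L3 := logw_ge1 h2 h3.
  by rewrite /a; case: (leP s (1 / 2)) => _; lra.
have h2 : logw a * M <= 5 * logw s * M by rewrite ler_wpM2r.
have h3 : M <= logw s * M by rewrite ler_peMl.
lra.
Qed.

(** From w^2 <= 14 M logw: s [logw] <= 2 gives 28, and 14^2 times the bound 5 of [logw2_intg] gives
    980. The fourth power is what puts |v|^2, and with it tau'', in L^2. *)
Lemma acr_bound_log4 w w' M : acr w w' -> mesI 0 1 w' -> 
  intg 0 1 (fun x => w x ^+ 2) -> II 0 1 (fun x => w x ^+ 2) <= M ->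
  intg 0 1 (fun x => (Num.sqrt x * w' x) ^+ 2) -> II 0 1 (fun x => (Num.sqrt x * w' x) ^+ 2) <= M ->
  (forall s, 0 < s -> s <= 1 -> s * w s ^+ 2 <= 28 * M) /\
  intg 0 1 (fun x => (w x ^+ 2) ^+ 2) /\ II 0 1 (fun x => (w x ^+ 2) ^+ 2) <= 980 * M ^+ 2.
Proof.
move=> h mw i1 l1 i2 l2; have B s := acr_bound_log h mw i1 l1 i2 l2 (s := s).
have M0 : 0 <= M.
  by apply: le_trans l1; apply: II_ge0; [exact: intg_mes i1|apply: aeI_all => x _; exact: sqr_ge0].
split=> [s s0 s1|].
  have := smul_logw s0 s1 => hs; have := ler_wpM2l (ltW s0) (B s s0 s1).
  rewrite [s * (14 * M * _)]mulrCA => h1; apply: (le_trans h1).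
  by have := ler_wpM2l (mulr_ge0 (ler0n R 14) M0) hs; lra.
have [il ll] := @logw2_intg R.
have b : aeI 0 1 (fun x => `|(w x ^+ 2) ^+ 2| <= 196 * M ^+ 2 * logw x ^+ 2).
  apply: aeI_all => x; rewrite in_itv/= => /andP[x0 x1].
  rewrite ger0_norm ?sqr_ge0//.
  have -> : 196 * M ^+ 2 * logw x ^+ 2 = (14 * M * logw x) ^+ 2 by ring.
  by rewrite ler_pXn2r ?nnegrE ?sqr_ge0//; [exact: B (ltW x1)|apply: le_trans (B x x0 (ltW x1)); exact: sqr_ge0].
have iz := intgZ (196 * M ^+ 2) il.
have i4 : intg 0 1 (fun x => (w x ^+ 2) ^+ 2).
  exact: intg_le (mesIX 2 (intg_mes i1)) b iz.
split => //; apply: (@le_trans _ _ (II 0 1 (fun x => 196 * M ^+ 2 * logw x ^+ 2))).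
  by apply: (II_le i4 iz); apply: aeI_imp b => x _; apply: le_trans; exact: ler_norm.
have M2 : 0 <= 196 * M ^+ 2 by rewrite mulr_ge0// sqr_ge0.
by rewrite (IIZ _ il); have := ler_wpM2l M2 ll; lra.
Qed.

End LocalAC.

(** * From vector norms and limits to components and inequalities *)

Section VectorNorms.
Context {R : realType}.
Notation mu := (@lebesgue_measure R).

Lemma enorm_sqr (a : 'rV[R]_3) : enorm a ^+ 2 = \sum_i a 0 i ^+ 2.
Proof.
have e : dotp a a = \sum_i a 0 i ^+ 2 by apply: eq_bigr => i _; rewrite expr2.
by rewrite /enorm sqr_sqrtr e//; apply: sumr_ge0 => i _; exact: sqr_ge0.
Qed.

Lemma L2sq_fin (f : R -> 'rV[R]_3) : (forall i, mesI 0 1 (fun s => f s 0 i)) ->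
  (L2sq f < +oo)%E -> forall i, intg 0 1 (fun s => f s 0 i ^+ 2) /\
  ((II 0 1 (fun s => f s 0 i ^+ 2))%:E <= L2sq f)%E.
Proof.
move=> mf fin i; have mfi := mesIX 2 (mf i).
have me : mesI 0 1 (fun s => enorm (f s) ^+ 2).
  rewrite (_ : (fun s => _) = (fun s => \sum_j f s 0 j ^+ 2)).
    by apply: mesI_sum => j; exact: (mesIX 2 (mf j)).
  by apply/funext => s; rewrite enorm_sqr.
have le_ : (\int[mu]_(s in `]0%R, 1%R[) (f s 0 i ^+ 2)%:E <= L2sq f)%E.
  apply: ge0_le_integral => //.
  - by move=> s _; rewrite lee_fin sqr_ge0.
  - exact/measurable_EFinP.
  - exact/measurable_EFinP.
  - move=> s _; rewrite lee_fin enorm_sqr (bigD1 i)//= lerDl.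
    by apply: sumr_ge0 => j _; exact: sqr_ge0.
have ii : intg 0 1 (fun s => f s 0 i ^+ 2).
  apply/integrableP; split; first exact/measurable_EFinP.
  apply: le_lt_trans fin; apply: le_trans le_.
  rewrite le_eqVlt; apply/orP; left; apply/eqP; apply: eq_integral => s _.
  by rewrite /= ger0_norm ?sqr_ge0.
split => //; rewrite /II /Rintegral fineK//.
exact: integrable_fin_num ii.
Qed.

Lemma L2sq_le (f : R -> 'rV[R]_3) (M : R) : (forall i, mesI 0 1 (fun s => f s 0 i)) ->
  (L2sq f <= M%:E)%E -> forall i, intg 0 1 (fun s => f s 0 i ^+ 2) /\
  II 0 1 (fun s => f s 0 i ^+ 2) <= M.
Proof.
move=> mf h i; have [ii l] := L2sq_fin mf (le_lt_trans h (ltry M)) i.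
by split => //; rewrite -lee_fin; exact: le_trans h.
Qed.

Lemma L2sq_ge0 (f : R -> 'rV[R]_3) : (0 <= L2sq f)%E.
Proof. by apply: integral_ge0 => s _; rewrite lee_fin sqr_ge0. Qed.

Lemma near_within_itv (T t : R) (P : R -> Prop) :
  (\forall r \near within [set` `[0, T]] (nbhs t), P r) ->
  exists2 d, 0 < d & forall r, 0 <= r -> r <= T -> `|r - t| < d -> P r.
Proof.
move=> [d /= d0 h]; exists d => // r r0 rT rt; apply: h; last by rewrite /= in_itv/= r0.
by rewrite /= distrC.
Qed.

Lemma near_within_dnbhs (T t : R) (P : R -> Prop) :
  (\forall r \near within [set` `[0, T]] (t^'), P r) ->
  exists2 d, 0 < d & forall r, 0 <= r -> r <= T -> r != t -> `|r - t| < d -> P r.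
Proof.
move=> [d /= d0 h]; exists d => // r r0 rT rn rt; apply: (h r) => //; last by rewrite /= in_itv/= r0.
by rewrite /= distrC.
Qed.

End VectorNorms.

(** * Regularity in time *)

Section TimeRegularity.
Context {R : realType}.
Variable T : R.
Hypothesis T0 : 0 < T.
Implicit Types (u v : R -> R -> R).

(** In [weak_dt] the exceptional set of s may depend on the test function. Countably many rational
    bumps give one null set, outside which [weak_ac] applies at fixed s. *)
Lemma weak_dt_lac u v : weak_dt T u v ->
  aeI 0 1 (fun s => exists w, lac 0 T w (v s) /\ aeI 0 T (fun t => u s t = w t)).
Proof.
move=> [mu_ mv hl ht]; have [q0 [r0 [k1 k2 k3]]] := rat_in2 T0.
have hc : aeI 0 1 (fun s => forall j : rat * rat * nat, (0 : R) < ratr j.1.1 ->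
    ratr j.1.1 < ratr j.1.2 :> R -> ratr j.1.2 < T ->
    weak_id 0 T (u s) (v s) (mbump (ratr j.1.1) (ratr j.1.2) (ratr q0) (ratr r0) j.2)).
  apply: aeI_count => -[[q r] n] /=.
  case: (boolP [&& (0 : R) < ratr q, ratr q < ratr r :> R & ratr r < T]); last first.
    by move=> hn; apply: aeI_all => s _ h1 h2 h3; rewrite h1 h2 h3 in hn.
  move=> /and3P[h1 h2 h3]; have [tf de] := mbump_test n h1 h2 h3 k1 k2 k3.
  have := ht _ tf; apply: aeI_imp => s _ + _ _ _.
  by rewrite /weak_id /II de.
apply: aeI_imp2 hl hc => s ss [lu lv] H.
have lv' := locally_lintg lv; have [V [_ hV]] := lintg_prim T0 lv'.
have [|k hk] := weak_ac (locally_lintg lu) lv' hV k1 k2 k3.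
  by move=> q r n h1 h2 h3; exact: (H (q, r, n)).
exists (fun t => k + V t); split => //; split => // x y x0 xy yT.
by rewrite -(hV x y)//; ring.
Qed.

Lemma weak_dt_uniq u v v' : weak_dt T u v -> weak_dt T u v' ->
  aeI 0 T (fun t => aeI 0 1 (fun s => v s t = v' s t)).
Proof.
move=> h h'; have [_ mv _ _] := h; have [_ mv' _ _] := h'.
apply: swap_st => //; apply: aeI_imp2 (weak_dt_lac h) (weak_dt_lac h') => s _ [w [l e]] [w' [l' e']].
have e2 : aeI 0 T (fun t => w t = w' t) by apply: aeI_imp2 e e' => t _ <- <-.
by have [] := lac_uniq l l' e2.
Qed.

Definition cl2 u : Prop := forall t, 0 <= t -> t <= T ->
  [/\ mesI 0 1 (u^~ t), intg 0 1 (fun s => u s t ^+ 2) &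
    forall e, 0 < e -> exists2 d, 0 < d & forall r, 0 <= r -> r <= T -> `|r - t| < d ->
      II 0 1 (fun s => (u s r - u s t) ^+ 2) <= e].

Lemma sqr_diff_intg (f g : R -> R) : mesI 0 1 f -> mesI 0 1 g ->
  intg 0 1 (fun s => f s ^+ 2) -> intg 0 1 (fun s => g s ^+ 2) ->
  intg 0 1 (fun s => (f s - g s) ^+ 2) /\
  II 0 1 (fun s => (f s - g s) ^+ 2) <= 2 * II 0 1 (fun s => f s ^+ 2) + 2 * II 0 1 (fun s => g s ^+ 2).
Proof.
move=> mf mg i1 i2; have i3 := intgD (intgZ 2 i1) (intgZ 2 i2).
have h : aeI 0 1 (fun s => `|(f s - g s) ^+ 2| <= 2 * f s ^+ 2 + 2 * g s ^+ 2).
  apply: aeI_all => s _; rewrite ger0_norm ?sqr_ge0//.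
  by have := sqr_ge0 (f s + g s); nra.
have i : intg 0 1 (fun s => (f s - g s) ^+ 2) := intg_le (mesIX 2 (mesIB mf mg)) h i3.
split => //; rewrite -(IIZ _ i1) -(IIZ _ i2) -(IID (intgZ 2 i1) (intgZ 2 i2)).
by apply: (II_le i i3); apply: aeI_imp h => s _; apply: le_trans; exact: ler_norm.
Qed.

(** The weak derivative only says that D = u - int v is constant in t for almost every s, at almost
    every t. Continuity of u in time with values in L^2 extends this to every t in [[0, T[], in
    particular to t = 0. *)
Lemma time_repr u v : weak_dt T u v -> linf2 T v -> cl2 u ->
  forall t, 0 <= t -> t < T -> aeI 0 1 (fun s => u s t = u s 0 + II 0 t (v s)).
Proof.
move=> h hv cu; have [mu_ mv _ _] := h.
have [iv _ _ _] := fubini (linf2_linf1 hv).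
pose D s t := u s t - II 0 t (v s).
have mD : mes2 0 1 0 T D by apply: mes2B => //; exact: mes2_primt.
have hk : aeI 0 1 (fun s => exists k, aeI 0 T (fun t => D s t = k)).
  apply: aeI_imp2 iv (weak_dt_lac h) => s _ i [w [lw e]].
  pose V t := II 0 t (v s); have mT : 0 < T / 2 by rewrite divr_gt0.
  have mT' : T / 2 < T by lra.
  have lV : lac 0 T V (v s).
    split; first exact: lintgW.
    move=> x y x0 xy yT; rewrite /V (II_split (ltW x0) xy); first ring.
    by apply: intg_sub i => //; exact: ltW.
  exists (w (T / 2) - V (T / 2)); apply: aeI_imp e => t; rewrite in_itv/= => /andP[t0 tT].
  rewrite /D -/(V t) => ->.
  have [le_|lt_] := leP t (T / 2).
    by have := lw.2 _ _ t0 le_ mT'; have := lV.2 _ _ t0 le_ mT'; lra.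
  by have := lw.2 _ _ mT (ltW lt_) tT; have := lV.2 _ _ mT (ltW lt_) tT; lra.
(* The constant value of D has no evident measurability in s. The arctangent is bounded, so its time
   average [m] is measurable by Fubini, and it is injective, so equality of arctangents gives
   equality of D. *)
pose hq s t := atan (D s t).
have mat : measurable_fun setT (@atan R) by apply: continuous_measurable_fun => x; exact: continuous_atan.
have mh : mes2 0 1 0 T hq by apply: measurableT_comp mD.
have bh : bndt T hq.
  split => //; exists 2; apply: aeI_all => t _; apply: aeI_all => s _.
  have := atan_gtNpi2 (D s t); have := atan_ltpi2 (D s t); have := @pihalf_lt2 R.
  by rewrite /hq ler_norml; lra.
have [_ im _ _] := fubini (linf2_linf1 (bndt_linf2 bh)).
pose m s := T^-1 * II 0 T (hq s).
have mm : mesI 0 1 m by apply: mesIM; [exact: mesI_cst|exact: intg_mes im].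
have hA : aeI 0 T (fun t => aeI 0 1 (fun s => hq s t = m s)).
  apply: (@swap_st R 0 1 0 T hq (fun s _ => m s)) => //; first exact: mes2_s.
  apply: aeI_imp hk => s ss [k e].
  have e2 : aeI 0 T (fun t => hq s t = atan k) by apply: aeI_imp e => t _; rewrite /hq => ->.
  have -> : m s = atan k.
    rewrite /m (II_ae (mes2_sect_s mh ss) (@mesI_cst _ _ _ _) e2) (II_cst _ (ltW T0)) subr0.
    by rewrite mulrC mulfK// gt_eqF.
  exact: e2.
have DD t t' : aeI 0 1 (fun s => hq s t = m s) -> aeI 0 1 (fun s => hq s t' = m s) ->
    aeI 0 1 (fun s => D s t = D s t').
  by apply: aeI_imp2 => s _; rewrite /hq => <- /esym e; apply: (can_inj (@atanK R)).
have [M M0 hM] := incr_L2 hv.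
have key t t0 : aeI 0 1 (fun s => hq s t = m s) -> t \in `]0, T[ -> 0 <= t0 -> t0 < T ->
    aeI 0 1 (fun s => D s t = D s t0).
  move=> At; rewrite in_itv/= => /andP[tp tT] t00 t0T.
  pose W s := D s t - D s t0.
  have mDt r : 0 <= r -> r <= T -> mesI 0 1 (fun s => D s r).
    move=> r0 rT; apply: mesIB; first by have [] := cu r r0 rT.
    by have [i _ _] := hM 0 r (lexx _) r0 rT; exact: intg_mes i.
  have mW : mesI 0 1 W by apply: mesIB; apply: mDt => //; exact: ltW.
  have [_ iu0 cu0] := cu t0 t00 (ltW t0T); have mu0 : mesI 0 1 (u^~ t0) by have [] := cu t0 t00 (ltW t0T).
  have est e : 0 < e -> intg 0 1 (fun s => W s ^+ 2) /\ II 0 1 (fun s => W s ^+ 2) <= 4 * e.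
    move=> e0; have [d d0 hd] := cu0 e e0.
    (* For t0 < r < t0 + d1 one has M (r - t0)^2 <= e, so the increment of the primitive contributes
       no more than that of u. *)
    pose d1 := Num.min 1 (e / (M + 1)).
    have M1 : 0 < M + 1 by rewrite ltr_wpDl.
    have d10 : 0 < d1 by rewrite lt_min ltr01 divr_gt0.
    have lt1 : t0 < Num.min T (Num.min (t0 + d) (t0 + d1)).
      by rewrite !lt_min t0T !ltrDl d0.
    have : aeI t0 (Num.min T (Num.min (t0 + d) (t0 + d1))) (fun t => aeI 0 1 (fun s => hq s t = m s)).
      by apply: aeI_sub hA => //; rewrite ge_min lexx.
    move=> /(aeI_ex lt1)[r]; rewrite in_itv/= !lt_min => /andP[t0r /and3P[rT rd rd1]] Ar.
    have r0 : 0 <= r := le_trans t00 (ltW t0r).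
    have [mur iur _] := cu r r0 (ltW rT).
    have [iV iV2 lV] := hM t0 r t00 (ltW t0r) (ltW rT).
    have lu : II 0 1 (fun s => (u s r - u s t0) ^+ 2) <= e.
      by apply: hd => //; [exact: ltW|rewrite gtr0_norm ?subr_gt0// ltrBlDl].
    have lV' : II 0 1 (fun s => II t0 r (v s) ^+ 2) <= e.
      apply: (le_trans lV).
      have x0 : 0 <= r - t0 by rewrite subr_ge0 ltW.
      have xd : r - t0 <= d1 by rewrite lerBlDl ltW.
      have x1 : r - t0 <= 1 by apply: (le_trans xd); rewrite ge_min lexx.
      have x2 : (r - t0) * (M + 1) <= e.
        by rewrite -ler_pdivlMr//; apply: (le_trans xd); rewrite ge_min lexx orbT.
      by nra.
    have [iur2 _] := sqr_diff_intg mur mu0 iur iu0.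
    have [i l] := sqr_diff_intg (mesIB mur mu0) (intg_mes iV) iur2 iV2.
    have eW : aeI 0 1 (fun s => W s ^+ 2 = ((u s r - u s t0) - II t0 r (v s)) ^+ 2).
      apply: aeI_imp2 (DD _ _ At Ar) iv => s _ e1 i1; rewrite /W e1 /D.
      rewrite (@II_split R 0 r t0 (v s) t00 (ltW t0r)); first by congr (_ ^+ 2); ring.
      by apply: intg_sub i1 => //; exact: ltW.
    split; first exact: intg_ae (mesIX 2 mW) eW i.
    rewrite (II_ae (mesIX 2 mW) (intg_mes i) eW); apply: (le_trans l).
    lra.
  have [iW _] := est 1 ltr01.
  have W0 : II 0 1 (fun s => W s ^+ 2) <= 0.
    apply/ler_addgt0Pr => e e0; rewrite add0r.
    by have e4 : 0 < e / 4 by [rewrite divr_gt0]; have [_] := est _ e4; lra.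
  have Wp : aeI 0 1 (fun s => 0 <= W s ^+ 2) by apply: aeI_all => s _; exact: sqr_ge0.
  apply: aeI_imp (II_eq0_ae iW Wp W0) => s _ /eqP.
  by rewrite sqrf_eq0 subr_eq0 => /eqP.
have [ts tss At] := aeI_ex T0 hA.
move=> t t0 tT; apply: aeI_imp2 (key ts t At tss t0 tT) (key ts 0 At tss (lexx _) T0) => s _ -> .
by rewrite /D (@II_nil R 0 0)// subr0 => /eqP; rewrite subr_eq => /eqP.
Qed.

(* With f(t) the integral of x(.,t)P, which is differentiable, the identity
   follows by differentiating f(t) = - int x_s(.,0)Q - int_0^t int v Q. *)
Lemma time_derivative (x xs xt v : R -> R -> R) P B lo : cutoff P B lo ->
  (forall t, 0 < t -> t < T -> acr (x^~ t) (xs^~ t) /\ x 1 t = 0) ->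
  (forall t, 0 < t -> t < T -> aeI 0 1 (fun s => xs s t = xs s 0 + II 0 t (v s))) ->
  intg 0 1 (fun s => xs s 0) -> linf2 T v ->
  (forall t, 0 < t -> t < T -> mesI 0 1 (x^~ t)) ->
  (forall t, 0 < t -> t < T -> mesI 0 1 (xt^~ t) /\ intg 0 1 (fun s => xt s t ^+ 2)) ->
  (forall t, 0 < t -> t < T -> forall e, 0 < e -> exists2 d, 0 < d & forall r, 0 < r -> r < T ->
     r != t -> `|r - t| < d ->
     intg 0 1 (fun s => ((r - t)^-1 * (x s r - x s t) - xt s t) ^+ 2) /\
     II 0 1 (fun s => ((r - t)^-1 * (x s r - x s t) - xt s t) ^+ 2) <= e) ->
  aeI 0 T (fun t => II 0 1 (fun s => xt s t * P s) = - II 0 1 (fun s => v s t * prim P s)).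
Proof.
move=> c hx hxs i0 hv mx hxt hd; have B0 := cut_B c.
have mQ := ac_mes (prim_ac c).
have bQ : aeI 0 1 (fun s => `|prim P s| <= B).
  by apply: aeI_all => s; rewrite in_itv/= => /andP[s0 s1]; apply: (prim_bnd1 c); exact: ltW.
have bP : aeI 0 1 (fun s => `|P s| <= B) by apply: aeI_all => s _; exact: cut_bnd c s.
have bQ2 : bndt T (fun s _ => prim P s).
  by split; [exact: mes2_s|exists B; apply: aeI_all => t _].
pose vQ s t := prim P s * v s t.
have lvQ : linf1 0 1 0 T vQ by apply: linf1_bnd => //; exact: linf2_linf1.
have [_ _ im _] := fubini lvQ; set m := (fun t => II 0 1 (vQ^~ t)) in im.
pose f t := II 0 1 (fun s => x s t * P s).
pose c0 := II 0 1 (fun s => xs s 0 * prim P s).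
have [iv _ _ _] := fubini (linf2_linf1 hv).
have ix0 : intg 0 1 (fun s => prim P s * xs s 0) := intgM_bnd i0 mQ bQ.
have fE t : 0 < t -> t < T -> f t = - c0 - II 0 t m.
  move=> t0 tT; have [hac x1] := hx t t0 tT; have [j1 j2 e] := cut_ibp c hac.
  rewrite /f e x1 mul0r sub0r.
  have lt_ := linf1_restr (lexx 0) (ltW tT) lvQ; have [k1 k2 k3 k4] := fubini lt_.
  have eq_ : II 0 1 (fun s => xs s t * prim P s) = II 0 1 (fun s => prim P s * xs s 0 + II 0 t (vQ s)).
    apply: II_ae; [exact: intg_mes j2|by apply: intg_mes; exact: intgD|].
    apply: aeI_imp2 (hxs t t0 tT) iv => s _ -> i; rewrite /vQ (IIZ (prim P s)); first ring.
    by apply: intg_sub i => //; exact: ltW.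
  rewrite eq_ (IID ix0 k2) k4 /c0 opprD; congr (- _ - _).
  by apply: II_eq => s _; rewrite mulrC.
have FTC := II_FTC im; apply: aeI_imp FTC => t; rewrite in_itv/= => /andP[t0 tT] [dF DF].
have [mxt ixt] := hxt t t0 tT.
set L := II 0 1 (fun s => xt s t * P s).
have -> : - II 0 1 (fun s => v s t * prim P s) = - m t.
  by congr (- _); apply: II_eq => s _; rewrite mulrC.
have ixtP : intg 0 1 (fun s => P s * xt s t) := intgM_bnd (intg_L2 mxt ixt) (cut_mes c) bP.
pose G (h : R) := h^-1 * (f (t + h) - f t).
have GL : G h @[h --> 0^'] --> L.
  (* Cauchy-Schwarz turns an L^2 error of squared size [e1] into at most B e / (B + 1) after testing
     with P. *)
  apply/cvgrPdist_le => e e0; pose e1 := (e / (B + 1)) ^+ 2.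
  have B1 : 0 < B + 1 by rewrite ltr_wpDl.
  have e10 : 0 < e1 by rewrite exprn_gt0// divr_gt0.
  have [d d0 hh] := hd t t0 tT e1 e10.
  near=> h.
  have hn : h != 0 by near: h; exact: nbhs_dnbhs_neq.
  have hs : `|h| < Num.min d (Num.min t (T - t)).
    near: h; apply: dnbhs0_lt; rewrite !lt_min d0 t0/= subr_gt0//.
  move: hs; rewrite !lt_min => /and3P[hsd ht hT].
  have r0 : 0 < t + h by have := ler_norm (- h); rewrite normrN; lra.
  have rT : t + h < T by have := ler_norm h; lra.
  have rn : t + h != t by rewrite -subr_eq0 addrC addKr.
  have rd : `|t + h - t| < d by rewrite addrC addKr.
  have [i l] := hh (t + h) r0 rT rn rd.
  have eh : t + h - t = h by rewrite addrC addKr.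
  rewrite eh in i l.
  have [hac _] := hx t t0 tT; have [hac' _] := hx (t + h) r0 rT.
  have [j1 _ _] := cut_ibp c hac; have [j2 _ _] := cut_ibp c hac'.
  pose W s := h^-1 * (x s (t + h) - x s t) - xt s t.
  have mW : mesI 0 1 W.
    by apply: mesIB mxt; apply: mesIM; [exact: mesI_cst|apply: mesIB; exact: mx].
  have iW := intg_L2 mW i.
  have -> : L - G h = - II 0 1 (fun s => P s * W s).
    have j3 := intgB j2 j1; have j4 := intgZ h^-1 j3; have j5 := intgB j4 ixtP.
    have -> : II 0 1 (fun s => P s * W s) =
       II 0 1 (fun s => h^-1 * (x s (t + h) * P s - x s t * P s) - P s * xt s t).
      by apply: II_eq => s _; rewrite /W; ring.
    rewrite (IIB j4 ixtP) (IIZ _ j3) (IIB j2 j1) /G /f /L.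
    have -> : II 0 1 (fun s => xt s t * P s) = II 0 1 (fun s => P s * xt s t).
      by apply: II_eq => s _; rewrite mulrC.
    ring.
  rewrite normrN.
  have iPW : intg 0 1 (fun s => P s * W s) := intgM_bnd iW (cut_mes c) bP.
  have mP2 : aeI 0 1 (fun s => `|P s ^+ 2| <= B ^+ 2).
    apply: aeI_imp bP => s _; rewrite normrX => h1.
    by rewrite ler_pXn2r ?nnegrE.
  have iP2 := intg_bnd (mesIX 2 (cut_mes c)) mP2.
  have CS := II_CS (cut_mes c) mW iP2 i.
  have lP : II 0 1 (fun s => P s ^+ 2) <= B ^+ 2.
    have := II_bnd ler01 (mesIX 2 (cut_mes c)) mP2; rewrite subr0 mulr1.
    by apply: le_trans; exact: ler_norm.
  rewrite -(@ler_pXn2r _ 2) ?nnegrE//; last exact: ltW.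
  rewrite real_normK ?num_real//; apply: (le_trans CS).
  apply: (@le_trans _ _ (B ^+ 2 * e1)).
    apply: ler_pM => //.
      by apply: II_ge0; [exact: intg_mes iP2|apply: aeI_all => s _; exact: sqr_ge0].
    by apply: II_ge0; [exact: intg_mes i|apply: aeI_all => s _; exact: sqr_ge0].
  have q0 : 0 <= B * (e / (B + 1)) by rewrite mulr_ge0// divr_ge0// ltW.
  rewrite /e1 -exprMn ler_pXn2r ?nnegrE ?q0 ?(ltW e0)//.
  rewrite mulrA ler_pdivrMr// mulrC ler_wpM2l ?(ltW e0)//; lra.
have dE : (fun h => h^-1 *: (((fun y => II 0 y m) \o shift t) (h *: (1 : R)) - II 0 t m)) @ 0^' --> m t.
  by rewrite -DF; exact: dF.
have GM : G h @[h --> 0^'] --> - m t.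
  apply: cvg_trans (cvgN dE); apply: near_eq_cvg; near=> h.
  have ht : `|h| < Num.min t (T - t).
    near: h; apply: dnbhs0_lt; rewrite !lt_min t0/= subr_gt0//.
  move: ht; rewrite lt_min => /andP[ht hT].
  have r0 : 0 < t + h by have := ler_norm (- h); rewrite normrN; lra.
  have rT : t + h < T by have := ler_norm h; lra.
  transitivity (- (h^-1 * (II 0 (h * 1 + t) m - II 0 t m))); first by [].
  by rewrite mulr1 /G !fE// [h + t]addrC; ring.
exact: cvg_unique GL GM.
Unshelve. all: end_near. Qed.

End TimeRegularity.

(** * The momentum equation tested with cutoffs *)

Section Momentum.
Context {R : realType}.
Implicit Types (f P : R -> R).

Definition rintg f : Prop := forall x : R, 0 < x -> x <= 1 -> intg x 1 f.

Lemma intg_rintg f : intg 0 1 f -> rintg f.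
Proof. by move=> h x x0 x1; apply: intg_sub h => //; exact: ltW. Qed.

Lemma rintg_weight f : mesI 0 1 f -> intg 0 1 (fun s => s * f s) -> rintg f.
Proof.
move=> mf h x x0 x1; have h' := intg_rintg h x0 x1.
have b : aeI x 1 (fun s => `|s^-1| <= x^-1).
  apply: aeI_all => s; rewrite in_itv/= => /andP[xs _]; have s0 := lt_trans x0 xs.
  by rewrite gtr0_norm ?invr_gt0// lef_pV2 ?posrE// ltW.
apply: (intg_ae _ _ (intgM_bnd h' (ac_mes (ac_inv x0 x1)) b)); first by apply: mesI_sub mf => //; exact: ltW.
apply: aeI_all => s; rewrite in_itv/= => /andP[xs _].
by rewrite mulKf// gt_eqF// (lt_trans x0).
Qed.

Lemma rintg_lintg f : rintg f -> lintg 0 1 f.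
Proof.
move=> h; have : acr (fun s => - II s 1 f) f.
  move=> x x0 x1; apply: acI; first exact: h.
  move=> y z xy yz z1; rewrite (II_split yz z1); first ring.
  by apply: h; [exact: lt_le_trans xy|exact: le_trans yz z1].
by move=> /acr_lac[].
Qed.

Lemma rintgB f g : rintg f -> rintg g -> rintg (fun s => f s - g s).
Proof. by move=> hf hg x x0 x1; apply: intgB; [exact: hf|exact: hg]. Qed.

Lemma cut_prim_intg P B lo f : cutoff P B lo -> rintg f -> intg 0 1 (fun s => f s * prim P s).
Proof.
move=> c h; have hac : acr (fun s => - II s 1 f) f.
  move=> x x0 x1; apply: acI; first exact: h.
  move=> y z xy yz z1; rewrite (II_split yz z1); first ring.
  by apply: h; [exact: lt_le_trans xy|exact: le_trans yz z1].
by have [] := cut_ibp c hac.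
Qed.

Lemma cut_P_intg P B lo f : cutoff P B lo -> intg 0 1 f -> intg 0 1 (fun s => f s * P s).
Proof.
move=> c h; have b : aeI 0 1 (fun s => `|P s| <= B) by apply: aeI_all => s _; exact: cut_bnd c s.
by have := intgM_bnd h (cut_mes c) b; congr intg; apply/funext => s; rewrite mulrC.
Qed.

Variable T : R.
Hypothesis T0 : 0 < T.

Lemma weight_fub (m : R -> R) (V : R -> R -> R) t0 : 0 < t0 -> t0 < T ->
  mes2 0 1 0 T V -> mesI 0 1 m ->
  linf1 0 1 0 T (fun s t => V s t * m s) -> aeI 0 1 (fun s => intg 0 T (V s)) ->
  [/\ intg 0 1 (fun s => II 0 t0 (V s) * m s),
      intg 0 t0 (fun t => II 0 1 (fun s => V s t * m s)) &
      II 0 1 (fun s => II 0 t0 (V s) * m s) = II 0 t0 (fun t => II 0 1 (fun s => V s t * m s))].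
Proof.
move=> t00 t0T mV mm l iV; have l' := linf1_restr (lexx 0) (ltW t0T) l.
have [i1 i2 i3 e] := fubini l'.
have ee : aeI 0 1 (fun s => II 0 t0 (V s) * m s = II 0 t0 (fun t => V s t * m s)).
  apply: aeI_imp iV => s _ i; have i' : intg 0 t0 (V s) by apply: intg_sub i => //; exact: ltW.
  have -> : (fun t => V s t * m s) = (fun t => m s * V s t) by apply/funext => t; rewrite mulrC.
  by rewrite (IIZ _ i') mulrC.
have mVm : mesI 0 1 (fun s => II 0 t0 (V s) * m s).
  apply: mesIM => //; have := mes2_sect_t (mes2_primt mV) (t := t0).
  by apply; rewrite in_itv/= t00.
have i := intg_ae mVm ee i2; split => //.
by rewrite (II_ae mVm (intg_mes i2) ee).
Qed.

Lemma cut_fub P B lo (U : R -> R -> R) t0 : cutoff P B lo -> linf1 0 1 0 T U -> 0 < t0 -> t0 < T ->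
  [/\ intg 0 1 (fun s => II 0 t0 (U s) * P s),
      intg 0 T (fun t => II 0 1 (fun s => U s t * P s)) &
      II 0 1 (fun s => II 0 t0 (U s) * P s) = II 0 t0 (fun t => II 0 1 (fun s => U s t * P s))].
Proof.
move=> c l t00 t0T; have [iU _ _ _] := fubini l.
have l2 : linf1 0 1 0 T (fun s t => U s t * P s).
  have -> : (fun s t => U s t * P s) = (fun s t => P s * U s t).
    by apply/funext => s; apply/funext => t; rewrite mulrC.
  apply: linf1_bnd => //; split; first by apply: mes2_s; exact: cut_mes c.
  by exists B; apply: aeI_all => t _; apply: aeI_all => s _; exact: cut_bnd c s.
have [_ _ i _] := fubini l2.
by have [h1 h2 h3] := weight_fub t00 t0T l.1 (cut_mes c) l2 iU.
Qed.

Lemma mesI_inv : mesI 0 1 (fun s : R => s^-1).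
Proof.
apply: open_continuous_measurable_fun; first exact: itv_open.
by move=> x; rewrite inE/= in_itv/= => /andP[x0 _]; apply: continuousV; [rewrite gt_eqF|exact: cvg_id].
Qed.

(** Integrability is known only for s V; since |prim P s| <= B s, the quotient [prim P s / s] is a
    bounded weight and makes up for the factor s. *)
Lemma cut_fub_prim P B lo (V : R -> R -> R) t0 : cutoff P B lo -> mes2 0 1 0 T V ->
  linf1 0 1 0 T (fun s t => s * V s t) -> 0 < t0 -> t0 < T ->
  [/\ intg 0 1 (fun s => II 0 t0 (V s) * prim P s),
      intg 0 T (fun t => II 0 1 (fun s => V s t * prim P s)) &
      II 0 1 (fun s => II 0 t0 (V s) * prim P s) = II 0 t0 (fun t => II 0 1 (fun s => V s t * prim P s))].
Proof.
move=> c mV l t00 t0T; have [iV _ _ _] := fubini l.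
have iV' : aeI 0 1 (fun s => intg 0 T (V s)).
  by apply: aeI_imp iV => s; rewrite in_itv/= => /andP[s0 _]; apply: intg_div; rewrite gt_eqF.
have mQ := ac_mes (prim_ac c).
have l2 : linf1 0 1 0 T (fun s t => V s t * prim P s).
  have bd : bndt T (fun s _ => prim P s / s).
    split; first by apply: mes2_s; apply: mesIM => //; exact: mesI_inv.
    exists B; apply: aeI_all => t _; apply: aeI_all => s; rewrite in_itv/= => /andP[s0 s1].
    by apply: prim_div c s0 _; exact: ltW.
  have [_ [M hM]] := linf1_bnd bd l.
  split; first by apply: mes2M => //; exact: mes2_s.
  have e t : aeI 0 1 (fun s => V s t * prim P s = prim P s / s * (s * V s t)).
    by apply: aeI_all => s; rewrite in_itv/= => /andP[s0 _]; field; rewrite gt_eqF.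
  exists M; apply: aeI_imp hM => t tt [i le_].
  have mVt : mesI 0 1 (fun s => V s t * prim P s) by apply: mesIM => //; exact: mes2_sect_t mV tt.
  split; first exact: intg_ae mVt (e t) i.
  rewrite (II_ae (mesI_abs mVt) (mesI_abs (intg_mes i)))//.
  by apply: aeI_imp (e t) => s _ ->.
have [_ _ i _] := fubini l2.
by have [h1 h2 h3] := weight_fub t00 t0T mV mQ l2 iV'.
Qed.

Lemma linf1_id (f : R -> R -> R) : linf1 0 1 0 T f -> linf1 0 1 0 T (fun s t => s * f s t).
Proof. by apply: linf1_bnd; exact: bndt_id. Qed.

Lemma rintg_II (V : R -> R -> R) t0 : mes2 0 1 0 T V -> linf1 0 1 0 T (fun s t => s * V s t) ->
  0 < t0 -> t0 < T -> rintg (fun s => II 0 t0 (V s)).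
Proof.
move=> mV l t00 t0T; have [iV _ _ _] := fubini l.
have l' := linf1_restr (lexx 0) (ltW t0T) l; have [_ i2 _ _] := fubini l'.
have mI : mesI 0 1 (fun s => II 0 t0 (V s)).
  by have := mes2_sect_t (mes2_primt mV) (t := t0); apply; rewrite in_itv/= t00.
apply: rintg_weight => //; apply: intg_ae i2; first by apply: mesIM => //; exact: mesI_id.
apply: aeI_imp iV => s; rewrite in_itv/= => /andP[s0 _] i.
rewrite IIZ//; apply: (@intg_div _ _ _ s); first by rewrite gt_eqF.
by apply: intg_sub i => //; exact: ltW.
Qed.

Lemma int0_const (f : R -> R) k : intg 0 T f -> aeI 0 T (fun t => II 0 t f = k) ->
  aeI 0 T (fun t => f t = 0).
Proof.
move=> i e; have l1 : lac 0 T (fun t => II 0 t f) f.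
  split; first exact: lintgW.
  move=> x y x0 xy yT; rewrite (II_split (ltW x0) xy); first ring.
  by apply: intg_sub i => //; exact: ltW.
have l2 : lac 0 T (fun=> k) (fun=> 0).
  by split=> [c d _ _|x y _ _ _]; [exact: intg_cst|rewrite II_0 subrr].
by have [] := lac_uniq l1 l2 e.
Qed.

(** The representation u = u(.,0) + int v is differentiated in s: it is tested with the family, the
    weak derivatives of u, v and u(.,0) are moved onto p, q and p0, and Fubini exchanges the
    integrals. *)
Lemma strain_repr (u p v q : R -> R -> R) (p0 : R -> R) :
  (forall t, 0 < t -> t < T -> aeI 0 1 (fun s => u s t = u s 0 + II 0 t (v s))) ->
  mesI 0 1 (fun s => u s 0) -> intg 0 1 (fun s => u s 0) ->
  aeI 0 T (fun t => [/\ weak_deriv 0 1 (u^~ t) (p^~ t), intg 0 1 (u^~ t) & intg 0 1 (p^~ t)]) ->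
  aeI 0 T (fun t => weak_deriv 0 1 (v^~ t) (q^~ t)) ->
  weak_deriv 0 1 (u^~ 0) p0 -> rintg p0 ->
  linf1 0 1 0 T v -> mes2 0 1 0 T q -> linf1 0 1 0 T (fun s t => s * q s t) ->
  aeI 0 T (fun t => aeI 0 1 (fun s => p s t = p0 s + II 0 t (q s))).
Proof.
move=> hu mu0 iu0 hw hvq h0 ip0 lv mq lq.
apply: aeI_imp hw => t; rewrite in_itv/= => /andP[t0 tT] [wu iu ip].
have iq := rintg_II mq lq t0 tT.
have rD : rintg (fun s => p s t - p0 s - II 0 t (q s)).
  by apply: rintgB => //; apply: rintgB => //; exact: intg_rintg.
suff Z : aeI 0 1 (fun s => p s t - p0 s - II 0 t (q s) = 0).
  by apply: aeI_imp Z => s _ /eqP; rewrite -addrA -opprD subr_eq0 => /eqP.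
apply: (fam_zero (rintg_lintg rD)) => j.
have [[B [lo c]] Q1] := @fam_cut R j.
have [a1 a2 a3] := cut_fub c lv t0 tT.
have [b1 b2 b3] := cut_fub_prim c mq lq t0 tT.
have ip' := cut_prim_intg c (intg_rintg ip); have ip0' := cut_prim_intg c ip0.
have -> : II 0 1 (fun s => (p s t - p0 s - II 0 t (q s)) * prim (fam j) s) =
    II 0 1 (fun s => p s t * prim (fam j) s) - II 0 1 (fun s => p0 s * prim (fam j) s)
    - II 0 1 (fun s => II 0 t (q s) * prim (fam j) s).
  by rewrite -(IIB ip' ip0') -(IIB (intgB ip' ip0') b1); apply: II_eq => s _; ring.
have e1 := fam_weak j wu; have e0 := fam_weak j h0.
have iu0' := cut_P_intg c iu0; have iu' := cut_P_intg c iu.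
have e2 : II 0 1 (fun s => u s t * fam j s) =
    II 0 1 (fun s => u s 0 * fam j s) + II 0 1 (fun s => II 0 t (v s) * fam j s).
  rewrite -(IID iu0' a1); apply: II_ae; [exact: intg_mes|apply: intg_mes; exact: intgD|].
  by apply: aeI_imp (hu t t0 tT) => s _ ->; ring.
have e3 : II 0 t (fun t => II 0 1 (fun s => v s t * fam j s)) =
    - II 0 t (fun t => II 0 1 (fun s => q s t * prim (fam j) s)).
  have tT' := ltW tT.
  have b2' : intg 0 t (fun t => II 0 1 (fun s => q s t * prim (fam j) s)) by apply: intg_sub b2.
  rewrite -(IIN b2'); apply: II_ae.
  - by apply: intg_mes; apply: intg_sub a2.
  - by apply: intg_mes; exact: intgN.
  - by apply: aeI_sub (lexx 0) tT' _; apply: aeI_imp hvq => r _ h; exact: fam_weak.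
have alg (a b d : R) : - b + - d = - a -> a - b - d = 0 by move=> h; rewrite -[a]opprK -h; ring.
by rewrite b3; rewrite a3 e3 in e2; rewrite e2 e0 in e1; exact: alg e1.
Qed.

Section Boundary.
Variables (xt v xtt k : R -> R -> R) (x1s : R -> R).
Hypotheses
  (hA : forall P B lo, cutoff P B lo -> aeI 0 T (fun t =>
     II 0 1 (fun s => xt s t * P s) = - II 0 1 (fun s => v s t * prim P s)))
  (hxt : forall t, 0 < t -> t < T -> aeI 0 1 (fun s => xt s t = xt s 0 + II 0 t (xtt s)))
  (ix0 : intg 0 1 (fun s => xt s 0)) (ixt : forall t, 0 < t -> t < T -> intg 0 1 (xt^~ t))
  (w1 : weak_deriv 0 1 (xt^~ 0) x1s) (lv : linf1 0 1 0 T v)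
  (lxtt : linf1 0 1 0 T xtt) (lk : linf1 0 1 0 T k)
  (hk : aeI 0 T (fun t => exists K, aeI 0 1 (fun s => xtt s t = K - II s 1 (k^~ t)))).

Let linf1_at (f : R -> R -> R) : linf1 0 1 0 T f -> aeI 0 T (fun t => intg 0 1 (f^~ t)).
Proof. by move=> [_ [M h]]; apply: aeI_imp h => t _ []. Qed.

Let xtt_cut P B lo t K : cutoff P B lo -> intg 0 1 (xtt^~ t) -> intg 0 1 (k^~ t) ->
  aeI 0 1 (fun s => xtt s t = K - II s 1 (k^~ t)) ->
  II 0 1 (fun s => xtt s t * P s) = K * prim P 1 - II 0 1 (fun s => k s t * prim P s).
Proof.
move=> c i ik e; have hac : acr (fun s => K - II s 1 (k^~ t)) (k^~ t).
  move=> x x0 x1; apply: acI; first exact: intg_rintg.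
  move=> y z xy yz z1; rewrite (II_split yz z1); first ring.
  by apply: intg_sub ik => //; apply: le_trans xy; exact: ltW.
have [j1 _ E] := cut_ibp c hac; rewrite (@II_nil R 1 1)// subr0 in E.
rewrite -E; apply: II_ae; [exact: intg_mes (cut_P_intg c i)|exact: intg_mes j1|].
by apply: aeI_imp e => s _ ->.
Qed.

(* The identity obtained by testing x_t = x_t(.,0) + int_0^t x_tt with P. *)
Let tested P B lo : cutoff P B lo -> aeI 0 T (fun t =>
  - II 0 1 (fun s => v s t * prim P s) = II 0 1 (fun s => xt s 0 * P s) +
    II 0 t (fun r => II 0 1 (fun s => xtt s r * P s))).
Proof.
move=> c; apply: aeI_imp (hA c) => t; rewrite in_itv/= => /andP[t0 tT] <-.
have [a1 a2 a3] := cut_fub c lxtt t0 tT.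
have i0 := cut_P_intg c ix0; rewrite -a3 -(IID i0 a1); apply: II_ae.
- by apply: intg_mes; apply: (cut_P_intg c); exact: ixt.
- by apply: intg_mes; exact: intgD.
- by apply: aeI_imp (hxt t0 tT) => s _ ->; ring.
Qed.

(** The constant K in [hk] is still unknown, but the primitives of the family vanish at s = 1 and K
    drops out of the tested identity. *)
Lemma velocity_repr : aeI 0 T (fun t => aeI 0 1 (fun s => v s t = x1s s + II 0 t (k s))).
Proof.
have ht : aeI 0 T (fun t => forall j, - II 0 1 (fun s => v s t * prim (fam j) s) =
    II 0 1 (fun s => xt s 0 * fam j s) + II 0 t (fun r => II 0 1 (fun s => xtt s r * fam j s))).
  by apply: aeI_count => j; have [[B [lo c]] _] := @fam_cut R j; exact: tested c.
apply: aeI_imp2 ht (linf1_at lv) => t; rewrite in_itv/= => /andP[t0 tT] ht iv.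
have [_ /locally_lintg l1 _] := w1.
have [_ iIk _ _] := fubini (linf1_restr (lexx 0) (ltW tT) lk).
have lD : lintg 0 1 (fun s => v s t - x1s s - II 0 t (k s)).
  by move=> c d c0 d1; apply: intgB; [apply: intgB; [exact: lintgW iv _ _ _ _|exact: l1]|exact: lintgW iIk _ _ _ _].
suff Z : aeI 0 1 (fun s => v s t - x1s s - II 0 t (k s) = 0).
  by apply: aeI_imp Z => s _ /eqP; rewrite -addrA -opprD subr_eq0 => /eqP.
apply: (fam_zero lD) => j.
have [[B [lo c]] Q1] := @fam_cut R j.
have [b1 b2 b3] := cut_fub_prim c lk.1 (linf1_id lk) t0 tT.
have [_ a2 _] := cut_fub c lxtt t0 tT.
have iv' := fam_prim_intg j (lintgW iv); have i1' := fam_prim_intg j l1.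
have -> : II 0 1 (fun s => (v s t - x1s s - II 0 t (k s)) * prim (fam j) s) =
    II 0 1 (fun s => v s t * prim (fam j) s) - II 0 1 (fun s => x1s s * prim (fam j) s)
    - II 0 1 (fun s => II 0 t (k s) * prim (fam j) s).
  by rewrite -(IIB iv' i1') -(IIB (intgB iv' i1') b1); apply: II_eq => s _; ring.
have e1 := fam_weak j w1; have e2 := ht j; rewrite e1 in e2.
have e3 : II 0 t (fun t => II 0 1 (fun s => xtt s t * fam j s)) =
    - II 0 t (fun t => II 0 1 (fun s => k s t * prim (fam j) s)).
  have b2' : intg 0 t (fun t => II 0 1 (fun s => k s t * prim (fam j) s)).
    by apply: intg_sub b2 => //; exact: ltW.
  rewrite -(IIN b2'); apply: II_ae.
  - by apply: intg_mes; apply: intg_sub a2 => //; exact: ltW.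
  - by apply: intg_mes; exact: intgN.
  - apply: aeI_sub (lexx 0) (ltW tT) _; apply: aeI_imp3 hk (linf1_at lxtt) (linf1_at lk) => r _ [K e] i ik.
    by rewrite (xtt_cut c i ik e) Q1 mulr0 sub0r.
have alg (a b d : R) : - a = - b + - d -> a - b - d = 0 by move=> h; rewrite -[a]opprK h; ring.
by rewrite b3; rewrite e3 in e2; exact: alg e2.
Qed.

(** Here the test function equals 1 at s = 1 and keeps K. By [velocity_repr] everything else
    cancels, so the integral of K over []0, t[] does not depend on t, and K = 0. The condition x = 0
    at s = 1 enters through [hA], which holds for cutoffs with nonzero boundary value. *)
Lemma boundary_flux : aeI 0 T (fun t => aeI 0 1 (fun s => xtt s t = - II s 1 (k^~ t))).
Proof.
have c := @step_cutoff R.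
have iT2 : 0 < T / 2 by rewrite divr_gt0.
have T2T : T / 2 < T by lra.
have [_ a2 _] := cut_fub c lxtt iT2 T2T.
have [_ b2 _] := cut_fub_prim c lk.1 (linf1_id lk) iT2 T2T.
(* The constant expressed through tested integrals, which makes it an integrable function of t. *)
pose Kf t := II 0 1 (fun s => xtt s t * step s) + II 0 1 (fun s => k s t * prim (@step R) s).
have iKf : intg 0 T Kf by exact: intgD.
have hK : aeI 0 T (fun t => aeI 0 1 (fun s => xtt s t = Kf t - II s 1 (k^~ t))).
  apply: aeI_imp3 hk (linf1_at lxtt) (linf1_at lk) => r _ [K e] i ik.
  by have := xtt_cut c i ik e; rewrite prim_step mulr1 /Kf => ->; rewrite subrK.
(* A weak derivative is only locally integrable; integrability up to s = 1 follows from
   [velocity_repr] at a single time. *)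
have rx1 : rintg x1s.
  have [t tt [et iv]] := aeI_ex T0 (aeI_and velocity_repr (linf1_at lv)).
  move: tt; rewrite in_itv/= => /andP[t0 tT].
  have [_ iIk _ _] := fubini (linf1_restr (lexx 0) (ltW tT) lk).
  have [_ l1 _] := w1; have m1 : mesI 0 1 x1s by have [] := l1.
  apply: intg_rintg; apply: intg_ae m1 _ (intgB iv iIk).
  by apply: aeI_imp et => s _ ->; rewrite addrK.
have hc : aeI 0 T (fun t => II 0 t Kf = - II 0 1 (fun s => x1s s * prim (@step R) s) -
    II 0 1 (fun s => xt s 0 * step s)).
  apply: aeI_imp3 (tested c) velocity_repr (linf1_at lv) => t; rewrite in_itv/= => /andP[t0 tT] e1 e2 iv.
  have [c1 _ c3] := cut_fub_prim c lk.1 (linf1_id lk) t0 tT.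
  have i1 := cut_prim_intg c rx1; have i2 := cut_prim_intg c (intg_rintg iv).
  have E : II 0 1 (fun s => v s t * prim (@step R) s) = II 0 1 (fun s => x1s s * prim (@step R) s) +
      II 0 1 (fun s => II 0 t (k s) * prim (@step R) s).
    rewrite -(IID i1 c1); apply: II_ae; [exact: intg_mes i2|apply: intg_mes; exact: intgD|].
    by apply: aeI_imp e2 => s _ ->; ring.
  have tT' := ltW tT.
  have a2' := intg_sub (lexx 0) tT' a2; have b2' := intg_sub (lexx 0) tT' b2.
  rewrite (IID a2' b2') -c3; rewrite E in e1.
  have alg (a b d e : R) : - (a + b) = d + e -> e + b = - a - d.
    by move=> h; have -> : e = - (a + b) - d by [rewrite h; ring]; ring.
  exact: alg e1.
apply: aeI_imp2 hK (int0_const iKf hc) => t _ h K0; apply: aeI_imp h => s _ ->.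
by rewrite K0 sub0r.
Qed.

End Boundary.

End Momentum.

(** * The tension equation at a fixed time *)

Section Tension1D.
Context {R : realType}.
Implicit Types (f g : R -> R).

Lemma weak_cont_lac (a b : R) f f' : a < b -> weak_deriv a b f f' ->
  (forall x, a < x -> x < b -> {for x, continuous f}) -> lac a b f f'.
Proof.
move=> ab h cf; have [w [lw e]] := weak_lac ab h.
have E := cont_ae_eq cf (fun x ax xb => lac_cont lw ax xb) e.
split; first exact: lw.1.
move=> x y ax xy yb; rewrite (E y (lt_le_trans ax xy) yb) (E x ax (le_lt_trans xy yb)).
exact: lw.2.
Qed.

Lemma lac_ae (a b : R) f f' g' : lac a b f f' -> lintg a b g' ->
  aeI a b (fun x => f' x = g' x) -> lac a b f g'.
Proof.
move=> [l h] lg e; split => // x y ax xy yb; rewrite h//; apply: II_ae.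
- exact: intg_mes (l _ _ ax yb).
- exact: intg_mes (lg _ _ ax yb).
- by apply: aeI_sub e; exact: ltW.
Qed.

Lemma lac_diff (a b : R) f g f' : a < b -> lac a b f f' -> lac a b g f' ->
  exists k, forall x, a < x -> x < b -> f x = g x + k.
Proof.
move=> ab hf hg; pose m := (a + b) / 2.
have am : a < m by rewrite /m; lra.
have mb : m < b by rewrite /m; lra.
exists (f m - g m) => x ax xb; have [mx|xm] := leP m x.
  by have := hf.2 _ _ am mx xb; have := hg.2 _ _ am mx xb; lra.
by have := hf.2 _ _ ax (ltW xm) mb; have := hg.2 _ _ ax (ltW xm) mb; lra.
Qed.

Lemma ac_lac (a b : R) f f' : ac a b f f' -> lac a b f f'.
Proof.
move=> h; split; first exact: lintgW h.1.
by move=> x y ax xy yb; apply: (ac_inc h) => //; exact: ltW.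
Qed.

Lemma lac_eq_right (a b : R) f g f' : a < b -> lac a b f f' -> ac a b g f' ->
  f x @[x --> b^'-] --> g b -> forall x, a < x -> x < b -> f x = g x.
Proof.
move=> ab hf hg lf; have [k hk] := lac_diff ab hf (ac_lac hg).
have lg : (g x + k) @[x --> b^'-] --> g b + k.
  by apply: cvgD; [exact: ac_lim_right hg|exact: cvg_cst].
have := lim_right_eq ab hk lf lg => e x ax xb.
by rewrite hk//; have -> : k = 0 by [lra]; rewrite addr0.
Qed.

Lemma lac_eq_left (a b : R) f g f' : a < b -> lac a b f f' -> ac a b g f' ->
  f x @[x --> a^'+] --> g a -> forall x, a < x -> x < b -> f x = g x.
Proof.
move=> ab hf hg lf; have [k hk] := lac_diff ab hf (ac_lac hg).
have lg : (g x + k) @[x --> a^'+] --> g a + k.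
  by apply: cvgD; [exact: ac_lim_left hg|exact: cvg_cst].
have := lim_left_eq ab hk lf lg => e x ax xb.
by rewrite hk//; have -> : k = 0 by [lra]; rewrite addr0.
Qed.

Lemma near_left_bound (a b : R) f l : a < b -> f x @[x --> b^'-] --> l ->
  exists m, [/\ a < m, m < b & forall x, m <= x -> x < b -> `|f x| <= `|l| + 1].
Proof.
move=> ab /cvgrPdist_le/(_ 1 ltr01) [d /= d0 h].
exists (Num.max ((a + b) / 2) (b - d / 2)); split.
- by rewrite lt_max; apply/orP; left; lra.
- by rewrite gt_max; apply/andP; split; lra.
move=> x; rewrite ge_max => /andP[h1 h2] xb.
have : `|l - f x| <= 1 by apply: h => //=; rewrite gtr0_norm ?subr_gt0//; lra.
move=> h3; have -> : f x = l - (l - f x) by ring.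
by apply: (le_trans (ler_normB _ _)); rewrite lerD2l.
Qed.

Lemma near_right_bound (a b : R) f l : a < b -> f x @[x --> a^'+] --> l ->
  exists m, [/\ a < m, m < b & forall x, a < x -> x <= m -> `|f x| <= `|l| + 1].
Proof.
move=> ab /cvgrPdist_le/(_ 1 ltr01) [d /= d0 h].
exists (Num.min ((a + b) / 2) (a + d / 2)); split.
- by rewrite lt_min; apply/andP; split; lra.
- by rewrite gt_min; apply/orP; left; lra.
move=> x ax; rewrite le_min => /andP[h1 h2].
have : `|l - f x| <= 1 by apply: h => //=; rewrite distrC gtr0_norm ?subr_gt0//; lra.
move=> h3; have -> : f x = l - (l - f x) by ring.
by apply: (le_trans (ler_normB _ _)); rewrite lerD2l.
Qed.

(** The limits control f near 0 and f' near 1, whence f near 1 by integration; compactness covers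
    the middle. For the tension this bound makes tau |x''|^2 integrable before anything else is
    known. *)
Lemma lac_bounded f f' (l m : R) : lac 0 1 f f' -> f x @[x --> 0^'+] --> l ->
  f' x @[x --> 1^'-] --> m -> exists B, forall x, 0 < x -> x < 1 -> `|f x| <= B.
Proof.
move=> h hl hm.
have [a [a0 a1 ha]] := near_right_bound ltr01 hl.
have [b [b0 b1 hb]] := near_left_bound ltr01 hm.
pose c := Num.max a b.
have ac_ : a <= c by rewrite le_max lexx.
have bc : b <= c by rewrite le_max lexx orbT.
have c1 : c < 1 by rewrite gt_max a1.
have hac := lac_ac h a0 c1.
pose D := `|f a| + II a c (fun z => `|f' z|).
have hD x : a <= x -> x <= c -> `|f x| <= D by exact: ac_bnd hac.
have D0 : 0 <= D by exact: le_trans (normr_ge0 _) (hD c ac_ (lexx _)).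
exists (`|l| + 1 + D + (`|m| + 1)) => x x0 x1.
have l0 : 0 <= `|l| := normr_ge0 l; have m0 : 0 <= `|m| := normr_ge0 m.
have [xa|ax] := leP x a; first by have := ha x x0 xa; lra.
have [xc|cx] := leP x c; first by have := hD x (ltW ax) xc; lra.
have c0 : 0 < c := lt_le_trans a0 ac_.
have e := h.2 _ _ c0 (ltW cx) x1.
have -> : f x = f c + II c x f' by rewrite -e; ring.
apply: (le_trans (ler_normD _ _)).
have h1 := hD c ac_ (lexx _).
have h2 : `|II c x f'| <= `|m| + 1.
  have m1 : mesI c x f' := intg_mes (h.1 _ _ c0 x1).
  have := @II_bnd _ c x f' (`|m| + 1) (ltW cx) m1 _.
  move=> H; apply: (@le_trans _ _ ((`|m| + 1) * (x - c))); last first.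
    by rewrite ler_piMr//; lra.
  apply: H; apply: aeI_all => z; rewrite in_itv/= => /andP[cz zx].
  by apply: hb; [exact: le_trans bc (ltW cz)|exact: lt_trans x1].
lra.
Qed.

(** Integrating the equation from s = 1 and the result from s = 0 yields representatives on the
    closed interval; they agree with tau' and tau inside because these are continuous up to s = 1
    and s = 0 respectively. As tau P >= 0, tau' is at most its value at 1 plus the integral of V,
    which gives the upper bound b + N. *)
Lemma tension_1d (tau taus tauss P V : R -> R) (c0 N b : R) : 0 < c0 -> 0 <= N ->
  weak_deriv 0 1 tau taus -> weak_deriv 0 1 taus tauss ->
  {within `[0, 1[, continuous tau} -> {within `]0, 1], continuous taus} ->
  tau 0 = 0 -> (forall s, 0 < s -> s < 1 -> c0 * s <= tau s) ->
  intg 0 1 P -> (forall s, 0 <= P s) -> II 0 1 P <= N ->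
  intg 0 1 V -> (forall s, 0 <= V s) -> II 0 1 V <= N ->
  `|taus 1| <= b -> aeI 0 1 (fun s => tauss s = tau s * P s - V s) ->
  let ta2 := fun s => tau s * P s - V s in
  let ta1 := fun s => if 0 < s then taus s else taus 1 - II 0 1 ta2 in
  let ta := fun s => if s < 1 then tau s else II 0 1 ta1 in
  [/\ ac 0 1 ta ta1, ac 0 1 ta1 ta2,
    forall s, 0 < s -> s <= 1 -> c0 * s <= ta s,
    forall s, 0 <= s -> s <= 1 -> ta s <= (b + N) * s &
    forall s, 0 <= s -> s <= 1 -> `|ta1 s| <= b + (b + N) * N + N].
Proof.
move=> c00 N0 w1 w2 ct cts tau0 low iP P0 PN iV V0 VN bb e ta2 ta1 ta.
have [ct1 ct2] := within_co ltr01 ct; have [cs1 cs2] := within_oc ltr01 cts.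
have l1 := weak_cont_lac ltr01 w1 ct1; have l2 := weak_cont_lac ltr01 w2 cs1.
have [B hB] := lac_bounded l1 ct2 cs2.
have mtau : mesI 0 1 tau by have [[]] := w1.
have bt : aeI 0 1 (fun s => `|tau s| <= B).
  by apply: aeI_all => s; rewrite in_itv/= => /andP[s0 s1]; exact: hB.
have i2 : intg 0 1 ta2 by apply: intgB => //; exact: intgM_bnd iP mtau bt.
have l2' : lac 0 1 taus ta2 := lac_ae l2 (lintgW i2) e.
pose W s := taus 1 - II s 1 ta2.
have hW : ac 0 1 W ta2.
  apply: acI => // x y x0 xy y1; rewrite /W (II_split xy y1); first ring.
  exact: intg_sub i2.
have W1 : W 1 = taus 1 by rewrite /W II_nil// subr0.
have tW s : 0 < s -> s < 1 -> taus s = W s.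
  by apply: (lac_eq_right ltr01 l2' hW); rewrite W1.
have E1 s : 0 <= s -> s <= 1 -> W s = ta1 s.
  rewrite le_eqVlt => /orP[/eqP<- _|s0]; first by rewrite /ta1 ltxx.
  rewrite le_eqVlt => /orP[/eqP->|s1]; first by rewrite W1 /ta1 ltr01.
  by rewrite -tW// /ta1 s0.
have h1 : ac 0 1 ta1 ta2 by apply: (ac_eq hW i2 E1); apply: aeI_all.
have i1 : intg 0 1 ta1 := ac_intg h1.
have hZ : ac 0 1 (fun s => II 0 s ta1) ta1 := ac_II i1.
have l1' : lac 0 1 tau ta1.
  apply: (lac_ae l1 (lintgW i1)); apply: aeI_all => s; rewrite in_itv/= => /andP[s0 _].
  by rewrite /ta1 s0.
have tZ s : 0 < s -> s < 1 -> tau s = II 0 s ta1.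
  have Z0 : II 0 0 ta1 = tau 0 by rewrite tau0 II_nil.
  have l : tau x @[x --> 0^'+] --> II 0 0 ta1 by rewrite Z0.
  exact: (lac_eq_left ltr01 l1' hZ l).
have EZ s : 0 <= s -> s <= 1 -> II 0 s ta1 = ta s.
  rewrite le_eqVlt => /orP[/eqP<- _|s0]; first by rewrite /ta ltr01 tau0 II_nil.
  rewrite le_eqVlt => /orP[/eqP->|s1]; first by rewrite /ta ltxx.
  by rewrite /ta s1 tZ.
have h0 : ac 0 1 ta ta1 by apply: (ac_eq hZ i1 EZ); apply: aeI_all.
have lows s : 0 < s -> s <= 1 -> c0 * s <= ta s.
  move=> s0; rewrite le_eqVlt => /orP[/eqP->|s1]; last by rewrite /ta s1; exact: low.
  rewrite mulr1; apply/ler_addgt0Pr => d d0.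
  have d2 : 0 < d / 2 by rewrite divr_gt0.
  have [r r0 hr] := ac_unif d2 h0.
  (* So close to 1 that the oscillation of [ta] and the loss c0 (1 - z) each cost at most d/2. *)
  pose z := Num.max (1 / 2) (Num.max (1 - r / 2) (1 - d / (2 * c0))).
  have q0 : 0 < d / (2 * c0) by rewrite divr_gt0// mulr_gt0.
  have z1 : z < 1 by rewrite !gt_max; apply/and3P; split; lra.
  have z2 : 1 / 2 <= z by rewrite le_max lexx.
  have z3 : 1 - r / 2 <= z by rewrite !le_max lexx orbT.
  have z4 : 1 - d / (2 * c0) <= z by rewrite !le_max lexx !orbT.
  have z0 : 0 < z by lra.
  have := hr z 1 (ltW z0) (ltW z1) (lexx _) ltac:(lra).
  have -> : ta z = tau z by rewrite /ta z1.
  rewrite ler_norml => /andP[hz _]; have := low z z0 z1.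
  have : c0 * (1 - d / (2 * c0)) <= c0 * z by rewrite ler_wpM2l// ltW.
  have -> : c0 * (1 - d / (2 * c0)) = c0 - d / 2 by field; rewrite gt_eqF.
  lra.
have iTP : intg 0 1 (fun s => tau s * P s) := intgM_bnd iP mtau bt.
have tp s : 0 < s -> s < 1 -> 0 <= tau s.
  by move=> s0 s1; apply: le_trans (low s s0 s1); rewrite mulr_ge0// ltW.
have up1 s : 0 <= s -> s <= 1 -> ta1 s <= b + N.
  move=> s0 s1; rewrite -E1// /W /ta2 IIB; [|exact: intg_sub iTP|exact: intg_sub iV].
  have x1 : 0 <= II s 1 (fun s => tau s * P s).
    apply: II_ge0; first by apply: intg_mes; exact: intg_sub iTP.
    apply: aeI_all => z; rewrite in_itv/= => /andP[sz z1].
    by rewrite mulr_ge0// tp// (le_lt_trans s0).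
  have x2 : II s 1 V <= N by apply: le_trans VN; apply: II_mono => //; apply: aeI_all.
  have := le_trans (ler_norm _) bb; lra.
have ups s : 0 <= s -> s <= 1 -> ta s <= (b + N) * s.
  move=> s0 s1; rewrite -EZ//.
  have := II_le (intg_sub (lexx 0) s1 i1) (intg_cst 0 s (b + N)); rewrite (II_cst _ s0) subr0; apply.
  by apply: aeI_all => z; rewrite in_itv/= => /andP[z0 zs]; apply: up1; [exact: ltW|exact: le_trans (ltW zs) s1].
split => // s s0 s1; rewrite -E1// /W.
apply: (le_trans (ler_normB _ _)); rewrite -addrA; apply: lerD => //.
apply: (le_trans (II_abs2 s0 s1 i2)).
have bN : 0 <= b + N by rewrite addr_ge0//; exact: le_trans (normr_ge0 _) bb.
have i3 : intg 0 1 (fun s => (b + N) * P s + V s) by apply: intgD => //; exact: intgZ.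
apply: (@le_trans _ _ (II 0 1 (fun s => (b + N) * P s + V s))); last first.
  by rewrite (IID (intgZ _ iP) iV) (IIZ _ iP) lerD// ler_wpM2l.
apply: (II_le (intg_abs i2) i3); apply: aeI_all => z; rewrite in_itv/= => /andP[z0 z1].
rewrite /ta2; apply: (le_trans (ler_normB _ _)); rewrite (ger0_norm (V0 z)) lerD2r normrM.
rewrite (ger0_norm (P0 z)) (ger0_norm (tp z z0 z1)) ler_wpM2r//.
have := ups z (ltW z0) (ltW z1); rewrite /ta z1 => h; apply: (le_trans h).
by rewrite ler_piMr// ltW.
Qed.

End Tension1D.

Section Misc.
Context {R : realType}.
Variable T : R.

Lemma linf2_ae (f g : R -> R -> R) : mes2 0 1 0 T g ->
  aeI 0 T (fun t => aeI 0 1 (fun s => g s t = f s t)) -> linf2 T f -> linf2 T g.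
Proof.
move=> mg e [mf [M hM]]; split => //; exists M.
apply: aeI_imp2 e hM => t tt e [i l].
have mgt : mesI 0 1 (fun s => g s t ^+ 2) by apply: (mesIX 2); exact: mes2_sect_t mg tt.
have e2 : aeI 0 1 (fun s => g s t ^+ 2 = f s t ^+ 2) by apply: aeI_imp e => s _ ->.
by split; [exact: intg_ae e2 i|rewrite (II_ae mgt (intg_mes i) e2)].
Qed.

Lemma within_coord (A : set R) (f : R -> 'rV[R]_3) i : {within A, continuous f} ->
  {within A, continuous (fun s => f s 0 i)}.
Proof.
move=> cf x; apply: (@continuous_comp _ _ _ (f : subspace A -> _) (fun a : 'rV[R]_3 => a 0 i)).
  exact: cf.
exact: coord_continuous.
Qed.

End Misc.

Lemma cont_sumsq (R : realType) n (f : 'I_n -> R -> R) r : (forall j, {for r, continuous (f j)}) ->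
  {for r, continuous (fun t => \sum_j f j t ^+ 2)}.
Proof.
elim: n f => [|n IH] f h.
  rewrite (_ : (fun t => _) = fun=> 0); first exact: cvg_cst.
  by apply/funext => t; rewrite big_ord0.
rewrite (_ : (fun t => _) = fun t => f ord0 t * f ord0 t + \sum_j f (lift ord0 j) t ^+ 2).
  by apply: cvgD; [apply: cvgM; exact: h|apply: IH => j; exact: h].
by apply/funext => t; rewrite big_ord_recl expr2.
Qed.

(** * Solutions of the transformed problem *)

Section Solution.
Context {R : realType}.
Notation mu := (@lebesgue_measure R).
Variables (g : 'rV[R]_3) (T c0 M M' : R).
Variables (x xs xt u1 u2 v v1 xtt flux xss xst : R -> R -> 'rV[R]_3).
Variables (tau taus tauss : R -> R -> R) (x0s x1s : R -> 'rV[R]_3).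

Hypotheses (T0 : 0 < T) (c00 : 0 < c0)
  (H1 : forall t : R, t \in `[0, T] -> weak_derivV 0 1 (x^~ t) (xs^~ t))
  (H2 : weak_dsV T xs u1) (H3 : weak_dsV T u1 u2)
  (H4 : ae_t T (fun t => (X2sq (xs^~ t) (u1^~ t) (u2^~ t) <= M%:E)%E))
  (H5 : weak_dtV T xs v) (H6 : weak_dsV T v v1)
  (H7 : ae_t T (fun t => (X1sq (v^~ t) (v1^~ t) <= M'%:E)%E))
  (H9 : C1_L2 T x xt) (H10 : C0_X1 T xs)
  (H11 : forall t : R, t \in `[0, T] -> {within `]0, 1], continuous (x^~ t)})
  (H12 : forall t : R, t \in `[0, T] -> {within `]0, 1], continuous (xs^~ t)})
  (H13 : weak_dtV T xt xtt) (H14 : weak_dsV T (fun s t => tau s t *: xs s t) flux)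
  (H15 : ae_Q T (fun s t => xtt s t - flux s t = g))
  (H16 : forall t : R, t \in `]0, T[ -> x 1 t = 0)
  (H17 : weak_dsV T xs xss) (H18 : weak_dtV T xs xst)
  (H19 : weak_ds T tau taus) (H20 : weak_ds T taus tauss)
  (H21 : ae_Q T (fun s t => - tauss s t + enorm (xss s t) ^+ 2 * tau s t = enorm (xst s t) ^+ 2))
  (H22 : ae_t T (fun t => [/\ {within `[0, 1[, continuous (tau^~ t)},
              {within `]0, 1], continuous (taus^~ t)},
              tau 0 t = 0 &
              taus 1 t = - dotp g (xs 1 t)]))
  (H23 : forall s t : R, s \in `]0, 1[ -> t \in `]0, T[ -> c0 <= tau s t / s)
  (H24 : aeI 0 1 (fun s => xs s 0 = x0s s))
  (H25 : weak_derivV 0 1 (xt^~ 0) x1s)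
  (H26 : ae_s (fun s => enorm (x0s s) = 1))
  (H27 : ae_s (fun s => dotp (x0s s) (x1s s) = 0)).

Let N : R := `|M| + `|M'|.
Let N0 : 0 <= N. Proof. by rewrite addr_ge0. Qed.

Definition comp (f : R -> R -> 'rV[R]_3) (i : 'I_3) (s t : R) : R := f s t 0 i.

Lemma ae_Q_ts (P : R -> R -> Prop) : ae_Q T P -> aeI 0 T (fun t => aeI 0 1 (fun s => P s t)).
Proof.
move=> /ae_prod; rewrite /aeI; apply: filterS => t h tt.
by move: h; apply: filterS => s h ss; exact: h.
Qed.

Lemma in_cc t : t \in `]0, T[ -> t \in `[0, T].
Proof. by rewrite !in_itv/= => /andP[t0 tT]; rewrite !ltW. Qed.

Let m_u i : mes2 0 1 0 T (comp xs i). Proof. by have [] := H2 i. Qed.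
Let m_p i : mes2 0 1 0 T (comp u1 i). Proof. by have [] := H2 i. Qed.
Let m_r i : mes2 0 1 0 T (comp u2 i). Proof. by have [] := H3 i. Qed.
Let m_v i : mes2 0 1 0 T (comp v i). Proof. by have [] := H5 i. Qed.
Let m_q i : mes2 0 1 0 T (comp v1 i). Proof. by have [] := H6 i. Qed.

Let m_scal (h : R -> R) (f : R -> 'rV[R]_3) : mesI 0 1 h -> (forall i, mesI 0 1 (fun s => f s 0 i)) ->
  forall i, mesI 0 1 (fun s => (h s *: f s) 0 i).
Proof.
move=> mh mf i; have -> : (fun s => (h s *: f s) 0 i) = (fun s => h s * f s 0 i).
  by apply/funext => s; rewrite mxE.
exact: mesIM.
Qed.

Let m_sqrt : mesI 0 1 (Num.sqrt : R -> R).
Proof. by apply: cont_mesI => z; exact: sqrt_continuous. Qed.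

Lemma X2_bounds : aeI 0 T (fun t => forall i,
  [/\ intg 0 1 (fun s => comp xs i s t ^+ 2) /\ II 0 1 (fun s => comp xs i s t ^+ 2) <= N,
      intg 0 1 (fun s => comp u1 i s t ^+ 2) /\ II 0 1 (fun s => comp u1 i s t ^+ 2) <= N &
      intg 0 1 (fun s => (s * comp u2 i s t) ^+ 2) /\
      II 0 1 (fun s => (s * comp u2 i s t) ^+ 2) <= N]).
Proof.
apply: aeI_imp H4 => t tt; rewrite /X2sq.
have a1 := L2sq_ge0 (xs^~ t); have a2 := L2sq_ge0 (u1^~ t).
have a3 := L2sq_ge0 (fun s => s *: u2 s t).
move=> h i; have MN : (M%:E <= N%:E)%E.
  by rewrite lee_fin /N; apply: (le_trans (ler_norm _)); rewrite lerDl.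
have {}h := le_trans h MN.
have b1 : (L2sq (xs^~ t) <= N%:E)%E.
  by apply: le_trans h; rewrite -addeA leeDl// adde_ge0.
have b2 : (L2sq (u1^~ t) <= N%:E)%E.
  by apply: le_trans h; rewrite addeAC leeDr// adde_ge0.
have b3 : (L2sq (fun s => s *: u2 s t)%R <= N%:E)%E.
  by apply: le_trans h; rewrite leeDr// adde_ge0.
have c3 := L2sq_le (m_scal (@mesI_id _ _ _) (fun i => mes2_sect_t (m_r i) tt)) b3 i.
split; [exact: (L2sq_le (fun i => mes2_sect_t (m_u i) tt) b1 i)|
  exact: (L2sq_le (fun i => mes2_sect_t (m_p i) tt) b2 i)|].
have e : (fun s => (s *: u2 s t) 0 i ^+ 2) = (fun s => (s * comp u2 i s t) ^+ 2).
  by apply/funext => s; rewrite mxE.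
by rewrite -e.
Qed.

Lemma X1_bounds : aeI 0 T (fun t => forall i,
  [/\ intg 0 1 (fun s => comp v i s t ^+ 2), II 0 1 (fun s => comp v i s t ^+ 2) <= N,
      intg 0 1 (fun s => (Num.sqrt s * comp v1 i s t) ^+ 2) &
      II 0 1 (fun s => (Num.sqrt s * comp v1 i s t) ^+ 2) <= N]).
Proof.
apply: aeI_imp H7 => t tt; rewrite /X1sq.
have a1 := L2sq_ge0 (v^~ t); have a3 := L2sq_ge0 (fun s => Num.sqrt s *: v1 s t).
move=> h i; have MN : (M'%:E <= N%:E)%E.
  by rewrite lee_fin /N; apply: (le_trans (ler_norm _)); rewrite lerDr.
have {}h := le_trans h MN.
have b1 : (L2sq (v^~ t) <= N%:E)%E by apply: le_trans h; rewrite leeDl.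
have b3 : (L2sq (fun s => Num.sqrt s *: v1 s t)%R <= N%:E)%E by apply: le_trans h; rewrite leeDr.
have [c1 c2] := L2sq_le (fun i => mes2_sect_t (m_v i) tt) b1 i.
have c3 := L2sq_le (m_scal m_sqrt (fun i => mes2_sect_t (m_q i) tt)) b3 i.
have e : (fun s => (Num.sqrt s *: v1 s t) 0 i ^+ 2) = (fun s => (Num.sqrt s * comp v1 i s t) ^+ 2).
  by apply/funext => s; rewrite mxE.
by rewrite e in c3; have [c4 c5] := c3.
Qed.

Let p_linf2 i : linf2 T (comp u1 i).
Proof. by split => //; exists N; apply: aeI_imp X2_bounds => t _ /(_ i)[]. Qed.

Let v_linf2' i : linf2 T (comp v i).
Proof. by split => //; exists N; apply: aeI_imp X1_bounds => t _ /(_ i)[]. Qed.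

Let sr_linf2 i : linf2 T (fun s t => s * comp u2 i s t).
Proof.
split; first by apply: mes2M => //; apply: mes2_s; exact: mesI_id.
by exists N; apply: aeI_imp X2_bounds => t _ /(_ i)[].
Qed.

Let sq_linf2 i : linf2 T (fun s t => s * comp v1 i s t).
Proof.
split; first by apply: mes2M => //; apply: mes2_s; exact: mesI_id.
exists N; apply: aeI_imp X1_bounds => t tt /(_ i)[_ _ j l].
have b : aeI 0 1 (fun s => `|(s * comp v1 i s t) ^+ 2| <= (Num.sqrt s * comp v1 i s t) ^+ 2).
  apply: aeI_all => s; rewrite in_itv/= => /andP[s0 s1].
  rewrite ger0_norm ?sqr_ge0//; move: (comp v1 i s t) => y; rewrite !exprMn ler_wpM2r ?sqr_ge0//.
  by rewrite (sqr_sqrtr (ltW s0)) expr2 ler_piMr ?(ltW s0)// ltW.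
have m : mesI 0 1 (fun s => (s * comp v1 i s t) ^+ 2).
  by apply: (mesIX 2); apply: mesIM; [exact: mesI_id|exact: mes2_sect_t (m_q i) tt].
have j2 := intg_le m b j; split => //; apply: le_trans l; apply: (II_le j2 j).
by apply: aeI_imp b => s _; apply: le_trans; exact: ler_norm.
Qed.

Let cont_u i t : t \in `[0, T] -> {within `]0, 1], continuous ((comp xs i)^~ t)}.
Proof. by move=> tt; apply: within_coord; exact: H12. Qed.

Lemma strain_reg : aeI 0 T (fun t => forall i, acr ((comp xs i)^~ t) ((comp u1 i)^~ t) /\
  forall s, 0 < s -> s <= 1 -> `|comp xs i s t| <= 6 * N + 1).
Proof.
apply: aeI_count => i; have [_ _ w] := H2 i.
apply: aeI_imp2 w X2_bounds => t tt w /(_ i)[[j1 l1] [j2 l2] _].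
have mp := mes2_sect_t (m_p i) tt.
have [f [hf e]] := weak_acr w (intg_rintg (intg_L2 mp j2)).
have E := acr_cont_eq (@cont_u i t (in_cc tt)) hf e.
have hu : acr ((comp xs i)^~ t) ((comp u1 i)^~ t) by exact: acr_ext E hf.
split => // s s0 s1; have B := acr_bound hu mp j1 l1 j2 l2 s0 s1.
have N1 : 0 <= 6 * N by rewrite mulr_ge0.
(* The square is at most 6N, hence at most (6N + 1)^2; this avoids a square root in the bound. *)
rewrite -(@ler_pXn2r _ 2) ?nnegrE//; last by rewrite addr_ge0.
rewrite real_normK ?num_real//; apply: (le_trans B); nra.
Qed.

Lemma curv_reg : aeI 0 T (fun t => forall i, exists w,
  [/\ acr w ((comp u2 i)^~ t), aeI 0 1 (fun s => comp u1 i s t = w s) &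
      forall s, 0 < s -> s <= 1 -> s * w s ^+ 2 <= 8 * N]).
Proof.
apply: aeI_count => i; have [_ _ w] := H3 i.
apply: aeI_imp2 w X2_bounds => t tt w /(_ i)[_ [j2 l2] [j3 l3]].
have mr := mes2_sect_t (m_r i) tt.
have mp := mes2_sect_t (m_p i) tt.
have rr : rintg ((comp u2 i)^~ t).
  by apply: rintg_weight => //; apply: intg_L2 j3; apply: mesIM => //; exact: mesI_id.
have [f [hf e]] := weak_acr w rr.
exists f; split => // s s0 s1.
have e2 : aeI 0 1 (fun s => f s ^+ 2 = comp u1 i s t ^+ 2) by apply: aeI_imp e => z _ <-.
have mf : mesI 0 1 f.
  apply: open_continuous_measurable_fun; first exact: itv_open.
  move=> z; rewrite inE/= in_itv/= => /andP[z0 z1]; exact: lac_cont (acr_lac hf) z0 z1.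
have j4 := intg_ae (mesIX 2 mf) e2 j2.
apply: (acr_bound_s hf mr j4 _ j3 l3 s0 s1).
by rewrite (II_ae (mesIX 2 mf) (intg_mes j2) e2).
Qed.

Lemma vel_reg : aeI 0 T (fun t => forall i, exists w,
  [/\ acr w ((comp v1 i)^~ t), aeI 0 1 (fun s => comp v i s t = w s),
      forall s, 0 < s -> s <= 1 -> s * w s ^+ 2 <= 28 * N,
      intg 0 1 (fun s => (comp v i s t ^+ 2) ^+ 2) &
      II 0 1 (fun s => (comp v i s t ^+ 2) ^+ 2) <= 980 * N ^+ 2]).
Proof.
apply: aeI_count => i; have [_ _ w] := H6 i.
apply: aeI_imp3 w X1_bounds (linf1_intg (linf2_linf1 (sq_linf2 i))) => t tt w /(_ i)[j2 l2 j3 l3] isq.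
have mq_ := mes2_sect_t (m_q i) tt.
have mv := mes2_sect_t (m_v i) tt.
have rr : rintg ((comp v1 i)^~ t) by exact: rintg_weight.
have [f [hf e]] := weak_acr w rr.
have e2 : aeI 0 1 (fun s => f s ^+ 2 = comp v i s t ^+ 2) by apply: aeI_imp e => z _ <-.
have mf : mesI 0 1 f.
  apply: open_continuous_measurable_fun; first exact: itv_open.
  move=> z; rewrite inE/= in_itv/= => /andP[z0 z1]; exact: lac_cont (acr_lac hf) z0 z1.
have j4 := intg_ae (mesIX 2 mf) e2 j2.
have l4 : II 0 1 (fun s => f s ^+ 2) <= N by rewrite (II_ae (mesIX 2 mf) (intg_mes j2) e2).
have [b1 [b2 b3]] := acr_bound_log4 hf mq_ j4 l4 j3 l3.
have e4 : aeI 0 1 (fun s => (comp v i s t ^+ 2) ^+ 2 = (f s ^+ 2) ^+ 2) by apply: aeI_imp e => z _ <-.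
have m4 : mesI 0 1 (fun s => (comp v i s t ^+ 2) ^+ 2) by apply: (mesIX 2 (mesIX 2 mv)).
exists f; split => //; first exact: intg_ae m4 e4 b2.
by rewrite (II_ae m4 (intg_mes b2) e4).
Qed.

(** The derivatives in the tension equation are chosen independently of those in the function class;
    uniqueness of weak derivatives in s and in t identifies them with [u1] and [v]. *)
Lemma tension_ae : aeI 0 T (fun t => aeI 0 1 (fun s =>
  tauss s t = tau s t * (\sum_i comp u1 i s t ^+ 2) - \sum_i comp v i s t ^+ 2)).
Proof.
have h1 : aeI 0 T (fun t => aeI 0 1 (fun s => forall i, comp xss i s t = comp u1 i s t)).
  have h i : aeI 0 T (fun t => aeI 0 1 (fun s => comp xss i s t = comp u1 i s t)).
    have [_ _ w] := H17 i; apply: aeI_imp2 w strain_reg => t tt w /(_ i)[hu _].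
    by apply: (weak_uniq ltr01 w (acr_lac hu)); apply: aeI_all.
  by apply: aeI_imp (aeI_count h) => t _ ht; exact: aeI_count.
have h2 : aeI 0 T (fun t => aeI 0 1 (fun s => forall i, comp xst i s t = comp v i s t)).
  have h i : aeI 0 T (fun t => aeI 0 1 (fun s => comp xst i s t = comp v i s t)).
    exact (weak_dt_uniq T0 (H18 i) (H5 i)).
  by apply: aeI_imp (aeI_count h) => t _ ht; exact: aeI_count.
apply: aeI_imp3 h1 h2 (ae_Q_ts H21) => t _ h1 h2 h3.
apply: aeI_imp3 h1 h2 h3 => s _ e1 e2.
rewrite !enorm_sqr.
have -> : \sum_i xss s t 0 i ^+ 2 = \sum_i comp u1 i s t ^+ 2.
  by apply: eq_bigr => i _; rewrite -e1.
have -> : \sum_i xst s t 0 i ^+ 2 = \sum_i comp v i s t ^+ 2.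
  by apply: eq_bigr => i _; rewrite -e2.
by move=> <-; ring.
Qed.

(** The right-hand side of the equation is itself taken as second derivative, so that the equation
    holds at every s < 1. *)
Definition ta2 s t : R := tau s t * (\sum_i comp u1 i s t ^+ 2) - \sum_i comp v i s t ^+ 2.
(* The values at the end points are not determined by the equations that hold
   for almost every s, and are recovered by integration. *)
Definition ta1 s t : R := if 0 < s then taus s t else taus 1 t - II 0 1 (ta2^~ t).
Definition ta s t : R := if s < 1 then tau s t else II 0 1 (ta1^~ t).

Let b : R := (\sum_i `|g 0 i|) * (6 * N + 1).
Let b0 : 0 <= b. Proof. by rewrite mulr_ge0 ?addr_ge0 ?mulr_ge0// sumr_ge0. Qed.

Lemma taus1 : aeI 0 T (fun t => taus 1 t = - \sum_i g 0 i * comp xs i 1 t /\ tau 0 t = 0 /\ `|taus 1 t| <= b).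
Proof.
apply: aeI_imp2 H22 strain_reg => t tt [_ _ h0 e] hu; split; first by rewrite e.
split => //; rewrite e normrN /dotp /b mulr_suml; apply: (le_trans (ler_norm_sum _ _ _)).
apply: ler_sum => i _; rewrite normrM ler_wpM2l//.
by have [_] := hu i; apply.
Qed.

Lemma tension_reg : aeI 0 T (fun t => [/\ ac 0 1 (ta^~ t) (ta1^~ t), ac 0 1 (ta1^~ t) (ta2^~ t),
    forall s, 0 < s -> s <= 1 -> c0 * s <= ta s t,
    forall s, 0 <= s -> s <= 1 -> ta s t <= (b + 3 * N) * s &
    forall s, 0 <= s -> s <= 1 -> `|ta1 s t| <= b + (b + 3 * N) * (3 * N) + 3 * N]).
Proof.
have [_ _ w1] := H19; have [_ _ w2] := H20.
have sum3 (f : 'I_3 -> R -> R) : (forall i, intg 0 1 (f i) /\ II 0 1 (f i) <= N) ->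
    intg 0 1 (fun s => \sum_i f i s) /\ II 0 1 (fun s => \sum_i f i s) <= 3 * N.
  move=> h; split; first by apply: intg_sum => i; have [] := h i.
  rewrite II_sum; last by move=> i; have [] := h i.
  rewrite (_ : 3 * N = \sum_(i < 3) N); last by rewrite sumr_const card_ord; ring.
  by apply: ler_sum => i _; have [] := h i.
apply: aeI_imp3 (aeI_and w1 w2) (aeI_and H22 taus1) (aeI_and tension_ae (aeI_and X2_bounds X1_bounds)).
move=> t tt [d1 d2] [[c1 c2 e0 _] [_ [_ tb]]] [te [hX2 hX1]].
have [iP lP] : intg 0 1 (fun s => \sum_i comp u1 i s t ^+ 2) /\
    II 0 1 (fun s => \sum_i comp u1 i s t ^+ 2) <= 3 * N.
  by apply: sum3 => i; have [] := hX2 i.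
have [iV lV] : intg 0 1 (fun s => \sum_i comp v i s t ^+ 2) /\
    II 0 1 (fun s => \sum_i comp v i s t ^+ 2) <= 3 * N.
  by apply: sum3 => i; have [] := hX1 i.
have low s : 0 < s -> s < 1 -> c0 * s <= tau s t.
  by move=> s0 s1; rewrite -ler_pdivlMr//; apply: H23 => //; rewrite in_itv/= s0.
have pos (a : 'I_3 -> R) : 0 <= \sum_i a i ^+ 2 by apply: sumr_ge0 => i _; exact: sqr_ge0.
have N3 : 0 <= 3 * N by rewrite mulr_ge0.
exact: (tension_1d c00 N3 d1 d2 c1 c2 e0 low iP (fun s => pos _) lP iV (fun s => pos _) lV tb te).
Qed.

Let Ct : R := b + 3 * N.
Let Ct1 : R := b + Ct * (3 * N) + 3 * N.
Let Ct0 : 0 <= Ct. Proof. by rewrite addr_ge0// mulr_ge0. Qed.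
Let N3 : 0 <= 3 * N. Proof. by rewrite mulr_ge0. Qed.
Let Ct10 : 0 <= Ct1. Proof. exact: addr_ge0 (addr_ge0 b0 (mulr_ge0 Ct0 N3)) N3. Qed.

Let m_tau : mes2 0 1 0 T tau. Proof. by have [] := H19. Qed.

Let m_ta2 : mes2 0 1 0 T ta2.
Proof.
apply: mes2B; last by apply: mes2_sum => i; exact: (mes2X 2 (m_v i)).
by apply: mes2M => //; apply: mes2_sum => i; exact: (mes2X 2 (m_p i)).
Qed.

Let m_ta : mes2 0 1 0 T ta.
Proof.
apply: eq_measurable_fun m_tau => -[s t]; rewrite inE => -[/= + _].
by rewrite in_itv/= /ta => /andP[_ ->].
Qed.

Let m_ta1 : mes2 0 1 0 T ta1.
Proof.
have [_ m _] := H19; apply: eq_measurable_fun m => -[s t]; rewrite inE => -[/= + _].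
by rewrite in_itv/= /ta1 => /andP[-> _].
Qed.

Let b_u i : bndt T (comp xs i).
Proof.
split => //; exists (6 * N + 1); apply: aeI_imp strain_reg => t _ h; have [_ k] := h i.
by apply: aeI_all => s; rewrite in_itv/= => /andP[s0 s1]; apply: k => //; exact: ltW.
Qed.

Let b_ta1 : bndt T ta1.
Proof.
split => //; exists Ct1; apply: aeI_imp tension_reg => t _ [_ _ _ _ k].
by apply: aeI_all => s; rewrite in_itv/= => /andP[s0 s1]; apply: k; exact: ltW.
Qed.

Let ta_abs t : (forall s, 0 < s -> s <= 1 -> c0 * s <= ta s t) ->
  (forall s, 0 <= s -> s <= 1 -> ta s t <= Ct * s) -> forall s, 0 < s -> s <= 1 -> `|ta s t| <= Ct * s.
Proof.
move=> h1 h2 s s0 s1; rewrite ger0_norm; first by apply: h2 => //; exact: ltW.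
by apply: le_trans (h1 s s0 s1); rewrite mulr_ge0// ltW.
Qed.

Let b_ta_s : bndt T (fun s t => ta s t / s).
Proof.
split; first by apply: mes2M => //; apply: mes2_s; exact: mesI_inv.
exists Ct; apply: aeI_imp tension_reg => t _ [_ _ h1 h2 _].
apply: aeI_all => s; rewrite in_itv/= => /andP[s0 s1].
rewrite normrM normfV (gtr0_norm s0) ler_pdivrMr//; apply: ta_abs => //; exact: ltW.
Qed.

Let b_ta : bndt T ta.
Proof.
split => //; exists Ct; apply: aeI_imp tension_reg => t _ [_ _ h1 h2 _].
apply: aeI_all => s; rewrite in_itv/= => /andP[s0 s1].
apply: (le_trans (ta_abs h1 h2 s0 (ltW s1))); by rewrite ler_piMr// ltW.
Qed.

(** tau |u_s|^2 is bounded, because tau is at most a multiple of s and s |u_s|^2 is bounded; |v|^2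
    is in L^2 by the fourth-power bound of [vel_reg]. *)
Lemma ta2_linf2 : linf2 T ta2.
Proof.
have bp i : bndt T (fun s t => ta s t * comp u1 i s t ^+ 2).
  split; first by apply: mes2M => //; exact: (mes2X 2 (m_p i)).
  exists (Ct * (8 * N)); apply: aeI_imp2 tension_reg curv_reg => t _ [_ _ h1 h2 _] /(_ i)[w [_ e hw]].
  apply: aeI_imp e => s; rewrite in_itv/= => /andP[s0 s1] ->.
  rewrite normrM (ger0_norm (sqr_ge0 _)).
  apply: (@le_trans _ _ (Ct * s * w s ^+ 2)).
    by rewrite ler_wpM2r ?sqr_ge0//; apply: ta_abs => //; exact: ltW.
  by rewrite -mulrA ler_wpM2l//; apply: hw => //; exact: ltW.
have lv i : linf2 T (fun s t => - 1 * comp v i s t ^+ 2).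
  apply: linf2_bnd; first exact: bndt_cst.
  split; first exact: (mes2X 2 (m_v i)).
  by exists (980 * N ^+ 2); apply: aeI_imp vel_reg => t _ /(_ i)[w []].
have l := linf2D (bndt_linf2 (bndt_sum bp)) (linf2_sum lv).
apply: linf2_ae l => //; apply: aeI_all => t _; apply: aeI_all => s.
rewrite in_itv/= => /andP[s0 s1]; rewrite /ta2 /ta s1 mulr_sumr -sumrN; congr (_ + _).
by apply: eq_bigr => i _; rewrite mulN1r.
Qed.

(** (tau u)'' expanded by the product rule. It becomes u_tt once [v_repr] is proved. *)
Definition kk i s t : R := ta2 s t * comp xs i s t + 2 * (ta1 s t * comp u1 i s t) + ta s t * comp u2 i s t.

Lemma kk_linf2 i : linf2 T (kk i).
Proof.
have l1 : linf2 T (fun s t => comp xs i s t * ta2 s t) by apply: linf2_bnd => //; exact: ta2_linf2.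
have l2 : linf2 T (fun s t => 2 * (ta1 s t * comp u1 i s t)).
  by apply: linf2_bnd; [exact: bndt_cst|apply: linf2_bnd].
have l3 : linf2 T (fun s t => ta s t / s * (s * comp u2 i s t)) by apply: linf2_bnd.
apply: linf2_ae (linf2D (linf2D l1 l2) l3).
  apply: mes2D; last exact: mes2M.
  apply: mes2D; first exact: mes2M.
  by apply: mes2M; [exact: mes2_cst|exact: mes2M].
apply: aeI_all => t _; apply: aeI_all => s; rewrite in_itv/= => /andP[s0 _].
by rewrite /kk; field; rewrite gt_eqF.
Qed.

(** With a representative of u_s in place of u_s, the flux is absolutely continuous away from 0 with
    derivative [kk]. Its value at s = 1 stays an unknown constant until [flux_boundary]. *)
Lemma flux_reg : aeI 0 T (fun t => forall i,
  aeI 0 1 (fun s => comp flux i s t = ta1 s t * comp xs i s t + ta s t * comp u1 i s t) /\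
  exists K, aeI 0 1 (fun s => ta1 s t * comp xs i s t + ta s t * comp u1 i s t = K - II s 1 ((kk i)^~ t))).
Proof.
apply: aeI_count => i; have [_ _ w] := H14 i.
apply: aeI_imp3 w (aeI_and strain_reg curv_reg) (aeI_and tension_reg (linf1_intg (linf2_linf1 (kk_linf2 i)))).
move=> t tt w [hu hc] [[a1 a2 _ _ _] ik].
have [hu' _] := hu i; have [wp [hw e _]] := hc i.
have acr01 f f' : ac 0 1 f f' -> acr f f' by move=> h y y0 y1; apply: ac_sub h => //; exact: ltW.
have A1 : acr (fun s => ta s t * comp xs i s t) (fun s => ta1 s t * comp xs i s t + ta s t * comp u1 i s t).
  by move=> y y0 y1; apply: ac_mul; [exact: acr01 a1 y y0 y1|exact: hu'].
have A2 : acr (fun s => ta1 s t * comp xs i s t + ta s t * wp s)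
   (fun s => (ta2 s t * comp xs i s t + ta1 s t * comp u1 i s t) +
             (ta1 s t * wp s + ta s t * comp u2 i s t)).
  move=> y y0 y1; apply: ac_add; apply: ac_mul; try exact: hu'; try exact: hw.
    exact: acr01 a2 y y0 y1.
  exact: acr01 a1 y y0 y1.
split.
  apply: (weak_uniq ltr01 w (acr_lac A1)); apply: aeI_all => s; rewrite in_itv/= => /andP[_ s1].
  by rewrite mxE /ta s1.
have A3 : acr (fun s => ta1 s t * comp xs i s t + ta s t * wp s) ((kk i)^~ t).
  apply: (acr_ae A2 (intg_rintg ik)); apply: aeI_imp e => s _ <-; rewrite /kk; ring.
exists (ta1 1 t * comp xs i 1 t + ta 1 t * wp 1).
apply: aeI_imp e => s; rewrite in_itv/= => /andP[s0 s1] ->.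
have := ac_inc (A3 s s0 (ltW s1)) (lexx _) (ltW s1) (lexx _).
by move=> <-; ring.
Qed.

Lemma xtt_eq : aeI 0 T (fun t => forall i, aeI 0 1 (fun s =>
  comp xtt i s t = ta1 s t * comp xs i s t + ta s t * comp u1 i s t + g 0 i)).
Proof.
apply: aeI_imp2 flux_reg (ae_Q_ts H15) => t _ h1 h2 i; have [h _] := h1 i.
apply: aeI_imp2 h h2 => s _ <- e; have := congr1 (fun a : 'rV[R]_3 => a 0 i) e.
by rewrite /= !mxE /comp => <-; ring.
Qed.

Let m_xtt i : mes2 0 1 0 T (comp xtt i). Proof. by have [] := H13 i. Qed.

Lemma xtt_linf2 i : linf2 T (comp xtt i).
Proof.
have l1 : linf2 T (fun s t => ta1 s t * comp xs i s t).
  by apply: linf2_bnd => //; exact: bndt_linf2.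
have l2 : linf2 T (fun s t => ta s t * comp u1 i s t) by apply: linf2_bnd.
have l := linf2D (linf2D l1 l2) (bndt_linf2 (bndt_cst T (g 0 i))).
by apply: (linf2_ae (m_xtt i) _ l); apply: aeI_imp xtt_eq => t _ h; exact: h.
Qed.

Let near0 (F : set_system R) (FF : Filter F) (f : R -> \bar R) (e : R) : 0 < e ->
  f r @[r --> F] --> 0%E -> \forall r \near F, (f r <= e%:E)%E.
Proof.
move=> e0 h; have : nbhs 0%E [set y : \bar R | (y < e%:E)%E].
  by apply: open_nbhs_nbhs; split; [exact: open_ereal_lt_ereal|rewrite /= lte_fin].
by move=> /h; rewrite /nbhs/=; apply: filterS => r /ltW.
Qed.

Let in_oc t : 0 <= t -> t <= T -> t \in `[0, T].
Proof. by move=> t0 tT; rewrite in_itv/= t0. Qed.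

Let comp_sub (f : R -> R -> 'rV[R]_3) i r t :
  (fun s => (f s r - f s t) 0 i) = (fun s => comp f i s r - comp f i s t).
Proof. by apply/funext => s; rewrite !mxE. Qed.

Lemma cl_u i : cl2 T (comp xs i).
Proof.
have [w hw] := H10; move=> t t0 tT.
have m r (rr : r \in `[0, T]) : forall j, mesI 0 1 (fun s => xs s r 0 j).
  by move=> j; have [[wd _] _] := hw r rr; have [[]] := wd j.
have tt := in_oc t0 tT; have [[_ fin] lim] := hw t tt.
have fin' : (L2sq (xs^~ t) < +oo)%E.
  by apply: le_lt_trans fin; rewrite /X1sq leeDl// L2sq_ge0.
split; [exact: m|by have [] := L2sq_fin (m t tt) fin' i|].
move=> e e0; have [d d0 h] := near_within_itv (near0 _ e0 lim); exists d => // r r0 rT rt; have rr := in_oc r0 rT.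
have l : (L2sq (fun s => xs s r - xs s t)%R <= e%:E)%E.
  by apply: le_trans (h r r0 rT rt); rewrite /X1sq leeDl// L2sq_ge0.
have md j : mesI 0 1 (fun s => (xs s r - xs s t) 0 j).
  by rewrite comp_sub; apply: mesIB; [exact: m r rr j|exact: m t tt j].
have [_] := L2sq_le md l i.
by under eq_fun do rewrite !mxE.
Qed.

Lemma cl_xt i : cl2 T (comp xt i).
Proof.
have [_ hw _] := H9; move=> t t0 tT.
have m r (rr : r \in `[0, T]) : forall j, mesI 0 1 (fun s => xt s r 0 j).
  by have [[]] := hw r rr.
have tt := in_oc t0 tT; have [[_ fin] lim] := hw t tt.
split; [exact: m|by have [] := L2sq_fin (m t tt) fin i|].
move=> e e0; have [d d0 h] := near_within_itv (near0 _ e0 lim); exists d => // r r0 rT rt; have rr := in_oc r0 rT.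
have md j : mesI 0 1 (fun s => (xt s r - xt s t) 0 j).
  by rewrite comp_sub; apply: mesIB; [exact: m r rr j|exact: m t tt j].
have [_] := L2sq_le md (h r r0 rT rt) i.
by under eq_fun do rewrite !mxE.
Qed.

Lemma u_repr i t : 0 <= t -> t < T ->
  aeI 0 1 (fun s => comp xs i s t = comp xs i s 0 + II 0 t (comp v i s)).
Proof. by move=> t0 tT; apply: (time_repr T0 (H5 i) (v_linf2' i) (cl_u i) t0 tT). Qed.

Lemma xt_repr i t : 0 <= t -> t < T ->
  aeI 0 1 (fun s => comp xt i s t = comp xt i s 0 + II 0 t (comp xtt i s)).
Proof. by move=> t0 tT; apply: (time_repr T0 (H13 i) (xtt_linf2 i) (cl_xt i) t0 tT). Qed.

Let intg_u i t : 0 <= t -> t <= T -> intg 0 1 ((comp xs i)^~ t).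
Proof. by move=> t0 tT; have [m j _] := cl_u i t0 tT; exact: intg_L2. Qed.

Let intg_xt i t : 0 <= t -> t <= T -> intg 0 1 ((comp xt i)^~ t).
Proof. by move=> t0 tT; have [m j _] := cl_xt i t0 tT; exact: intg_L2. Qed.

Lemma acr_mes (f f' : R -> R) : acr f f' -> mesI 0 1 f.
Proof.
move=> h; apply: open_continuous_measurable_fun; first exact: itv_open.
by move=> z; rewrite inE/= in_itv/= => /andP[z0 z1]; exact: lac_cont (acr_lac h) z0 z1.
Qed.

Lemma x_acr i t : 0 <= t -> t <= T -> acr ((comp x i)^~ t) ((comp xs i)^~ t).
Proof.
move=> t0 tT; have tt := in_oc t0 tT; have w := H1 tt i.
have [f [hf e]] := weak_acr w (intg_rintg (intg_u i t0 tT)).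
have E := acr_cont_eq (within_coord (i := i) (H11 tt)) hf e.
exact: acr_ext E hf.
Qed.

Lemma xt_tested i P B lo : cutoff P B lo -> aeI 0 T (fun t =>
  II 0 1 (fun s => comp xt i s t * P s) = - II 0 1 (fun s => comp v i s t * prim P s)).
Proof.
move=> c; have A := @time_derivative R T (comp x i) (comp xs i) (comp xt i) (comp v i) P B lo c.
apply: A.
- move=> t t0 tT; split; first by apply: x_acr; exact: ltW.
  by rewrite /comp H16 ?mxE// in_itv/= t0.
- by move=> t t0 tT; apply: u_repr => //; exact: ltW.
- by apply: intg_u => //; exact: ltW.
- exact: v_linf2'.
- by move=> t t0 tT; apply: acr_mes (x_acr _ _ _); exact: ltW.
- by move=> t t0 tT; have [] := cl_xt i (ltW t0) (ltW tT).
- move=> t t0 tT e e0; have [_ _ h] := H9.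
  have tt := in_oc (ltW t0) (ltW tT).
  have [d d0 hd] := near_within_dnbhs (near0 _ e0 (h t tt)); exists d => // r r0 rT rn rt.
  have md j : mesI 0 1 (fun s => ((r - t)^-1 *: (x s r - x s t) - xt s t) 0 j).
    have -> : (fun s => ((r - t)^-1 *: (x s r - x s t) - xt s t) 0 j) =
        (fun s => (r - t)^-1 * (comp x j s r - comp x j s t) - comp xt j s t).
      by apply/funext => s; rewrite !mxE.
    apply: mesIB; last by have [] := cl_xt j (ltW t0) (ltW tT).
    apply: mesIM; first exact: mesI_cst.
    by apply: mesIB; apply: acr_mes (x_acr _ _ _); exact: ltW.
  have := L2sq_le md (hd r (ltW r0) (ltW rT) rn rt) i.
  by under eq_fun do rewrite !mxE.
Qed.

(** The X^2 bounds hold only for almost every t, so at t = 0 the derivative of the strain is taken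
    from continuity in X^1; the weight sqrt(s) leaves it integrable on every []x, 1[] with x > 0. *)
Lemma init_strain : exists p0 : 'I_3 -> R -> R, forall i,
  weak_deriv 0 1 ((comp xs i)^~ 0) (p0 i) /\ rintg (p0 i).
Proof.
have [w hw] := H10; have [[wd fin] _] := hw 0 (in_oc (lexx _) (ltW T0)).
exists (fun i s => w s 0 0 i) => i; have wi := wd i; split => //.
have m j : mesI 0 1 (fun s => w s 0 0 j) by have [_ []] := wd j.
have fin' : (L2sq (fun s => Num.sqrt s *: w s 0)%R < +oo)%E.
  by apply: le_lt_trans fin; rewrite /X1sq leeDr// L2sq_ge0.
have [j _] := L2sq_fin (m_scal m_sqrt m) fin' i.
have ms : mesI 0 1 (fun s => (Num.sqrt s *: w s 0) 0 i) by exact: m_scal.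
have j1 := intg_L2 ms j.
apply: rintg_weight => //.
have bs : aeI 0 1 (fun s => `|Num.sqrt s : R| <= 1).
  apply: aeI_all => s; rewrite in_itv/= => /andP[s0 s1].
  by rewrite ger0_norm ?sqrtr_ge0// -sqrtr1 ler_wsqrtr// ltW.
have := intgM_bnd j1 m_sqrt bs; apply: eq_integrable => //.
move=> s; rewrite inE /= in_itv/= => /andP[s0 _].
by rewrite mxE mulrA -expr2 sqr_sqrtr// ltW.
Qed.

Let v_lf1 i : linf1 0 1 0 T (comp v i) := linf2_linf1 (v_linf2' i).
Let xtt_lf1 i : linf1 0 1 0 T (comp xtt i) := linf2_linf1 (xtt_linf2 i).
Let kk_lf1 i : linf1 0 1 0 T (kk i) := linf2_linf1 (kk_linf2 i).

Let xtt_const i : aeI 0 T (fun t => exists K, aeI 0 1 (fun s => comp xtt i s t = K - II s 1 ((kk i)^~ t))).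
Proof.
apply: aeI_imp2 flux_reg xtt_eq => t _ /(_ i)[_ [K e]] /(_ i) e2.
exists (K + g 0 i); by apply: aeI_imp2 e e2 => s _ e3 ->; rewrite e3; ring.
Qed.

Lemma v_repr i : aeI 0 T (fun t => aeI 0 1 (fun s =>
  comp v i s t = x1s s 0 i + II 0 t (kk i s))).
Proof.
apply: (@velocity_repr R T (comp xt i) (comp v i) (comp xtt i) (kk i) (fun s => x1s s 0 i)) => //.
- by move=> P B lo; exact: xt_tested.
- by move=> t t0 tT; apply: xt_repr => //; exact: ltW.
- by apply: intg_xt => //; exact: ltW.
- by move=> t t0 tT; apply: intg_xt; exact: ltW.
- exact: H25.
Qed.

Lemma flux_boundary : aeI 0 T (fun t => forall i, aeI 0 1 (fun s =>
  ta1 s t * comp xs i s t + ta s t * comp u1 i s t = - g 0 i - II s 1 ((kk i)^~ t))).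
Proof.
apply: aeI_count => i.
have h : aeI 0 T (fun t => aeI 0 1 (fun s => comp xtt i s t = - II s 1 ((kk i)^~ t))).
  apply: (@boundary_flux R T T0 (comp xt i) (comp v i) (comp xtt i) (kk i) (fun s => x1s s 0 i)) => //.
  - by move=> P B lo; exact: xt_tested.
  - by move=> t t0 tT; apply: xt_repr => //; exact: ltW.
  - by apply: intg_xt => //; exact: ltW.
  - by move=> t t0 tT; apply: intg_xt; exact: ltW.
  - exact: H25.
apply: aeI_imp2 h xtt_eq => t _ h /(_ i) e; apply: aeI_imp2 h e => s _ -> e2.
have -> : ta1 s t * comp xs i s t + ta s t * comp u1 i s t =
  (ta1 s t * comp xs i s t + ta s t * comp u1 i s t + g 0 i) - g 0 i by ring.
by rewrite -e2; ring.
Qed.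

Let Cc : R := (6 * N + 1) + 28 * N + 8 * N + Ct + Ct1.

Definition goodt (t : R) : Prop := (t \in `]0, T[) /\
  (forall i, acr ((comp xs i)^~ t) ((comp u1 i)^~ t) /\
    forall s, 0 < s -> s <= 1 -> `|comp xs i s t| <= Cc) /\
  (forall i, aeI 0 1 (fun s => s * comp u1 i s t ^+ 2 <= Cc)) /\
  (forall i, exists w, [/\ acr w ((comp v1 i)^~ t), aeI 0 1 (fun s => comp v i s t = w s) &
      forall s, 0 < s -> s <= 1 -> s * w s ^+ 2 <= Cc]) /\
  [/\ ac 0 1 (ta^~ t) (ta1^~ t), ac 0 1 (ta1^~ t) (ta2^~ t),
    forall s, 0 < s -> s <= 1 -> c0 * s <= ta s t,
    forall s, 0 <= s -> s <= 1 -> ta s t <= Cc * s &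
    forall s, 0 <= s -> s <= 1 -> `|ta1 s t| <= Cc] /\
  (taus 1 t = - \sum_i g 0 i * comp xs i 1 t /\ tau 0 t = 0) /\
  (forall i, aeI 0 1 (fun s =>
    ta1 s t * comp xs i s t + ta s t * comp u1 i s t = - g 0 i - II s 1 ((kk i)^~ t))) /\
  (forall i : 'I_3, intg 0 1 ((kk i)^~ t)).

Let N6 : 0 <= 6 * N. Proof. by rewrite mulr_ge0. Qed.
Let N28 : 0 <= 28 * N. Proof. by rewrite mulr_ge0. Qed.
Let N8 : 0 <= 8 * N. Proof. by rewrite mulr_ge0. Qed.
Let Cu : 6 * N + 1 <= Cc. Proof. by rewrite /Cc; move: N6 N28 N8 Ct0 Ct10; lra. Qed.
Let Cv : 28 * N <= Cc. Proof. by rewrite /Cc; move: N6 N28 N8 Ct0 Ct10; lra. Qed.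
Let Cp : 8 * N <= Cc. Proof. by rewrite /Cc; move: N6 N28 N8 Ct0 Ct10; lra. Qed.
Let Cta : Ct <= Cc. Proof. by rewrite /Cc; move: N6 N28 N8 Ct0 Ct10; lra. Qed.
Let Cta1 : Ct1 <= Cc. Proof. by rewrite /Cc; move: N6 N28 N8 Ct0 Ct10; lra. Qed.

Lemma goodt_ae : aeI 0 T goodt.
Proof.
have hk : aeI 0 T (fun t => forall i, intg 0 1 ((kk i)^~ t)).
  by apply: aeI_count => i; exact: linf1_intg (kk_lf1 i).
apply: aeI_imp3 (aeI_and strain_reg curv_reg) (aeI_and vel_reg tension_reg)
  (aeI_and taus1 (aeI_and flux_boundary hk)) => t tt [h1 h2] [h3 [k1 k2 k3 k4 k5]] [[h5 [h6 _]] [h7 h8]].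
split => //; split.
  by move=> i; have [l1 l2] := h1 i; split => // s s0 s1; apply: le_trans (l2 s s0 s1) Cu.
split.
  move=> i; have [w [_ e l]] := h2 i; apply: aeI_imp e => s; rewrite in_itv/= => /andP[s0 s1] ->.
  by apply: le_trans (l s s0 _) Cp; exact: ltW.
split.
  move=> i; have [w [l1 l2 l3 _ _]] := h3 i; exists w; split => // s s0 s1.
  exact: le_trans (l3 s s0 s1) Cv.
split => //; split => // s s0 s1; last exact: le_trans (k5 s s0 s1) Cta1.
by apply: (le_trans (k4 s s0 s1)); rewrite ler_wpM2r.
Qed.

Let init_unit : aeI 0 1 (fun s => \sum_i comp xs i s 0 ^+ 2 = 1).
Proof.
apply: aeI_imp2 H24 H26 => s _ e h; have := enorm_sqr (xs s 0).
by rewrite e h expr1n => ->; rewrite /comp e.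
Qed.

Lemma extracted_facts (p0 : 'I_3 -> R -> R) :
  (forall i, weak_deriv 0 1 ((comp xs i)^~ 0) (p0 i) /\ rintg (p0 i)) ->
  facts T c0 Cc (fun i => g 0 i) (comp xs) (comp v) (comp u1) (comp v1) kk ta ta1 ta2
    (fun i => (comp xs i)^~ 0) (fun i s => x1s s 0 i) p0 goodt.
Proof.
move=> hp0.
have m_p0 i : mesI 0 1 (p0 i) by have [[_ [] ]] := hp0 i.
constructor => //.
- by apply: le_trans Cu; rewrite addr_ge0.
- exact: goodt_ae.
- by move=> t [+ _]; rewrite in_itv/= => /andP[].
- by move=> t [_ [h _]] i; have [] := h i.
- by move=> t [_ [h _]] i; have [_] := h i.
- by move=> t [_ [_ [_ [h _]]]].
- by move=> t [_ [_ [h _]]].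
- by move=> t [_ [_ [_ [_ [[h _ _ _ _] _]]]]].
- by move=> t [_ [_ [_ [_ [[_ h _ _ _] _]]]]].
- by move=> t [_ [_ [_ [_ [_ [[_ h] _]]]]]]; rewrite /ta ltr01.
- by move=> t [_ [_ [_ [_ [_ [[h _] _]]]]]]; rewrite /ta1 ltr01.
- by move=> t [_ [_ [_ [_ [[_ _ h _ _] _]]]]].
- by move=> t [_ [_ [_ [_ [[_ _ _ h _] _]]]]].
- by move=> t [_ [_ [_ [_ [[_ _ _ _ h] _]]]]].
- by move=> t [_ [_ [_ [_ [_ [_ [h _]]]]]]].
- move=> t _; apply: aeI_all => s; rewrite in_itv/= => /andP[_ s1].
  by rewrite /ta2 /ta s1.
- by move=> t [_ [_ [_ [_ [_ [_ [_ h]]]]]]].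
- exact: kk_linf2.
- move=> i; split; first exact: (mes2X 2 (m_v i)).
  by exists (980 * N ^+ 2); apply: aeI_imp vel_reg => t _ /(_ i)[w []].
- exact: ta2_linf2.
- by move=> i; have [] := cl_u i (lexx _) (ltW T0).
- by move=> i; have [_ []] := H25 i.
- move=> i; apply: aeI_all => t; rewrite in_itv/= => /andP[t0 tT].
  by apply: u_repr => //; exact: ltW.
- exact: v_repr.
- move=> i; have [w0 r0] := hp0 i; have [_ _ wu] := H2 i; have [_ _ wv] := H6 i.
  apply: (@strain_repr R T (comp xs i) (comp u1 i) (comp v i) (comp v1 i) (p0 i)) => //.
  + by move=> t t0 tT; apply: u_repr => //; exact: ltW.
  + by have [] := cl_u i (lexx _) (ltW T0).
  + by apply: intg_u => //; exact: ltW.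
  + apply: aeI_imp2 wu (linf1_intg (linf2_linf1 (p_linf2 i))) => t; rewrite in_itv/= => /andP[t0 tT] w ip.
    by split => //; apply: intg_u; exact: ltW.
  + exact: linf2_linf1.
- by apply: aeI_imp2 H24 H27 => s _ e; rewrite /dotp -e.
(* The orthogonality of u and p0 at t = 0 is the s-derivative of |u|^2 = 1: both sides are
   absolutely continuous inside the interval, and densities are unique. *)
- have hu i : acr ((comp xs i)^~ 0) (p0 i).
    have [w r] := hp0 i; have [f [hf e]] := weak_acr w r.
    have E := acr_cont_eq (@cont_u i 0 (in_oc (lexx _) (ltW T0))) hf e.
    exact: acr_ext E hf.
  have A : acr (fun s => \sum_i comp xs i s 0 * comp xs i s 0)
      (fun s => \sum_i (p0 i s * comp xs i s 0 + comp xs i s 0 * p0 i s)).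
    by move=> y y0 y1; apply: ac_sum => i; apply: ac_mul; exact: hu.
  have L : lac 0 1 (fun=> 1 : R) (fun=> 0).
    by split=> [c d _ _|y z _ _ _]; [exact: intg_cst|rewrite II_0 subrr].
  have e : aeI 0 1 (fun s => \sum_i comp xs i s 0 * comp xs i s 0 = 1).
    by apply: aeI_imp init_unit => s _ <-; apply: eq_bigr => i _; rewrite expr2.
  have [_ Z] := lac_uniq (acr_lac A) L e.
  apply: aeI_imp Z => s _; rewrite !big_ord_recl !big_ord0; lra.
Qed.

(** From almost every to every point in two moves: for almost every s the representative [w] is
    continuous in t, which gives the identity at all t; then at fixed t, [xs] is continuous in s. *)
Lemma strain_unit (s t : R) : s \in `]0, 1[ -> t \in `]0, T[ -> enorm (xs s t) = 1.
Proof.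
have [p0 hp0] := init_strain.
have U := facts_unit (extracted_facts hp0).
pose w i s t := comp xs i s 0 + II 0 t (comp v i s).
have mw i : mes2 0 1 0 T (w i).
  apply: mes2D; last exact: mes2_primt.
  by apply: mes2_s; have [] := cl_u i (lexx _) (ltW T0).
have U1 : aeI 0 1 (fun s => aeI 0 T (fun t => \sum_i w i s t ^+ 2 = 1)).
  apply: (@swap_ts R 0 1 0 T (fun s t => \sum_i w i s t ^+ 2) (fun _ _ => 1)).
  - by apply: mes2_sum => i; exact: (mes2X 2 (mw i)).
  - exact: mes2_cst.
  apply: aeI_imp U => r; rewrite in_itv/= => /andP[r0 rT] h.
  have hr : aeI 0 1 (fun s => forall i, comp xs i s r = w i s r).
    by apply: aeI_count => i; apply: u_repr => //; exact: ltW.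
  by apply: aeI_imp2 h hr => z _ <- e; apply: eq_bigr => i _; rewrite e.
have iv : aeI 0 1 (fun s => forall i, intg 0 T (comp v i s)).
  by apply: aeI_count => i; have [] := fubini (v_lf1 i).
have U2 : aeI 0 1 (fun s => forall t, 0 < t -> t < T -> \sum_i w i s t ^+ 2 = 1).
  apply: aeI_imp2 U1 iv => z _ h i.
  have cw j r : 0 < r -> r < T -> {for r, continuous (w j z)}.
    move=> r0 rT; apply: cvgD; first exact: cvg_cst.
    exact: ac_cont (ac_II (i j)) r0 rT.
  apply: (cont_ae_eq (g := fun=> 1)) h => [r r0 rT|r _ _]; last exact: cvg_cst.
  by apply: cont_sumsq => j; exact: cw.
move=> ss tt; move: (tt); rewrite in_itv/= => /andP[t0 tT].
have U3 : aeI 0 1 (fun s => \sum_i comp xs i s t ^+ 2 = 1).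
  have hr : aeI 0 1 (fun s => forall i, comp xs i s t = w i s t).
    by apply: aeI_count => i; apply: u_repr => //; exact: ltW.
  apply: aeI_imp2 U2 hr => z _ h e; rewrite -(h t t0 tT).
  by apply: eq_bigr => i _; rewrite e.
have cu i y : 0 < y -> y < 1 -> {for y, continuous ((comp xs i)^~ t)}.
  by have [c _] := within_oc ltr01 (@cont_u i t (in_cc tt)); exact: c.
move: (ss); rewrite in_itv/= => /andP[s0 s1].
have : \sum_i comp xs i s t ^+ 2 = 1.
  apply: (cont_ae_eq (f := fun y => \sum_i comp xs i y t ^+ 2) (g := fun=> 1) _ _ U3 s0 s1) => [y y0 y1|y _ _]; last exact: cvg_cst.
  by apply: cont_sumsq => j; exact: cu.
rewrite /enorm /dotp => e; rewrite -[RHS]sqrtr1 -e; congr Num.sqrt.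
Qed.

End Solution.

Lemma weak_deriv_ext (R : realType) (u u' v : R -> R) : weak_deriv 0 1 u v -> intg 0 1 u' ->
  aeI 0 1 (fun s => u' s = u s) -> weak_deriv 0 1 u' v.
Proof.
move=> [lu lv h] i e; split => //.
  apply: open_integrable_locally i; exact: itv_open.
move=> phi tf; rewrite -(h phi tf).
have [dphi cphi _] := tf.
have mphi : mesI 0 1 (derive1 phi) by exact: cont_mesI.
have mu_ : mesI 0 1 u by have [] := lu.
apply: II_ae; [apply: mesIM => //; exact: intg_mes i|exact: mesIM|].
by apply: aeI_imp e => s _ ->.
Qed.

Theorem theorem2p5 (R : realType) (g : 'rV[R]_3) (T : R)
    (x xs xt : R -> R -> 'rV[R]_3) (tau : R -> R -> R)
    (x0 x1 x0s x1s : R -> 'rV[R]_3)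
    (hg : enorm g = 1 \/ g = 0) (hT : 0 < T)
    (hsol : transformed_solution g T x xs xt tau x0 x1)
    (hstab : stability_cond T tau)
    (hx0s : weak_derivV 0 1 x0 x0s) (hx1s : weak_derivV 0 1 x1 x1s)
    (hx0 : ae_s (fun s => enorm (x0s s) = 1))
    (hx01 : ae_s (fun s => dotp (x0s s) (x1s s) = 0)) :
  forall s t : R, s \in `]0, 1[ -> t \in `]0, T[ -> enorm (xs s t) = 1.
Proof.
have [hc hs ht [i0 i1]] := hsol.
have [H1 [u1 [u2 [H2 H3 [M H4]]]] [_ [v [H5 [v1 [H6 [M' H7]]]]]] _ H9 H10 _ H11 H12] := hc.
have [[xtt [flux [H13 H14 H15]]] H16] := hs.
have [xss [xst [taus [tauss [H17 H18 [H19 H20] H21 H22]]]]] := ht.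
have [c0 c00 H23] := hstab.
have T00 : (0 : R) \in `[0, T] by rewrite in_itv/= lexx ltW.
(* The initial condition concerns x itself; uniqueness of weak derivatives passes it on to x'. *)
have H24 : aeI 0 1 (fun s => xs s 0 = x0s s).
  have h : aeI 0 1 (fun s => forall i, xs s 0 0 i = x0s s 0 i).
    apply: aeI_count => i; have [w [lw e]] := weak_lac ltr01 (hx0s i).
    apply: (weak_uniq ltr01 (H1 0 T00 i) lw).
    by apply: aeI_imp2 e i0 => s _ <- ->.
  by apply: aeI_imp h => s _ h; apply/rowP => i; exact: h.
(* x_t(.,0) agrees with the initial velocity only almost everywhere. A weak derivative survives such
   a change, and local integrability comes from x_t(.,0) being in L^2. *)
have H25 : weak_derivV 0 1 (xt^~ 0) x1s.
  move=> i; have [_ hC _] := H9; have [[m fin] _] := hC 0 T00.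
  have [j _] := L2sq_fin m fin i.
  apply: (weak_deriv_ext (hx1s i) (intg_L2 (m i) j)).
  by apply: aeI_imp i1 => s _ ->.
move=> s t; exact: (strain_unit hT c00 H1 H2 H3 H4 H5 H6 H7 H9 H10 H11 H12 H13 H14 H15 H16
  H17 H18 H19 H20 H21 H22 H23 H24 H25 hx0 hx01).
Qed.
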